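(* Let $\psi$ be a $C^2$ convex function on $\mathbb{R}^+$, uniformly convex on $[0,A]$ for each $A>0$, with $\psi(1)=0$ and $\lim_{u\to+\infty}\psi(u)/u=+\infty$. Let $C_\psi>0$. Then the following are equivalent: (i) for every density of probability $h$ (with respect to $\mu$) such that $\int\psi(h)\,d\mu<+\infty$ and every $t\ge0$, $$I_\psi(t,h)\le e^{-t/2C_\psi}\,I_\psi(h);$$ (ii) for every nice density of probability $h$, $$\int\psi(h)\,d\mu\le C_\psi\int\psi''(h)\,\Gamma(h)\,d\mu.$$ In this case there is a constant $M_\psi$ such that for every such density $h$ and every $t\ge 0$ $$\|P_t^*(h\mu)-\mu\|_{TV}\le M_\psi\,e^{-t/4C_\psi}\,\sqrt{I_\psi(h)},$$ so that the total variation distance goes to $0$ at an exponential rate.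
   Context: Setting: $(X_t,\mathbb{P}_x)$ is a time-continuous Markov process with a unique ergodic invariant probability measure $\mu$, infinitesimal generator $L$, semi-group $P_t$ and dual (adjoint) semi-group $P_t^*$, so that for a density of probability $h$ w.r.t. $\mu$, $P_t^*h\,d\mu$ is the law of $X_t$ with initial law $h\,d\mu$; this law is also denoted $P_t^*(h\mu)$. It is assumed that there is an algebra of uniformly continuous and bounded functions, containing the constants, which is a core for $L$ and on which a carré du champ $\Gamma$ exists: $L(fg)=fLg+gLf+\Gamma(f,g)$. One writes $\Gamma(f)=\Gamma(f,f)$ (note the normalization: $\Gamma(f)=|\nabla f|^2$ when $L=\frac12\Delta$). Moreover $\Gamma$ comes from a derivation: $\Gamma(fg,h)=f\Gamma(g,h)+g\Gamma(f,h)$. Consequently, for smooth $\Psi$, $L\Psi(f)=\Psi'(f)Lf+\frac12\Psi''(f)\Gamma(f)$ and $\Gamma(\Psi(f))=(\Psi'(f))^2\Gamma(f)$. Replacing $L$ by $L^*$ does not change $\Gamma$. Notation: $I_\psi(t,h)=\int\psi(P_t^*h)\,d\mu$ and $I_\psi(h)=I_\psi(0,h)=\int\psi(h)\,d\mu$. ''Nice density of probability'' means a nonnegative $h$ with $\int h\,d\mu=1$ belonging to the domain of the Dirichlet form $\mathcal{E}(h)=\int\Gamma(h)\,d\mu$. The total variation distance is normalized as $\|g\mu-\mu\|_{TV}=\int|g-1|\,d\mu$. *)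

(* Defs.v *)
From HB Require Import structures.
From mathcomp Require Import all_boot all_order all_algebra.
From mathcomp Require Import all_classical all_reals all_analysis.

Set Implicit Arguments.
Unset Strict Implicit.
Unset Printing Implicit Defensive.
Import Order.TTheory GRing.Theory Num.Theory.
Import numFieldNormedType.Exports.

Local Open Scope classical_set_scope.
Local Open Scope ring_scope.

Definition borel (E : puniformType) := g_sigma_algebraType (@open E).

Definition Lp_dist (d : measure_display) (T : measurableType d) (R : realType)
    (mu : {measure set T -> \bar R}) (p : \bar R) (f g : T -> R) : \bar R :=
  ('N[mu]_p[EFin \o (f \- g)%R])%E.

Section MarkovProcess.
Context (R : realType) (dO : measure_display) (Omega : measurableType dO).
Context (E : puniformType).

Definition past (X : R -> Omega -> borel E) (s : R) : set_system Omega :=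
  <<s \bigcup_(u in [set u | 0 <= u <= s])
        preimage_set_system setT (X u) measurable >>.

(* Time runs over [0, +oo[; the values [X t] for [t < 0] play no role. *)
Record markov_process := MarkovProcess {
  law : R.-pker (borel E) ~> Omega ;
  path : R -> Omega -> borel E ;
  path_measurable : forall t, measurable_fun setT (path t) ;
  path_start : forall x B, measurable B ->
    law x (path 0 @^-1` B) = \d_x B ;
  path_markov : forall x s t F B, 0 <= s -> 0 <= t ->
    past path s F -> measurable B ->
    law x (F `&` path (s + t) @^-1` B) =
    (\int[law x]_(w in F) law (path s w) (path t @^-1` B))%E }.

Definition transition (M : markov_process) (t : R) (x : borel E)
    (B : set (borel E)) : \bar R :=
  law M x (path M t @^-1` B).

Definition semigroup (M : markov_process) (t : R) (f : borel E -> R) :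
    borel E -> R :=
  fun x => \int[law M x]_w f (path M t w).

Definition invariant (M : markov_process)
    (nu : {measure set (borel E) -> \bar R}) : Prop :=
  forall t B, 0 <= t -> measurable B ->
    (\int[nu]_x transition M t x B)%E = nu B.

Definition ergodic (M : markov_process)
    (nu : {measure set (borel E) -> \bar R}) : Prop :=
  forall B, measurable B ->
    (forall t, 0 <= t ->
      {ae nu, forall x, transition M t x B = (\1_B x)%:E}) ->
    nu B = 0%E \/ nu B = 1%E.

Section InvariantMeasure.
Context (M : markov_process) (mu : {measure set (borel E) -> \bar R}).

(* [g mu] is the law of [X_t] when [X_0] has (signed) law [h mu]. The last
   clause only selects, among the mu-a.e. equal candidates, one which is
   everywhere nonnegative when [h] is: below, [psi] is only meaningful on
   [0, +oo[. *)
Definition is_dual (t : R) (h g : borel E -> R) : Prop :=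
  [/\ mu.-integrable setT (EFin \o g),
      forall B, measurable B ->
        (\int[mu]_(x in B) (g x)%:E =
         \int[mu]_x ((h x)%:E * transition M t x B))%E &
      (forall x, 0 <= h x) -> (forall x, 0 <= g x)].

Definition dual_semigroup (t : R) (h : borel E -> R) : borel E -> R :=
  get (is_dual t h).

End InvariantMeasure.

Section Generator.
Context (mu : {measure set (borel E) -> \bar R}).
Context (S : R -> (borel E -> R) -> (borel E -> R)).

Definition is_generator (f g : borel E -> R) : Prop :=
  [/\ f \in Lfun mu 2%:E, g \in Lfun mu 2%:E &
      Lp_dist mu 2%:E (fun x => t^-1 * (S t f x - f x)) g
        @[t --> (0 : R)^'+] --> 0%E].

Definition in_domain (f : borel E -> R) : Prop := exists g, is_generator f g.

Definition generator (f : borel E -> R) : borel E -> R :=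
  get (is_generator f).

Definition carre_du_champ (f g : borel E -> R) : borel E -> R :=
  generator (f \* g) \- f \* generator g \- g \* generator f.

Definition is_core (A : set (borel E -> R)) : Prop :=
  (forall f, A f -> in_domain f) /\
  forall f, in_domain f -> exists u : nat -> borel E -> R,
    [/\ forall n, A (u n),
        Lp_dist mu 2%:E (u n) f @[n --> \oo] --> 0%E &
        Lp_dist mu 2%:E (generator (u n)) (generator f)
          @[n --> \oo] --> 0%E].

End Generator.

Definition is_algebra (A : set (E -> R)) : Prop :=
  [/\ forall c, A (cst c),
      forall f g, A f -> A g -> A (f \+ g) &
      forall f g, A f -> A g -> A (f \* g)].

Section Setting.
Context (M : markov_process) (mu : probability (borel E) R).
Context (A : set (E -> R)).

Let P := semigroup M.
Let Pdual := dual_semigroup M mu.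
Let Gamma := carre_du_champ mu P.

Record standing_assumptions : Prop := StandingAssumptions {
  mu_invariant : invariant M mu ;
  mu_ergodic : ergodic M mu ;
  mu_unique : forall nu : probability (borel E) R,
    invariant M nu -> forall B, measurable B -> nu B = mu B ;
  semigroup_continuous : forall f, f \in Lfun mu 2%:E ->
    Lp_dist mu 2%:E (P t f) f @[t --> (0 : R)^'+] --> 0%E ;
  core_algebra : is_algebra A ;
  core_unif_continuous : forall f, A f -> unif_continuous (f : E -> R^o) ;
  core_bounded : forall f, A f -> exists K : R, forall x, `|f x| <= K ;
  core_generator : is_core mu P A ;
  carre_derivation : forall f g h, A f -> A g -> A h ->
    {ae mu, forall x, Gamma (f \* g) h x = f x * Gamma g h x + g x * Gamma f h x} ;
  dual_domain : forall f, A f -> in_domain mu Pdual f ;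
  dual_carre : forall f g, A f -> A g ->
    {ae mu, forall x, carre_du_champ mu Pdual f g x = Gamma f g x} }.

(* The form [f |-> \int Gamma(f, f) dmu] on [A] is closable because
   [A] is contained in the domain of the dual generator. The domain of its
   closure is the set of the L2 limits of the sequences of [A] which are Cauchy
   for the form, and [Gamma(h)] is the L1 limit of [Gamma(u_n, u_n)] along any
   such sequence, hence unique up to a mu-null set. *)
Definition is_carre_limit (h G : borel E -> R) : Prop :=
  [/\ h \in Lfun mu 2%:E, mu.-integrable setT (EFin \o G) &
  exists u : nat -> borel E -> R,
    [/\ forall n, A (u n),
        Lp_dist mu 2%:E (u n) h @[n --> \oo] --> 0%E,
        (\int[mu]_x (Gamma (u mn.1 \- u mn.2) (u mn.1 \- u mn.2) x)%:E)%E
          @[mn --> (\oo, \oo)] --> 0%E &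
        Lp_dist mu 1%:E (Gamma (u n) (u n)) G @[n --> \oo] --> 0%E]].

Definition in_dirichlet_domain (h : borel E -> R) : Prop :=
  exists G, is_carre_limit h G.

Definition carre (h : borel E -> R) : borel E -> R := get (is_carre_limit h).

Definition is_density (h : borel E -> R) : Prop :=
  [/\ measurable_fun setT h, forall x, 0 <= h x &
      (\int[mu]_x (h x)%:E = 1)%E].

Definition nice_density (h : borel E -> R) : Prop :=
  is_density h /\ in_dirichlet_domain h.

Definition I_psi (psi : R -> R) (h : borel E -> R) : \bar R :=
  (\int[mu]_x (psi (h x))%:E)%E.

Definition TV_to_mu (g : borel E -> R) : \bar R :=
  (\int[mu]_x `|g x - 1|%:E)%E.

End Setting.
End MarkovProcess.

(* One-sided derivatives at [0] are the continuous extensions of the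
   derivatives on ]0, +oo[. *)
Definition C2_on_nonneg (R : realType) (psi psi' psi'' : R -> R) : Prop :=
  [/\ {within `[0, +oo[, continuous psi},
      {within `[0, +oo[, continuous psi'},
      {within `[0, +oo[, continuous psi''},
      forall u : R, 0 < u -> is_derive u 1 psi (psi' u) &
      forall u : R, 0 < u -> is_derive u 1 psi' (psi'' u)].

(* Uniform convexity with a quadratic modulus; for a C2 function,
   this is a positive lower bound on the second derivative. *)
Definition uniformly_convex_on (R : realType) (D : set R) (psi : R -> R) : Prop :=
  exists2 c : R, 0 < c &
    forall (x y t : R), D x -> D y -> 0 <= t <= 1 ->
      psi (t * x + (1 - t) * y) + c * t * (1 - t) * (x - y) ^+ 2 <=
      t * psi x + (1 - t) * psi y.

(* Main.v *)
From HB Require Import structures.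
Require Import Defs.
From mathcomp Require Import all_boot all_order all_algebra.
From mathcomp Require Import all_classical all_reals all_analysis.
From mathcomp Require Import measurable_realfun ring lra.

Set Implicit Arguments.
Unset Strict Implicit.
Unset Printing Implicit Defensive.
Import Order.TTheory GRing.Theory Num.Theory.
Import numFieldNormedType.Exports.

Local Open Scope classical_set_scope.
Local Open Scope ring_scope.

(** Let [B (a, b) = psi a - psi b - psi' b * (a - b)] be the Bregman divergence
    of [psi]. Formally, the entropy [I (t)] of [h_t = P_t^* h] satisfies
    [I' (t) = - 1/2 \int psi'' (h_t) Gamma (h_t) dmu], so that (ii), applied to
    all the [h_t], is the differential inequality [I' <= - I / (2 C)], while
    (i) gives (ii) by differentiation at time 0. The difficulty is to
    differentiate without knowing anything on the regularity of [h_t]. It is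
    avoided by proving each half of the formula for [I'] as an inequality, for
    functions for which it makes sense, and by passing to the limit.

    Both halves come from the stationary pair [(X_0, X_t)]. A pointwise
    inequality between finite sums of products [f x * g y] holds in expectation
    for this pair [joint_sum_ge0]. For [v] in the algebra, the increment
    [v (X_0) - v (X_t)] has a second moment asymptotic to [t] times the mean of
    [Gamma (v)] [quad_cvg] and, because [Gamma] is a derivation, a fourth moment
    negligible with respect to [t] [quart_cvg]. Hence it is enough to compare
    [B] with quadratic forms in such increments, up to fourth powers.

    From (ii) to (i). Let [u] be a bounded density such that [P_t^* u] has at
    time 0 an L2 derivative [l]. It belongs to the domain of the Dirichlet form
    [dual_domain_dirichlet], and the lower bound [bregman_lower] of [B] by
    [(J a - J b) * z - z ^+ 2 / 2], where [J' ^+ 2 = psi''] and [z] is the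
    increment of a function of the algebra, gives after optimization over this
    function [1/2 \int psi'' (u) Gamma (u) dmu <= - <l, psi' (u)>]
    [dissipation]. The class of these [u] is stable under the dual semigroup and
    contains the time averages [regular_density] of all bounded densities: with
    (ii), the entropy decreases at rate [1 / (2 C)] in the sense of Dini
    [entropy_dini], whence the exponential decay [dini_exp_decay] for bounded
    densities, then for all densities by truncation and Fatou's lemma
    [entropy_decay].

    From (i) to (ii). For [w = phi (v)] with [v] in the algebra and [phi] of
    class C1, [I (w) - I (P_t^* w)] is at most the expectation of
    [B (w (X_0), w (X_t))], and the upper bound [bregman_upper] gives (ii) for
    [w] at time 0 [production_algebra]. The inequality passes to the limit along
    a sequence of the algebra which approximates a nice density [h], for [phi]
    bounded [production_limit]. Finally [phi] tends to the identity: it is a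
    C1 truncation which preserves the mass of [h] and for which
    [psi'' (phi) * phi' ^+ 2] is at most [psi''] times a factor close to 1
    [balanced_cutoff], and Fatou's lemma applies [production_inequality].

    The bound in total variation is an inequality of Pinsker type: since [psi] is
    uniformly convex near 1, [B (u, 1)] controls [(u - 1) ^+ 2] near 1 and
    [u - 1] far from it [bregman_pinsker, TV_entropy]. *)

(** * Uniform continuity *)

Section RealFunctions.
Context (R : realType).
Implicit Types f g : R -> R.

(** Continuity is uniform even for the pairs of which only one point lies in the
    segment: the other one may leave it by less than [r]. *)
Lemma heine f a b e : continuous f -> 0 < e ->
  exists2 r, 0 < r &
    forall x y, x \in `[a, b] -> `|x - y| <= r -> `|f x - f y| <= e.
Proof.
move=> cf e0.
pose P r x := forall y, `|x - y| <= r -> `|f x - f y| <= e.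
have /compact_near_coveringP cov := @segment_compact _ a b.
have H : \forall r \near (0 : R)^'+, `[a, b]%classic `<=` P r.
  apply: cov => x xab.
  have e20 : 0 < e / 2 by rewrite divr_gt0.
  have /cvgrPdist_le/(_ _ e20)/nbhs_ballP [dl /= dl0 Hdl] := cf x.
  have close z : `|x - z| < dl -> `|f x - f z| <= e / 2 by exact: Hdl.
  exists (ball x (dl / 2), [set r | 0 < r < dl / 2]).
    split; first by apply: nbhsx_ballx; rewrite divr_gt0.
    by near=> r => /=; apply/andP; split; near: r;
      [exact: nbhs_right_gt|apply: nbhs_right_lt; rewrite divr_gt0].
  move=> [z r] /= [xz /andP[r0 rdl]] y zy; rewrite /ball/= in xz.
  rewrite (le_trans (ler_distD (f x) _ _))// (splitr e) lerD//.
    by rewrite distrC close// (lt_trans xz)// ltr_pdivrMr// ltr_pMr// ltr1n.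
  rewrite close// (le_lt_trans (ler_distD z _ _))// (splitr dl) ltrD//.
  exact: le_lt_trans rdl.
have [r [r0 Hr]] : exists r : R, 0 < r /\ `[a, b]%classic `<=` P r.
  apply: (@filter_ex _ (0 : R)^'+); apply: filterI H; exact: nbhs_right_gt.
by exists r => // x y xab; exact: Hr.
Unshelve. all: by end_near. Qed.

(** * Weierstrass approximation *)

(** The Bernstein polynomial of the samples [g 0], ..., [g n]: its value at [x]
    is the mean of [g] under the binomial law of parameters [n] and [x], here
    generated by one Bernoulli trial at a time. *)
Fixpoint bernstein (n : nat) (g : nat -> R) : {poly R} :=
  if n is n'.+1 then
    (1 - 'X) * bernstein n' g + 'X * bernstein n' (fun k => g k.+1)
  else (g 0%N)%:P.

Lemma bernsteinS n (g : nat -> R) x : (bernstein n.+1 g).[x] =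
  (1 - x) * (bernstein n g).[x] + x * (bernstein n (fun k => g k.+1)).[x].
Proof. by rewrite /= !hornerE. Qed.

Lemma le_bernstein n (g h : nat -> R) x : 0 <= x <= 1 ->
  (forall k, (k <= n)%N -> g k <= h k) ->
  (bernstein n g).[x] <= (bernstein n h).[x].
Proof.
move=> /andP[x0 x1]; elim: n g h => [|n IH] g h gh.
  by rewrite /= !hornerE gh.
rewrite !bernsteinS lerD// ler_wpM2l ?subr_ge0 ?IH// => k kn; apply: gh => //.
exact: leqW.
Qed.

Lemma bernstein_lin n (g h : nat -> R) x c :
  (bernstein n (fun k => g k + c * h k)).[x] =
  (bernstein n g).[x] + c * (bernstein n h).[x].
Proof.
elim: n g h => [|n IH] g h; first by rewrite /= !hornerE.
by rewrite !bernsteinS (IH g h) (IH (fun k => g k.+1) (fun k => h k.+1)); ring.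
Qed.

Lemma bernstein_cst n c x : (bernstein n (fun=> c)).[x] = c.
Proof.
by elim: n => [|n IH]; rewrite ?bernsteinS ?IH /= ?hornerE//; ring.
Qed.

Lemma norm_bernstein n (g h : nat -> R) x : 0 <= x <= 1 ->
  (forall k, (k <= n)%N -> `|g k| <= h k) ->
  `|(bernstein n g).[x]| <= (bernstein n h).[x].
Proof.
move=> x01 gh; rewrite ler_norml; apply/andP; split; last first.
  by apply: le_bernstein => // k kn; rewrite (le_trans (ler_norm _))// gh.
rewrite lerNl (_ : - _ = (bernstein n (fun k => 0 + (-1) * g k)).[x]).
  apply: le_bernstein => // k kn.
  by rewrite add0r mulN1r (le_trans _ (gh k kn))// -normrN ler_norm.
by rewrite bernstein_lin bernstein_cst add0r mulN1r.
Qed.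

Lemma bernstein_sqr n c x :
  (bernstein n (fun k => (k%:R - c) ^+ 2)).[x] =
  (n%:R * x - c) ^+ 2 + n%:R * x * (1 - x).
Proof.
elim: n c => [|n IH] c; first by rewrite /= !hornerE; ring.
rewrite bernsteinS IH.
under [X in bernstein n X]eq_fun => k.
  rewrite (_ : k.+1%:R - c = k%:R - (c - 1)); last by rewrite -natr1; ring.
  over.
by rewrite IH -natr1; ring.
Qed.

(** Bernstein's proof: the samples far from [x] are controlled by the variance of
    the binomial law, of order [1 / n] after rescaling. *)
Lemma weierstrass01 f e M : continuous f -> (forall x, `|f x| <= M) -> 0 < e ->
  exists p : {poly R}, forall x, 0 <= x <= 1 -> `|p.[x] - f x| <= e.
Proof.
move=> cf fM e0.
have M0 : 0 <= M := le_trans (normr_ge0 _) (fM 0).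
have e20 : 0 < e / 2 by rewrite divr_gt0.
have [r r0 Hr] := heine 0 1 cf e20.
have [n Hn] : exists n : nat, M / (r ^+ 2 * (e / 2)) < n.+1%:R.
  exists (Num.trunc (M / (r ^+ 2 * (e / 2)))).
  by rewrite truncnS_gt// divr_ge0// mulr_ge0// ltW// exprn_gt0.
have {}Hn : M / (r ^+ 2 * n.+1%:R) <= e / 2.
  move: Hn; rewrite ltr_pdivrMr ?mulr_gt0 ?exprn_gt0// => /ltW Hn.
  rewrite ler_pdivrMr ?mulr_gt0 ?exprn_gt0//.
  by rewrite (le_trans Hn)// le_eqVlt; apply/orP; left; apply/eqP; ring.
exists (bernstein n.+1 (fun k => f (k%:R / n.+1%:R))) => x x01.
have n0 : 0 < n.+1%:R :> R by rewrite ltr0n.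
pose D := 2 * M / (r * n.+1%:R) ^+ 2.
have D0 : 0 <= D by rewrite /D divr_ge0 ?sqr_ge0// mulr_ge0.
have key k : `|f (k%:R / n.+1%:R) - f x| <=
    e / 2 + D * (k%:R - n.+1%:R * x) ^+ 2.
  have [xk|xk] := leP `|x - k%:R / n.+1%:R| r.
    rewrite distrC (le_trans (Hr _ _ _ xk))//.
    by rewrite lerDl mulr_ge0// sqr_ge0.
  rewrite (@le_trans _ _ (2 * M))//.
    by rewrite (le_trans (ler_normB _ _))// (_ : 2 * M = M + M) ?lerD//; ring.
  rewrite (@le_trans _ _ (D * (k%:R - n.+1%:R * x) ^+ 2))//; last first.
    by rewrite lerDr ltW.
  rewrite (_ : D * _ = 2 * M * (`|x - k%:R / n.+1%:R| / r) ^+ 2); last first.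
    rewrite expr_div_n real_normK ?num_real// /D; field.
    by rewrite !gt_eqF.
  rewrite ler_peMr ?mulr_ge0// expr_ge1 ?divr_ge0 ?(ltW r0)//.
  by rewrite ler_pdivlMr// mul1r ltW.
have mom : (bernstein n.+1 (fun k =>
    e / 2 + D * (k%:R - n.+1%:R * x) ^+ 2)).[x] <= e.
  rewrite (bernstein_lin _ (fun=> e / 2)) bernstein_cst bernstein_sqr subrr.
  rewrite expr0n add0r [leRHS]splitr lerD2l (le_trans _ Hn)//.
  rewrite (_ : D * _ = M / (r ^+ 2 * n.+1%:R) * (2 * (x * (1 - x)))); last first.
    by rewrite /D; field; rewrite !gt_eqF.
  rewrite ler_piMr//; first by rewrite divr_ge0// mulr_ge0// sqr_ge0.
  by have := sqr_ge0 (2 * x - 1); rewrite expr2; nra.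
have fxE : f x = (bernstein n.+1 (fun=> f x)).[x] by rewrite bernstein_cst.
have dE : (bernstein n.+1 (fun k => f (k%:R / n.+1%:R))).[x] - f x =
    (bernstein n.+1 (fun k => f (k%:R / n.+1%:R) + (-1) * f x)).[x].
  by rewrite bernstein_lin bernstein_cst mulN1r.
rewrite dE (le_trans _ mom)//; apply: norm_bernstein => // k _.
by rewrite mulN1r.
Qed.

Lemma weierstrass f V e M : continuous f -> (forall x, `|f x| <= M) -> 0 < V ->
  0 < e -> exists p : {poly R}, forall x, `|x| <= V -> `|p.[x] - f x| <= e.
Proof.
move=> cf fM V0 e0.
pose g y := f (V * (2 * y - 1)).
have cg : continuous g.
  move=> y; apply: (@continuous_comp _ _ _ (fun y : R => V * (2 * y - 1)) f);
    last exact: cf.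
  apply: cvgMr; apply: cvgB; last exact: cvg_cst.
  by apply: cvgMr; exact: cvg_id.
have [p Hp] := weierstrass01 cg (fun y => fM _) e0.
exists (p \Po ((1 / (2 * V)) *: 'X + (1 / 2)%:P)) => x xV.
have /andP[x1 x2] : - V <= x <= V by rewrite -ler_norml.
rewrite horner_comp.
have -> : f x = g (1 / (2 * V) * x + 1 / 2).
  by rewrite /g; congr f; field; rewrite gt_eqF.
rewrite hornerD hornerZ hornerX hornerC; apply: Hp.
have -> : 1 / (2 * V) * x + 1 / 2 = (x + V) / (2 * V) by field; rewrite gt_eqF.
by rewrite divr_ge0 ?ler_pdivrMr ?mulr_gt0 ?mulr_ge0//=; lra.
Qed.

Definition primitive_poly (q : {poly R}) : {poly R} :=
  'X * \poly_(i < size q) (q`_i / i.+1%:R).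

Lemma primitive_polyE q : (primitive_poly q)^`() = q.
Proof.
apply/polyP => i; rewrite coef_deriv coefXM/= coef_poly.
case: ltnP => [iq|qi]; last by rewrite mul0rn nth_default.
by rewrite -[LHS]mulr_natr divfK// pnatr_eq0.
Qed.

Lemma primitive_poly0 q : (primitive_poly q).[0] = 0.
Proof. by rewrite /primitive_poly hornerM hornerX mul0r. Qed.

(** * Mean value formulas *)

(** At the end point 0 only continuity is available, as for a function which has
    there no more than a one-sided derivative. *)
Lemma MVT_ge0 f (df : R -> R) : (forall x : R, 0 < x -> is_derive x 1 f (df x)) ->
  continuous f -> forall a b : R, 0 <= a -> 0 <= b ->
  exists2 c, Num.min a b <= c <= Num.max a b & f a - f b = df c * (a - b).
Proof.
move=> dfE cf a b a0 b0.
wlog ab : a b a0 b0 / a <= b => [wl|].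
  have [|ba] := orP (le_total a b); first exact: wl.
  have [c cab E] := wl _ _ b0 a0 ba.
  by exists c; [rewrite minC maxC|rewrite -opprB E -mulrN opprB].
have [|c + E] := @MVT_segment R f df a b ab _ (continuous_subspaceT cf).
  move=> x; rewrite in_itv/= => /andP[ax _].
  by apply: dfE; rewrite (le_lt_trans a0).
rewrite in_itv/= => cab; exists c; first by rewrite min_l// max_r.
by rewrite -opprB E -mulrN opprB.
Qed.

Lemma MVT_real f (df : R -> R) : (forall x : R, is_derive x 1 f (df x)) ->
  forall a b : R,
  exists2 c, Num.min a b <= c <= Num.max a b & f a - f b = df c * (a - b).
Proof.
move=> dfE a b.
wlog ab : a b / a <= b => [wl|].
  have [|ba] := orP (le_total a b); first exact: wl.
  have [c cab E] := wl _ _ ba.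
  by exists c; [rewrite minC maxC|rewrite -opprB E -mulrN opprB].
have cf : {within `[a, b], continuous f}.
  by apply: derivable_within_continuous => x _; apply: ex_derive.
have [c + E] := @MVT_segment R f df a b ab (fun x _ => dfE x) cf.
rewrite in_itv/= => cab; exists c; first by rewrite min_l// max_r.
by rewrite -opprB E -mulrN opprB.
Qed.

(** * Exponential decay from a differential inequality *)

(** A function which decreases at rate at least [k] times itself in the sense of
    Dini decays exponentially: the set of times up to which the bound holds has
    a supremum, which it contains because a nonincreasing function can only jump
    down, and which it can exceed by the Dini inequality. *)
Lemma dini_exp_decay (I : R -> R) (k : R) : 0 <= k ->
  (forall s, 0 <= s -> 0 <= I s) ->
  (forall s t, 0 <= s -> s <= t -> I t <= I s) ->
  (forall s eta, 0 <= s -> 0 < eta ->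
    \forall e \near 0^'+, I (s + e) <= I s - e * (k * I s) + eta * e) ->
  forall t, 0 <= t -> I t <= expR (- (k * t)) * I 0.
Proof.
move=> k0 I0 Imon Idini t t0.
pose G s := expR (k * s) * I s.
suff H eta : 0 < eta -> G t <= G 0 + eta * t.
  have Gt : G t <= G 0.
    apply/ler_addgt0Pr => e e0.
    have := H (e / (t + 1)); rewrite divr_gt0 ?ltr_wpDl// => /(_ isT).
    move=> /le_trans; apply; rewrite lerD2l mulrAC ler_pdivrMr ?ltr_wpDl//.
    by rewrite ler_pM2l// lerDl.
  rewrite -(ler_pM2l (expR_gt0 (k * t))) mulrA -expRD addrN expR0 mul1r.
  by rewrite (le_trans Gt)// /G mulr0 expR0 mul1r.
move=> eta0.
pose S := [set s | 0 <= s <= t /\ forall r, 0 <= r <= s -> G r <= G 0 + eta * r].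
have S0 : S 0.
  split; first by rewrite lexx.
  by move=> r; rewrite -eq_le => /eqP <-; rewrite mulr0 addr0.
have Sub : has_ubound S by exists t => s [/andP[]].
have Ssup : has_sup S by split=> //; exists 0.
pose s := sup S.
have s0 : 0 <= s by apply: ub_le_sup.
have st : s <= t by apply: ge_sup; [exists 0|move=> r [/andP[]]].
have below r : 0 <= r -> r < s -> G r <= G 0 + eta * r.
  move=> r0 rs; have [q Sq rq] := sup_gt (proj1 Ssup) rs.
  by apply: (proj2 Sq); rewrite r0 ltW.
have Gs : G s <= G 0 + eta * s.
  have [->|sn0] := eqVneq s 0; first by rewrite mulr0 addr0.
  have sp : 0 < s by rewrite lt_neqAle eq_sym sn0.
  have lim : expR (k * (s - r)) * (G 0 + eta * r) @[r --> s^'-] -->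
      expR (k * (s - s)) * (G 0 + eta * s).
    apply: cvg_at_left_filter; apply: cvgM.
      apply: continuous_cvg; first exact: continuous_expR.
      by apply: cvgMr; apply: cvgB; [exact: cvg_cst|exact: cvg_id].
    by apply: cvgD; [exact: cvg_cst|apply: cvgMr; exact: cvg_id].
  rewrite subrr mulr0 expR0 mul1r in lim.
  rewrite -(cvg_lim (@Rhausdorff R) lim).
  apply: limr_ge; first by apply/cvg_ex; eexists; exact: lim.
  near=> r.
  have rs : r < s by near: r; exact: nbhs_left_lt.
  have r0 : 0 <= r by near: r; apply: nbhs_left_ge.
  rewrite (le_trans _ (ler_wpM2l (expR_ge0 _) (below _ r0 rs)))//.
  rewrite /G mulrA -expRD -mulrDr subrK ler_wpM2l ?expR_ge0//.
  by apply: Imon => //; exact: ltW.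
have Ss : S s.
  split; first by rewrite s0.
  move=> r /andP[r0]; rewrite le_eqVlt => /predU1P[->//|rs].
  exact: below.
have [ts|ts] := leP t s.
  by rewrite (_ : t = s)//; apply/eqP; rewrite eq_le ts st.
pose eta' := eta * expR (- (k * (s + 1))).
have eta'0 : 0 < eta' by rewrite mulr_gt0// expR_gt0.
have step : \forall e \near (0 : R)^'+, G (s + e) <= G 0 + eta * (s + e).
  near=> e.
  have e0 : 0 < e by near: e; exact: nbhs_right_gt.
  have e1 : e <= 1 by near: e; apply: nbhs_right_le.
  have Ie : I (s + e) <= I s - e * (k * I s) + eta' * e.
    by near: e; apply: Idini.
  rewrite /G mulrDr expRD.
  rewrite (le_trans (ler_wpM2l _ Ie)) ?mulr_ge0 ?expR_ge0//.
  have e2 : expR (k * e) * (1 - e * k) <= 1.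
    have := ler_wpM2l (expR_ge0 (k * e)) (expR_ge1Dx (- (k * e))).
    by rewrite -expRD addrN expR0 (mulrC e).
  rewrite mulrDr (_ : _ * (I s - _) =
    (expR (k * e) * (1 - e * k)) * G s); last by rewrite /G; ring.
  rewrite [in leRHS]mulrDr [leRHS]addrA; apply: lerD.
    rewrite (le_trans _ Gs)// ler_piMl// /G mulr_ge0 ?expR_ge0//.
    exact: I0.
  rewrite mulrA ler_wpM2r ?(ltW e0)// /eta' mulrCA ler_piMr ?(ltW eta0)//.
  rewrite -expRD -expRD -[leRHS]expR0 ler_expR -mulrDr subr_le0.
  by rewrite ler_wpM2l// lerD2l.
have /nbhs_ballP[dl /= dl0 Hdl] := step.
pose e := Num.min (dl / 2) (t - s).
have e0 : 0 < e by rewrite lt_min divr_gt0// subr_gt0.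
have edl : e < dl by rewrite gt_min ltr_pdivrMr// ltr_pMr// ltr1n.
have Sse : S (s + e).
  split; first by rewrite addr_ge0 ?(ltW e0)//= -lerBrDl ge_min lexx orbT.
  move=> r /andP[r0 rse]; have [rs|sr] := leP r s.
    by apply: (proj2 Ss); rewrite r0.
  rewrite -(subrKC s r); apply: Hdl; last by rewrite subr_gt0.
  rewrite /ball/= sub0r normrN gtr0_norm ?subr_gt0//.
  by rewrite (le_lt_trans _ edl)// lerBlDl.
have := ub_le_sup Sub Sse; rewrite -/s => /(lt_le_trans _).
by move=> /(_ s); rewrite ltrDl e0 ltxx => /(_ isT).
Unshelve. all: by end_near. Qed.

End RealFunctions.

(** * Elementary estimates *)

Section Between.
Context (R : realType).
Implicit Types a b c x l u : R.

Lemma between_itv a b x l u : l <= a <= u -> l <= b <= u ->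
  Num.min a b <= x <= Num.max a b -> l <= x <= u.
Proof.
move=> /andP[la au] /andP[lb bu] /andP[h1 h2].
by rewrite (le_trans _ h1) ?le_min ?la//= (le_trans h2)// ge_max au.
Qed.

Lemma between_dist a b c x : Num.min a b <= c <= Num.max a b ->
  Num.min a b <= x <= Num.max a b -> `|c - x| <= `|a - b|.
Proof.
wlog ab : a b / a <= b => [wl|].
  have [|ba] := orP (le_total a b); first exact: wl.
  by rewrite minC maxC (distrC a); exact: wl.
rewrite min_l// max_r// (distrC a) (ger0_norm (_ : 0 <= b - a)) ?subr_ge0//.
by move=> /andP[? ?] /andP[? ?]; rewrite ler_norml; apply/andP; split; lra.
Qed.

Lemma between_l a b : Num.min a b <= a <= Num.max a b.
Proof. by rewrite ge_min le_max lexx. Qed.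

Lemma sqr_perturb (x y t L : R) : 0 <= x -> 0 <= y -> y <= L -> 0 <= t ->
  t <= 1 -> x <= y + t -> x ^+ 2 <= y ^+ 2 + t * (2 * L + 1).
Proof.
move=> x0 y0 yL t0 t1 xyt.
have : x ^+ 2 <= (y + t) ^+ 2 by rewrite lerXn2r ?nnegrE ?addr_ge0.
move=> /le_trans; apply.
have h1 : t * (2 * y) <= t * (2 * L) by rewrite ler_wpM2l// ler_pM2l.
have h2 : t * t <= t * 1 by rewrite ler_wpM2l.
by rewrite expr2; lra.
Qed.

Lemma prod_perturb (p q q' t L M tau : R) : 0 <= p -> p <= M -> 0 <= q ->
  q <= L ^+ 2 -> q' <= q + t * (2 * L + 1) -> 0 <= t -> t <= M -> 0 <= L ->
  t * (M * (2 * L + 1) + L ^+ 2) <= tau ->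
  (p + t) * q' <= p * q + 2 * tau.
Proof.
move=> p0 pM q0 qL qq t0 tM L0 tt.
have M0 : 0 <= M by rewrite (le_trans p0).
have w0 : 0 <= t * (2 * L + 1) by rewrite mulr_ge0// addr_ge0// mulr_ge0.
apply: (@le_trans _ _ ((p + t) * (q + t * (2 * L + 1)))).
  by rewrite ler_wpM2l// addr_ge0.
have h1 := ler_wpM2r w0 pM.
have h2 := ler_wpM2l t0 qL.
have h3 := ler_wpM2r w0 tM.
have h4 : 0 <= t * L ^+ 2 by rewrite mulr_ge0// sqr_ge0.
have E : t * (M * (2 * L + 1) + L ^+ 2) = M * (t * (2 * L + 1)) + t * L ^+ 2.
  by ring.
by move: tt; rewrite E mulrDl !mulrDr; lra.
Qed.

Lemma half_bound (x y tau s c : R) : x <= (y + 2 * tau) * s -> 0 <= c ->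
  1 / 2 * x <= 1 / 2 * y * s + tau * s + c.
Proof. by move=> h c0; lra. Qed.

End Between.

(** * Bregman divergence of a uniformly convex function *)

Section Entropy.
Context (R : realType).
Implicit Types f g : R -> R.

Lemma bounded_itv f a b : continuous f ->
  exists2 K, 0 <= K & forall x, x \in `[a, b] -> `|f x| <= K.
Proof.
move=> cf; have [ab|ba] := leP a b; last first.
  exists 0 => // x; rewrite in_itv/= => /andP[/le_trans h /h].
  by rewrite leNgt ba.
have cn : {within `[a, b], continuous (fun x => `|f x|)}.
  apply: continuous_subspaceT => x.
  exact: (continuous_comp (cf x) (@norm_continuous _ _ _)).
have [c cab H] := EVT_max ab cn.
by exists `|f c|.
Qed.

Lemma exists_primitive f : continuous f ->
  exists J : R -> R, [/\ continuous J, J 0 = 0 &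
    forall x : R, 0 < x -> is_derive x 1 J (f x)].
Proof.
move=> cf.
(* starting from -1 makes 0 an interior point *)
pose F x := \int[lebesgue_measure]_(t in [set` `[-1, x]]) f t.
have dF x : -1 < x -> derivable F x 1 /\ derive1 F x = f x.
  move=> x1; apply: (@continuous_FTC1_closed _ f (-1) x (x + 1)) => //.
  - by rewrite ltrDl.
  - apply: continuous_compact_integrable; first exact: segment_compact.
    exact: continuous_subspaceT.
  - exact: cf.
have cF x : -1 < x -> {for x, continuous F}.
  by move=> /dF[dx _]; apply: differentiable_continuous; apply/derivable1_diffP.
exists (fun x => F (Num.max x 0) - F 0); split.
- move=> x; apply: cvgB; last exact: cvg_cst.
  apply: (@continuous_comp _ _ _ (fun x : R => Num.max x 0) F).
    by apply: continuous_max; [exact: cvg_id|exact: cvg_cst].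
  by apply: cF; rewrite lt_max ltrN10 orbT.
- by rewrite max_l// subrr.
- move=> x x0.
  have [dx <-] : derivable F x 1 /\ derive1 F x = f x.
    by apply: dF; rewrite (lt_trans _ x0)// ltrN10.
  have dFx : is_derive x 1 (fun x => F x - F 0) (derive1 F x).
    rewrite -[derive1 F x]subr0; apply: is_deriveB.
    by rewrite derive1E; exact: derivableP.
  apply: near_eq_is_derive dFx.
  near=> y; rewrite max_l// ltW//; near: y; exact: lt_nbhsr.
Unshelve. all: by end_near. Qed.

(** The three functions stand for [psi] and its first two derivatives,
    extended to the whole line by their values at 0: they are then continuous,
    hence measurable, everywhere. *)
Record smooth_convex (p p1 p2 : R -> R) : Prop := SmoothConvex {
  sc_cont0 : continuous p ;
  sc_cont1 : continuous p1 ;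
  sc_cont2 : continuous p2 ;
  sc_derive0 : forall u : R, 0 < u -> is_derive u 1 p (p1 u) ;
  sc_derive1 : forall u : R, 0 < u -> is_derive u 1 p1 (p2 u) ;
  sc_pos : forall K : R, exists2 c, 0 < c & forall u, 0 <= u <= K -> c <= p2 u }.

Section SmoothConvex.
Context (p p1 p2 : R -> R) (sc : smooth_convex p p1 p2).

Definition bregman a b := p a - p b - p1 b * (a - b).

Lemma sc_ge0 u : 0 <= u -> 0 < p2 u.
Proof.
by move=> u0; have [c c0 H] := sc_pos sc u; rewrite (lt_le_trans c0)// H ?u0/=.
Qed.

(** Two successive mean value theorems; the weight [w = (c - b) * (a - b)] is
    nonnegative because [c] lies between [a] and [b]. *)
Lemma bregman_aux m a b : 0 <= a -> 0 <= b -> exists2 xi,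
  Num.min a b <= xi <= Num.max a b &
  exists2 w, 0 <= w & bregman a b - 1 / 2 * m * (a - b) ^+ 2 = (p2 xi - m) * w.
Proof.
move=> a0 b0.
pose k s := p s - p1 b * s - 1 / 2 * m * (s - b) ^+ 2.
have ck : continuous k.
  move=> x; apply: cvgB; first apply: cvgB; first exact: (sc_cont0 sc).
    by apply: cvgMr; exact: cvg_id.
  apply: cvgMr; apply: (@continuous_comp _ _ _ (fun x : R => x - b) (@GRing.exp R ^~ 2%N)).
    by apply: cvgB; [exact: cvg_id|exact: cvg_cst].
  exact: exprn_continuous.
have dk (x : R) : 0 < x -> is_derive x 1 k (p1 x - p1 b - m * (x - b)).
  move=> x0; have dp := sc_derive0 sc x0.
  rewrite /k; apply: is_derive_eq.
  by rewrite /GRing.scale/=; field.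
have [c cab Ek] := MVT_ge0 dk ck a0 b0.
have c0 : 0 <= c.
  by have /andP[h _] := cab; rewrite (le_trans _ h)// le_min a0.
have [xi xicb E1] := MVT_ge0 (sc_derive1 sc) (sc_cont1 sc) c0 b0.
exists xi.
  move: cab xicb => /andP[c1 c2] /andP[x1 x2].
  rewrite (le_trans _ x1) ?(le_trans x2)//.
    by rewrite ge_max c2 le_max lexx orbT.
  by rewrite le_min c1 ge_min lexx orbT.
exists ((c - b) * (a - b)).
  move: cab; have [ab|ba] := leP a b; move=> /andP[h1 h2].
    by rewrite -mulrNN mulr_ge0; lra.
  by rewrite mulr_ge0; lra.
rewrite mulrA.
have <- : p1 c - p1 b - m * (c - b) = (p2 xi - m) * (c - b).
  by rewrite E1; ring.
by rewrite -Ek /k /bregman; ring.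
Qed.

Lemma bregman_ge m a b : 0 <= a -> 0 <= b ->
  (forall x, Num.min a b <= x <= Num.max a b -> m <= p2 x) ->
  1 / 2 * m * (a - b) ^+ 2 <= bregman a b.
Proof.
move=> a0 b0 H; have [xi xiab [w w0 E]] := bregman_aux m a0 b0.
by rewrite -subr_ge0 E mulr_ge0// subr_ge0 H.
Qed.

Lemma bregman_le m a b : 0 <= a -> 0 <= b ->
  (forall x, Num.min a b <= x <= Num.max a b -> p2 x <= m) ->
  bregman a b <= 1 / 2 * m * (a - b) ^+ 2.
Proof.
move=> a0 b0 H; have [xi xiab [w w0 E]] := bregman_aux m a0 b0.
by rewrite -subr_le0 E mulr_le0_ge0// subr_le0 H.
Qed.

Lemma bregman_ge0 a b : 0 <= a -> 0 <= b -> 0 <= bregman a b.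
Proof.
move=> a0 b0; rewrite -[leLHS](_ : 1 / 2 * 0 * (a - b) ^+ 2 = _); last by ring.
apply: bregman_ge => // x /andP[h _]; apply/ltW/sc_ge0.
by rewrite (le_trans _ h)// le_min a0.
Qed.

Lemma sc_lip1 K : exists2 M, 0 <= M & forall a b, 0 <= a <= K -> 0 <= b <= K ->
  `|p1 a - p1 b| <= M * `|a - b|.
Proof.
have [M M0 HM] := bounded_itv 0 K (sc_cont2 sc).
exists M => // a b /andP[a0 aK] /andP[b0 bK].
have [c cab ->] := MVT_ge0 (sc_derive1 sc) (sc_cont1 sc) a0 b0.
rewrite normrM ler_wpM2r// HM// in_itv/=.
by apply: between_itv cab; apply/andP.
Qed.

Lemma sc_lip0 K : exists2 M, 0 <= M & forall a b, 0 <= a <= K -> 0 <= b <= K ->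
  `|p a - p b| <= M * `|a - b|.
Proof.
have [M M0 HM] := bounded_itv 0 K (sc_cont1 sc).
exists M => // a b /andP[a0 aK] /andP[b0 bK].
have [c cab ->] := MVT_ge0 (sc_derive0 sc) (sc_cont0 sc) a0 b0.
rewrite normrM ler_wpM2r// HM// in_itv/=.
by apply: between_itv cab; apply/andP.
Qed.

(** The relative entropy controls the distance to 1, quadratically near 1 and
    linearly far from 1; the parameter [s] interpolates between the two. *)
Lemma bregman_pinsker : exists2 c, 0 < c & forall u s, 0 <= u -> 0 < s <= 1 ->
  `|u - 1| <= s + bregman u 1 / (c * s).
Proof.
have [c0 c00 Hc] := sc_pos sc 2.
pose c := c0 / 2.
have cp : 0 < c by rewrite divr_gt0.
exists c => // u s u0 /andP[s0 s1].
have quad v : 0 <= v <= 2 -> c * (v - 1) ^+ 2 <= bregman v 1.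
  move=> /andP[v0 v2].
  rewrite (_ : c = 1 / 2 * c0); last by rewrite /c; field.
  apply: bregman_ge => // x xv; apply: Hc; move: xv.
  by have [vb|bv] := leP v 1; move=> /andP[? ?]; apply/andP; split; lra.
have [u2|u2] := leP u 2.
  have q : c * (u - 1) ^+ 2 <= bregman u 1 by apply: quad; rewrite u0.
  apply: (@le_trans _ _ (s + (u - 1) ^+ 2 / s)).
    rewrite -(ler_pM2r s0) mulrDl divfK ?gt_eqF//.
    rewrite -(real_normK (num_real (u - 1))).
    by have := sqr_ge0 (s - `|u - 1|); rewrite !expr2;
      have := normr_ge0 (u - 1); nra.
  rewrite lerD2l invfM mulrA ler_pM2r ?invr_gt0//.
  by rewrite ler_pdivlMr// mulrC.
have lin : c * (u - 1) <= bregman u 1.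
  have q2 : c <= bregman 2 1.
    by have := quad 2; rewrite lexx ler0n (_ : 2 - 1 = 1) ?expr1n ?mulr1//; [exact|ring].
  have [xi xi12 E1] := MVT_ge0 (sc_derive1 sc) (sc_cont1 sc) (ler0n R 2) ler01.
  have xi2 : c0 <= p2 xi.
    apply: Hc; move: xi12; rewrite /Num.min/Num.max; case: ifP => _.
      by move=> /andP[? ?]; apply/andP; split; lra.
    by move=> /andP[? ?]; apply/andP; split; lra.
  have Eu : bregman u 1 = bregman u 2 + bregman 2 1 + (p1 2 - p1 1) * (u - 2).
    by rewrite /bregman; ring.
  have b2 : 0 <= bregman u 2 by apply: bregman_ge0 => //; exact: ler0n.
  rewrite Eu E1 (_ : 2 - 1 = 1); last by ring.
  have c0E : c0 = 2 * c by rewrite /c; field.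
  rewrite c0E in xi2; nra.
rewrite ger0_norm; last by lra.
have bu : 0 <= bregman u 1 by apply: bregman_ge0.
rewrite (le_trans (_ : u - 1 <= bregman u 1 / c))//.
  by rewrite ler_pdivlMr// mulrC.
rewrite (@le_trans _ _ (bregman u 1 / (c * s)))//; last by rewrite lerDr ltW.
rewrite ler_wpM2l// lef_pV2 ?posrE ?mulr_gt0//.
by rewrite ler_piMr// ltW.
Qed.

(** Local lower bound of the Bregman divergence, in a form which is bilinear in
    a test increment [z]: jumps of [a - b] are absorbed by [z ^+ 4], which is
    negligible along a diffusion. The function [J] is an antiderivative of the
    square root of [p2]. *)
Lemma bregman_lower K J : continuous J ->
  (forall u : R, 0 < u -> is_derive u 1 J (Num.sqrt (p2 u))) ->
  forall tau, 0 < tau -> exists2 C, 0 <= C &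
    forall a b z, 0 <= a <= K -> 0 <= b <= K ->
      (J a - J b) * z - 1 / 2 * z ^+ 2 - tau * (a - b) ^+ 2 - C * z ^+ 4 <=
      bregman a b.
Proof.
move=> cJ dJ tau tau0.
have [M M0 HM] := bounded_itv 0 K (sc_cont2 sc).
pose L := Num.sqrt M + 1.
have L0 : 0 < L by rewrite ltr_wpDl// sqrtr_ge0.
have lipJ a b : 0 <= a <= K -> 0 <= b <= K -> exists2 c,
    Num.min a b <= c <= Num.max a b &
    J a - J b = Num.sqrt (p2 c) * (a - b) /\ `|J a - J b| <= L * `|a - b|.
  move=> /andP[a0 aK] /andP[b0 bK].
  have [c cab E] := MVT_ge0 dJ cJ a0 b0.
  exists c => //; split=> //; rewrite E normrM ler_wpM2r//.
  rewrite ger0_norm ?sqrtr_ge0// (@le_trans _ _ (Num.sqrt M)) ?lerDl//.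
  apply: ler_wsqrtr; rewrite (le_trans (ler_norm _))// HM// in_itv/=.
  by apply: between_itv cab; apply/andP.
have [r r0 Hr] := heine 0 K (sc_cont2 sc) tau0.
pose sg := tau * r / L.
have sg0 : 0 < sg by rewrite divr_gt0// mulr_gt0.
pose C := L * `|K| / sg ^+ 3.
have C0 : 0 <= C.
  by apply: divr_ge0; [apply: mulr_ge0|apply: exprn_ge0]; rewrite ?normr_ge0// ltW.
exists C => // a b z aK bK.
have [c cab [EJ nJ]] := lipJ a b aK bK.
have [a0 aK'] := andP aK; have [b0 bK'] := andP bK.
have z4 : 0 <= C * z ^+ 4 by rewrite mulr_ge0// exprn_even_ge0.
have segK x : Num.min a b <= x <= Num.max a b -> 0 <= x <= K /\ `|c - x| <= `|a - b|.
  by move=> xab; split; [apply: between_itv xab|apply: between_dist].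
(* near the diagonal, p2 is almost constant: complete a square *)
have [abr|rab] := leP `|a - b| r.
  have Bge : 1 / 2 * (p2 c - tau) * (a - b) ^+ 2 <= bregman a b.
    apply: bregman_ge => // x /segK[xK cx].
    have [cK _] := segK c cab.
    have := Hr c x; rewrite in_itv/= => /(_ cK (le_trans cx abr)).
    by rewrite ler_norml => /andP[h1 h2]; lra.
  have p2c : 0 <= p2 c by apply/ltW/sc_ge0; have [/andP[]] := segK c cab.
  apply: le_trans Bge.
  have sq : (J a - J b) ^+ 2 = p2 c * (a - b) ^+ 2 by rewrite EJ exprMn sqr_sqrtr.
  have := sqr_ge0 (J a - J b - z); have := sqr_ge0 (a - b); rewrite !expr2 in sq *.
  nra.
(* away from it, the bilinear term is bounded by the square of [a - b] if [z]
   is small, and by [z ^+ 4] if it is large *)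
have B0 : 0 <= bregman a b by apply: bregman_ge0.
apply: le_trans B0.
suff : (J a - J b) * z <= tau * (a - b) ^+ 2 + C * z ^+ 4.
  by have := sqr_ge0 z; lra.
have jz : (J a - J b) * z <= L * `|a - b| * `|z|.
  by rewrite (le_trans (ler_norm _))// normrM ler_wpM2r.
have [zs|sz] := leP `|z| sg.
  have Lab : 0 <= L * `|a - b| by rewrite mulr_ge0// ltW.
  rewrite (le_trans jz)// (le_trans (ler_wpM2l Lab zs))//.
  rewrite (_ : L * _ * sg = tau * (`|a - b| * r)); last first.
    by rewrite /sg; field; rewrite gt_eqF.
  rewrite (@le_trans _ _ (tau * (a - b) ^+ 2)) ?lerDl//.
  rewrite ler_wpM2l ?(ltW tau0)// -(real_normK (num_real (a - b))) expr2.
  by rewrite ler_wpM2l// ltW.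
rewrite (le_trans jz)// (@le_trans _ _ (C * z ^+ 4))//; last first.
  by rewrite lerDr mulr_ge0 ?sqr_ge0// ltW.
have abK : `|a - b| <= `|K|.
  by rewrite (@le_trans _ _ K) ?ler_norm// ler_norml; apply/andP; split; lra.
rewrite (@le_trans _ _ (L * `|K| * `|z|))//.
  by rewrite ler_wpM2r// ler_wpM2l// ltW.
rewrite (_ : z ^+ 4 = `|z| ^+ 3 * `|z|); last first.
  by rewrite -exprSr -normrX ger0_norm// exprn_even_ge0.
rewrite mulrA ler_wpM2r// /C mulrAC ler_pdivlMr ?exprn_gt0//.
rewrite ler_wpM2l ?mulr_ge0 ?(ltW L0)//.
by rewrite lerXn2r ?nnegrE ?normr_ge0 ?(ltW sg0) ?(ltW sz).
Qed.

(** Local upper bound of the Bregman divergence of the images under a C1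
    function, with an error which is negligible along a diffusion. *)
Lemma bregman_upper (phi phi1 : R -> R) V : continuous phi1 ->
  (forall x : R, is_derive x 1 phi (phi1 x)) -> (forall x, 0 <= phi x) ->
  forall tau, 0 < tau -> exists2 C, 0 <= C &
    forall a b, `|a| <= V -> `|b| <= V ->
      bregman (phi a) (phi b) <=
      1 / 2 * (p2 (phi a) * phi1 a ^+ 2) * (a - b) ^+ 2 +
      tau * (a - b) ^+ 2 + C * (a - b) ^+ 4.
Proof.
move=> cphi1 dphi phi0 tau tau0.
have cphi : continuous phi.
  by move=> x; apply: differentiable_continuous; apply/derivable1_diffP;
    apply: ex_derive.
have [L0 L00 HL0] := bounded_itv (-V) V cphi1.
have [K K0 HK] := bounded_itv (-V) V cphi.
have [M0 M00 HM0] := bounded_itv 0 K (sc_cont2 sc).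
pose L := L0 + 1. pose M := M0 + 1.
have Lp : 1 <= L by rewrite lerDr. have Mp : 1 <= M by rewrite lerDr.
have inV x : `|x| <= V -> x \in `[-V, V] by rewrite ler_norml in_itv.
have phiK x : `|x| <= V -> phi x \in `[0, K].
  by move=> /inV/HK h; rewrite in_itv/= phi0 (le_trans (ler_norm _)).
pose t := Num.min 1 (tau / (M * (2 * L + 1) + L ^+ 2)).
have den : 0 < M * (2 * L + 1) + L ^+ 2 by rewrite expr2; nra.
have t0 : 0 < t by rewrite lt_min ltr01 divr_gt0.
have t1 : t <= 1 by rewrite ge_min lexx.
have tt : t * (M * (2 * L + 1) + L ^+ 2) <= tau.
  by rewrite -ler_pdivlMr// ge_min lexx orbT.
have [r1 r10 Hr1] := heine (-V) V cphi1 t0.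
have [r2 r20 Hr2] := heine 0 K (sc_cont2 sc) t0.
pose r := Num.min r1 (r2 / L).
have r0 : 0 < r by rewrite lt_min r10 divr_gt0// (lt_le_trans ltr01).
pose C := M * L ^+ 2 / r ^+ 2.
have C0 : 0 <= C.
  by apply: divr_ge0; [apply: mulr_ge0|]; rewrite ?sqr_ge0// (le_trans ler01).
exists C => // a b aV bV.
have [c cab E] := MVT_real dphi a b.
have cV : `|c| <= V /\ `|a - c| <= `|a - b|.
  split; last by apply: between_dist => //; exact: between_l.
  by rewrite ler_norml; apply: between_itv cab; rewrite -ler_norml.
have phi1L x : `|x| <= V -> `|phi1 x| <= L.
  by move=> /inV/HL0 h; rewrite (le_trans h)// lerDl.
have p2M x : x \in `[0, K] -> p2 x <= M.
  by move=> /HM0 h; rewrite (le_trans (ler_norm _))// (le_trans h)// lerDl.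
have lip : `|phi a - phi b| <= L * `|a - b|.
  by rewrite E normrM ler_wpM2r// phi1L//; case: cV.
have seg x : Num.min (phi a) (phi b) <= x <= Num.max (phi a) (phi b) ->
    x \in `[0, K] /\ `|phi a - x| <= `|phi a - phi b|.
  move=> xab; rewrite in_itv/=; split.
    by apply: between_itv xab; [have := phiK a aV|have := phiK b bV]; rewrite in_itv.
  by apply: between_dist => //; exact: between_l.
have ab4 : 0 <= (a - b) ^+ 4 by rewrite exprn_even_ge0.
have pa : 0 < p2 (phi a) by apply: sc_ge0.
have [abr|rab] := leP `|a - b| r.
  have abr1 : `|a - b| <= r1 by rewrite (le_trans abr)// ge_min lexx.
  have abr2 : L * `|a - b| <= r2.
    rewrite mulrC -ler_pdivlMr ?(lt_le_trans ltr01)//.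
    by rewrite (le_trans abr)// ge_min lexx orbT.
  have B1 : bregman (phi a) (phi b) <=
      1 / 2 * (p2 (phi a) + t) * (phi a - phi b) ^+ 2.
    apply: bregman_le => // x /seg[xK xa].
    have := Hr2 (phi a) x (phiK a aV) (le_trans xa (le_trans lip abr2)).
    by rewrite distrC => /(le_trans (ler_norm _)); rewrite lerBlDl.
  have pc : `|phi1 c| <= `|phi1 a| + t.
    have := Hr1 a c (inV a aV) (le_trans (proj2 cV) abr1).
    have := ler_distD 0 (phi1 c) (phi1 a); rewrite distrC.
    have h := ler_normB (phi1 a) (phi1 a - phi1 c).
    move=> _ h2; rewrite (le_trans (_ : _ <= `|phi1 a| + `|phi1 a - phi1 c|))//.
      by rewrite (le_trans _ h)// opprB addrCA subrr addr0.
    by rewrite lerD2l.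
  have pc2 : phi1 c ^+ 2 <= phi1 a ^+ 2 + t * (2 * L + 1).
    rewrite -(real_normK (num_real (phi1 c))) -(real_normK (num_real (phi1 a))).
    by apply: sqr_perturb => //; [exact: phi1L|exact: ltW].
  have paM : p2 (phi a) <= M by apply: p2M; exact: phiK.
  have q2 : (phi1 a) ^+ 2 <= L ^+ 2.
    by rewrite -(real_normK (num_real (phi1 a))) lerXn2r ?nnegrE ?phi1L// (le_trans ler01).
  have main : (p2 (phi a) + t) * phi1 c ^+ 2 <= p2 (phi a) * phi1 a ^+ 2 + 2 * tau.
    apply: (prod_perturb (ltW pa) paM (sqr_ge0 _) q2 pc2 (ltW t0) _ _ tt).
      exact: le_trans t1 Mp.
    exact: le_trans ler01 Lp.
  have mn := ler_wpM2r (sqr_ge0 (a - b)) main.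
  have := half_bound mn (mulr_ge0 C0 ab4).
  by apply: le_trans; rewrite (le_trans B1)// E exprMn !mulrA.
have B1 : bregman (phi a) (phi b) <= 1 / 2 * M * (phi a - phi b) ^+ 2.
  by apply: bregman_le => // x /seg[xK xa]; exact: p2M.
have l2 : (phi a - phi b) ^+ 2 <= L ^+ 2 * (a - b) ^+ 2.
  rewrite -(real_normK (num_real (phi a - phi b))) -(real_normK (num_real (a - b))).
  by rewrite -exprMn lerXn2r ?nnegrE ?mulr_ge0// (le_trans ler01).
have l4 : (a - b) ^+ 2 <= (a - b) ^+ 4 / r ^+ 2.
  rewrite ler_pdivlMr ?exprn_gt0// (_ : (a - b) ^+ 4 = (a - b) ^+ 2 * (a - b) ^+ 2); last by ring.
  rewrite ler_wpM2l ?sqr_ge0// -(real_normK (num_real (a - b))).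
  by rewrite lerXn2r ?nnegrE ?normr_ge0 ?(ltW r0) ?(ltW rab).
have m1 : M * (phi a - phi b) ^+ 2 <= C * (a - b) ^+ 4.
  rewrite (_ : C * _ = M * (L ^+ 2 * ((a - b) ^+ 4 / r ^+ 2))); last first.
    by rewrite /C; ring.
  rewrite ler_wpM2l ?(le_trans ler01)// (le_trans l2)//.
  by rewrite ler_wpM2l ?sqr_ge0.
apply: (le_trans B1); rewrite (@le_trans _ _ (C * (a - b) ^+ 4))//.
  rewrite (le_trans _ m1)// -mulrA mul1r ler_piMl ?invf_le1 ?ler1n//.
  by rewrite mulr_ge0 ?sqr_ge0// (le_trans ler01).
have pq := mulr_ge0 (ltW pa) (sqr_ge0 (phi1 a)).
rewrite lerDr; apply: addr_ge0; apply: mulr_ge0; rewrite ?sqr_ge0 ?(ltW tau0)//.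
by rewrite mulr_ge0 ?divr_ge0.
Qed.

End SmoothConvex.

(** * Extension of psi to the whole line *)

Definition posext (f : R -> R) (u : R) := f (Num.max u 0).

Lemma posext_continuous f : {within `[0, +oo[, continuous f} ->
  continuous (posext f).
Proof.
move=> /continuous_within_itvcyP[cf cf0] x.
have cm : continuous (fun u : R => Num.max u 0).
  by move=> u; apply: continuous_max; [exact: cvg_id|exact: cvg_cst].
have [x0|x0|->] := ltgtP x 0.
- apply: (@near_cst_continuous _ _ (f 0)); near=> y.
  by rewrite /posext max_r// ltW//; near: y; exact: lt_nbhsl.
- apply: (@continuous_comp _ _ _ (fun u : R => Num.max u 0) f); first exact: cm.
  by rewrite max_l ?ltW//; apply: cf; rewrite in_itv/= x0.
- apply/cvgrPdist_le => e e0; rewrite /posext maxxx.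
  have /cvgrPdist_le/(_ _ e0)/nbhs_ballP[dl /= dl0 H] := cf0.
  apply/nbhs_ballP; exists dl => //= y; rewrite /ball/= sub0r normrN => ydl.
  have [y0|y0] := leP y 0; first by rewrite subrr normr0 ltW.
  by apply: H => //; rewrite /ball/= sub0r normrN.
Unshelve. all: by end_near. Qed.

Lemma posext_derive f f' : (forall u : R, 0 < u -> is_derive u 1 f (f' u)) ->
  forall u : R, 0 < u -> is_derive u 1 (posext f) (posext f' u).
Proof.
move=> df u u0; have dfu := df u u0.
rewrite /posext (max_l (ltW u0)).
apply: near_eq_is_derive dfu.
near=> y; rewrite max_l// ltW//; near: y; exact: lt_nbhsr.
Unshelve. all: by end_near. Qed.

Lemma posextE f u : 0 <= u -> posext f u = f u.
Proof. by move=> u0; rewrite /posext max_l. Qed.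

(** The quadratic modulus bounds from below a second difference of [p], which two
    mean value theorems turn into a value of [p2] near any given point. *)
Lemma uniformly_convex_derive2 p p1 p2 K : continuous p -> continuous p1 ->
  continuous p2 ->
  (forall u : R, 0 < u -> is_derive u 1 p (p1 u)) ->
  (forall u : R, 0 < u -> is_derive u 1 p1 (p2 u)) ->
  (forall a : R, 0 < a -> uniformly_convex_on `[0, a] p) ->
  exists2 c, 0 < c & forall u, 0 <= u <= K -> c <= p2 u.
Proof.
move=> cp cp1 cp2 dp dp1 uc.
have [c c0 Hc] := uc (`|K| + 1) (ltr_wpDl (normr_ge0 K) ltr01).
exists c => // u /andP[u0 uK].
rewrite leNgt; apply/negP => uc'.
have /cvgrPdist_lt/(_ (c - p2 u)) := cp2 u.
rewrite subr_gt0 => /(_ uc')/nbhs_ballP[dl /= dl0 Hdl].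
pose s := Num.min (dl / 4) (1 / 4).
have s0 : 0 < s by rewrite lt_min !divr_gt0.
have sdl : s <= dl / 4 by rewrite ge_min lexx.
have s1 : s <= 1 / 4 by rewrite ge_min lexx orbT.
(* the centre of the second difference is shifted to the right of [u] to keep
   the three points nonnegative *)
pose x := u + s * 3 / 2.
have KK : K <= `|K| := ler_norm K.
have conv : p x + c * (1 / 2) * (1 - 1 / 2) * (x + s - (x - s)) ^+ 2 <=
    1 / 2 * p (x + s) + (1 - 1 / 2) * p (x - s).
  rewrite -{1}(_ : 1 / 2 * (x + s) + (1 - 1 / 2) * (x - s) = x); last by field.
  apply: Hc; rewrite /= ?in_itv/=; apply/andP; split; rewrite /x; lra.
have xs0 : 0 <= x - s by rewrite /x; lra.
have x0 : 0 <= x by rewrite /x; lra.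
have xps0 : 0 <= x + s by lra.
have sK (y z : R) : y <= z -> Num.min z y = y /\ Num.max z y = z.
  by move=> yz; rewrite min_r// max_l.
have [a1 + E1] := MVT_ge0 dp cp xps0 x0.
have [a2 + E2] := MVT_ge0 dp cp x0 xs0.
have [-> ->] := sK (x - s) x ltac:(lra).
have [-> ->] := sK x (x + s) ltac:(lra).
move=> /andP[a21 a22] /andP[a11 a12].
have a10 : 0 <= a1 by lra. have a20 : 0 <= a2 by lra.
have [xi + E3] := MVT_ge0 dp1 cp1 a10 a20.
have [-> ->] := sK a2 a1 ltac:(lra).
move=> /andP[xi1 xi2].
have cxi : p2 xi < c.
  have := Hdl xi; rewrite /ball/= => h.
  have /h : `|u - xi| < dl.
    by rewrite ltr_norml; apply/andP; split; rewrite /x in a11 a12 a21 a22 *; lra.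
  by rewrite ltr_norml => /andP[h1 h2]; lra.
have d2 : p (x + s) - p x - (p x - p (x - s)) = s * (p2 xi * (a1 - a2)).
  by rewrite E1 E2 -E3; ring.
have lower : 2 * c * s ^+ 2 <= s * (p2 xi * (a1 - a2)).
  by rewrite -d2; move: conv; rewrite !expr2; lra.
have a12s : a1 - a2 <= 2 * s by lra.
have a12p : 0 <= a1 - a2 by lra.
have : 2 * c * s <= p2 xi * (a1 - a2).
  by move: lower; rewrite expr2 [leLHS](_ : _ = s * (2 * c * s)) ?ler_pM2l//; ring.
have [a120|a12n] := eqVneq (a1 - a2) 0.
  by rewrite a120 mulr0 leNgt mulr_gt0// mulr_gt0.
have a12pp : 0 < a1 - a2 by rewrite lt_neqAle eq_sym a12n.
by nra.
Qed.

Lemma smooth_convex_posext psi psi' psi'' : C2_on_nonneg psi psi' psi'' ->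
  (forall a : R, 0 < a -> uniformly_convex_on `[0, a] psi) ->
  smooth_convex (posext psi) (posext psi') (posext psi'').
Proof.
move=> [c0 c1 c2 d0 d1] uc.
have cc0 := posext_continuous c0; have cc1 := posext_continuous c1.
have cc2 := posext_continuous c2.
split=> //; [exact: posext_derive|exact: posext_derive|move=> K].
apply: (uniformly_convex_derive2 _ cc0 cc1 cc2);
  [exact: posext_derive|exact: posext_derive|move=> a a0].
have [c cp H] := uc a a0; exists c => // x y t xa ya t01.
have x0 : 0 <= x by move: xa; rewrite /= in_itv/= => /andP[].
have y0 : 0 <= y by move: ya; rewrite /= in_itv/= => /andP[].
have [tt0 tt1] := andP t01.
rewrite !posextE//; first exact: H.
by rewrite addr_ge0// mulr_ge0// subr_ge0.
Qed.

End Entropy.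

(** * Integration of real functions against a probability *)

Section Mean.
Context d (T : measurableType d) (R : realType) (mu : probability T R).
Implicit Types f g h : T -> R.

Local Notation L1 f := (mu.-integrable setT (EFin \o f)).
Local Notation L2 f := (f \in Lfun mu 2%:E).

(** The bounds hold everywhere, and not only almost everywhere: such functions can
    be integrated against the laws of the process from any starting point. *)
Definition bounded_mfun (f : T -> R) : Prop :=
  measurable_fun setT f /\ exists K, forall x, `|f x| <= K.

Definition mean (f : T -> R) : R := \int[mu]_x f x.

Definition ip (f g : T -> R) : R := mean (f \* g).

Definition nrm (f : T -> R) : R := Num.sqrt (ip f f).

Lemma L1_meas f : L1 f -> measurable_fun setT f.
Proof. by move=> /measurable_int/measurable_EFinP. Qed.

Lemma L2_meas f : L2 f -> measurable_fun setT f.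
Proof. by rewrite inE => /andP[/[!inE]]. Qed.

Lemma bmf_L1 f : bounded_mfun f -> L1 f.
Proof.
move=> [mf [K fK]]; apply: measurable_bounded_integrable => //.
  by have := probability_setT mu; rewrite /= => ->; rewrite ltry.
exists K; split; first exact: num_real.
by move=> M KM x _ /=; apply: (le_trans (fK x)); exact: ltW.
Qed.

Lemma L1_cst c : L1 (cst c : T -> R).
Proof. by apply: bmf_L1; split=> //; exists `|c| => x. Qed.

Lemma L1_D f g : L1 f -> L1 g -> L1 (f \+ g).
Proof.
move=> lf lg; have := integrableD measurableT lf lg.
by apply: eq_integrable.
Qed.

Lemma L1_Z c f : L1 f -> L1 (fun x => c * f x).
Proof.
by move=> lf; have := integrableZl measurableT c lf; apply: eq_integrable.
Qed.

Lemma L1_N f : L1 f -> L1 (fun x => - f x).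
Proof.
by move=> lf; have := integrableN lf; apply: eq_integrable.
Qed.

Lemma L1_B f g : L1 f -> L1 g -> L1 (f \- g).
Proof. by move=> lf lg; apply: L1_D => //; exact: L1_N. Qed.

Lemma L1_norm f : L1 f -> L1 (fun x => `|f x|).
Proof. exact: integrable_norm. Qed.

Lemma L1_le f g : measurable_fun setT f -> L1 g ->
  (forall x, `|f x| <= g x) -> L1 f.
Proof.
move=> mf lg fg; apply: le_integrable lg => //; first exact/measurable_EFinP.
by move=> x _ /=; rewrite lee_fin (le_trans (fg x))// ler_norm.
Qed.

Lemma L1_M f g : bounded_mfun f -> L1 g -> L1 (f \* g).
Proof.
move=> [mf [K fK]] lg.
apply: (@L1_le _ (fun x => K * `|g x|)).
- by apply: measurable_funM => //; exact: L1_meas.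
- exact/L1_Z/L1_norm.
- by move=> x /=; rewrite normrM ler_wpM2r.
Qed.

Lemma L2_mul f g : L2 f -> L2 g -> L1 (f \* g).
Proof. by move=> lf lg; apply/Lfun1_integrable/Lfun2_mul_Lfun1. Qed.

Lemma L2P f : measurable_fun setT f -> L1 (f \* f) -> L2 f.
Proof.
move=> mf lf; rewrite inE; apply/andP; split; rewrite inE//=.
rewrite /finite_norm unlock poweR_lty//.
have /integrableP[_] := lf; apply: le_lt_trans.
rewrite le_eqVlt; apply/orP; left; apply/eqP; apply: eq_integral => x _ /=.
by rewrite powR_mulrn// -normrX expr2.
Qed.

Lemma L2_bmf f : bounded_mfun f -> L2 f.
Proof.
move=> bf; apply: L2P; first by case: bf.
by apply: L1_M => //; exact: bmf_L1.
Qed.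

Lemma L2_L1 f : L2 f -> L1 f.
Proof.
move=> lf; have lc : L2 (cst 1 : T -> R) by apply: Lfun_cst.
have := L2_mul lf lc; apply: eq_integrable => // x _ /=.
by rewrite mulr1.
Qed.

Lemma L2_D f g : L2 f -> L2 g -> L2 (f \+ g).
Proof.
move=> lf lg; apply: L2P.
  by apply: measurable_funD; exact: L2_meas.
apply: (@L1_le _ (fun x => 2 * (f x * f x) + 2 * (g x * g x))).
- by apply: measurable_funM; apply: measurable_funD; exact: L2_meas.
- by apply: L1_D; apply: L1_Z; exact: L2_mul.
- move=> x /=; rewrite ger0_norm -?expr2 ?sqr_ge0//.
  by have := sqr_ge0 (f x - g x); rewrite !expr2; nra.
Qed.

Lemma L2_Z c f : L2 f -> L2 (fun x => c * f x).
Proof.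
move=> lf; apply: L2P; first by apply: measurable_funM => //; exact: L2_meas.
have := L1_Z (c * c) (L2_mul lf lf); apply: eq_integrable => // x _ /=.
by congr EFin; ring.
Qed.

Lemma L2_N f : L2 f -> L2 (fun x => - f x).
Proof.
move=> /(L2_Z (-1)).
by rewrite (_ : (fun x => -1 * f x) = (fun x => - f x))//; apply/funext => x;
  rewrite mulN1r.
Qed.

Lemma L2_B f g : L2 f -> L2 g -> L2 (f \- g).
Proof. by move=> lf lg; apply: L2_D => //; exact: L2_N. Qed.

Lemma L2_M f g : bounded_mfun f -> L2 g -> L2 (f \* g).
Proof.
move=> bf lg; apply: L2P.
  by apply: measurable_funM; [case: bf|exact: L2_meas].
have := L1_M bf (L1_M bf (L2_mul lg lg)); apply: eq_integrable => // x _ /=.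
by congr EFin; ring.
Qed.

Lemma bmf_cst c : bounded_mfun (cst c).
Proof. by split=> //; exists `|c|. Qed.

Lemma bmf_D f g : bounded_mfun f -> bounded_mfun g ->
  bounded_mfun (f \+ g).
Proof.
move=> [mf [K fK]] [mg [L gL]]; split; first exact: measurable_funD.
by exists (K + L) => x /=; rewrite (le_trans (ler_normD _ _))// lerD.
Qed.

Lemma bmf_M f g : bounded_mfun f -> bounded_mfun g ->
  bounded_mfun (f \* g).
Proof.
move=> [mf [K fK]] [mg [L gL]]; split; first exact: measurable_funM.
exists (K * L) => x /=; rewrite normrM ler_pM//.
Qed.

Lemma bmf_Z c f : bounded_mfun f -> bounded_mfun (fun x => c * f x).
Proof. by move=> bf; apply: bmf_M => //; exact: bmf_cst. Qed.

Lemma bmf_N f : bounded_mfun f -> bounded_mfun (fun x => - f x).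
Proof.
by move=> [mf [K fK]]; split; [exact: measurableT_comp|
  exists K => x; rewrite normrN].
Qed.

Lemma bmf_B f g : bounded_mfun f -> bounded_mfun g ->
  bounded_mfun (f \- g).
Proof. by move=> bf bg; apply: bmf_D => //; exact: bmf_N. Qed.

Lemma mean_D f g : L1 f -> L1 g -> mean (f \+ g) = mean f + mean g.
Proof. by move=> lf lg; rewrite /mean RintegralD. Qed.

Lemma mean_B f g : L1 f -> L1 g -> mean (f \- g) = mean f - mean g.
Proof. by move=> lf lg; rewrite /mean RintegralB. Qed.

Lemma mean_Z c f : L1 f -> mean (fun x => c * f x) = c * mean f.
Proof. by move=> lf; rewrite /mean RintegralZl. Qed.

Lemma mean_N f : L1 f -> mean (fun x => - f x) = - mean f.
Proof.
move=> lf; rewrite -mulN1r -mean_Z//; congr mean.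
by apply/funext => x; rewrite mulN1r.
Qed.

Lemma mean_cst c : mean (cst c) = c.
Proof. rewrite /mean Rintegral_cst//.
by have := probability_setT mu; rewrite /= => ->; rewrite mulr1. Qed.

Lemma mean_EFin f : L1 f -> (\int[mu]_x (f x)%:E)%E = (mean f)%:E.
Proof. by move=> lf; rewrite /mean /Rintegral fineK// integrable_fin_num. Qed.

Lemma mean_ae f g : measurable_fun setT f -> measurable_fun setT g ->
  {ae mu, forall x, f x = g x} -> mean f = mean g.
Proof.
move=> mf mg fg; congr fine; apply: ae_eq_integral => //;
  try exact/measurable_EFinP.
by apply: filterS fg => x /= -> .
Qed.

Lemma L1_ae f g : L1 f -> measurable_fun setT g ->
  {ae mu, forall x, f x = g x} -> L1 g.
Proof.
move=> lf mg fg; apply/integrableP; split; first exact/measurable_EFinP.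
have /integrableP[mf] := lf; apply: le_lt_trans.
rewrite le_eqVlt; apply/orP; left; apply/eqP; apply: ae_eq_integral => //.
- by apply: measurableT_comp => //; exact/measurable_EFinP.
- exact: measurableT_comp.
- by apply: filterS fg => x /= ->.
Qed.

Lemma mean_ge0 f : (forall x, 0 <= f x) -> 0 <= mean f.
Proof. by move=> f0; apply: Rintegral_ge0. Qed.

Lemma mean_ge0_ae f : measurable_fun setT f ->
  {ae mu, forall x, 0 <= f x} -> 0 <= mean f.
Proof.
move=> mf f0; rewrite (@mean_ae _ (fun x => `|f x|)) ?mean_ge0//.
  exact: measurableT_comp.
by apply: filterS f0 => x f0; rewrite ger0_norm.
Qed.

Lemma mean_le f g : L1 f -> L1 g -> (forall x, f x <= g x) ->
  mean f <= mean g.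
Proof. by move=> lf lg fg; apply: le_Rintegral. Qed.

Lemma mean_le_ae f g : L1 f -> L1 g -> {ae mu, forall x, f x <= g x} ->
  mean f <= mean g.
Proof.
move=> lf lg fg; rewrite -subr_ge0 -mean_B//; apply: mean_ge0_ae.
  by apply: measurable_funB; exact: L1_meas.
by apply: filterS fg => x /=; rewrite subr_ge0.
Qed.

Lemma mean_norm f : L1 f -> `|mean f| <= mean (fun x => `|f x|).
Proof. exact: le_normr_Rintegral. Qed.

Lemma mean_distC f g :
  mean (fun x => `|f x - g x|) = mean (fun x => `|g x - f x|).
Proof. by congr mean; apply/funext => x; rewrite distrC. Qed.

Lemma mean_distD f g h : L1 f -> L1 g -> L1 h ->
  mean (fun x => `|f x - h x|) <=
  mean (fun x => `|f x - g x|) + mean (fun x => `|g x - h x|).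
Proof.
move=> lf lg lh; rewrite -mean_D; try by apply: L1_norm; exact: L1_B.
apply: mean_le; try by [apply: L1_norm; exact: L1_B|apply: L1_D; apply: L1_norm; exact: L1_B].
by move=> x; exact: ler_distD.
Qed.

Lemma mean_norm0_ae f : L1 f -> mean (fun x => `|f x|) = 0 ->
  {ae mu, forall x, f x = 0}.
Proof.
move=> lf m0.
have : ae_eq mu setT (EFin \o f) (cst 0%E).
  apply/(ae_eq_integral_abs mu measurableT (measurable_int mu lf)).
  by have := mean_EFin (L1_norm lf); rewrite m0.
by apply: filterS => x /(_ I) /= [].
Qed.

(** * Inner product and quadratic norm *)

Lemma ipC f g : ip f g = ip g f.
Proof. by congr mean; apply/funext => x; rewrite /= mulrC. Qed.

Lemma ip_ge0 f : 0 <= ip f f.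
Proof. by apply: mean_ge0 => x; rewrite /= -expr2 sqr_ge0. Qed.

Lemma ipDl f g h : L2 f -> L2 g -> L2 h ->
  ip (f \+ g) h = ip f h + ip g h.
Proof.
move=> lf lg lh; rewrite /ip -mean_D; [|exact: L2_mul|exact: L2_mul].
by congr mean; apply/funext => x /=; ring.
Qed.

Lemma ipBl f g h : L2 f -> L2 g -> L2 h ->
  ip (f \- g) h = ip f h - ip g h.
Proof.
move=> lf lg lh; rewrite /ip -mean_B; [|exact: L2_mul|exact: L2_mul].
by congr mean; apply/funext => x /=; ring.
Qed.

Lemma ipZl c f g : L2 f -> L2 g -> ip (fun x => c * f x) g = c * ip f g.
Proof.
move=> lf lg; rewrite /ip -mean_Z; last exact: L2_mul.
by congr mean; apply/funext => x /=; ring.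
Qed.

Lemma ipDr f g h : L2 f -> L2 g -> L2 h ->
  ip h (f \+ g) = ip h f + ip h g.
Proof. by move=> *; rewrite ipC ipDl// !(ipC h). Qed.

Lemma ipBr f g h : L2 f -> L2 g -> L2 h ->
  ip h (f \- g) = ip h f - ip h g.
Proof. by move=> *; rewrite ipC ipBl// !(ipC h). Qed.

Lemma ipZr c f g : L2 f -> L2 g -> ip g (fun x => c * f x) = c * ip g f.
Proof. by move=> *; rewrite ipC ipZl// (ipC g). Qed.

Lemma nrm_ge0 f : 0 <= nrm f.
Proof. exact: sqrtr_ge0. Qed.

Lemma nrm_sqr f : nrm f ^+ 2 = ip f f.
Proof. by rewrite sqr_sqrtr// ip_ge0. Qed.

Lemma ip_le_nrm f g : L2 f -> L2 g -> `|ip f g| <= nrm f * nrm g.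
Proof.
move=> lf lg.
(* the quadratic polynomial s |-> |s f + g|^2 is nonnegative *)
have H (s : R) : 0 <= s ^+ 2 * ip f f + 2 * s * ip f g + ip g g.
  have lsf := L2_Z s lf.
  have := ip_ge0 ((fun x => s * f x) \+ g).
  rewrite ipDl ?ipDr ?(L2_D lsf lg)//.
  by rewrite !ipZl ?ipZr// (ipC g f); congr (_ <= _); ring.
rewrite -sqrtrM ?ip_ge0// -sqrtr_sqr ler_sqrt; last first.
  by rewrite mulr_ge0// ip_ge0.
have [f0|f0] := eqVneq (ip f f) 0.
  rewrite f0 mul0r; move: H; rewrite f0.
  have [->|fg0] := eqVneq (ip f g) 0; first by rewrite expr0n.
  move=> /(_ (- (ip g g + 1) / (2 * ip f g))).
  rewrite (_ : _ + ip g g = - 1) ?oppr_ge0 ?ler10//.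
  by field.
have fp : 0 < ip f f by rewrite lt_neqAle eq_sym f0 ip_ge0.
move: (H (- ip f g / ip f f)).
rewrite (_ : _ + ip g g = (ip f f * ip g g - ip f g ^+ 2) / ip f f).
  by rewrite pmulr_lge0 ?invr_gt0// subr_ge0.
by field.
Qed.

Lemma nrmD f g : L2 f -> L2 g -> nrm (f \+ g) <= nrm f + nrm g.
Proof.
move=> lf lg; rewrite -(@ler_pXn2r _ 2) ?nnegrE ?addr_ge0 ?nrm_ge0//.
rewrite nrm_sqr ipDl ?ipDr ?(L2_D lf lg)// (ipC g f).
have := ip_le_nrm lf lg => /(le_trans (ler_norm _)).
by have := nrm_sqr f; have := nrm_sqr g; rewrite !expr2; nra.
Qed.

Lemma nrmZ c f : L2 f -> nrm (fun x => c * f x) = `|c| * nrm f.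
Proof.
move=> lf; have lcf := L2_Z c lf.
by rewrite /nrm ipZl// ipZr// mulrA -expr2 sqrtrM ?sqr_ge0// sqrtr_sqr.
Qed.

Lemma nrmBC f g : nrm (f \- g) = nrm (g \- f).
Proof.
by rewrite /nrm; congr (Num.sqrt (mean _)); apply/funext => x /=; ring.
Qed.

Lemma nrmB3 f g h : L2 f -> L2 g -> L2 h ->
  nrm (f \- h) <= nrm (f \- g) + nrm (g \- h).
Proof.
move=> lf lg lh; have := nrmD (L2_B lf lg) (L2_B lg lh).
by congr (nrm _ <= _); apply/funext => x /=; ring.
Qed.

Lemma ip_eq_ae f g h : measurable_fun setT f -> measurable_fun setT g ->
  measurable_fun setT h ->
  {ae mu, forall x, f x = g x} -> ip f h = ip g h.
Proof.
move=> mf mg mh fg; apply: mean_ae; try exact: measurable_funM.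
by apply: filterS fg => x /= ->.
Qed.

Lemma nrm0_ae f : L2 f -> nrm f = 0 -> {ae mu, forall x, f x = 0}.
Proof.
move=> lf f0.
have ff0 : ip f f = 0 by rewrite -nrm_sqr f0 expr0n.
have : mean (fun x => `|(f \* f) x|) = 0.
  rewrite -ff0; congr mean; apply/funext => x /=.
  by rewrite ger0_norm// -expr2 sqr_ge0.
move=> /(mean_norm0_ae (L2_mul lf lf)); apply: filterS => x /= /eqP.
by rewrite mulf_eq0 orbb => /eqP.
Qed.

Lemma mean_norm_le_nrm f : L2 f -> mean (fun x => `|f x|) <= nrm f.
Proof.
move=> lf.
have mf := L2_meas lf.
have ln : L2 (fun x => `|f x|).
  apply: L2P; first exact: measurableT_comp.
  have := L2_mul lf lf; apply: eq_integrable => // x _ /=.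
  by rewrite -normrM ger0_norm// -expr2 sqr_ge0.
have := ip_le_nrm ln (Lfun_cst mu 1 2).
have -> : nrm (fun x => `|f x|) = nrm f.
  congr Num.sqrt; congr mean; apply/funext => x /=.
  by rewrite -normrM ger0_norm// -expr2 sqr_ge0.
have -> : nrm (cst 1) = 1.
  rewrite /nrm /ip (_ : _ \* _ = cst 1) ?mean_cst ?sqrtr1//.
  by apply/funext => x /=; rewrite mulr1.
rewrite mulr1 => /(le_trans (ler_norm _)); apply: le_trans.
by rewrite le_eqVlt; apply/orP; left; apply/eqP; congr mean;
  apply/funext => x /=; rewrite mulr1.
Qed.

Lemma nrm_le_bound f g c : 0 <= c -> measurable_fun setT f -> L2 g ->
  (forall x, `|f x| <= c * `|g x|) -> nrm f <= c * nrm g.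
Proof.
move=> c0 mf lg fg.
have le2 x : f x * f x <= c ^+ 2 * (g x * g x).
  have := fg x; have := normr_ge0 (f x); rewrite -(normr_id (g x)).
  move=> a b; have : `|f x| ^+ 2 <= (c * `|g x|) ^+ 2.
    by rewrite ler_pXn2r ?nnegrE ?mulr_ge0// -[`|g x|]normr_id.
  by rewrite exprMn !real_normK ?num_real// !expr2.
have lf : L1 (f \* f).
  apply: (@L1_le _ (fun x => c ^+ 2 * (g x * g x))) => //.
  - exact: measurable_funM.
  - exact/L1_Z/L2_mul.
  - by move=> x /=; rewrite ger0_norm// -expr2 sqr_ge0.
rewrite -(@ler_pXn2r _ 2) ?nnegrE ?mulr_ge0 ?nrm_ge0//.
rewrite exprMn !nrm_sqr /ip -mean_Z; last exact: L2_mul.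
apply: mean_le => //; exact/L1_Z/L2_mul.
Qed.

(** The norm of an element is attained on itself: an estimate of all the
    products with bounded functions is an estimate of the norm. *)
Lemma nrm_le_ip f c : bounded_mfun f -> 0 <= c ->
  (forall g, bounded_mfun g -> ip f g <= c * nrm g) -> nrm f <= c.
Proof.
move=> bf c0 /(_ f bf); rewrite -nrm_sqr expr2.
have [->|f0] := eqVneq (nrm f) 0; first by [].
by rewrite ler_pM2r// lt_neqAle eq_sym f0 nrm_ge0.
Qed.

(** * Quadratic convergence along a filter *)

Section Convergence.
Context (I : Type) (F : set_system I) {FF : ProperFilter F}.
Implicit Types u v : I -> T -> R.

Lemma cvg_ip u v f g : (forall i, L2 (u i)) -> (forall i, L2 (v i)) ->
  L2 f -> L2 g ->
  nrm (u i \- f) @[i --> F] --> 0 -> nrm (v i \- g) @[i --> F] --> 0 ->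
  ip (u i) (v i) @[i --> F] --> ip f g.
Proof.
move=> lu lv lf lg uf vg.
apply/cvgrPdist_le => e e0.
have H i : `|ip f g - ip (u i) (v i)| <=
    nrm (u i \- f) * nrm (v i \- g) + nrm (u i \- f) * nrm g +
    nrm f * nrm (v i \- g).
  have luf := L2_B (lu i) lf; have lvg := L2_B (lv i) lg.
  have -> : ip f g - ip (u i) (v i) =
      - (ip (u i \- f) (v i \- g) + ip (u i \- f) g + ip f (v i \- g)).
    by rewrite !ipBr// !ipBl//; ring.
  rewrite normrN !(le_trans (ler_normD _ _))// lerD ?ip_le_nrm//.
  by rewrite (le_trans (ler_normD _ _))// lerD ?ip_le_nrm.
have : nrm (u i \- f) * nrm (v i \- g) + nrm (u i \- f) * nrm g +
    nrm f * nrm (v i \- g) @[i --> F] --> 0 * 0 + 0 * nrm g + nrm f * 0.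
  apply: cvgD; [apply: cvgD|].
  - exact: cvgM.
  - by apply: cvgMl.
  - by apply: cvgMr.
rewrite !mulr0 mul0r !addr0 => /cvgrPdist_le/(_ _ e0).
apply: filterS => i; rewrite sub0r normrN => Hi.
by rewrite (le_trans (H i))// (le_trans _ Hi)// ler_norm.
Qed.

Lemma cvg_ipl u f g : (forall i, L2 (u i)) -> L2 f -> L2 g ->
  nrm (u i \- f) @[i --> F] --> 0 -> ip (u i) g @[i --> F] --> ip f g.
Proof.
move=> lu lf lg uf; apply: cvg_ip => //.
rewrite (_ : (fun i => _) = cst 0); first exact: cvg_cst.
apply/funext => i; rewrite /nrm /ip (_ : _ \* _ = cst 0) ?mean_cst ?sqrtr0//.
by apply/funext => x /=; ring.
Qed.

Lemma cvg_ipr u f g : (forall i, L2 (u i)) -> L2 f -> L2 g ->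
  nrm (u i \- f) @[i --> F] --> 0 -> ip g (u i) @[i --> F] --> ip g f.
Proof.
move=> lu lf lg uf; under eq_fun do rewrite ipC; rewrite ipC.
exact: cvg_ipl.
Qed.

Lemma nrm_cvg_unique u f g : (forall i, L2 (u i)) -> L2 f -> L2 g ->
  nrm (u i \- f) @[i --> F] --> 0 -> nrm (u i \- g) @[i --> F] --> 0 ->
  {ae mu, forall x, f x = g x}.
Proof.
move=> lu lf lg uf ug.
have fg0 : nrm (f \- g) = 0.
  apply/eqP; rewrite eq_le nrm_ge0 andbT.
  have h : nrm (u i \- f) + nrm (u i \- g) @[i --> F] --> 0 + 0 by exact: cvgD.
  rewrite addr0 in h.
  rewrite -(cvg_lim (@Rhausdorff R) h).
  apply: limr_ge; first by apply/cvg_ex; exists 0.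
  near=> i; rewrite (le_trans (nrmB3 lf (lu i) lg))//.
  by rewrite (nrmBC f).
have := nrm0_ae (L2_B lf lg) fg0.
by apply: filterS => x /= /eqP; rewrite subr_eq0 => /eqP.
Unshelve. all: by end_near. Qed.

End Convergence.

(** * The distances of the spaces L2 and L1 as extended reals *)

Lemma Lnorm2_nrm f : L2 f -> ('N[mu]_2%:E[EFin \o f] = (nrm f)%:E)%E.
Proof.
move=> lf; rewrite unlock /nrm.
rewrite (_ : (\int[mu]_x _)%E = (ip f f)%:E); last first.
  rewrite -mean_EFin; last exact: L2_mul.
  apply: eq_integral => x _ /=.
  by rewrite powR_mulrn// -normrX expr2 ger0_norm// -expr2 sqr_ge0.
by rewrite poweR_EFin powR12_sqrt// ip_ge0.
Qed.

Lemma Lnorm1_mean f : L1 f ->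
  ('N[mu]_1%:E[EFin \o f] = (mean (fun x => `|f x|))%:E)%E.
Proof. by move=> lf; rewrite Lnorm1 -mean_EFin//; exact: L1_norm. Qed.

Lemma cvg_Lp_dist2 (I : Type) (F : set_system I) {FF : ProperFilter F}
    (u : I -> T -> R) f : (forall i, L2 (u i)) -> L2 f ->
  (Lp_dist mu 2%:E (u i) f @[i --> F] --> 0%E) <->
  nrm (u i \- f) @[i --> F] --> 0.
Proof.
move=> lu lf.
rewrite (_ : (fun i => _) = (fun i => (nrm (u i \- f))%:E)).
  by split => [/fine_cvgP[_]|h]; [|apply: cvg_EFin => //; exact: nearW].
by apply/funext => i; rewrite /Lp_dist Lnorm2_nrm//; exact: L2_B.
Qed.

Lemma cvg_Lp_dist1 (I : Type) (F : set_system I) {FF : ProperFilter F}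
    (u : I -> T -> R) f : (forall i, L1 (u i)) -> L1 f ->
  (Lp_dist mu 1%:E (u i) f @[i --> F] --> 0%E) <->
  mean (fun x => `|u i x - f x|) @[i --> F] --> 0.
Proof.
move=> lu lf.
rewrite (_ : (fun i => _) = (fun i => (mean (fun x => `|u i x - f x|))%:E)).
  by split => [/fine_cvgP[_]|h]; [|apply: cvg_EFin => //; exact: nearW].
by apply/funext => i; rewrite /Lp_dist Lnorm1_mean//; exact: L1_B.
Qed.

End Mean.

(** * Completeness of L1 *)

Lemma cvgn_infty_ge (s : nat -> nat) : (forall k, (k <= s k)%N) ->
  s k @[k --> \oo] --> \oo.
Proof.
move=> sk; apply/cvgnyPge => N.
by exists N => // k /= Nk; rewrite (leq_trans Nk).
Qed.

Section Completeness.
Context d (T : measurableType d) (R : realType) (mu : probability T R).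
Implicit Types f g h : T -> R.

Local Notation L1 f := (mu.-integrable setT (EFin \o f)).

(** The increments are summable in L1, hence almost everywhere: their series gives
    both the pointwise limit and a dominating function. *)
Lemma fast_L1_cvg (f_ : nat -> T -> R) : (forall n, L1 (f_ n)) ->
  (forall n, mean mu (fun x => `|f_ n.+1 x - f_ n x|) <= (1 / 2) ^+ n) ->
  exists f, [/\ L1 f, mean mu (fun x => `|f_ n x - f x|) @[n --> \oo] --> 0 &
    {ae mu, forall x, f_ n x @[n --> \oo] --> f x}].
Proof.
move=> lf fast.
pose D n x := `|f_ n.+1 x - f_ n x|.
have lD n : L1 (D n) by apply: L1_norm; exact: L1_B.
have mD n : measurable_fun setT (EFin \o D n).
  exact/measurable_EFinP/(L1_meas (lD n)).
pose g x := (`|f_ 0 x|%:E + \sum_(n <oo) (D n x)%:E)%E.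
have mf0 : measurable_fun setT (fun x => `|f_ 0 x|%:E).
  exact/measurable_EFinP/(L1_meas (L1_norm (lf 0))).
have msum : measurable_fun setT (fun x => \sum_(n <oo) (D n x)%:E)%E.
  apply: (@ge0_emeasurable_sum _ _ _ setT (fun n x => (D n x)%:E) xpredT).
    by move=> k x _ _; rewrite lee_fin normr_ge0.
  by move=> k _; exact: mD.
have sum0 x : (0 <= \sum_(n <oo) (D n x)%:E)%E.
  by apply: nneseries_ge0 => n _ _; rewrite lee_fin normr_ge0.
have g0 x : (0 <= g x)%E by rewrite adde_ge0// lee_fin.
have mg : measurable_fun setT g by exact: emeasurable_funD.
have ig : mu.-integrable setT g.
  apply/integrableP; split=> //.
  under eq_integral => x _ do rewrite gee0_abs//.
  rewrite ge0_integralD//.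
  apply: lte_add_pinfty.
    by rewrite mean_EFin ?ltry//; exact: L1_norm.
  rewrite integral_nneseries//; last first.
    by move=> n x _; rewrite lee_fin normr_ge0.
  apply: (@le_lt_trans _ _ (\sum_(n <oo) ((1 / 2) ^+ n : R)%:E)%E).
    apply: lee_nneseries => n _.
      by move=> _; apply: integral_ge0 => x _; rewrite lee_fin normr_ge0.
    by rewrite (mean_EFin (lD n)) lee_fin; exact: fast.
  have h : (\sum_(0 <= n < N) ((1 / 2) ^+ n : R)%:E)%E @[N --> \oo] -->
      (1 / (1 - 1 / 2) : R)%:E.
    under eq_fun do rewrite sumEFin.
    apply: cvg_EFin; first exact: nearW.
    have := @cvg_geometric_series R 1 (1 / 2).
    rewrite ger0_norm ?divr_ge0// => /(_ ltac:(lra)).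
    apply: cvg_trans; apply: near_eq_cvg; near=> N.
    rewrite /series/=; apply: eq_bigr => i _.
    exact: mul1r.
  by rewrite (cvg_lim (@ereal_hausdorff R) h) ltry.
have aeg : {ae mu, forall x, g x \is a fin_num}.
  have := integrable_ae measurableT ig.
  by apply: filterS => x; exact.
have dom x n : (`|f_ n x|%:E <= g x)%E.
  apply: (@le_trans _ _ (`|f_ 0 x|%:E + \sum_(0 <= k < n) (D k x)%:E)%E).
    rewrite sumEFin -EFinD lee_fin.
    elim: n => [|n IH]; first by rewrite big_nil addr0.
    rewrite big_nat_recr//= addrA.
    rewrite (le_trans _ (lerD IH (lexx _)))//.
    rewrite (_ : f_ n.+1 x = f_ n x + (f_ n.+1 x - f_ n x)) ?ler_normD//; ring.
  rewrite leeD2l//.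
  by apply: (@nneseries_lim_ge R (fun k => (D k x)%:E) xpredT 0) => k _ _;
    rewrite lee_fin normr_ge0.
have aecvg : {ae mu, forall x, cvgn (f_ ^~ x)}.
  apply: filterS aeg => x gx.
  pose dl n := f_ n.+1 x - f_ n x.
  have fE : f_ ^~ x = (fun n => f_ 0 x + series dl n).
    apply/funext => n; rewrite /series/= /dl.
    by rewrite telescope_sumr//; ring.
  rewrite fE; apply: is_cvgD; first exact: is_cvg_cst.
  apply: normed_cvg; apply: nondecreasing_is_cvgn.
    apply/nondecreasing_seqP => n.
    change (\sum_(0 <= k < n) `|dl k| <= \sum_(0 <= k < n.+1) `|dl k|).
    by rewrite big_nat_recr//= lerDl.
  exists (fine (g x)) => _ [n _ <-].
  rewrite -lee_fin fineK//.
  change ((\sum_(0 <= k < n) `|dl k|)%:E <= g x)%E; rewrite -sumEFin.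
  rewrite (@le_trans _ _ (\sum_(n <oo) (D n x)%:E)%E)//.
    by apply: (@nneseries_lim_ge R (fun k => (D k x)%:E) xpredT 0) => k _ _;
      rewrite lee_fin normr_ge0.
  by rewrite leeDr// lee_fin.
pose f x := fine (limn_esup (fun n => (f_ n x)%:E)).
have mf : measurable_fun setT f.
  apply: measurableT_comp => //.
  apply: (@measurable_fun_limn_esup _ _ _ _ (fun n x => (f_ n x)%:E)) => n.
  exact/measurable_EFinP/L1_meas.
have aef : {ae mu, forall x, f_ n x @[n --> \oo] --> f x}.
  apply: filterS aecvg => x cx.
  have cE : (f_ n x)%:E @[n --> \oo] --> (limn (f_ ^~ x))%:E.
    by apply: cvg_EFin => //; exact: nearW.
  rewrite /f is_cvg_limn_esupE; last by apply/cvg_ex; eexists; exact: cE.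
  by rewrite (cvg_lim (@ereal_hausdorff R) cE)/=.
have [||||if_ c0 _] := @dominated_convergence _ T R mu setT measurableT
    (fun n => EFin \o f_ n) (EFin \o f) g _ _ _ ig _.
- by move=> n; exact/measurable_EFinP/L1_meas.
- exact/measurable_EFinP.
- by apply: filterS aef => x fx _; apply: cvg_EFin => //; exact: nearW.
- by apply: aeW => x n _; exact: dom.
exists f; split=> //.
move: c0; rewrite /=.
rewrite (_ : (fun n => _) =
  (fun n => (mean mu (fun x => `|f_ n x - f x|))%:E)).
  by move=> /fine_cvgP[_].
apply/funext => n; rewrite -mean_EFin//.
by apply: L1_norm; exact: L1_B.
Unshelve. all: by end_near. Qed.

Let fast_subseq (f_ : nat -> T -> R) : (forall n, L1 (f_ n)) ->
  (forall e, 0 < e -> exists N, forall n m, (N <= n)%N -> (N <= m)%N ->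
    mean mu (fun x => `|f_ n x - f_ m x|) <= e) ->
  exists s : nat -> nat, (forall k, (k <= s k)%N) /\
    forall k, mean mu (fun x => `|f_ (s k.+1) x - f_ (s k) x|) <= (1 / 2) ^+ k.
Proof.
move=> lf cauchy.
have /choice[N HN] : forall k, exists N, forall n m, (N <= n)%N -> (N <= m)%N ->
    mean mu (fun x => `|f_ n x - f_ m x|) <= (1 / 2) ^+ k.
  by move=> k; apply: cauchy; rewrite exprn_gt0//; lra.
exists (fun k => \sum_(j < k.+1) N j + k)%N; split=> [k|k].
  by rewrite leq_addl.
apply: HN; rewrite -?addnA; last by rewrite big_ord_recr/= -addnA addnCA leq_addr.
by rewrite big_ord_recr/= big_ord_recr/= -!addnA addnCA leq_addr.
Qed.

Lemma L1_complete (f_ : nat -> T -> R) : (forall n, L1 (f_ n)) ->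
  (forall e, 0 < e -> exists N, forall n m, (N <= n)%N -> (N <= m)%N ->
    mean mu (fun x => `|f_ n x - f_ m x|) <= e) ->
  exists f, L1 f /\ mean mu (fun x => `|f_ n x - f x|) @[n --> \oo] --> 0.
Proof.
move=> lf cauchy; have [s [sk fast]] := fast_subseq lf cauchy.
have [f [if_ cf _]] := fast_L1_cvg (fun k => lf (s k)) fast.
exists f; split=> //.
apply/cvgrPdist_le => e e0.
have e20 : 0 < e / 2 by rewrite divr_gt0.
have [N HN] := cauchy _ e20.
have /cvgrPdist_le/(_ _ e20) [K _ HK] := cf.
exists N => // n /= Nn.
rewrite sub0r normrN ger0_norm; last by apply: mean_ge0.
pose k := maxn N K.
have Kk := HK k (leq_maxr _ _).
rewrite sub0r normrN ger0_norm in Kk; last by apply: mean_ge0.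
have Nk : mean mu (fun x => `|f_ n x - f_ (s k) x|) <= e / 2.
  by apply: HN => //; rewrite (leq_trans _ (sk k))// leq_maxl.
rewrite (le_trans (mean_distD (lf n) (lf (s k)) if_))//.
by rewrite (splitr e) lerD.
Qed.

Lemma L1_cvg_ae_subseq (f_ : nat -> T -> R) f : (forall n, L1 (f_ n)) ->
  L1 f -> mean mu (fun x => `|f_ n x - f x|) @[n --> \oo] --> 0 ->
  exists s : nat -> nat, (forall k, (k <= s k)%N) /\
    {ae mu, forall x, f_ (s k) x @[k --> \oo] --> f x}.
Proof.
move=> lf lf0 cf.
have tri n m : mean mu (fun x => `|f_ n x - f_ m x|) <=
    mean mu (fun x => `|f_ n x - f x|) + mean mu (fun x => `|f_ m x - f x|).
  by rewrite (mean_distC mu (f_ m)); exact: mean_distD.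
have cauchy e : 0 < e -> exists N, forall n m, (N <= n)%N -> (N <= m)%N ->
    mean mu (fun x => `|f_ n x - f_ m x|) <= e.
  move=> e0; have e20 : 0 < e / 2 by rewrite divr_gt0.
  have /cvgrPdist_le/(_ _ e20) [N _ HN] := cf.
  exists N => n m Nn Nm; rewrite (le_trans (tri n m))// (splitr e).
  have := HN n Nn; have := HN m Nm.
  rewrite /= !sub0r !normrN !ger0_norm; try by apply: mean_ge0.
  by move=> a b; rewrite lerD.
have [s [sk fast]] := fast_subseq lf cauchy.
have [g [lg cg aeg]] := fast_L1_cvg (fun k => lf (s k)) fast.
exists s; split=> //.
have fg0 : mean mu (fun x => `|(f \- g) x|) = 0.
  apply/eqP; rewrite eq_le mean_ge0 ?andbT//.
  have cfs : mean mu (fun x => `|f_ (s k) x - f x|) @[k --> \oo] --> 0.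
    exact: (cvg_comp _ _ (cvgn_infty_ge sk) cf).
  have h : mean mu (fun x => `|f_ (s k) x - f x|) +
     mean mu (fun x => `|f_ (s k) x - g x|) @[k --> \oo] --> 0 + 0.
    exact: cvgD.
  rewrite addr0 in h.
  rewrite -(cvg_lim (@Rhausdorff R) h).
  apply: limr_ge; first by apply/cvg_ex; exists 0.
  near=> k.
  by rewrite (mean_distC mu (f_ (s k)) f); exact: mean_distD.
have := mean_norm0_ae (L1_B lf0 lg) fg0.
apply: filterS2 aeg => x cx /= /eqP; rewrite subr_eq0 => /eqP ->.
exact: cx.
Unshelve. all: by end_near. Qed.

End Completeness.

(** * Functionals on bounded measurable functions *)

Section FunctionalExtensionality.
Context d (T : measurableType d) (R : realType).
Implicit Types f g : T -> R.

Lemma bmf_indic (B : set T) : measurable B ->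
  bounded_mfun (\1_B : T -> R).
Proof.
move=> mB; split; first exact: measurable_indic.
by exists 1 => x; rewrite indicE; case: (_ \in _); rewrite ?normr1// normr0.
Qed.

Lemma bmf_sum n (F : nat -> T -> R) : (forall i, bounded_mfun (F i)) ->
  bounded_mfun (fun x => \sum_(i < n) F i x).
Proof.
move=> bF; elim: n => [|n IH].
  by under eq_fun do rewrite big_ord0; exact: bmf_cst.
by under eq_fun do rewrite big_ord_recr/=; exact: bmf_D.
Qed.

(** The step function counting the thresholds passed by [f] is a linear
    combination of indicators. *)
Lemma step_approx f K n : (0 < n)%N -> 0 < K -> (forall x, `|f x| <= K) ->
  forall x,
  `|f x - (- K + 2 * K / n%:R * \sum_(i < n)
      \1_(f @^-1` [set y | - K + 2 * K / n%:R * i.+1%:R <= y]) x)| <=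
  2 * K / n%:R.
Proof.
move=> n0 K0 fK x.
have n0' : 0 < n%:R :> R by rewrite ltr0n.
pose e := 2 * K / n%:R.
have e0 : 0 < e by rewrite divr_gt0 ?mulr_gt0.
have eE : e * n%:R = 2 * K by rewrite divfK// gt_eqF.
have /andP[f1 f2] : - K <= f x <= K by rewrite -ler_norml.
pose S m := \sum_(i < m) (\1_(f @^-1` [set y | - K + e * i.+1%:R <= y]) x : R).
have H m : (f x < - K + e * m.+1%:R -> - K + e * S m <= f x <= - K + e * S m + e) /\
    (- K + e * m%:R <= f x -> S m = m%:R).
  elim: m => [|m [IH1 IH2]].
    rewrite /S big_ord0 mulr0 addr0; split=> // h.
    by rewrite f1/= ltW// -[X in _ + X]mulr1.
  have Sm : S m.+1 = S m + \1_(f @^-1` [set y | - K + e * m.+1%:R <= y]) x.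
    by rewrite /S big_ord_recr.
  have [h|h] := leP (- K + e * m.+1%:R) (f x).
    have -> : S m.+1 = m.+1%:R.
      rewrite Sm IH2; last by rewrite (le_trans _ h)// lerD2l ler_pM2l// ler_nat.
      by rewrite indicE mem_set//= natr1.
    split=> // h2; rewrite h/= ltW// (lt_le_trans h2)//.
    by rewrite -addrA lerD2l -[m.+2%:R]natr1 mulrDr mulr1.
  have -> : S m.+1 = S m.
    rewrite Sm indicE memNset ?addr0//= => h2.
    by move: h; rewrite ltNge h2.
  by split=> // _; exact: IH1.
have [H1 H2] := H n.
suff : - K + e * S n <= f x <= - K + e * S n + e.
  rewrite -/e -/(S n) => /andP[h1 h2].
  by rewrite ger0_norm ?subr_ge0// lerBlDl.
have [h|h] := leP (- K + e * n.+1%:R) (f x); last exact: H1.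
have := le_trans h f2; rewrite -natr1 mulrDr eE mulr1 => h3.
by exfalso; lra.
Qed.

(** A linear functional which is continuous for the uniform norm is determined
    by its values on the indicators. *)
Lemma bounded_functional_ext (L : (T -> R) -> R) C :
  (forall f g, bounded_mfun f -> bounded_mfun g -> L (f \+ g) = L f + L g) ->
  (forall c f, bounded_mfun f -> L (fun x => c * f x) = c * L f) ->
  (forall f K, bounded_mfun f -> (forall x, `|f x| <= K) -> `|L f| <= C * K) ->
  (forall B, measurable B -> L \1_B = 0) ->
  forall f, bounded_mfun f -> L f = 0.
Proof.
move=> LD LZ Lb L1 f bf; have [mf [K0 fK0]] := bf.
pose K := `|K0| + 1.
have K0' : 0 < K by rewrite ltr_wpDl.
have fK x : `|f x| <= K.
  by rewrite (le_trans (fK0 x))// (le_trans (ler_norm _))// lerDl.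
have Lsum n (F : nat -> T -> R) : (forall i, bounded_mfun (F i)) ->
    (forall i, L (F i) = 0) -> L (fun x => \sum_(i < n) F i x) = 0.
  move=> bF LF; elim: n => [|n IH].
    under eq_fun do rewrite big_ord0.
    have := LZ 0 (cst 0) (bmf_cst T 0); rewrite mul0r.
    by rewrite (_ : (fun x => 0 * cst 0 x) = fun=> 0)//; apply/funext => x;
      rewrite mul0r.
  under eq_fun do rewrite big_ord_recr/=.
  by rewrite LD ?IH ?LF ?addr0//; exact: bmf_sum.
have L_cst c : L (cst c) = 0.
  have := LZ c (\1_setT) (bmf_indic measurableT); rewrite L1// mulr0 => <-.
  by congr L; apply/funext => x; rewrite indicE mem_set// mulr1.
have C0 : 0 <= C.
  have := Lb (cst 1) 1 (bmf_cst T 1) (fun=> _).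
  by rewrite L_cst normr0 mulr1; apply => x; rewrite normr1.
apply/eqP; rewrite -normr_le0; apply/ler_addgt0Pr => e e0; rewrite add0r.
pose n := (Num.trunc (C * (2 * K) / e)).+1.
have Hn : C * (2 * K) / e < n%:R by rewrite truncnS_gt// divr_ge0 ?mulr_ge0// ltW.
have n0 : 0 < n%:R :> R by rewrite ltr0n.
pose F i := \1_(f @^-1` [set y | - K + 2 * K / n%:R * i.+1%:R <= y]) : T -> R.
have mF i : measurable (f @^-1` [set y | - K + 2 * K / n%:R * i.+1%:R <= y]).
  rewrite -[X in measurable X]setTI; apply: mf => //.
  rewrite (_ : [set y | _] = `[- K + 2 * K / n%:R * i.+1%:R, +oo[%classic)//.
  by apply/seteqP; split=> y /=; rewrite in_itv/= andbT.
have bF i : bounded_mfun (F i) by exact: bmf_indic.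
pose g x := - K + 2 * K / n%:R * \sum_(i < n) F i x.
have bg : bounded_mfun g.
  by apply: bmf_D; [exact: bmf_cst|apply: bmf_Z; exact: bmf_sum].
have Lg : L g = 0.
  rewrite /g (LD (cst (-K))); [|exact: bmf_cst|apply: bmf_Z; exact: bmf_sum].
  rewrite L_cst LZ; last exact: bmf_sum.
  by rewrite Lsum ?mulr0 ?addr0// => i; exact: L1.
have -> : f = (f \- g) \+ g by apply/funext => x /=; rewrite subrK.
have bfg := bmf_B bf bg.
rewrite LD// Lg addr0 (le_trans (Lb _ (2 * K / n%:R) bfg _))//.
  by move=> x; exact: step_approx.
by rewrite mulrA ler_pdivrMr// [leRHS]mulrC -ler_pdivrMr// ltW.
Qed.

End FunctionalExtensionality.

(** * The semigroup on bounded functions *)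

Section Transition.
Context (R : realType) (dO : measure_display) (Omega : measurableType dO).
Context (E : puniformType).
Context (M : markov_process R Omega E).
Implicit Types (f g : borel E -> R) (x : borel E) (t s : R).

(** A copy of [law M x] which carries the structure of a probability. *)
Definition path_law x : set Omega -> \bar R := law M x.

HB.instance Definition _ x := Measure.on (path_law x).

Let path_lawT x : path_law x setT = 1%E.
Proof. exact: prob_kernel. Qed.

HB.instance Definition _ x :=
  Measure_isProbability.Build _ _ _ (path_law x) (path_lawT x).

Lemma semigroup_mean t f x : semigroup M t f x = mean (path_law x) (f \o Defs.path M t).
Proof. by []. Qed.

Lemma bmf_path t f : bounded_mfun f -> bounded_mfun (f \o Defs.path M t).
Proof.
move=> [mf [K fK]]; split; last by exists K => w; exact: fK.
by apply: measurableT_comp => //; exact: path_measurable.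
Qed.

Lemma semigroup_D t f g : bounded_mfun f -> bounded_mfun g ->
  semigroup M t (f \+ g) = semigroup M t f \+ semigroup M t g.
Proof.
move=> bf bg; apply/funext => x; rewrite /= !semigroup_mean -mean_D//;
  apply: bmf_L1; exact: bmf_path.
Qed.

Lemma semigroup_Z t c f : bounded_mfun f ->
  semigroup M t (fun x => c * f x) = (fun x => c * semigroup M t f x).
Proof.
move=> bf; apply/funext => x; rewrite !semigroup_mean -mean_Z//.
by apply: bmf_L1; exact: bmf_path.
Qed.

Lemma semigroup_cst t c : semigroup M t (cst c) = cst c.
Proof. by apply/funext => x; rewrite semigroup_mean mean_cst. Qed.

Lemma semigroup_ge0 t f : (forall x, 0 <= f x) ->
  forall x, 0 <= semigroup M t f x.
Proof. by move=> f0 x; rewrite semigroup_mean; apply: mean_ge0 => w /=. Qed.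

Lemma semigroup_norm t f K : bounded_mfun f -> (forall x, `|f x| <= K) ->
  forall x, `|semigroup M t f x| <= K.
Proof.
move=> bf fK x; have bp := bmf_path t bf.
rewrite semigroup_mean (le_trans (mean_norm (bmf_L1 _ bp)))//.
rewrite -[leRHS](mean_cst (path_law x)) mean_le//.
- exact/L1_norm/bmf_L1.
- exact: L1_cst.
- by move=> w; exact: fK.
Qed.

Lemma semigroup_indic t (B : set (borel E)) x : measurable B ->
  (semigroup M t \1_B x)%:E = transition M t x B.
Proof.
move=> mB; rewrite semigroup_mean -mean_EFin; last first.
  apply: bmf_L1; apply: bmf_path; exact: bmf_indic.
rewrite /transition (_ : (fun w => _) = (fun w => (\1_(Defs.path M t @^-1` B) w)%:E)).
  rewrite integral_indic ?setIT// -[X in measurable X]setTI.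
  exact: path_measurable.
by [].
Qed.

Lemma semigroup_measurable t f : bounded_mfun f ->
  measurable_fun setT (semigroup M t f).
Proof.
move=> bf; have [mf [K fK]] := bf.
have bK : bounded_mfun (fun x => f x + K) by apply: bmf_D => //; exact: bmf_cst.
have fK0 x : 0 <= f x + K.
  by rewrite -lerBlDr sub0r; have := fK x; rewrite ler_norml => /andP[].
have E1 : semigroup M t f = (fun x => semigroup M t (fun x => f x + K) x - K).
  by rewrite semigroup_D ?semigroup_cst//; [apply/funext => x /=; rewrite addrK|
    exact: bmf_cst].
rewrite E1; apply: measurable_funB => //.
apply: measurableT_comp => //.
apply: (@measurable_fun_integral_kernel _ _ _ _ _ (fun x => law M x) _
  (fun w => (f (Defs.path M t w) + K)%:E)).
- by move=> U mU; exact: measurable_kernel.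
- by move=> w; rewrite lee_fin.
- apply/measurable_EFinP.
  by have [] := bmf_path t bK.
Qed.

Lemma bmf_semigroup t f : bounded_mfun f -> bounded_mfun (semigroup M t f).
Proof.
move=> bf; split; first exact: semigroup_measurable.
by have [_ [K fK]] := bf; exists K; exact: semigroup_norm.
Qed.

Lemma semigroupDt s t f : 0 <= s -> 0 <= t -> bounded_mfun f ->
  semigroup M (s + t) f = semigroup M s (semigroup M t f).
Proof.
move=> s0 t0 bf; apply/funext => x.
pose L f := semigroup M (s + t) f x - semigroup M s (semigroup M t f) x.
apply/eqP; rewrite -subr_eq0; apply/eqP.
apply: (@bounded_functional_ext _ _ _ L 2) bf.
- move=> g h bg bh; rewrite /L !semigroup_D//=; try exact: bmf_semigroup.
  by ring.
- move=> c g bg; rewrite /L !semigroup_Z//; last exact: bmf_semigroup.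
  by ring.
- move=> g K bg gK; rewrite (le_trans (ler_normB _ _))// mulr_natl mulr2n.
  rewrite lerD//; apply: semigroup_norm => //; first exact: bmf_semigroup.
  exact: semigroup_norm.
- move=> B mB; rewrite /L; apply/eqP; rewrite subr_eq0; apply/eqP.
  apply: EFin_inj; rewrite semigroup_indic//.
  have := @path_markov _ _ _ _ M x s t setT B s0 t0.
  have pT : past (Defs.path M) s setT.
    have [h0 hC _] := smallest_sigma_algebra setT
      (\bigcup_(u in [set u | 0 <= u <= s])
        preimage_set_system setT (Defs.path M u) measurable).
    by have := hC _ h0; rewrite setD0.
  move=> /(_ pT mB); rewrite setTI /transition => ->.
  rewrite semigroup_mean -mean_EFin; last first.
    apply: bmf_L1; apply: bmf_path; apply: bmf_semigroup.
    exact: bmf_indic.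
  by apply: eq_integral => w _; rewrite /= semigroup_indic.
Qed.

End Transition.

Section BoundedFunctions.
Context d (T : measurableType d) (R : realType) (mu : probability T R).
Implicit Types f g : T -> R.

Lemma mean_indic (B : set T) : measurable B -> mean mu \1_B = fine (mu B).
Proof.
move=> mB; rewrite /mean /Rintegral integral_indic// setIT//.
Qed.

Lemma bmf_ip_ae f g : bounded_mfun f -> bounded_mfun g ->
  (forall h, bounded_mfun h -> ip mu f h = ip mu g h) ->
  {ae mu, forall x, f x = g x}.
Proof.
move=> bf bg H; have bfg := bmf_B bf bg.
have : nrm mu (f \- g) = 0.
  rewrite /nrm ipBl ?L2_bmf// H// subrr sqrtr0//.
move=> /(nrm0_ae (L2_bmf mu bfg)); apply: filterS => x /= /eqP.
by rewrite subr_eq0 => /eqP.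
Qed.

Lemma ip_mul1 f : ip mu f (cst 1) = mean mu f.
Proof. by congr mean; apply/funext => x /=; rewrite mulr1. Qed.

End BoundedFunctions.

(** * The stationary pair (X_0, X_t) *)

Section Invariant.
Context (R : realType) (dO : measure_display) (Omega : measurableType dO).
Context (E : puniformType) (M : markov_process R Omega E).
Context (mu : probability (borel E) R) (inv : Defs.invariant M mu).
Implicit Types (f g h : borel E -> R) (x : borel E) (t s : R).

Local Notation P := (semigroup M).
Local Notation L1 f := (mu.-integrable setT (EFin \o f)).
Local Notation L2 f := (f \in Lfun mu 2%:E).

Lemma mean_semigroup t f : 0 <= t -> bounded_mfun f ->
  mean mu (P t f) = mean mu f.
Proof.
move=> t0 bf; apply/eqP; rewrite -subr_eq0; apply/eqP.
apply: (@bounded_functional_ext _ _ _ (fun f => mean mu (P t f) - mean mu f) 2)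
  bf.
- move=> g h bg bh; have bPg := bmf_semigroup M t bg.
  have bPh := bmf_semigroup M t bh.
  by rewrite semigroup_D// !mean_D ?bmf_L1//; ring.
- move=> c g bg; rewrite semigroup_Z// !mean_Z ?bmf_L1//; last first.
    exact: bmf_semigroup.
  by ring.
- move=> g K bg gK.
  have bPg := bmf_semigroup M t bg.
  have b u : bounded_mfun u -> (forall x, `|u x| <= K) -> `|mean mu u| <= K.
    move=> bu uK; rewrite (le_trans (mean_norm (bmf_L1 mu bu)))//.
    rewrite -[leRHS](mean_cst mu) mean_le//.
    + exact/L1_norm/bmf_L1.
    + exact: L1_cst.
  rewrite (le_trans (ler_normB _ _))// mulr_natl mulr2n lerD ?b//.
  exact: semigroup_norm.
- move=> B mB; apply/eqP; rewrite subr_eq0; apply/eqP.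
  rewrite mean_indic//; congr fine; rewrite -(inv t0 mB).
  by apply: eq_integral => x _; rewrite semigroup_indic.
Qed.

(** The expectation of [f (X_0) * g (X_t)] when [X_0] has law [mu]. *)
Definition joint t f g := ip mu f (P t g).

Lemma jointE t f g : joint t f g = ip mu f (P t g).
Proof. by []. Qed.

Lemma jointZl t c f g : bounded_mfun f -> bounded_mfun g ->
  joint t (fun x => c * f x) g = c * joint t f g.
Proof.
by move=> bf bg; apply: ipZl; apply: L2_bmf => //; exact: bmf_semigroup.
Qed.

Lemma joint_1r t f : joint t f (cst 1) = mean mu f.
Proof. by rewrite /joint semigroup_cst ip_mul1. Qed.

Lemma joint_1l t f : 0 <= t -> bounded_mfun f -> joint t (cst 1) f = mean mu f.
Proof. by move=> t0 bf; rewrite /joint ipC ip_mul1 mean_semigroup. Qed.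

Fixpoint bmf_pairs (s : seq ((borel E -> R) * (borel E -> R))) : Prop :=
  if s is p :: s' then
    [/\ bounded_mfun p.1, bounded_mfun p.2 & bmf_pairs s'] else True.

(** A pointwise inequality with separated variables holds in expectation for
    [(X_0, X_t)]: integrate first in [y] against the law of [X_t] from [x], then
    in [x] against [mu]. *)
Lemma joint_sum_ge0 t (s : seq ((borel E -> R) * (borel E -> R))) :
  bmf_pairs s ->
  (forall x y, 0 <= \sum_(p <- s) p.1 x * p.2 y) ->
  0 <= \sum_(p <- s) joint t p.1 p.2.
Proof.
move=> bs pos.
have [bS SE] : (forall x, bounded_mfun (fun y => \sum_(p <- s) p.1 x * p.2 y)) /\
    (forall x, P t (fun y => \sum_(p <- s) p.1 x * p.2 y) x =
      \sum_(p <- s) p.1 x * P t p.2 x).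
  elim: s bs {pos} => [_|p s IH /= [b1 b2 /IH[bS SE]]].
    split=> x; first by under eq_fun do rewrite big_nil; exact: bmf_cst.
    under [X in P t X]eq_fun do rewrite big_nil.
    by rewrite big_nil (semigroup_cst M t 0).
  split=> x.
    under eq_fun do rewrite big_cons.
    by apply: bmf_D; [exact: bmf_Z|exact: bS].
  under [X in P t X]eq_fun do rewrite big_cons.
  rewrite big_cons semigroup_D; [|exact: bmf_Z|exact: bS].
  by rewrite /= semigroup_Z// SE.
have -> : \sum_(p <- s) joint t p.1 p.2 =
    mean mu (fun x => \sum_(p <- s) p.1 x * P t p.2 x).
  elim: s bs {pos bS SE} => [_|p s IH /= [b1 b2 bs]].
    by rewrite big_nil; under eq_fun do rewrite big_nil; rewrite (mean_cst mu 0).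
  have bl : L1 (fun x => \sum_(p <- s) p.1 x * P t p.2 x).
    apply: bmf_L1; elim: s bs {IH} => [_|q s IH /= [c1 c2 /IH bs]].
      by under eq_fun do rewrite big_nil; exact: bmf_cst.
    under eq_fun do rewrite big_cons.
    by apply: bmf_D => //; apply: bmf_M => //; exact: bmf_semigroup.
  rewrite big_cons IH//; under [in RHS]eq_fun do rewrite big_cons.
  rewrite mean_D//; apply: bmf_L1; apply: bmf_M => //; exact: bmf_semigroup.
apply: mean_ge0 => x; rewrite -SE; apply: semigroup_ge0 => y; exact: pos.
Qed.

(** Jensen's inequality: expand the expectation of
    [(f (X_t) - P_t f (X_0)) ^+ 2]. *)
Lemma semigroup_contraction t f : 0 <= t -> bounded_mfun f ->
  nrm mu (P t f) <= nrm mu f.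
Proof.
move=> t0 bf; have bP := bmf_semigroup M t bf.
rewrite -(@ler_pXn2r _ 2) ?nnegrE ?nrm_ge0// !nrm_sqr.
have b1 := @bmf_cst _ (borel E) R 1.
have := @joint_sum_ge0 t [:: (cst 1, f \* f); (fun x => - 2 * P t f x, f);
   (P t f \* P t f, cst 1)].
rewrite !big_cons !big_nil /= !addr0.
rewrite joint_1r joint_1l//; last exact: bmf_M.
rewrite jointZl// -/(ip mu f f) -/(ip mu (P t f) (P t f)).
have -> : joint t (P t f) f = ip mu (P t f) (P t f) by [].
move=> H; rewrite -subr_ge0 (le_trans (H _ _))//.
- by split=> //; [exact: bmf_M|split=> //; [exact: bmf_Z|split=> //; exact: bmf_M]].
- move=> x y; rewrite !big_cons !big_nil/= !addr0.
  by have := sqr_ge0 (f y - P t f x); rewrite expr2; lra.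
- by rewrite le_eqVlt; apply/orP; left; apply/eqP; ring.
Qed.

(** * The dual semigroup *)

Lemma semigroup_null t (B : set (borel E)) : 0 <= t -> measurable B ->
  mu B = 0%E -> {ae mu, forall x, P t \1_B x = 0}.
Proof.
move=> t0 mB B0; have bB := bmf_indic R mB.
apply: mean_norm0_ae; first by apply: bmf_L1; exact: bmf_semigroup.
rewrite (_ : (fun x => _) = P t \1_B); last first.
  by apply/funext => x; rewrite ger0_norm// semigroup_ge0.
by rewrite mean_semigroup// mean_indic// B0.
Qed.

Section DualMeasure.
Context (t : R) (h : borel E -> R) (lh : L1 h) (h0 : forall x, 0 <= h x).

Definition dual_measure (B : set (borel E)) : \bar R :=
  (\int[mu]_x ((h x)%:E * transition M t x B))%E.

Let dual_measure0 : dual_measure set0 = 0%E.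
Proof.
rewrite /dual_measure; under eq_integral => x _.
  by rewrite /transition preimage_set0 measure0 mule0; over.
exact: integral0.
Qed.

Let dual_measure_ge0 B : (0 <= dual_measure B)%E.
Proof.
by apply: integral_ge0 => x _; rewrite mule_ge0// lee_fin.
Qed.

Let dual_measure_sigma_additive : semi_sigma_additive dual_measure.
Proof.
move=> F mF tF mUF; rewrite [X in _ --> X](_ : _ =
  \int[mu]_x (\sum_(n <oo) ((h x)%:E * transition M t x (F n))))%E; last first.
  apply: eq_integral => x _.
  rewrite nneseriesZl//; congr (_ * _)%E.
  rewrite /transition preimage_bigcup; apply/esym/cvg_lim => //.
  apply: measure_semi_sigma_additive.
  - by move=> n; rewrite -[X in measurable X]setTI; exact: path_measurable.
  - by apply/trivIsetP => i j _ _ ij; rewrite -preimage_setI;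
      have /trivIsetP -> := tF; rewrite ?preimage_set0.
  - by apply: bigcup_measurable => n _; rewrite -[X in measurable X]setTI;
      exact: path_measurable.
apply/cvg_closeP; split.
  apply: is_cvg_nneseries => n _ _; exact: dual_measure_ge0.
rewrite closeE// integral_nneseries//.
- move=> n; apply: emeasurable_funM.
    by apply/measurable_EFinP; exact: (L1_meas lh).
  have -> : (fun x => transition M t x (F n)) = EFin \o P t \1_(F n).
    by apply/funext => x; rewrite /= semigroup_indic.
  apply/measurable_EFinP; apply: semigroup_measurable; exact: bmf_indic.
- by move=> n x _; rewrite mule_ge0// lee_fin.
Qed.

HB.instance Definition _ := isMeasure.Build _ _ _ dual_measure
  dual_measure0 dual_measure_ge0 dual_measure_sigma_additive.

Let dual_measure_fin : fin_num_fun dual_measure.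
Proof.
apply: lty_fin_num_fun.
change (dual_measure setT < +oo)%E; rewrite /dual_measure.
under eq_integral => x _.
  by rewrite /transition preimage_setT prob_kernel mule1; over.
by rewrite mean_EFin// ltry.
Qed.

HB.instance Definition _ := Measure_isFinite.Build _ _ _ dual_measure
  dual_measure_fin.

(** The law of [X_t] when [X_0] has law [h mu] is absolutely continuous: by
    invariance, the semigroup does not charge null sets. *)
Lemma dual_measure_density : 0 <= t -> exists g, [/\ L1 g, (forall x, 0 <= g x) &
  forall B, measurable B -> (\int[mu]_(x in B) (g x)%:E = dual_measure B)%E].
Proof.
move=> t0.
have numu : dual_measure `<< mu.
  apply/null_content_dominatesP => B mB B0; rewrite /dual_measure.
  rewrite (_ : 0%E = \int[mu]_x (cst 0%E x))%E; last by rewrite integral0.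
  apply: ae_eq_integral => //.
    apply: emeasurable_funM.
      by apply/measurable_EFinP; exact: (L1_meas lh).
    have -> : (fun x => transition M t x B) = EFin \o P t \1_B.
      by apply/funext => x; rewrite /= semigroup_indic.
    apply/measurable_EFinP; apply: semigroup_measurable; exact: bmf_indic.
  have := semigroup_null t0 mB B0; apply: filterS => x Px _.
  by rewrite -semigroup_indic// Px mule0.
have [f [f0 ffin intf fE]] := @radon_nikodym_sigma_finite _ _ _ mu
  dual_measure numu.
exists (fine \o f); split.
- by apply: eq_integrable intf => // x _; rewrite /= fineK.
- by move=> x /=; rewrite fine_ge0.
- move=> B mB; rewrite fE ?inE//; apply: eq_integral => x _.
  by rewrite /= fineK.
Qed.

End DualMeasure.

End Invariant.

Section Dual.
Context (R : realType) (dO : measure_display) (Omega : measurableType dO).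
Context (E : puniformType) (M : markov_process R Omega E).
Context (mu : probability (borel E) R) (inv : Defs.invariant M mu).
Implicit Types (f g h : borel E -> R) (x : borel E) (t s : R).

Local Notation P := (semigroup M).
Local Notation Pdual := (dual_semigroup M mu).
Local Notation L1 f := (mu.-integrable setT (EFin \o f)).
Local Notation L2 f := (f \in Lfun mu 2%:E).

Let L1_mulP t h f : L1 h -> bounded_mfun f -> L1 (h \* P t f).
Proof.
move=> lh bf; have := L1_M (bmf_semigroup M t bf) lh.
by apply: eq_integrable => // x _ /=; rewrite mulrC.
Qed.

Let L1_mul h f : L1 h -> bounded_mfun f -> L1 (h \* f).
Proof.
move=> lh bf; have := L1_M bf lh.
by apply: eq_integrable => // x _ /=; rewrite mulrC.
Qed.

Let int_indic g (B : set (borel E)) : L1 g -> measurable B ->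
  (\int[mu]_(x in B) (g x)%:E = (mean mu (g \* \1_B))%:E)%E.
Proof.
move=> lg mB; rewrite -mean_EFin; last by apply: L1_mul => //; exact: bmf_indic.
rewrite integral_mkcond; apply: eq_integral => x _.
rewrite patchE /= indicE; case: ifPn => xB.
  by rewrite mulr1.
by rewrite mulr0.
Qed.

Let int_dual t h (B : set (borel E)) : L1 h -> measurable B ->
  (\int[mu]_x ((h x)%:E * transition M t x B) =
   (mean mu (h \* P t \1_B))%:E)%E.
Proof.
move=> lh mB; rewrite -mean_EFin; last by apply: L1_mulP => //; exact: bmf_indic.
by apply: eq_integral => x _; rewrite EFinM semigroup_indic.
Qed.

(** The last clause of [is_dual] asks for a nonnegative density when [h] is
    nonnegative; otherwise the positive and negative parts of [h] are transported
    separately. *)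
Lemma is_dual_exists t h : 0 <= t -> L1 h -> exists g, is_dual M mu t h g.
Proof.
move=> t0 lh.
have [h0|hneg] := pselect (forall x, 0 <= h x).
  have [g [lg g0 gE]] := dual_measure_density inv lh h0 t0.
  by exists g; split.
pose hp x := Num.max (h x) 0. pose hn x := Num.max (- h x) 0.
have mh := L1_meas lh.
have lhp : L1 hp.
  apply: (@L1_le _ _ _ _ _ (fun x => `|h x|)); last 2 first.
  - exact: L1_norm.
  - by move=> x; rewrite /hp; case: (leP (h x) 0) => h0; rewrite ?normr0.
  - exact: measurable_maxr.
have lhn : L1 hn.
  apply: (@L1_le _ _ _ _ _ (fun x => `|h x|)); last 2 first.
  - exact: L1_norm.
  - by move=> x; rewrite /hn; case: (leP (- h x) 0) => h0; rewrite ?normr0 ?normrN.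
  - by apply: measurable_maxr => //; exact: measurableT_comp.
have hE : h = hp \- hn.
  apply/funext => x /=; rewrite /hp /hn.
  by have [h0|h0|->] := ltgtP (h x) 0;
    [rewrite max_l ?opprK ?add0r// oppr_ge0 ltW|
     rewrite max_r ?subr0// oppr_le0 ltW|rewrite oppr0 maxxx subr0].
have hp0 x : 0 <= hp x by rewrite le_max lexx orbT.
have hn0 x : 0 <= hn x by rewrite le_max lexx orbT.
have [gp [lgp _ gpE]] := dual_measure_density inv lhp hp0 t0.
have [gn [lgn _ gnE]] := dual_measure_density inv lhn hn0 t0.
exists (gp \- gn); split=> //.
- exact: L1_B.
- move=> B mB; rewrite int_indic//; last exact: L1_B.
  have bB := bmf_indic R mB.
  have e1 := gpE B mB; have e2 := gnE B mB.
  rewrite int_indic// /dual_measure int_dual// in e1.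
  rewrite int_indic// /dual_measure int_dual// in e2.
  rewrite int_dual//; congr EFin.
  have -> : (gp \- gn) \* \1_B = (gp \* \1_B) \- (gn \* \1_B).
    by apply/funext => x /=; rewrite mulrBl.
  rewrite mean_B; [|exact: L1_mul|exact: L1_mul].
  rewrite (EFin_inj e1) (EFin_inj e2) -mean_B; [|exact: L1_mulP|exact: L1_mulP].
  by congr mean; apply/funext => x; rewrite hE /= mulrBl.
Qed.

Lemma dual_semigroupP t h : 0 <= t -> L1 h -> is_dual M mu t h (Pdual t h).
Proof. by move=> t0 lh; apply: getPex; exact: is_dual_exists. Qed.

Lemma dual_L1 t h : 0 <= t -> L1 h -> L1 (Pdual t h).
Proof. by move=> t0 lh; have [] := dual_semigroupP t0 lh. Qed.

Lemma dual_ge0 t h : 0 <= t -> L1 h -> (forall x, 0 <= h x) ->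
  forall x, 0 <= Pdual t h x.
Proof. by move=> t0 lh; have [_ _] := dual_semigroupP t0 lh. Qed.

Lemma dual_ip t h f : 0 <= t -> L1 h -> bounded_mfun f ->
  mean mu (Pdual t h \* f) = mean mu (h \* P t f).
Proof.
move=> t0 lh bf; have [lg gE _] := dual_semigroupP t0 lh.
set g := Pdual t h in lg gE *.
apply/eqP; rewrite -subr_eq0; apply/eqP.
apply: (@bounded_functional_ext _ _ _ (fun f => mean mu (g \* f) -
  mean mu (h \* P t f)) (mean mu (fun x => `|g x|) + mean mu (fun x => `|h x|)))
  bf.
- move=> u v bu bv.
  have -> : g \* (u \+ v) = (g \* u) \+ (g \* v).
    by apply/funext => x /=; rewrite mulrDr.
  have -> : h \* P t (u \+ v) = (h \* P t u) \+ (h \* P t v).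
    by apply/funext => x /=; rewrite semigroup_D//= mulrDr.
  rewrite !mean_D; [|exact: L1_mulP|exact: L1_mulP|exact: L1_mul|exact: L1_mul].
  by ring.
- move=> c u bu.
  have -> : g \* (fun x => c * u x) = (fun x => c * (g \* u) x).
    by apply/funext => x /=; ring.
  have -> : h \* P t (fun x => c * u x) = (fun x => c * (h \* P t u) x).
    by apply/funext => x /=; rewrite semigroup_Z//=; ring.
  rewrite !mean_Z; [|exact: L1_mulP|exact: L1_mul].
  by ring.
- move=> u K bu uK.
  have b k v : L1 k -> bounded_mfun v -> (forall x, `|v x| <= K) ->
      `|mean mu (k \* v)| <= mean mu (fun x => `|k x|) * K.
    move=> lk bv vK; rewrite (le_trans (mean_norm (L1_mul lk bv)))//.
    rewrite mulrC -mean_Z; last exact: L1_norm.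
    apply: mean_le; first exact/L1_norm/L1_mul.
      exact/L1_Z/L1_norm.
    by move=> x /=; rewrite normrM mulrC ler_wpM2r.
  rewrite (le_trans (ler_normB _ _))// mulrDl lerD ?b//.
    exact: bmf_semigroup.
  exact: semigroup_norm.
- move=> B mB; apply/eqP; rewrite subr_eq0; apply/eqP.
  apply: EFin_inj; rewrite -int_indic// gE//.
  exact: int_dual.
Qed.

Lemma dual_mean t h : 0 <= t -> L1 h -> mean mu (Pdual t h) = mean mu h.
Proof.
move=> t0 lh; have := dual_ip t0 lh (@bmf_cst _ (borel E) R 1).
rewrite semigroup_cst => H; rewrite -[LHS]ip_mul1 -[RHS]ip_mul1.
exact: H.
Qed.

(** Test against the indicator of the set where the bound fails. *)
Lemma dual_le t h K : 0 <= t -> L1 h -> (forall x, h x <= K) ->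
  {ae mu, forall x, Pdual t h x <= K}.
Proof.
move=> t0 lh hK; set g := Pdual t h.
have lg : L1 g by exact: dual_L1.
have mB : measurable (g @^-1` [set y | K < y]).
  rewrite -[X in measurable X]setTI; apply: (L1_meas lg) => //.
  rewrite (_ : [set y | _] = `]K, +oo[%classic)//.
  by apply/seteqP; split=> y /=; rewrite in_itv/= andbT.
pose B := \1_(g @^-1` [set y | K < y]) : borel E -> R.
have bB : bounded_mfun B by exact: bmf_indic.
have B0 x : 0 <= B x by rewrite /B indicE.
have lK : L1 (fun x => K * B x) by apply: L1_Z; exact: bmf_L1.
have le0 : mean mu (g \* B) <= mean mu (fun x => K * B x).
  rewrite (dual_ip t0 lh bB) mean_Z; last exact: bmf_L1.
  rewrite -(mean_semigroup inv t0 bB) -mean_Z; last first.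
    by apply: bmf_L1; exact: bmf_semigroup.
  apply: mean_le; [exact: L1_mulP|by apply: L1_Z; apply: bmf_L1; exact: bmf_semigroup|].
  by move=> x /=; rewrite ler_wpM2r ?semigroup_ge0.
have lgB : L1 (g \* B) by exact: L1_mul.
have ge0 x : 0 <= ((g \* B) \- (fun x => K * B x)) x.
  rewrite /= -mulrBl /B indicE; case: (boolP (x \in _)) => xB; last by rewrite mulr0.
  by rewrite mulr1 subr_ge0; move: xB; rewrite inE /= => /ltW.
have eq0 : mean mu (fun x => `|((g \* B) \- (fun x => K * B x)) x|) = 0.
  apply/eqP; rewrite eq_le mean_ge0 ?andbT//.
  rewrite (_ : (fun x => _) = (g \* B) \- (fun x => K * B x)); last first.
    by apply/funext => x; rewrite ger0_norm.
  by rewrite mean_B// subr_le0.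
have := mean_norm0_ae (L1_B lgB lK) eq0.
apply: filterS => x; rewrite leNgt => H; apply/negP => Kg.
move: H; rewrite /= /B indicE mem_set// !mulr1 => /eqP.
by rewrite subr_eq0 gt_eqF.
Qed.

(** By duality: test the difference against its sign, which the semigroup keeps
    between -1 and 1. *)
Lemma dual_dist t h k : 0 <= t -> L1 h -> L1 k ->
  mean mu (fun x => `|Pdual t h x - Pdual t k x|) <=
  mean mu (fun x => `|h x - k x|).
Proof.
move=> t0 lh lk; set gh := Pdual t h; set gk := Pdual t k.
have lgh : L1 gh by exact: dual_L1.
have lgk : L1 gk by exact: dual_L1.
have lg := L1_B lgh lgk.
have mB : measurable ((gh \- gk) @^-1` [set y | 0 <= y]).
  rewrite -[X in measurable X]setTI; apply: (L1_meas lg) => //.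
  rewrite (_ : [set y | _] = `[0, +oo[%classic)//.
  by apply/seteqP; split=> y /=; rewrite in_itv/= andbT.
pose s x : R := 2 * \1_((gh \- gk) @^-1` [set y | 0 <= y]) x - 1.
have bs : bounded_mfun s.
  by apply: bmf_D; [apply: bmf_Z; exact: bmf_indic|exact: (@bmf_cst _ _ R (-1))].
have sE x : (0 <= gh x - gk x /\ s x = 1) \/ (gh x - gk x < 0 /\ s x = -1).
  rewrite /s indicE; case: (boolP (x \in _)) => [|/negP] h0.
    by left; split; [exact: (set_mem h0)|rewrite -[true%:R]/(1 : R); ring].
  by right; split; [rewrite ltNge; apply/negP => h1; apply: h0; exact: mem_set|
    rewrite -[false%:R]/(0 : R); ring].
have -> : mean mu (fun x => `|gh x - gk x|) = mean mu (gh \* s) - mean mu (gk \* s).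
  rewrite -mean_B; [|exact: L1_mul|exact: L1_mul].
  congr mean; apply/funext => x /=; rewrite -mulrBl.
  by case: (sE x) => -[h0 ->]; [rewrite ger0_norm// mulr1|
    rewrite ltr0_norm// mulrN1].
rewrite !dual_ip// -mean_B; [|exact: L1_mulP|exact: L1_mulP].
apply: mean_le; [by apply: L1_B; exact: L1_mulP|exact/L1_norm/L1_B|].
move=> x /=; rewrite -mulrBl (le_trans (ler_norm _))// normrM ler_piMr//.
by apply: semigroup_norm => // y; case: (sE y) => -[_ ->]; rewrite ?normrN normr1.
Qed.

(** * The dual semigroup on bounded functions *)

Definition supnorm h : R := sup [set `|h x| | x in setT].

Lemma le_supnorm h : bounded_mfun h -> forall x, `|h x| <= supnorm h.
Proof.
move=> [_ [K hK]] x; apply: ub_le_sup; last by exists x.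
by exists K => _ [y _ <-].
Qed.

Lemma supnorm_le h K : (forall x, `|h x| <= K) -> supnorm h <= K.
Proof.
move=> hK; apply: ge_sup; first by exists `|h point|; exists point.
by move=> _ [y _ <-].
Qed.

(** A version of the dual semigroup which has everywhere, and not only almost
    everywhere, the bounds of the initial function. *)
Definition bdual t h x : R :=
  Num.max (- supnorm h) (Num.min (supnorm h) (Pdual t h x)).

Lemma supnorm_ge0 h : bounded_mfun h -> 0 <= supnorm h.
Proof. by move=> /le_supnorm/(_ point); apply: le_trans. Qed.

Lemma bdual_norm t h : bounded_mfun h -> forall x, `|bdual t h x| <= supnorm h.
Proof.
move=> bh x; have s0 := supnorm_ge0 bh.
rewrite ler_norml /bdual le_max lexx/= ge_max ge_min lexx andbT.
by rewrite (le_trans _ s0)// oppr_le0.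
Qed.

Lemma bmf_bdual t h : 0 <= t -> bounded_mfun h -> bounded_mfun (bdual t h).
Proof.
move=> t0 bh; split; last by exists (supnorm h); exact: bdual_norm.
apply: measurable_maxr => //; apply: measurable_minr => //.
by apply: L1_meas; apply: dual_L1 => //; exact: bmf_L1.
Qed.

Lemma bdual_itv t h K : 0 <= t -> bounded_mfun h ->
  (forall x, 0 <= h x <= K) -> forall x, 0 <= bdual t h x <= K.
Proof.
move=> t0 bh hK x.
have s0 := supnorm_ge0 bh.
have sK : supnorm h <= K.
  by apply: supnorm_le => y; have /andP[h0 h1] := hK y; rewrite ger0_norm.
apply/andP; split; last first.
  by rewrite (le_trans _ sK)// (le_trans (ler_norm _))// bdual_norm.
rewrite /bdual le_max le_min s0 dual_ge0 ?orbT//; first exact: bmf_L1.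
by move=> y; have /andP[] := hK y.
Qed.

Lemma bdual_ae t h : 0 <= t -> bounded_mfun h ->
  {ae mu, forall x, Pdual t h x = bdual t h x}.
Proof.
move=> t0 bh; have lh := bmf_L1 mu bh.
have u1 : {ae mu, forall x, Pdual t h x <= supnorm h}.
  by apply: dual_le => // x; rewrite (le_trans (ler_norm _))// le_supnorm.
pose k x := - h x.
have bk : bounded_mfun k by exact: bmf_N.
have lk := bmf_L1 mu bk.
have u2 : {ae mu, forall x, Pdual t k x <= supnorm h}.
  by apply: dual_le => // x; rewrite (le_trans (ler_norm _))// normrN le_supnorm.
have u3 : {ae mu, forall x, Pdual t k x = - Pdual t h x}.
  have lg : L1 (Pdual t k \+ Pdual t h) by apply: L1_D; exact: dual_L1.
  have : ae_eq mu setT (EFin \o (Pdual t k \+ Pdual t h)) (cst 0%E).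
    apply: integral_ae_eq => // B _ mB.
    have bB := bmf_indic R mB.
    rewrite int_indic// integral0; congr EFin.
    have -> : (Pdual t k \+ Pdual t h) \* \1_B =
        (Pdual t k \* \1_B) \+ (Pdual t h \* \1_B).
      by apply/funext => x /=; rewrite mulrDl.
    rewrite mean_D; try by apply: L1_mul => //; exact: dual_L1.
    rewrite !dual_ip// -mean_D; try exact: L1_mulP.
    rewrite -[RHS](mean_cst mu 0); congr mean; apply/funext => x /=.
    by rewrite /k -mulrDl addNr mul0r.
  apply: filterS => x /(_ I) /= [] /eqP; by rewrite addr_eq0 => /eqP.
move: u1 u2 u3; apply: filterS3 => x h1 h2 h3.
by rewrite /bdual min_r// max_r// lerNl -h3.
Qed.

Lemma bdual_ip t h f : 0 <= t -> bounded_mfun h -> bounded_mfun f ->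
  ip mu (bdual t h) f = joint M mu t h f.
Proof.
move=> t0 bh bf; rewrite /joint /ip -dual_ip//; last exact: bmf_L1.
have bd := bmf_bdual t0 bh.
have lP : L1 (Pdual t h) by apply: dual_L1 => //; exact: bmf_L1.
apply: mean_ae.
- by apply: measurable_funM; [case: bd|case: bf].
- by apply: measurable_funM; [exact: (L1_meas lP)|case: bf].
- by apply: filterS (bdual_ae t0 bh) => x /= ->.
Qed.

Lemma mean_bdual t h : 0 <= t -> bounded_mfun h ->
  mean mu (bdual t h) = mean mu h.
Proof.
move=> t0 bh; rewrite -[LHS]ip_mul1 bdual_ip//; last exact: bmf_cst.
by rewrite joint_1r.
Qed.

Lemma bdual_contraction t h : 0 <= t -> bounded_mfun h ->
  nrm mu (bdual t h) <= nrm mu h.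
Proof.
move=> t0 bh; have bd := bmf_bdual t0 bh.
apply: nrm_le_ip => //; first exact: nrm_ge0.
move=> g bg; rewrite bdual_ip// /joint.
have bPg := bmf_semigroup M t bg.
rewrite (le_trans (ler_norm _))// (le_trans (ip_le_nrm _ _)) ?L2_bmf//.
by rewrite ler_wpM2l ?nrm_ge0// semigroup_contraction.
Qed.

Lemma bdualDt s t h f : 0 <= s -> 0 <= t -> bounded_mfun h -> bounded_mfun f ->
  ip mu (bdual (s + t) h) f = ip mu (bdual t (bdual s h)) f.
Proof.
move=> s0 t0 bh bf; have bd := bmf_bdual s0 bh.
have bPf := bmf_semigroup M t bf.
rewrite (bdual_ip (addr_ge0 s0 t0) bh bf) (bdual_ip t0 bd bf).
have := bdual_ip s0 bh bPf; rewrite /joint => ->.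
by rewrite (semigroupDt M s0 t0 bf).
Qed.

End Dual.

(** * Time averages of a contraction semigroup *)

Section Averages.
Context d (T : measurableType d) (R : realType) (mu : probability T R).
Context (Q Q' : R -> (T -> R) -> T -> R).
Implicit Types f g u v : T -> R.

(** The identities are stated against test functions, that is up to null sets:
    this covers the dual semigroup, which is only defined up to null sets. *)
Record bounded_semigroup : Prop := BoundedSemigroup {
  bs_bmf : forall s f, 0 <= s -> bounded_mfun f -> bounded_mfun (Q s f) ;
  bs_bmf' : forall s f, 0 <= s -> bounded_mfun f -> bounded_mfun (Q' s f) ;
  bs_itv : forall s f K, 0 <= s -> bounded_mfun f ->
    (forall x, 0 <= f x <= K) -> forall x, 0 <= Q s f x <= K ;
  bs_adj : forall s f g, 0 <= s -> bounded_mfun f -> bounded_mfun g ->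
    ip mu (Q s f) g = ip mu f (Q' s g) ;
  bs_contr' : forall s f, 0 <= s -> bounded_mfun f ->
    nrm mu (Q' s f) <= nrm mu f ;
  bs_0 : forall f g, bounded_mfun f -> bounded_mfun g ->
    ip mu (Q 0 f) g = ip mu f g ;
  bs_D : forall s t f g, 0 <= s -> 0 <= t -> bounded_mfun f ->
    bounded_mfun g -> ip mu (Q (s + t) f) g = ip mu (Q t (Q s f)) g ;
  bs_cont : forall f, bounded_mfun f ->
    nrm mu (Q t f \- f) @[t --> (0 : R)^'+] --> 0 }.

Context (bs : bounded_semigroup).

Let bmf_Q s f : 0 <= s -> bounded_mfun f -> bounded_mfun (Q s f).
Proof. exact: (bs_bmf bs). Qed.

Let ip_Q_le s f g : 0 <= s -> bounded_mfun f -> bounded_mfun g ->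
  `|ip mu (Q s f) g| <= nrm mu f * nrm mu g.
Proof.
move=> s0 bf bg; rewrite (bs_adj bs)//.
have bQ := bs_bmf' bs s0 bg.
rewrite (le_trans (ip_le_nrm (L2_bmf mu bf) (L2_bmf mu bQ)))//.
by rewrite ler_wpM2l ?nrm_ge0// (bs_contr' bs).
Qed.

Let ip_Q_B s f h g : 0 <= s -> bounded_mfun f -> bounded_mfun h ->
  bounded_mfun g ->
  ip mu (Q s (f \- h)) g = ip mu (Q s f) g - ip mu (Q s h) g.
Proof.
move=> s0 bf bh bg; have bQ := bs_bmf' bs s0 bg.
by rewrite !(bs_adj bs) ?ipBl ?L2_bmf//; exact: bmf_B.
Qed.

(** Continuity at time 0 is uniform along the semigroup, by contraction. *)
Lemma bs_modulus f : bounded_mfun f -> forall e, 0 < e -> exists2 r, 0 < r &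
  forall s, 0 <= s <= r -> forall q g, 0 <= q -> bounded_mfun g ->
    `|ip mu (Q (q + s) f) g - ip mu (Q q f) g| <= e * nrm mu g.
Proof.
move=> bf e e0.
have /cvgrPdist_le/(_ _ e0)/nbhs_ballP[dl /= dl0 Hdl] := bs_cont bs bf.
exists (dl / 2); first by rewrite divr_gt0.
move=> s /andP[s0 sdl] q g q0 bg.
have [->|sn0] := eqVneq s 0.
  by rewrite addr0 subrr normr0 mulr_ge0 ?nrm_ge0// ltW.
have bQ := bmf_Q s0 bf.
have -> : ip mu (Q (q + s) f) g = ip mu (Q q (Q s f)) g.
  by rewrite addrC (bs_D bs).
rewrite -ip_Q_B//; have bQf := bmf_B bQ bf.
rewrite (le_trans (ip_Q_le q0 bQf bg))// ler_wpM2r ?nrm_ge0//.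
have := Hdl s; rewrite /ball/= sub0r normrN ger0_norm// sub0r normrN.
rewrite ger0_norm ?nrm_ge0//; apply.
  by rewrite (le_lt_trans sdl)// ltr_pdivrMr// ltr_pMr// ltr1n.
by rewrite lt_neqAle eq_sym sn0.
Qed.

Lemma sum_nat_mul (V : zmodType) (F : nat -> V) a b :
  \sum_(0 <= j < a * b) F j = \sum_(0 <= i < a) \sum_(0 <= l < b) F (i * b + l)%N.
Proof.
elim: a => [|a IH]; first by rewrite mul0n !big_geq.
rewrite mulSn addnC (@big_cat_nat _ _ _ (a * b))//=; last by rewrite leq_addr.
rewrite IH big_nat_recr//=; congr (_ + _).
rewrite -{1}(add0n (a * b)%N) big_addn addnC addnK.
by apply: eq_bigr => l _; rewrite addnC.
Qed.

Section Average.
Context (u : T -> R) (K : R) (tau : R).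
Context (bu : bounded_mfun u) (uK : forall x, 0 <= u x <= K) (tau0 : 0 < tau).

Let del k : R := tau / (2 ^ k)%:R.
Let v k x := (2 ^ k)%:R^-1 * \sum_(0 <= j < 2 ^ k) Q (j%:R * del k) u x.
Let b g s := ip mu (Q s u) g.

Let pow0 k : 0 < (2 ^ k)%:R :> R.
Proof. by rewrite ltr0n expn_gt0. Qed.

Let del0 k : 0 < del k.
Proof. by rewrite divr_gt0. Qed.

Let jdel0 j k : 0 <= j%:R * del k.
Proof. by rewrite mulr_ge0// ltW. Qed.

Let delE k : (2 ^ k)%:R * del k = tau.
Proof. by rewrite /del mulrC divfK// gt_eqF. Qed.

Let bQj j k : bounded_mfun (Q (j%:R * del k) u).
Proof. exact: bmf_Q. Qed.

Let v_itv k x : 0 <= v k x <= K.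
Proof.
have H j : 0 <= Q (j%:R * del k) u x <= K by exact: (bs_itv bs).
have K0 : 0 <= K by have /andP[a c] := uK x; exact: le_trans c.
apply/andP; split.
  apply: mulr_ge0; first by rewrite invr_ge0 ltW.
  by apply: sumr_ge0 => j _; case/andP: (H j).
rewrite /v ler_pdivrMl// mulrC.
rewrite (@le_trans _ _ (\sum_(0 <= j < 2 ^ k) K))//.
  by apply: ler_sum => j _; case/andP: (H j).
by rewrite sumr_const_nat subn0 mulr_natr.
Qed.

Let bsum k n : bounded_mfun (fun x => \sum_(0 <= j < n) Q (j%:R * del k) u x).
Proof.
under eq_fun do rewrite big_mkord.
exact: (@bmf_sum _ _ _ n (fun j => Q (j%:R * del k) u)).
Qed.

Let bv k : bounded_mfun (v k).
Proof. by apply: bmf_Z; exact: bsum. Qed.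

Let ip_v k g : bounded_mfun g ->
  ip mu (v k) g = (2 ^ k)%:R^-1 * \sum_(0 <= j < 2 ^ k) b g (j%:R * del k).
Proof.
move=> bg; rewrite ipZl; [|exact/L2_bmf/bsum|exact: L2_bmf].
congr (_ * _); elim: (2 ^ k)%N => [|n IH].
  rewrite big_geq//; under [X in ip mu X]eq_fun do rewrite big_geq//.
  transitivity (mean mu (cst 0)); last exact: mean_cst.
  by congr mean; apply/funext => x /=; rewrite mul0r.
rewrite big_nat_recr//= -IH.
have -> : (fun x => \sum_(0 <= j < n.+1) Q (j%:R * del k) u x) =
    (fun x => \sum_(0 <= j < n) Q (j%:R * del k) u x) \+ Q (n%:R * del k) u.
  by apply/funext => x; rewrite big_nat_recr.
by rewrite ipDl//; apply: L2_bmf.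
Qed.

Let v_cauchy e : 0 < e -> exists N, forall n m, (N <= n)%N -> (N <= m)%N ->
  nrm mu (v n \- v m) <= e.
Proof.
move=> e0; have e20 : 0 < e / 2 by rewrite divr_gt0.
have [r r0 Hr] := bs_modulus bu e20.
have [N HN] : exists N, del N <= r.
  exists (Num.trunc (tau / r)).+1.
  rewrite /del ler_pdivrMr// mulrC -ler_pdivrMr//.
  rewrite (@le_trans _ _ (Num.trunc (tau / r)).+1%:R)//.
    by rewrite ltW// truncnS_gt// divr_ge0// ltW.
  by rewrite ler_nat ltnW// ltn_expl.
have H n : (N <= n)%N -> nrm mu (v n \- v N) <= e / 2.
  move=> Nn; apply: nrm_le_ip; [exact: bmf_B|exact: ltW|move=> g bg].
  rewrite ipBl ?L2_bmf// !ip_v// -(subnK Nn) expnD.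
  set p := (2 ^ (n - N))%N.
  have p0 : 0 < p%:R :> R by rewrite ltr0n expn_gt0.
  have dn : del (n - N + N) = del N / p%:R.
    by rewrite /del expnD natrM invfM mulrA -/p mulrAC.
  rewrite (mulnC p) sum_nat_mul dn natrM.
  have -> : \sum_(0 <= j < 2 ^ N) b g (j%:R * del N) =
    p%:R^-1 * \sum_(0 <= i < 2 ^ N) \sum_(0 <= l < p) b g (i%:R * del N).
    rewrite mulr_sumr; apply: eq_bigr => i _.
    by rewrite sumr_const_nat subn0 -(mulr_natl (b g _)) [RHS]mulrA mulVf ?mul1r// gt_eqF.
  rewrite invfM -[X in X - _]mulrA -mulrBr -mulrBr -sumrB.
  rewrite ler_pdivrMl// ler_pdivrMl// mulrA -natrM.
  rewrite (@le_trans _ _ (\sum_(0 <= i < 2 ^ N) \sum_(0 <= l < p)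
    (e / 2 * nrm mu g)))//; last first.
    rewrite sumr_const_nat sumr_const_nat !subn0 -mulrnA -[X in X <= _]mulr_natl.
    by rewrite mulnC.
  apply: ler_sum => i _; rewrite -sumrB big_nat [leRHS]big_nat.
  apply: ler_sum => l /andP[_ lp].
  have ldel0 : 0 <= l%:R * (del N / p%:R).
    by rewrite mulr_ge0// divr_ge0// ltW.
  have -> : (i * p + l)%:R * (del N / p%:R) =
      i%:R * del N + l%:R * (del N / p%:R).
    by rewrite natrD natrM mulrDl; congr (_ + _); field; rewrite gt_eqF.
  rewrite (le_trans (ler_norm _))// /b Hr// ldel0/= (le_trans _ HN)//.
  by rewrite mulrCA ler_piMr ?(ltW (del0 N))// ler_pdivrMr// mul1r ler_nat ltnW.
exists N => n m Nn Nm; rewrite (splitr e).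
rewrite (le_trans (nrmB3 _ _ _ (g := v N)))//; try exact: L2_bmf.
apply: lerD; first exact: H.
by rewrite nrmBC; exact: H.
Qed.

(** [f] is the mean of [Q s u] over the times [s] in [0, tau], a limit of dyadic
    Riemann sums. The third clause says that it lies in the closed convex hull of
    the [Q s u], the last one that it belongs to the domain of the generator. *)
Lemma average_exists : exists f, [/\ bounded_mfun f, forall x, 0 <= f x <= K,
  forall g c, bounded_mfun g ->
    (forall s, 0 <= s <= tau -> ip mu (Q s u) g <= c) -> ip mu f g <= c &
  nrm mu ((fun x => t^-1 * (Q t f x - f x)) \-
          (fun x => tau^-1 * (Q tau u x - u x))) @[t --> (0 : R)^'+] --> 0].
Proof.
have Lv k : mu.-integrable setT (EFin \o v k) by exact: bmf_L1.
have [|f0 [lf0 cf0]] := L1_complete Lv.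
  move=> e e0; have [N HN] := v_cauchy e0; exists N => n m Nn Nm.
  rewrite (le_trans _ (HN n m Nn Nm))//.
  by apply: mean_norm_le_nrm; apply: L2_bmf; exact: bmf_B.
have K0 : 0 <= K by have /andP[a c] := uK point; exact: le_trans c.
pose f x := Num.max 0 (Num.min K (f0 x)).
have fK x : 0 <= f x <= K.
  by rewrite /f le_max lexx/= ge_max K0 ge_min lexx.
have mf : measurable_fun setT f.
  by apply: measurable_maxr => //; apply: measurable_minr => //; exact: (L1_meas lf0).
have bf : bounded_mfun f.
  by split=> //; exists K => x; have /andP[a c] := fK x; rewrite ger0_norm.
have vf k x : `|v k x - f x| <= `|v k x - f0 x|.
  have /andP[a c] := v_itv k x; rewrite /f.
  have [h|h] := leP (f0 x) K.
    have [h2|//] := leP (f0 x) 0.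
    by rewrite subr0 !ger0_norm ?subr_ge0 ?(le_trans h2)// lerBrDr gerDl.
  rewrite max_r// (distrC (v k x) K) (distrC (v k x) (f0 x)).
  rewrite !ger0_norm ?subr_ge0//; last by rewrite (le_trans c)// ltW.
  by rewrite lerD2r ltW.
have cvf : nrm mu (v k \- f) @[k --> \oo] --> 0.
  have c1 : Num.sqrt (K * mean mu (fun x => `|v k x - f0 x|)) @[k --> \oo] --> 0.
    rewrite -[X in _ --> X](_ : Num.sqrt (K * 0) = 0); last first.
      by rewrite mulr0 sqrtr0.
    by apply: continuous_cvg; [exact: sqrt_continuous|exact: cvgMr].
  apply: (@squeeze_cvgr _ _ _ _ (cst 0)) c1; last exact: cvg_cst.
  apply: nearW => k; rewrite nrm_ge0/= ler_sqrt; last first.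
    by rewrite mulr_ge0// mean_ge0.
  have l1 : mu.-integrable setT (EFin \o (fun x => `|v k x - f0 x|)).
    exact/L1_norm/L1_B.
  have bd : bounded_mfun (v k \- f) by exact: bmf_B.
  rewrite -mean_Z//; apply: mean_le.
  - exact/bmf_L1/bmf_M.
  - exact: L1_Z.
  - move=> x; rewrite /= -expr2 -(real_normK (num_real _)) expr2.
    rewrite ler_pM//.
    have /andP[a c] := v_itv k x; have /andP[a' c'] := fK x.
    by rewrite ler_norml; apply/andP; split; lra.
have ip_f g : bounded_mfun g -> ip mu (v k) g @[k --> \oo] --> ip mu f g.
  by move=> bg; apply: cvg_ipl => // [i||]; exact: L2_bmf.
exists f; split=> //.
- move=> g c bg H.
  rewrite -(cvg_lim (@Rhausdorff R) (ip_f g bg)).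
  apply: limr_le; first by apply/cvg_ex; eexists; exact: ip_f.
  apply: nearW => k; rewrite ip_v// ler_pdivrMl// mulrC.
  rewrite (@le_trans _ _ (\sum_(0 <= j < 2 ^ k) c))//.
    rewrite big_nat [leRHS]big_nat; apply: ler_sum => j /andP[_ jk].
    by apply: H; rewrite jdel0/= -(delE k) ler_wpM2r ?(ltW (del0 k))// ler_nat ltnW.
  by rewrite sumr_const_nat subn0 mulr_natr.
- pose y := Q tau u \- u.
  have by_ : bounded_mfun y by apply: bmf_B => //; apply: bmf_Q => //; exact: ltW.
  apply/cvgrPdist_le => e e0.
  have et0 : 0 < e * tau by exact: mulr_gt0.
  have [r r0 Hr] := bs_modulus by_ et0.
  near=> t.
  have t0 : 0 < t by near: t; exact: nbhs_right_gt.
  have tr : t <= r by near: t; exact: nbhs_right_le.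
  rewrite sub0r normrN ger0_norm ?nrm_ge0//.
  have bQf : bounded_mfun (Q t f) by apply: bmf_Q => //; exact: ltW.
  have bd : bounded_mfun ((fun x => t^-1 * (Q t f x - f x)) \-
          (fun x => tau^-1 * (Q tau u x - u x))).
    by apply: bmf_B; apply: bmf_Z => //; exact: bmf_B.
  apply: nrm_le_ip => //; first exact: ltW.
  move=> g bg.
  have -> : ip mu ((fun x => t^-1 * (Q t f x - f x)) \-
          (fun x => tau^-1 * (Q tau u x - u x))) g =
      t^-1 * (ip mu (Q t f) g - ip mu f g - t / tau * ip mu y g).
    have l1 : (fun x => Q t f x - f x) \in Lfun mu 2%:E by exact/L2_bmf/bmf_B.
    rewrite ipBl; [|exact: L2_Z|exact/L2_Z/L2_bmf|exact: L2_bmf].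
    have l2 : (fun x => Q tau u x - u x) \in Lfun mu 2%:E by exact: (L2_bmf mu by_).
    have -> : ip mu (fun x => t^-1 * (Q t f x - f x)) g =
        t^-1 * (ip mu (Q t f) g - ip mu f g).
      rewrite (ipZl _ l1 (L2_bmf mu bg)); congr (_ * _).
      by apply: ipBl; exact: L2_bmf.
    have -> : ip mu (fun x => tau^-1 * (Q tau u x - u x)) g = tau^-1 * ip mu y g.
      exact: (ipZl _ l2 (L2_bmf mu bg)).
    by field; rewrite !gt_eqF.
  rewrite mulrC ler_pdivrMr// -[leRHS]mulrA (mulrC (nrm mu g)) mulrA.
  apply/ler_addgt0Pr => eta eta0.
  have bQ'g : bounded_mfun (Q' t g) by apply: (bs_bmf' bs) => //; exact: ltW.
  (* the Riemann sum of the increments telescopes, up to the remainder of the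
     division of t by the mesh *)
  have L : ip mu (v k) (Q' t g) - ip mu (v k) g - t / tau * ip mu y g
      @[k --> \oo] --> ip mu (Q t f) g - ip mu f g - t / tau * ip mu y g.
    rewrite (bs_adj bs) ?(ltW t0)//.
    by apply: cvgB; [apply: cvgB; exact: ip_f|exact: cvg_cst].
  rewrite -(cvg_lim (@Rhausdorff R) L).
  apply: limr_le; first by apply/cvg_ex; eexists; exact: L.
  pose A := 1 + nrm mu g + `|ip mu y g| / tau.
  have A1 : 1 <= A.
    by rewrite /A -addrA lerDl addr_ge0 ?nrm_ge0// divr_ge0// ltW.
  have A0 : 0 < A by rewrite (lt_le_trans ltr01).
  have eA : 0 < eta / A by rewrite divr_gt0.
  have [r2 r20 Hr2] := bs_modulus bu eA.
  near=> k.
  have dk1 : del k <= r2.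
    near: k; have [N HN] : exists N, del N <= r2.
      exists (Num.trunc (tau / r2)).+1.
      rewrite /del ler_pdivrMr// mulrC -ler_pdivrMr//.
      rewrite (@le_trans _ _ (Num.trunc (tau / r2)).+1%:R)//.
        by rewrite ltW// truncnS_gt// divr_ge0// ltW.
      by rewrite ler_nat ltnW// ltn_expl.
    exists N => // k /= Nk; rewrite (le_trans _ HN)// /del.
    rewrite ler_pM2l// lef_pV2 ?posrE// ler_nat leq_exp2l//.
  have dk2 : del k <= eta / A.
    near: k; have [N HN] : exists N, del N <= eta / A.
      exists (Num.trunc (tau / (eta / A))).+1.
      rewrite /del ler_pdivrMr// mulrC -ler_pdivrMr//.
      rewrite (@le_trans _ _ (Num.trunc (tau / (eta / A))).+1%:R)//.
        by rewrite ltW// truncnS_gt// divr_ge0// ltW.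
      by rewrite ler_nat ltnW// ltn_expl.
    exists N => // k /= Nk; rewrite (le_trans _ HN)// /del.
    rewrite ler_pM2l// lef_pV2 ?posrE// ler_nat leq_exp2l//.
  have td0 : 0 <= t / del k by rewrite divr_ge0 ?ltW.
  pose i := Num.trunc (t / del k).
  have /andP[i1 i2] := trunc_itv td0; rewrite -/i in i1 i2.
  pose rho := t - i%:R * del k.
  have rho0 : 0 <= rho by rewrite subr_ge0 -ler_pdivlMr.
  have rhod : rho <= del k.
    rewrite lerBlDl -[X in _ + X]mul1r -mulrDl natr1 ltW//.
    by rewrite -ltr_pdivrMr.
  have tE : t = i%:R * del k + rho by rewrite /rho; ring.
  rewrite !ip_v// -mulrBr -sumrB.
  have N0 := pow0 k; set N := (2 ^ k)%N in N0 *.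
  have bE j : b (Q' t g) (j%:R * del k) = b g ((j + i)%:R * del k + rho).
    have h0 : 0 <= j%:R * del k by exact: jdel0.
    rewrite /b -(bs_adj bs) ?(ltW t0)// -(bs_D bs) ?(ltW t0)//.
    by congr (ip mu (Q _ u) g); rewrite tE natrD; ring.
  have tel : \sum_(0 <= j < N) (b g ((j + i)%:R * del k) - b g (j%:R * del k)) =
     \sum_(0 <= j < i) ip mu (Q (j%:R * del k) y) g.
    rewrite sumrB.
    have -> : \sum_(0 <= j < N) b g ((j + i)%:R * del k) =
       \sum_(i <= j < N + i) b g (j%:R * del k).
      by rewrite -{2}(add0n i) big_addn addnK.
    have h1 : \sum_(0 <= j < N + i) b g (j%:R * del k) =
        \sum_(0 <= j < i) b g (j%:R * del k) + \sum_(i <= j < N + i) b g (j%:R * del k).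
      by rewrite (@big_cat_nat _ _ _ i)//= leq_addl.
    have h2 : \sum_(0 <= j < N + i) b g (j%:R * del k) =
        \sum_(0 <= j < N) b g (j%:R * del k) + \sum_(0 <= j < i) b g (j%:R * del k + tau).
      rewrite (@big_cat_nat _ _ _ N)//= ?leq_addr//; congr (_ + _).
      rewrite -{1}(add0n N) big_addn addnC addnK; apply: eq_bigr => j _.
      by congr (b g _); rewrite natrD mulrDl delE.
    have -> : \sum_(i <= j < N + i) b g (j%:R * del k) =
       \sum_(0 <= j < N) b g (j%:R * del k) +
       (\sum_(0 <= j < i) b g (j%:R * del k + tau) -
       \sum_(0 <= j < i) b g (j%:R * del k)).
      by rewrite [RHS]addrA -h2 h1 addrAC subrr add0r.
    rewrite addrC addKr -sumrB; apply: eq_bigr => j _.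
    rewrite ip_Q_B//; last by apply: bmf_Q => //; exact: ltW.
    by rewrite /b (addrC (j%:R * del k)) (bs_D bs) ?(ltW tau0).
  have S1 : \sum_(0 <= j < N) (b (Q' t g) (j%:R * del k) - b g (j%:R * del k)) <=
      N%:R * (eta / A * nrm mu g) + \sum_(0 <= j < i) ip mu (Q (j%:R * del k) y) g.
    rewrite -tel -lerBlDr -sumrB.
    rewrite (@le_trans _ _ (\sum_(0 <= j < N) (eta / A * nrm mu g)))//; last first.
      by rewrite sumr_const_nat subn0 mulr_natl.
    apply: ler_sum => j _; rewrite bE opprB addrA subrK.
    by rewrite (le_trans (ler_norm _))// Hr2// rho0 (le_trans rhod).
  have S2 : \sum_(0 <= j < i) ip mu (Q (j%:R * del k) y) g <=
      i%:R * (e * tau * nrm mu g + ip mu y g).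
    rewrite (@le_trans _ _ (\sum_(0 <= j < i) (e * tau * nrm mu g + ip mu y g)))//; last first.
      by rewrite sumr_const_nat subn0 mulr_natl.
    rewrite big_nat [leRHS]big_nat; apply: ler_sum => j /andP[_ ji].
    rewrite -lerBlDr -(bs_0 bs by_ bg) (le_trans (ler_norm _))//.
    rewrite -{1}[j%:R * del k]add0r Hr// jdel0/= (le_trans _ tr)//.
    rewrite (@le_trans _ _ (i%:R * del k))//; last by rewrite -ler_pdivlMr.
    by rewrite ler_wpM2r ?(ltW (del0 k))// ler_nat ltnW.
  have iN : N%:R^-1 * i%:R = (t - rho) / tau.
    by rewrite /rho -(delE k) -/N; field; rewrite !gt_eqF.
  have N1 : 0 <= N%:R^-1 :> R by rewrite invr_ge0 ltW.
  apply: (le_trans (lerB (ler_wpM2l N1 (le_trans S1 (lerD (lexx _) S2))) (lexx _))).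
  have alg (n c p q : R) : n != 0 -> n^-1 * (n * p + c * q) = p + n^-1 * c * q.
    by move=> n0; field.
  rewrite alg ?gt_eqF// iN.
  have -> : eta / A * nrm mu g + (t - rho) / tau * (e * tau * nrm mu g + ip mu y g) -
     t / tau * ip mu y g = e * t * nrm mu g + (eta / A * nrm mu g -
       rho * e * nrm mu g - rho * (ip mu y g / tau)).
    by field; rewrite !gt_eqF.
  rewrite -mulrA (mulrC t) mulrA lerD2l.
  have h1 : - (rho * (ip mu y g / tau)) <= eta / A * (`|ip mu y g| / tau).
    rewrite (le_trans (ler_norm _))// normrN normrM (ger0_norm rho0).
    rewrite normrM (gtr0_norm (_ : 0 < tau^-1)) ?invr_gt0//.
    rewrite ler_wpM2r ?divr_ge0 ?(ltW tau0)//.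
    exact: le_trans rhod dk2.
  have h2 : 0 <= rho * e * nrm mu g by rewrite !mulr_ge0 ?nrm_ge0// ltW.
  have h3 : eta = eta / A * A by rewrite divfK// gt_eqF.
  have h4 : eta = eta / A + eta / A * nrm mu g + eta / A * (`|ip mu y g| / tau).
    by rewrite {1}h3 /A !mulrDr mulr1.
  by rewrite [leRHS]h4; have := ltW eA; lra.
Unshelve. all: by end_near. Qed.

End Average.

End Averages.

(** * The generator on the algebra *)

Lemma Lp_dist_eq_ae (d : measure_display) (T : measurableType d) (R : realType)
  (mu : probability T R) (f g h : T -> R) : measurable_fun setT f ->
  measurable_fun setT g -> measurable_fun setT h ->
  {ae mu, forall x, f x = g x} -> Lp_dist mu 2%:E f h = Lp_dist mu 2%:E g h.
Proof.
move=> mf mg mh fg; rewrite /Lp_dist unlock.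
apply: (congr1 (fun z => z `^ (2^-1))%E).
have mp (k : T -> R) : measurable_fun setT k -> measurable_fun setT
    (fun x => (`|(EFin \o (k \- h)%R) x| `^ 2)%E).
  move=> mk; apply/measurable_EFinP.
  apply: (measurableT_comp (measurable_powR _)) => //.
  by apply: measurableT_comp => //; exact: measurable_funB.
apply: ae_eq_integral => //; [exact: mp|exact: mp|].
by apply: filterS fg => x fgx _ /=; rewrite fgx.
Qed.

Lemma quad_rate_arith (R : realType) (i a j k : R) :
  i * (j - a) - 2 * (i * (k - a)) = i * (a - 2 * k + j).
Proof. by ring. Qed.

Lemma quad_joint_arith (R : realType) (a b c : R) :
  a + ((-2) * b + c) = a - 2 * b + c.
Proof. by ring. Qed.

Lemma quart_rate_arith (R : realType) (i m a b c e : R) :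
  (-4) * (i * (a - m)) + 6 * (i * (b - m)) + (-4) * (i * (c - m)) +
    i * (e - m) = i * (m - 4 * a + 6 * b - 4 * c + e).
Proof. by ring. Qed.

Section GeneratorLemmas.
Context (R : realType) (dO : measure_display) (Omega : measurableType dO).
Context (E : puniformType) (M : markov_process R Omega E).
Context (mu : probability (borel E) R) (A : set (E -> R)).
Context (setting : standing_assumptions M mu A).
Implicit Types (f g h u v : borel E -> R) (x : borel E) (t s : R).

Local Notation P := (semigroup M).
Local Notation Pdual := (dual_semigroup M mu).
Local Notation L := (Defs.generator mu P).
Local Notation Ld := (Defs.generator mu Pdual).
Local Notation Gamma := (carre_du_champ mu P).
Local Notation L1 f := (mu.-integrable setT (EFin \o f)).
Local Notation L2 f := (f \in Lfun mu 2%:E).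
Local Notation joint := (joint M mu).

Let inv : Defs.invariant M mu := mu_invariant setting.

Lemma is_generatorP f g : bounded_mfun f -> is_generator mu P f g <->
  L2 g /\ nrm mu ((fun x => t^-1 * (P t f x - f x)) \- g) @[t --> (0 : R)^'+] --> 0.
Proof.
move=> bf.
have bt t : L2 (fun x => t^-1 * (P t f x - f x)).
  by apply: L2_bmf; apply: bmf_Z; apply: bmf_B => //; exact: bmf_semigroup.
split=> [[_ lg /cvg_Lp_dist2 H]|[lg H]]; split=> //.
- by apply: H.
- exact: L2_bmf.
- by apply/cvg_Lp_dist2.
Qed.

Lemma generatorP f : in_domain mu P f -> is_generator mu P f (L f).
Proof. by move=> df; apply: getPex. Qed.

Lemma generator_unique f g : bounded_mfun f -> is_generator mu P f g ->
  {ae mu, forall x, L f x = g x}.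
Proof.
move=> bf Hg; have /(is_generatorP _ bf)[lg cg] := Hg.
have /generatorP/(is_generatorP _ bf)[lL cL] : in_domain mu P f by exists g.
apply: (nrm_cvg_unique _ lL lg cL cg) => t.
by apply: L2_bmf; apply: bmf_Z; apply: bmf_B => //; exact: bmf_semigroup.
Qed.

(** Since [joint t f g] is both [<f, P_t g>] and [<P_t^* f, g>], this difference
    quotient serves for the generator and for its dual. *)
Definition rate t f g := t^-1 * (joint t f g - ip mu f g).

Lemma rateE t f g : rate t f g = t^-1 * (joint t f g - ip mu f g).
Proof. by []. Qed.

Lemma rate_cvg f g k : bounded_mfun f -> bounded_mfun g ->
  is_generator mu P g k -> rate t f g @[t --> (0 : R)^'+] --> ip mu f k.
Proof.
move=> bf bg /(is_generatorP _ bg)[lk ck].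
have bt t : L2 (fun x => t^-1 * (P t g x - g x)).
  by apply: L2_bmf; apply: bmf_Z; apply: bmf_B => //; exact: bmf_semigroup.
have H : ip mu f (fun x => t^-1 * (P t g x - g x)) @[t --> (0 : R)^'+] --> ip mu f k.
  by apply: (cvg_ipr bt lk (L2_bmf mu bf) ck).
apply: cvg_trans H; apply: near_eq_cvg; near=> t.
have bPt := bmf_semigroup M t bg.
rewrite /rate ipZr; [|exact/L2_bmf/bmf_B|exact: L2_bmf].
by congr (_ * _); apply: ipBr; exact: L2_bmf.
Unshelve. all: by end_near. Qed.

Lemma algebra_bmf f : A f -> bounded_mfun f.
Proof.
move=> Af; have [/(_ f Af)[g [lf _ _]] _] := core_generator setting.
have [K fK] := core_bounded setting Af.
by split; [exact: L2_meas lf|exists K].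
Qed.

Lemma algebra_gen f : A f -> is_generator mu P f (L f).
Proof.
by move=> Af; apply: generatorP; have [/(_ f Af)] := core_generator setting.
Qed.

Lemma algebra_genL2 f : A f -> L2 (L f).
Proof. by move=> /algebra_gen[]. Qed.

Lemma algebra_rate f v : bounded_mfun f -> A v ->
  rate t f v @[t --> (0 : R)^'+] --> ip mu f (L v).
Proof.
move=> bf Av; apply: rate_cvg => //; [exact: algebra_bmf|exact: algebra_gen].
Qed.

Lemma algebra_dualL2 f : A f -> L2 (Ld f).
Proof.
by move=> /(dual_domain setting) df; have [] : is_generator mu Pdual f (Ld f)
  by apply: getPex.
Qed.

Lemma algebra_dual_rate v g : A v -> bounded_mfun g ->
  rate t v g @[t --> (0 : R)^'+] --> ip mu (Ld v) g.
Proof.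
move=> Av bg; have bv := algebra_bmf Av.
have [lv lL] : is_generator mu Pdual v (Ld v).
  by apply: getPex; exact: (dual_domain setting).
(* the difference quotients are replaced by 0 for t < 0, where the dual
   semigroup means nothing *)
pose q t : borel E -> R := if 0 <= t then
  fun x => t^-1 * (bdual M mu t v x - v x) else cst 0.
have bq t : bounded_mfun (q t).
  rewrite /q; case: ifP => t0; last exact: bmf_cst.
  by apply: bmf_Z; apply: bmf_B => //; exact: bmf_bdual.
have lq t : L2 (q t) by exact: L2_bmf.
move=> H.
have cq : nrm mu (q t \- Ld v) @[t --> (0 : R)^'+] --> 0.
  apply/(cvg_Lp_dist2 lq lL); apply: cvg_trans H.
  apply: near_eq_cvg; near=> t.
  have t0 : 0 < t by near: t; exact: nbhs_right_gt.
  have lP := dual_L1 inv (ltW t0) (bmf_L1 mu bv).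
  apply: Lp_dist_eq_ae; [|by case: (bq t)|exact: (L2_meas lL)|].
    apply: measurable_funM => //; apply: measurable_funB; first exact: (L1_meas lP).
    by case: bv.
  have := bdual_ae inv (ltW t0) bv; apply: filterS => x Hx /=.
  by rewrite /q (ltW t0) Hx.
have H' : ip mu (q t) g @[t --> (0 : R)^'+] --> ip mu (Ld v) g.
  by apply: (cvg_ipl lq lL (L2_bmf mu bg) cq).
apply: cvg_trans H'; apply: near_eq_cvg; near=> t.
have t0 : 0 < t by near: t; exact: nbhs_right_gt.
rewrite /rate /q (ltW t0) -(bdual_ip inv (ltW t0) bv bg).
have bb := bmf_bdual inv (ltW t0) bv.
rewrite ipZl; [|exact/L2_bmf/bmf_B|exact: L2_bmf].
by congr (_ * _); apply: ipBl; exact: L2_bmf.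
Unshelve. all: by end_near. Qed.

Lemma algebra_cst c : A (cst c).
Proof. by have [] := core_algebra setting. Qed.

Lemma algebra_D f g : A f -> A g -> A (f \+ g).
Proof. by have [_ H _] := core_algebra setting => Af Ag; exact: H. Qed.

Lemma algebra_M f g : A f -> A g -> A (f \* g).
Proof. by have [_ _ H] := core_algebra setting => Af Ag; exact: H. Qed.

Lemma algebra_Z c f : A f -> A (fun x => c * f x).
Proof. by move=> Af; apply: (algebra_M (algebra_cst c) Af). Qed.

Lemma algebra_B f g : A f -> A g -> A (f \- g).
Proof.
move=> Af Ag; have := algebra_D Af (algebra_Z (-1) Ag).
by congr (A _); apply/funext => x /=; rewrite mulN1r.
Qed.

Lemma generator_D f g : A f -> A g ->
  {ae mu, forall x, L (f \+ g) x = L f x + L g x}.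
Proof.
move=> Af Ag; have bf := algebra_bmf Af; have bg := algebra_bmf Ag.
apply: generator_unique; first exact: bmf_D.
apply/is_generatorP; first exact: bmf_D.
have /(is_generatorP _ bf)[lf cf] := algebra_gen Af.
have /(is_generatorP _ bg)[lg cg] := algebra_gen Ag.
split; first exact: L2_D.
have b1 t u : bounded_mfun u -> L2 (fun x => t^-1 * (P t u x - u x)).
  by move=> bu; apply: L2_bmf; apply: bmf_Z; apply: bmf_B => //; exact: bmf_semigroup.
have c0 : nrm mu ((fun x => t^-1 * (P t f x - f x)) \- L f) +
   nrm mu ((fun x => t^-1 * (P t g x - g x)) \- L g) @[t --> (0 : R)^'+] --> (0 : R) + 0.
  exact: (cvgD cf cg).
rewrite addr0 in c0.
apply: (@squeeze_cvgr _ _ _ _ (cst 0)) c0; last exact: cvg_cst.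
apply: nearW => t; rewrite nrm_ge0/=.
rewrite (le_trans _ (nrmD _ _)) ?L2_B//; [|exact: b1|exact: b1].
rewrite le_eqVlt; apply/orP; left; apply/eqP; congr nrm.
by apply/funext => x /=; rewrite semigroup_D//=; ring.
Qed.

Lemma generator_Z c f : A f ->
  {ae mu, forall x, L (fun x => c * f x) x = c * L f x}.
Proof.
move=> Af; have bf := algebra_bmf Af.
apply: generator_unique; first exact: bmf_Z.
apply/is_generatorP; first exact: bmf_Z.
have /(is_generatorP _ bf)[lf cf] := algebra_gen Af.
split; first exact: L2_Z.
have b1 t : L2 (fun x => t^-1 * (P t f x - f x)).
  by apply: L2_bmf; apply: bmf_Z; apply: bmf_B => //; exact: bmf_semigroup.
have c0 : `|c| * nrm mu ((fun x => t^-1 * (P t f x - f x)) \- L f)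
    @[t --> (0 : R)^'+] --> 0.
  by rewrite -[X in _ --> X](mulr0 `|c|); exact: cvgMr.
apply: cvg_trans c0; apply: near_eq_cvg; apply: nearW => t.
rewrite -nrmZ ?L2_B//; congr nrm.
by apply/funext => x /=; rewrite semigroup_Z//=; ring.
Qed.

Lemma generator_mean f : A f -> mean mu (L f) = 0.
Proof.
move=> Af; have bf := algebra_bmf Af.
have := algebra_rate (@bmf_cst _ (borel E) R 1) Af.
rewrite ipC ip_mul1 => H.
apply: (@cvg_unique _ (@Rhausdorff R) _ _ _ _ H).
apply: (@cvg_trans _ (cst 0 @ (0 : R)^'+)); last exact: cvg_cst.
apply: near_eq_cvg; near=> t; have t0 : 0 < t by near: t; exact: nbhs_right_gt.
by rewrite /rate (joint_1l inv (ltW t0) bf) ipC ip_mul1 subrr mulr0.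
Unshelve. all: by end_near. Qed.

(** Both sides are the derivative of [<f, P_t g>] at time 0. *)
Lemma generator_adj f g : A f -> A g -> ip mu f (L g) = ip mu (Ld f) g.
Proof.
move=> Af Ag.
apply: (@cvg_unique _ (@Rhausdorff R) _ _ _ _
  (algebra_rate (algebra_bmf Af) Ag)).
by apply: algebra_dual_rate => //; exact: algebra_bmf.
Qed.

(** * The carré du champ on the algebra *)

Lemma carreE f g x : Gamma f g x = L (f \* g) x - f x * L g x - g x * L f x.
Proof. by []. Qed.

Lemma carre_L2 f g : A f -> A g -> L2 (Gamma f g).
Proof.
move=> Af Ag; apply: L2_B; first apply: L2_B.
- by apply: algebra_genL2; exact: algebra_M.
- by apply: L2_M; [exact: algebra_bmf|exact: algebra_genL2].
- by apply: L2_M; [exact: algebra_bmf|exact: algebra_genL2].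
Qed.

Lemma carreC f g x : Gamma f g x = Gamma g f x.
Proof.
rewrite !carreE (_ : f \* g = g \* f); first by ring.
by apply/funext => y; rewrite /= mulrC.
Qed.

Lemma carre_Dl f g h : A f -> A g -> A h ->
  {ae mu, forall x, Gamma (f \+ g) h x = Gamma f h x + Gamma g h x}.
Proof.
move=> Af Ag Ah.
have e1 := generator_D Af Ag.
have e2 := generator_D (algebra_M Af Ah) (algebra_M Ag Ah).
move: e1 e2; apply: filterS2 => x e1 e2; rewrite !carreE e1.
rewrite (_ : (f \+ g) \* h = (f \* h) \+ (g \* h)) ?e2.
  by rewrite /=; ring.
by apply/funext => y /=; rewrite mulrDl.
Qed.

Lemma carre_Zl c f h : A f -> A h ->
  {ae mu, forall x, Gamma (fun x => c * f x) h x = c * Gamma f h x}.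
Proof.
move=> Af Ah.
have e1 := generator_Z c Af; have e2 := generator_Z c (algebra_M Af Ah).
move: e1 e2; apply: filterS2 => x e1 e2; rewrite !carreE e1.
rewrite (_ : (fun x => c * f x) \* h = (fun x => c * (f \* h) x)) ?e2.
  by rewrite /=; ring.
by apply/funext => y /=; rewrite mulrA.
Qed.

Lemma carre_Bl f g h : A f -> A g -> A h ->
  {ae mu, forall x, Gamma (f \- g) h x = Gamma f h x - Gamma g h x}.
Proof.
move=> Af Ag Ah.
have e1 := carre_Dl Af (algebra_Z (-1) Ag) Ah.
have e2 := carre_Zl (-1) Ag Ah.
move: e1 e2; apply: filterS2 => x e1 e2.
rewrite (_ : f \- g = f \+ (fun x => -1 * g x)) ?e1 ?e2; first by ring.
by apply/funext => y /=; rewrite mulN1r.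
Qed.

Lemma carre_B2 f g : A f -> A g -> {ae mu, forall x,
  Gamma (f \- g) (f \- g) x = Gamma f f x - 2 * Gamma f g x + Gamma g g x}.
Proof.
move=> Af Ag; have Afg := algebra_B Af Ag.
have e1 := carre_Bl Af Ag Afg; have e2 := carre_Bl Af Ag Af.
have e3 := carre_Bl Af Ag Ag.
move: e1 e2 e3; apply: filterS3 => x -> e2 e3.
by rewrite (carreC f) (carreC g) e2 e3 (carreC g f); ring.
Qed.

Lemma carre_D2 f g : A f -> A g -> {ae mu, forall x,
  Gamma (f \+ g) (f \+ g) x = Gamma f f x + 2 * Gamma f g x + Gamma g g x}.
Proof.
move=> Af Ag; have Afg := algebra_D Af Ag.
have e1 := carre_Dl Af Ag Afg; have e2 := carre_Dl Af Ag Af.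
have e3 := carre_Dl Af Ag Ag.
move: e1 e2 e3; apply: filterS3 => x -> e2 e3.
by rewrite (carreC f) (carreC g) e2 e3 (carreC g f); ring.
Qed.

Lemma carre_Ml f g h : A f -> A g -> A h -> {ae mu, forall x,
  Gamma (f \* g) h x = f x * Gamma g h x + g x * Gamma f h x}.
Proof. exact: (carre_derivation setting). Qed.

Lemma carre_cst c h : A h -> {ae mu, forall x, Gamma (cst c) h x = 0}.
Proof.
move=> Ah; have A1 := algebra_cst 1.
have e1 := carre_Ml A1 A1 Ah; have e2 := carre_Zl c A1 Ah.
move: e1 e2; apply: filterS2 => x.
rewrite (_ : cst 1 \* cst 1 = cst 1); last by apply/funext => y /=; rewrite mulr1.
rewrite (_ : (fun x => c * cst 1 x) = cst c); last first.
  by apply/funext => y /=; rewrite mulr1.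
rewrite /= !mul1r => e1 ->.
have -> : Gamma (cst 1) h x = 0 by lra.
by rewrite mulr0.
Qed.

Lemma algebra_poly (p : {poly R}) v : A v -> A (fun x => p.[v x]).
Proof.
move=> Av; elim/poly_ind: p => [|p c IH].
  by have := algebra_cst 0; congr (A _); apply/funext => x /=; rewrite horner0.
have := algebra_D (algebra_M IH Av) (algebra_cst c).
by congr (A _); apply/funext => x /=; rewrite hornerMXaddC.
Qed.

Lemma carre_poly (p : {poly R}) v h : A v -> A h -> {ae mu, forall x,
  Gamma (fun x => p.[v x]) h x = p^`().[v x] * Gamma v h x}.
Proof.
move=> Av Ah; elim/poly_ind: p => [|p c IH].
  have := carre_cst 0 Ah; apply: filterS => x.
  rewrite (_ : (fun x => (0 : {poly R}).[v x]) = cst 0); last first.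
    by apply/funext => y; rewrite horner0.
  by move=> ->; rewrite linear0 horner0 mul0r.
have Ap := algebra_poly p Av.
have e1 := carre_Dl (algebra_M Ap Av) (algebra_cst c) Ah.
have e2 := carre_Ml Ap Av Ah; have e3 := carre_cst c Ah.
have : {ae mu, forall x, Gamma ((fun x => p.[v x]) \* v) h x + Gamma (cst c) h x =
   (p^`() * 'X + p).[v x] * Gamma v h x}.
  move: e2 e3 IH; apply: filterS3 => x -> -> ->.
  by rewrite hornerD hornerMX; ring.
move: e1; apply: filterS2 => x e1.
rewrite (_ : (fun x => (p * 'X + c%:P).[v x]) =
  ((fun x => p.[v x]) \* v) \+ cst c); last first.
  by apply/funext => y /=; rewrite hornerMXaddC.
rewrite e1 => ->; congr (_ * _); congr (_.[_]).
by rewrite derivD derivM derivX derivC mulr1 addr0.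
Qed.

Lemma carre_poly2 (p q : {poly R}) v w : A v -> A w -> {ae mu, forall x,
  Gamma (fun x => p.[v x]) (fun x => q.[w x]) x =
  p^`().[v x] * q^`().[w x] * Gamma v w x}.
Proof.
move=> Av Aw; have Aq := algebra_poly q Aw.
have e1 := carre_poly p Av Aq; have e2 := carre_poly q Aw Av.
move: e1 e2; apply: filterS2 => x -> e2.
by rewrite (carreC v) e2 (carreC w); ring.
Qed.

(** * Small time increments along the process *)

(** The expectation of [g (X_0) * (v (X_0) - v (X_t)) ^+ 2]. *)
Definition quad t g v := joint t (g \* (v \* v)) (cst 1) -
  2 * joint t (g \* v) v + joint t g (v \* v).

Lemma quad_cvg g v : bounded_mfun g -> A v ->
  t^-1 * quad t g v @[t --> (0 : R)^'+] --> ip mu g (Gamma v v).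
Proof.
move=> bg Av; have bv := algebra_bmf Av.
have lg := L2_bmf mu bg; have lv := L2_bmf mu bv.
have Avv := algebra_M Av Av.
have lLv := algebra_genL2 Av; have lLvv := algebra_genL2 Avv.
have H : rate t g (v \* v) - 2 * rate t (g \* v) v @[t --> (0 : R)^'+] -->
    ip mu g (L (v \* v)) - 2 * ip mu (g \* v) (L v).
  apply: cvgB; first exact: algebra_rate.
  by apply: cvgMr; apply: algebra_rate => //; exact: bmf_M.
have -> : ip mu g (Gamma v v) = ip mu g (L (v \* v)) - 2 * ip mu (g \* v) (L v).
  have lvL : L2 (v \* L v) by exact: L2_M.
  rewrite /carre_du_champ ipBr//; last exact: L2_B.
  rewrite ipBr// (_ : ip mu g (v \* L v) = ip mu (g \* v) (L v)).
    by move: (ip _ _ _) (ip _ _ _) => a b; clear; ring.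
  by congr mean; apply/funext => x /=; ring.
apply: cvg_trans H; apply: near_eq_cvg; apply: nearW => t.
rewrite /quad /rate joint_1r.
rewrite (_ : mean mu (g \* (v \* v)) = ip mu (g \* v) v); last first.
  by congr mean; apply/funext => x /=; ring.
rewrite (_ : ip mu g (v \* v) = ip mu (g \* v) v); last first.
  by congr mean; apply/funext => x /=; ring.
exact: quad_rate_arith.
Qed.

Lemma quad_ge0 t g v : bounded_mfun g -> bounded_mfun v ->
  (forall x, 0 <= g x) -> 0 <= quad t g v.
Proof.
move=> bg bv g0; have b1 := @bmf_cst _ (borel E) R 1.
have bvv := bmf_M bv bv; have bgv := bmf_M bg bv.
have := @joint_sum_ge0 _ _ _ _ M mu t [:: (g \* (v \* v), cst 1);
  (fun x => -2 * (g \* v) x, v); (g, v \* v)].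
rewrite !big_cons big_nil /= addr0 jointZl// => H.
rewrite /quad (le_trans (H _ _))//.
- by split=> //; [exact: bmf_M|split=> //; exact: bmf_Z].
- move=> x y; rewrite !big_cons big_nil/= addr0.
  rewrite (_ : _ + _ = g x * (v x - v y) ^+ 2); last by ring.
  by rewrite mulr_ge0// sqr_ge0.
- by rewrite le_eqVlt; apply/orP; left; apply/eqP; exact: quad_joint_arith.
Qed.

(** [Gamma v v] is a limit of second moments of increments, which are tested on
    the set where it would be negative. *)
Lemma carre_ge0 v : A v -> {ae mu, forall x, 0 <= Gamma v v x}.
Proof.
move=> Av; have bv := algebra_bmf Av; set G := Gamma v v.
have lG : L2 G by exact: carre_L2.
have mB : measurable (G @^-1` [set y | y < 0]).
  rewrite -[X in measurable X]setTI; apply: (L2_meas lG) => //.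
  rewrite (_ : [set y | _] = `]-oo, 0[%classic)//.
pose B := \1_(G @^-1` [set y | y < 0]) : borel E -> R.
have bB : bounded_mfun B by exact: bmf_indic.
have B0 x : 0 <= B x by rewrite /B indicE.
have ge0 : 0 <= ip mu B G.
  have c := quad_cvg bB Av.
  rewrite -(cvg_lim (@Rhausdorff R) c).
  apply: limr_ge; first by apply/cvg_ex; eexists; exact: c.
  near=> t; have t0 : 0 < t by near: t; exact: nbhs_right_gt.
  by rewrite mulr_ge0 ?invr_ge0 ?(ltW t0)// quad_ge0.
have BG0 x : (B \* G) x <= 0.
  rewrite /= /B indicE; case: (boolP (x \in _)) => [xB|_]; last by rewrite mul0r.
  by rewrite mul1r; move: xB; rewrite inE /= => /ltW.
have lBG : L1 (B \* G) by apply: L1_M => //; exact: L2_L1.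
have eq0 : mean mu (fun x => `|(B \* G) x|) = 0.
  apply/eqP; rewrite eq_le mean_ge0 ?andbT//.
  rewrite (_ : (fun x => _) = (fun x => - (B \* G) x)); last first.
    by apply/funext => x; rewrite ler0_norm.
  by rewrite mean_N// oppr_le0.
have := mean_norm0_ae lBG eq0; apply: filterS => x H.
rewrite leNgt; apply/negP => Gx; move: H.
by rewrite /= /B indicE mem_set// mul1r => H; rewrite H ltxx in Gx.
Unshelve. all: by end_near. Qed.

(** The expectation of [(v (X_0) - v (X_t)) ^+ 4]. *)
Definition quart t v :=
  joint t (v \* v \* v \* v) (cst 1) - 4 * joint t (v \* v \* v) v +
  6 * joint t (v \* v) (v \* v) - 4 * joint t v (v \* v \* v) +
  joint t (cst 1) (v \* v \* v \* v).

(** This is how the derivation property expresses that the process is a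
    diffusion. It computes [L] on the powers of [v] from [L v] and [L (v ^+ 2)], and
    the terms of the limit cancel. *)
Lemma quart_cvg v : A v -> t^-1 * quart t v @[t --> (0 : R)^'+] --> 0.
Proof.
move=> Av; have bv := algebra_bmf Av.
have A2 := algebra_M Av Av; have A3 := algebra_M A2 Av.
have A4 := algebra_M A3 Av.
have b1 := @bmf_cst _ (borel E) R 1.
have b2 := algebra_bmf A2; have b3 := algebra_bmf A3; have b4 := algebra_bmf A4.
have H : (-4) * rate t (v \* v \* v) v + 6 * rate t (v \* v) (v \* v) +
   (-4) * rate t v (v \* v \* v) + rate t (cst 1) (v \* v \* v \* v)
   @[t --> (0 : R)^'+] -->
   (-4) * ip mu (v \* v \* v) (L v) + 6 * ip mu (v \* v) (L (v \* v)) +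
   (-4) * ip mu v (L (v \* v \* v)) + ip mu (cst 1) (L (v \* v \* v \* v)).
  apply: cvgD; last exact: algebra_rate.
  apply: cvgD; last by apply: cvgMr; exact: algebra_rate.
  by apply: cvgD; apply: cvgMr; exact: algebra_rate.
have ip0 : (-4) * ip mu (v \* v \* v) (L v) + 6 * ip mu (v \* v) (L (v \* v)) +
   (-4) * ip mu v (L (v \* v \* v)) + ip mu (cst 1) (L (v \* v \* v \* v)) = 0.
  have l1 : L1 (v \* v \* v \* L v) by apply: L2_L1; apply: L2_M => //; exact: algebra_genL2.
  have l2 : L1 (v \* v \* L (v \* v)) by apply: L2_L1; apply: L2_M => //; exact: algebra_genL2.
  have l3 : L1 (v \* L (v \* v \* v)) by apply: L2_L1; apply: L2_M => //; exact: algebra_genL2.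
  have l4 : L1 (cst 1 \* L (v \* v \* v \* v)).
    by apply: L2_L1; apply: L2_M => //; exact: algebra_genL2.
  rewrite /ip -(mean_Z (-4) l1) -(mean_Z 6 l2) -(mean_Z (-4) l3).
  have z1 := L1_Z (-4) l1; have z2 := L1_Z 6 l2; have z3 := L1_Z (-4) l3.
  rewrite -mean_D// -mean_D//; last exact: L1_D.
  rewrite -mean_D//; last by apply: L1_D => //; exact: L1_D.
  rewrite -[RHS](mean_cst mu 0); apply: mean_ae => //.
    by apply: (@L1_meas _ _ _ mu); apply: L1_D => //; apply: L1_D => //; exact: L1_D.
  have e1 := carre_Ml Av Av Av; have e2 := carre_Ml A2 Av Av.
  move: e1 e2; apply: filterS2 => x.
  rewrite !carreE /= => e1 e2.
  have E3 : L (v \* v \* v) x = 3 * v x * L (v \* v) x - 3 * (v x * v x) * L v x.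
    by lra.
  have E4 : L (v \* v \* v \* v) x = 6 * (v x * v x) * L (v \* v) x -
     8 * (v x * v x * v x) * L v x.
    rewrite E3 in e2; lra.
  by rewrite E3 E4; ring.
rewrite ip0 in H; apply: cvg_trans H; apply: near_eq_cvg; near=> t.
have t0 : 0 < t by near: t; exact: nbhs_right_gt.
rewrite /quart /rate joint_1r (joint_1l inv (ltW t0) b4).
rewrite (ipC _ (cst 1)) ip_mul1.
rewrite (_ : ip mu (v \* v \* v) v = mean mu (v \* v \* v \* v))//.
rewrite (_ : ip mu (v \* v) (v \* v) = mean mu (v \* v \* v \* v)); last first.
  by congr mean; apply/funext => x /=; ring.
rewrite (_ : ip mu v (v \* v \* v) = mean mu (v \* v \* v \* v)); last first.
  by congr mean; apply/funext => x /=; ring.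
exact: quart_rate_arith.
Unshelve. all: by end_near. Qed.

End GeneratorLemmas.

(** * The Dirichlet form and its domain *)

(** Translates the Cauchy condition of [is_carre_limit], an extended real limit
    along pairs of indices. *)
Lemma double_cvg0 (R : realType) (F : nat -> nat -> R) :
  (forall e, 0 < e -> exists N, forall n k, (N <= n)%N -> (N <= k)%N ->
     `|F n k| <= e) <->
  ((F mn.1 mn.2)%:E @[mn --> (\oo, \oo)] --> 0%E).
Proof.
split=> [H|].
- apply/fine_cvgP; split; first exact: nearW.
  apply/cvgr0Pnorm_le => e e0; have [N HN] := H _ e0.
  exists ([set n | (N <= n)%N], [set n | (N <= n)%N]).
    by split; exists N.
  by move=> [n k] [/= n1 k1]; exact: HN.
- move=> /fine_cvgP[_ /cvgr0Pnorm_le H] e /H[[P Q] [[N1 _ HN1] [N2 _ HN2]] PQ].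
  exists (maxn N1 N2) => n k; rewrite !geq_max => /andP[n1 _] /andP[_ k2].
  by apply: (PQ (n, k)); split; [exact: HN1|exact: HN2].
Qed.

Lemma dist_arith (R : realType) (a b j c : R) :
  b <= a -> a - j <= c -> b - j - (j - a) <= 2 * c.
Proof. lra. Qed.

Lemma young_arith (R : realType) (th a b c : R) : 0 < th ->
  0 <= a + 2 * (th * b) + th ^+ 2 * c -> 0 <= a - 2 * (th * b) + th ^+ 2 * c ->
  `|b| <= 1 / 2 * (th^-1 * a + th * c).
Proof.
move=> th0 x1 x2; rewrite -(ler_pM2l th0) mulrCA mulrDr (mulrA th th^-1).
rewrite divff ?gt_eqF// mul1r (mulrA th th) -expr2.
rewrite -[X in X * `|b|](gtr0_norm th0) -normrM ler_norml.
by apply/andP; split; lra.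
Qed.

Lemma half_sum_le (R : realType) (a b e : R) :
  a <= e -> b <= e -> 1 / 2 * a + 1 / 2 * b <= e.
Proof. lra. Qed.

Lemma four_sum_le (R : realType) (a b C : R) :
  a <= C -> b <= C -> 2 * a + 2 * b <= 4 * C.
Proof. lra. Qed.

Lemma cauchy_bound_arith (R : realType) (p q r s : R) : 0 <= p ->
  p + q = 2 * r + 2 * s -> r <= 1 -> q <= 2 + 2 * s.
Proof. lra. Qed.

Lemma minimizing_arith (R : realType) (p q a b m e : R) :
  p + q = 2 * a + 2 * b -> m - e / 8 <= (1 / 2) ^+ 2 * q ->
  a <= m + e / 8 -> b <= m + e / 8 -> p <= e.
Proof. rewrite expr2; lra. Qed.

Lemma dist_arith2 (R : realType) (a b j : R) :
  b <= a -> b - j - (j - a) <= 2 * (a - j).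
Proof. lra. Qed.

Lemma average_arith (R : realType) (a b cT : R) :
  2 * b <= cT -> a <= cT -> a + b <= 3 / 2 * cT.
Proof. lra. Qed.

Lemma average_arith2 (R : realType) (a b : R) : a <= 3 / 2 * b -> 2 * a <= 3 * b.
Proof. lra. Qed.

Lemma two_dist_arith (R : realType) (a b : R) :
  `|a - b| <= 1 / 2 -> -2 * b <= -2 * a + 1.
Proof. rewrite ler_norml => /andP[]; lra. Qed.

Section DirichletDomain.
Context (R : realType) (dO : measure_display) (Omega : measurableType dO).
Context (E : puniformType) (M : markov_process R Omega E).
Context (mu : probability (borel E) R) (A : set (E -> R)).
Context (setting : standing_assumptions M mu A).
Implicit Types (f g h u v : borel E -> R) (x : borel E) (t s : R).

Local Notation P := (semigroup M).
Local Notation Pd := (bdual M mu).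
Local Notation L := (Defs.generator mu P).
Local Notation Gamma := (carre_du_champ mu P).
Local Notation L1 f := (mu.-integrable setT (EFin \o f)).
Local Notation L2 f := (f \in Lfun mu 2%:E).
Local Notation joint := (joint M mu).

Let inv : Defs.invariant M mu := mu_invariant setting.

Lemma semigroup_0 f : bounded_mfun f -> P 0 f = f.
Proof.
move=> bf; apply/funext => x; apply/eqP; rewrite -subr_eq0; apply/eqP.
apply: (@bounded_functional_ext _ _ R (fun f => P 0 f x - f x) 2) => //.
- by move=> g h bg bh; rewrite semigroup_D//=; ring.
- by move=> c g bg; rewrite semigroup_Z//=; ring.
- move=> g K bg gK; rewrite (le_trans (ler_normB _ _))// mulr_natl mulr2n.
  by rewrite lerD// semigroup_norm.
- move=> B mB; apply/eqP; rewrite subr_eq0; apply/eqP; apply: EFin_inj.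
  by rewrite semigroup_indic// /transition path_start// diracE indicE.
Qed.

Lemma semigroup_itv s f K : 0 <= s -> bounded_mfun f ->
  (forall x, 0 <= f x <= K) -> forall x, 0 <= P s f x <= K.
Proof.
move=> s0 bf fK x; rewrite semigroup_ge0 /=; last by move=> y; case/andP: (fK y).
rewrite (le_trans (ler_norm _))// semigroup_norm// => y.
by have /andP[h1 h2] := fK y; rewrite ger0_norm.
Qed.

Lemma semigroup_cvg f : bounded_mfun f ->
  nrm mu (P t f \- f) @[t --> (0 : R)^'+] --> 0.
Proof.
move=> bf; have lf := L2_bmf mu bf.
have lP t : L2 (P t f) by apply: L2_bmf; exact: bmf_semigroup.
apply/(cvg_Lp_dist2 lP lf); exact: (semigroup_continuous setting).
Qed.

(** The square of the norm of [P_t^* f - f] is at most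
    [2 * (<f, f> - <f, P_t f>)]. *)
Lemma bdual_cvg f : bounded_mfun f ->
  nrm mu (Pd t f \- f) @[t --> (0 : R)^'+] --> 0.
Proof.
move=> bf; have lf := L2_bmf mu bf; have cf := semigroup_cvg bf.
have : Num.sqrt (2 * (nrm mu f * nrm mu (P t f \- f))) @[t --> (0 : R)^'+] --> 0.
  rewrite -[X in _ --> X]sqrtr0; apply: continuous_cvg; first exact: sqrt_continuous.
  rewrite -[X in _ --> X](mulr0 2); apply: cvgMr.
  by rewrite -[X in _ --> X](mulr0 (nrm mu f)); exact: cvgMr.
apply: (@squeeze_cvgr _ _ _ _ (cst 0)); last exact: cvg_cst.
near=> t; have t0 : 0 <= t by apply: ltW; near: t; exact: nbhs_right_gt.
have bPd := bmf_bdual inv t0 bf; have bP := bmf_semigroup M t bf.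
have lPd := L2_bmf mu bPd; have lP := L2_bmf mu bP.
rewrite nrm_ge0 /= -(ler_sqr (nrm_ge0 _ _)) ?nnegrE ?sqrtr_ge0//.
rewrite nrm_sqr sqr_sqrtr ?mulr_ge0 ?nrm_ge0//.
rewrite ipBl ?ipBr ?L2_B// (ipC mu f (Pd t f)) (bdual_ip inv t0 bf bf).
have h1 : ip mu (Pd t f) (Pd t f) <= ip mu f f.
  by rewrite -!nrm_sqr ler_sqr ?nnegrE ?nrm_ge0// bdual_contraction.
have h2 : ip mu f f - joint t f f <= nrm mu f * nrm mu (P t f \- f).
  rewrite -[leLHS]opprB -ipBr//; apply: le_trans (ip_le_nrm lf _); last exact: L2_B.
  by rewrite -normrN ler_norm.
exact: dist_arith h1 h2.
Unshelve. all: by end_near. Qed.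

Lemma semigroup_bounded : bounded_semigroup mu P Pd.
Proof.
split.
- by move=> s f _; exact: bmf_semigroup.
- by move=> s f s0; exact: bmf_bdual.
- by move=> s f K; exact: semigroup_itv.
- by move=> s f g s0 bf bg; rewrite (ipC mu f) bdual_ip// ipC.
- by move=> s f s0 bf; exact: bdual_contraction.
- by move=> f g bf _; rewrite semigroup_0.
- by move=> s t f g s0 t0 bf bg; rewrite addrC semigroupDt.
- exact: semigroup_cvg.
Qed.

Lemma bdual_bounded : bounded_semigroup mu Pd P.
Proof.
split.
- by move=> s f s0; exact: bmf_bdual.
- by move=> s f _; exact: bmf_semigroup.
- by move=> s f K; exact: bdual_itv.
- by move=> s f g s0 bf bg; rewrite bdual_ip.
- by move=> s f s0 bf; exact: semigroup_contraction.
- by move=> f g bf bg; rewrite bdual_ip// jointE semigroup_0.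
- by move=> s t f g s0 t0 bf bg; exact: bdualDt.
- exact: bdual_cvg.
Qed.

(** * The energy of the functions of the algebra *)

Definition energy f : R := mean mu (Gamma f f).

Lemma energy_mean f : energy f = mean mu (Gamma f f).
Proof. by []. Qed.

Lemma carre_L1 f g : A f -> A g -> L1 (Gamma f g).
Proof. by move=> Af Ag; apply: L2_L1; exact: (carre_L2 setting). Qed.

Lemma energy_ge0 f : A f -> 0 <= energy f.
Proof.
move=> Af; apply: mean_ge0_ae; last exact: (carre_ge0 setting).
exact: L1_meas (carre_L1 Af Af).
Qed.

Lemma energyE f : A f -> energy f = -2 * ip mu f (L f).
Proof.
move=> Af; have Aff := algebra_M setting Af Af.
have l1 := L2_L1 (algebra_genL2 setting Aff).
have l2 : L1 (f \* L f).
  by apply: L2_mul; [exact/L2_bmf/(algebra_bmf setting)|exact: algebra_genL2 setting _ _].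
rewrite /energy /carre_du_champ mean_B//; last exact: L1_B.
by rewrite mean_B// (generator_mean setting Aff) /ip; ring.
Qed.

Lemma energy_parallelogram f g : A f -> A g ->
  energy (f \- g) + energy (f \+ g) = 2 * energy f + 2 * energy g.
Proof.
move=> Af Ag; have lD := carre_L1 (algebra_D setting Af Ag) (algebra_D setting Af Ag).
have lB := carre_L1 (algebra_B setting Af Ag) (algebra_B setting Af Ag).
have lf := carre_L1 Af Af; have lg := carre_L1 Ag Ag.
transitivity (mean mu (Gamma (f \- g) (f \- g) \+ Gamma (f \+ g) (f \+ g))).
  by rewrite (mean_D lB lD).
transitivity (mean mu ((fun x => 2 * Gamma f f x) \+ (fun x => 2 * Gamma g g x))).
  2: by rewrite (mean_D (L1_Z 2 lf) (L1_Z 2 lg)) (mean_Z 2 lf) (mean_Z 2 lg).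
apply: mean_ae; [exact: L1_meas (L1_D lB lD)|
  exact: L1_meas (L1_D (L1_Z 2 lf) (L1_Z 2 lg))|].
have := carre_B2 setting Af Ag; have := carre_D2 setting Af Ag.
by apply: filterS2 => x /= -> ->; ring.
Qed.

Lemma energy_Z c f : A f -> energy (fun x => c * f x) = c ^+ 2 * energy f.
Proof.
move=> Af; have Acf := algebra_Z setting c Af.
rewrite /energy -mean_Z; last exact: carre_L1.
apply: mean_ae; [exact: L1_meas (carre_L1 Acf Acf)|
  exact: L1_meas (L1_Z _ (carre_L1 Af Af))|].
have := carre_Zl setting c Af Acf; have := carre_Zl setting c Af Af.
by apply: filterS2 => x e1 ->; rewrite carreC e1; ring.
Qed.

(** Cauchy-Schwarz in the form of Young, from the positivity of [Gamma] at
    [f + th * g] and [f - th * g]. *)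
Lemma carre_young f g th : A f -> A g -> 0 < th -> {ae mu, forall x,
  `|Gamma f g x| <= 1 / 2 * (th^-1 * Gamma f f x + th * Gamma g g x)}.
Proof.
move=> Af Ag th0; have Ag' := algebra_Z setting th Ag.
have e1 := carre_ge0 setting (algebra_D setting Af Ag').
have e2 := carre_ge0 setting (algebra_B setting Af Ag').
have e3 := carre_D2 setting Af Ag'.
have e4 := carre_B2 setting Af Ag'.
have e5 := carre_Zl setting th Ag Af; have e6 := carre_Zl setting th Ag Ag'.
have e7 := carre_Zl setting th Ag Ag.
have h7 : {ae mu, forall x, Gamma f (fun x => th * g x) x = th * Gamma f g x /\
    Gamma (fun x => th * g x) (fun x => th * g x) x = th ^+ 2 * Gamma g g x}.
  move: e5 e6 e7; apply: filterS3 => x h5 h6 h7; split.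
    by rewrite carreC h5 (carreC M mu g).
  by rewrite h6 carreC h7 expr2 mulrA.
have h8 : {ae mu, forall x, 0 <= Gamma f f x + 2 * (th * Gamma f g x) +
    th ^+ 2 * Gamma g g x}.
  by move: e1 e3 h7; apply: filterS3 => x h1 h3 [<- <-]; rewrite -h3.
have h9 : {ae mu, forall x, 0 <= Gamma f f x - 2 * (th * Gamma f g x) +
    th ^+ 2 * Gamma g g x}.
  by move: e2 e4 h7; apply: filterS3 => x h1 h3 [<- <-]; rewrite -h3.
by move: h8 h9; apply: filterS2 => x; exact: young_arith.
Qed.

(** By polarization, [Gamma f f - Gamma g g = Gamma (f - g) (f + g)]. *)
Lemma carre_dist f g th : A f -> A g -> 0 < th ->
  mean mu (fun x => `|Gamma f f x - Gamma g g x|) <=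
  1 / 2 * (th^-1 * energy (f \- g) + th * (2 * energy f + 2 * energy g)).
Proof.
move=> Af Ag th0; have AB := algebra_B setting Af Ag.
have AD := algebra_D setting Af Ag.
have lB := carre_L1 AB AB; have lD := carre_L1 AD AD.
have lf := carre_L1 Af Af; have lg := carre_L1 Ag Ag.
apply: (@le_trans _ _ (1 / 2 * (th^-1 * energy (f \- g) + th * energy (f \+ g)))).
  have z1 := L1_Z th^-1 lB; have z2 := L1_Z th lD.
  rewrite /energy -mean_Z// -[X in _ + X]mean_Z// -mean_D// -mean_Z; last exact: L1_D.
  apply: mean_le_ae; [by apply: L1_norm; exact: L1_B|by apply: L1_Z; exact: L1_D|].
  have := carre_young AB AD th0; have := carre_Bl setting Af Ag AD.
  have e1 := carre_Dl setting Af Ag Af; have e2 := carre_Dl setting Af Ag Ag.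
  have : {ae mu, forall x, Gamma f (f \+ g) x - Gamma g (f \+ g) x =
     Gamma f f x - Gamma g g x}.
    move: e1 e2; apply: filterS2 => x e1 e2.
    by rewrite (carreC M mu f (_ \+ _)) (carreC M mu g (_ \+ _)) e1 e2 (carreC M mu g f) opprD addrA addrK.
  by apply: filterS3 => x <- -> H.
rewrite ler_pM2l ?divr_gt0// lerD2l ler_pM2l//.
by rewrite -energy_parallelogram// lerDr energy_ge0.
Qed.

(** * The domain of the closed form *)

(** Cauchy sequences for the energy have a bounded energy, so that their carrés du
    champ form a Cauchy sequence in L1. *)
Lemma energy_cauchy_domain (a : nat -> borel E -> R) u :
  (forall n, A (a n)) -> L2 u -> nrm mu (a n \- u) @[n --> \oo] --> 0 ->
  (forall e, 0 < e -> exists N, forall n k, (N <= n)%N -> (N <= k)%N ->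
     energy (a n \- a k) <= e) ->
  in_dirichlet_domain M mu A u.
Proof.
move=> Aa lu cu H.
have AB n k := algebra_B setting (Aa n) (Aa k).
have [C C0 aC] : exists2 C, 0 < C & exists N, forall n, (N <= n)%N -> energy (a n) <= C.
  have [N HN] := H _ ltr01; exists (2 + 2 * energy (a N)).
    by rewrite ltr_wpDr// mulr_ge0// energy_ge0.
  exists N => n Nn; have := HN _ _ Nn (leqnn N).
  have := energy_parallelogram (AB n N) (Aa N).
  rewrite (_ : (a n \- a N) \+ a N = a n); last by apply/funext => x /=; ring.
  have p0 := energy_ge0 (algebra_B setting (AB n N) (Aa N)).
  exact: cauchy_bound_arith.
have [G [lG cG]] : exists G, L1 G /\
    mean mu (fun x => `|Gamma (a n) (a n) x - G x|) @[n --> \oo] --> 0.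
  apply: L1_complete => [n|e e0]; first exact: carre_L1.
  have [N1 HN1] := aC.
  pose th := e / (4 * C); have th0 : 0 < th by rewrite divr_gt0// mulr_gt0.
  have [N2 HN2] := H _ (mulr_gt0 e0 th0).
  exists (maxn N1 N2) => n k; rewrite !geq_max => /andP[n1 n2] /andP[k1 k2].
  rewrite (le_trans (carre_dist (Aa n) (Aa k) th0))//.
  have h1 : th^-1 * energy (a n \- a k) <= e.
    by rewrite mulrC ler_pdivrMr// HN2.
  have h2 : th * (2 * energy (a n) + 2 * energy (a k)) <= e.
    have := HN1 _ n1; have := HN1 _ k1 => b1 b2.
    apply: (@le_trans _ _ (th * (4 * C))); last by rewrite divfK// gt_eqF// mulr_gt0.
    by rewrite ler_pM2l// four_sum_le.
  by rewrite mulrDr; exact: half_sum_le h1 h2.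
exists G; split=> //; exists a; split=> //.
- by apply/cvg_Lp_dist2 => // n; exact/L2_bmf/(algebra_bmf setting).
- rewrite (_ : (fun mn : nat * nat => _) =
     (fun mn => (energy (a mn.1 \- a mn.2))%:E)); last first.
    by apply/funext => -[n k] /=; rewrite mean_EFin//; exact: carre_L1.
  apply/(double_cvg0 (fun n k => energy (a n \- a k))) => e e0; have [N HN] := H e e0; exists N => n k Nn Nk.
  by rewrite ger0_norm ?energy_ge0// HN.
- by apply/cvg_Lp_dist1 => // n; exact: carre_L1.
Qed.

(** Minimizing sequences for the energy are Cauchy, by the parallelogram
    identity. *)
Lemma bounded_energy_domain u C : L2 u ->
  (forall d, 0 < d -> exists f, [/\ A f, nrm mu (f \- u) <= d & energy f <= C]) ->
  in_dirichlet_domain M mu A u.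
Proof.
move=> lu uC.
pose V := [set c | forall d, 0 < d ->
  exists f, [/\ A f, nrm mu (f \- u) <= d & energy f <= c]].
have VC : V C by [].
have V0 : lbound V 0.
  by move=> c /(_ 1 ltr01)[f [Af _ fc]]; rewrite (le_trans (energy_ge0 Af)).
have iV : has_inf V by split; [exists C|exists 0].
pose m := inf V.
have Vm n : exists f, [/\ A f, nrm mu (f \- u) <= n.+1%:R^-1 &
    energy f <= m + n.+1%:R^-1].
  have n0 : 0 < (n.+1%:R^-1 : R) by rewrite invr_gt0.
  have [c Vc cm] := inf_adherent n0 iV; have [f [Af fu fc]] := Vc _ n0.
  by exists f; split=> //; rewrite (le_trans fc)// ltW.
have [a Ha] := choice Vm.
have Aa n : A (a n) by have [] := Ha n.
have la n : L2 (a n) by exact/L2_bmf/(algebra_bmf setting).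
apply: (energy_cauchy_domain Aa lu).
  apply/cvgr0Pnorm_le => e e0; near=> n; have [_ H _] := Ha n.
  rewrite ger0_norm ?nrm_ge0// (le_trans H)// ltW//.
  by near: n; exact: near_infty_natSinv_lt (PosNum e0).
move=> e e0; (* close to the infimum, the energy of the half-sum cannot be smaller than the
   infimum by more than [e / 8] *)
pose e' := e / 8; have e'0 : 0 < e' by rewrite divr_gt0.
have [d d0 Hd] : exists2 d, 0 < d & forall f, A f -> nrm mu (f \- u) <= d ->
    m - e' <= energy f.
  have : ~ V (m - e').
    move=> Vm'; have : inf V <= m - e' by apply: ge_inf => //; exists 0.
    by rewrite /m; move: e'0; clear; lra.
  move=> /existsNP[d /not_implyP[d0 /forallNP H]]; exists d => // f Af fd.
  by rewrite leNgt; apply/negP => fm; apply: (H f); split=> //; exact: ltW.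
have [N _ HN] : \forall n \near \oo, n.+1%:R^-1 < Num.min d e'.
  have de : 0 < Num.min d e' by rewrite lt_min d0.
  exact: near_infty_natSinv_lt (PosNum de).
exists N => n k Nn Nk.
have [_ an1 an2] := Ha n; have [_ ak1 ak2] := Ha k.
have := HN _ Nn; have := HN _ Nk; rewrite !lt_min => /andP[k1 k2] /andP[n1 n2].
have AD := algebra_D setting (Aa n) (Aa k).
have h : m - e' <= energy (fun x => 1 / 2 * (a n \+ a k) x).
  apply: Hd; first exact: (algebra_Z setting).
  rewrite (_ : _ \- u = (fun x => 1 / 2 * (a n \- u) x) \+
    (fun x => 1 / 2 * (a k \- u) x)); last by apply/funext => x /=; field.
  have ln := L2_B (la n) lu; have lk := L2_B (la k) lu.
  rewrite (le_trans (nrmD (L2_Z _ ln) (L2_Z _ lk)))// !nrmZ//.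
  rewrite ger0_norm//; apply: half_sum_le.
    by rewrite (le_trans an1)// ltW.
  by rewrite (le_trans ak1)// ltW.
rewrite energy_Z// in h.
have p := energy_parallelogram (Aa n) (Aa k).
rewrite (minimizing_arith p h (le_trans an2 _) (le_trans ak2 _))//.
- by rewrite lerD2l ltW.
- by rewrite lerD2l ltW.
Unshelve. all: by end_near. Qed.

(** Time averages of the [P_s u] belong to the domain of [L]. Their energy is
    bounded because [<u - P_s u, u> = <u - P_s^* u, u>] is of order [s], [u] having
    a derivative under the dual semigroup. They are approximated in the algebra
    by the core property. *)
Lemma dual_domain_dirichlet u l K : bounded_mfun u ->
  (forall x, 0 <= u x <= K) -> L2 l ->
  nrm mu ((fun x => t^-1 * (Pd t u x - u x)) \- l) @[t --> (0 : R)^'+] --> 0 ->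
  in_dirichlet_domain M mu A u.
Proof.
move=> bu uK ll cl; have lu := L2_bmf mu bu.
(* [2 * <u - P_s u, u> <= c * s] for small [s] *)
pose c := 2 * ((nrm mu l + 1) * nrm mu u).
have c0 : 0 <= c by rewrite !mulr_ge0 ?addr_ge0 ?nrm_ge0.
have [s0 s00 Hs] : exists2 s0, 0 < s0 & forall s, 0 < s < s0 ->
    2 * (ip mu u u - joint s u u) <= c * s.
  have := cl; move=> /cvgr0Pnorm_le/(_ 1 ltr01)[s0 /= s00 H].
  exists s0 => // s /andP[sp ss].
  have := H s; rewrite /ball_/= sub0r normrN (gtr0_norm sp) => /(_ ss sp).
  rewrite ger0_norm ?nrm_ge0// => H1.
  have bPu := bmf_bdual inv (ltW sp) bu.
  have lq : L2 (fun x => s^-1 * (Pd s u x - u x)).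
    by apply: L2_bmf; apply: bmf_Z; exact: bmf_B.
  have H2 : nrm mu (fun x => s^-1 * (Pd s u x - u x)) <= nrm mu l + 1.
    have := nrmD (L2_B lq ll) ll.
    rewrite (_ : (_ \- l) \+ l = fun x => s^-1 * (Pd s u x - u x)); last first.
      by apply/funext => x /=; rewrite subrK.
    by move=> /le_trans; apply; rewrite addrC lerD2l.
  have -> : ip mu u u - joint s u u =
      - (s * ip mu (fun x => s^-1 * (Pd s u x - u x)) u).
    have lPu := L2_bmf mu bPu.
    have -> : ip mu (fun x => s^-1 * (Pd s u x - u x)) u =
        s^-1 * ip mu (Pd s u \- u) u by exact: (ipZl s^-1 (L2_B lPu lu) lu).
    by rewrite mulrA divff ?gt_eqF// mul1r ipBl// opprB (bdual_ip inv (ltW sp) bu bu).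
  rewrite /c -[leRHS]mulrA ler_pM2l// -mulrN mulrC ler_pM2r//.
  rewrite (le_trans (ler_norm _))// normrN (le_trans (ip_le_nrm lq lu))//.
  by rewrite ler_wpM2r ?nrm_ge0.
clearbody c.
have Hn s : 0 < s < s0 -> nrm mu (P s u \- u) <= Num.sqrt (c * s).
  move=> sp; have /andP[sp0 _] := sp.
  rewrite -(ler_sqr (nrm_ge0 _ _)) ?nnegrE ?sqrtr_ge0//.
  rewrite nrm_sqr sqr_sqrtr ?mulr_ge0 ?(ltW sp0)//.
  have bPu := bmf_semigroup M s bu; have lPu := L2_bmf mu bPu.
  rewrite (le_trans _ (Hs s sp))// ipBl ?ipBr ?L2_B//.
  rewrite (ipC mu (P s u) u).
  have h1 : ip mu (P s u) (P s u) <= ip mu u u.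
    by rewrite -!nrm_sqr ler_sqr ?nnegrE ?nrm_ge0// semigroup_contraction// ltW.
  exact: dist_arith2.
apply: (@bounded_energy_domain u (3 * c + 1) lu) => d d0.
have [T T0 [Ts Td]] : exists2 T, 0 < T & T < s0 /\ Num.sqrt (c * T) <= d / 2.
  have : Num.sqrt (c * t) @[t --> (0 : R)^'+] --> 0.
    rewrite -[X in _ --> X]sqrtr0; apply: continuous_cvg; first exact: sqrt_continuous.
    rewrite -[X in _ --> X](mulr0 c); apply: cvgMr.
    by apply: cvg_at_right_filter; exact: cvg_id.
  move=> /cvgr0Pnorm_le/(_ (d / 2)); rewrite divr_gt0// => /(_ isT) H.
  near (0 : R)^'+ => T.
  exists T; first by near: T; exact: nbhs_right_gt.
  split; first by near: T; exact: nbhs_right_lt.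
  by rewrite -[leLHS]ger0_norm ?sqrtr_ge0//; near: T; exact: H.
have T0s s : 0 <= s <= T -> nrm mu (P s u \- u) <= Num.sqrt (c * T).
  move=> /andP[s1 sT]; have [s2|s2] := ltrP 0 s.
    rewrite (le_trans (Hn s _))// ?s2 ?(le_lt_trans sT)// ler_sqrt ?mulr_ge0 ?(ltW T0)//.
    by rewrite ler_wpM2l.
  have -> : s = 0 by apply/eqP; rewrite eq_le s1 s2.
  rewrite semigroup_0// (_ : u \- u = fun x => 0 * u x); last first.
    by apply/funext => x /=; rewrite subrr mul0r.
  by rewrite nrmZ// normr0 mul0r sqrtr_ge0.
have [f [bf fK fint fgen]] := average_exists semigroup_bounded bu uK T0.
have lf := L2_bmf mu bf.
have bPT := bmf_semigroup M T bu.
pose k x := T^-1 * (P T u x - u x).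
have bk : bounded_mfun k by apply: bmf_Z; exact: bmf_B.
have lk := L2_bmf mu bk.
have gf : is_generator mu P f k by apply/is_generatorP.
have fu : nrm mu (f \- u) <= d / 2.
  apply: (le_trans _ Td); apply: nrm_le_ip => [||g bg]; first exact: bmf_B.
    exact: sqrtr_ge0.
  have lg := L2_bmf mu bg.
  rewrite ipBl// lerBlDr; apply: fint => // s sT.
  have bPs := bmf_semigroup M s bu.
  rewrite -lerBlDr -ipBl ?(L2_bmf mu)// (le_trans (ler_norm _))//.
  rewrite (le_trans (ip_le_nrm _ lg)) ?(L2_bmf mu)//; first exact: bmf_B.
  by rewrite ler_wpM2r ?nrm_ge0// T0s.
(* E(f) = - 2 <f, L f> = 2 / T <f, u - P_T u> *)
have Ef : -2 * ip mu f k <= 3 * c.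
  have lPT := L2_bmf mu bPT.
  have h : ip mu f (u \- P T u) <= 3 / 2 * c * T.
    apply: fint => [|s sT]; first exact: bmf_B.
    have bPs := bmf_semigroup M s bu; have lPs := L2_bmf mu bPs.
    have -> : ip mu (P s u) (u \- P T u) = ip mu (P s u \- u) (u \- P T u) +
        (ip mu u u - joint T u u).
      rewrite ipBl ?L2_B// [X in _ + X](_ : _ = ip mu u (u \- P T u)) ?subrK//.
      by rewrite ipBr.
    have h1 := Hs T; rewrite T0 Ts in h1; have h2 := h1 isT.
    have h3 : ip mu (P s u \- u) (u \- P T u) <= c * T.
      rewrite (le_trans (ler_norm _))// (le_trans (ip_le_nrm _ _)) ?L2_B//.
      rewrite -[leRHS]sqr_sqrtr ?mulr_ge0 ?(ltW T0)// expr2.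
      have h4 : nrm mu (u \- P T u) <= Num.sqrt (c * T).
        by rewrite nrmBC T0s// lexx ltW.
      exact: (ler_pM (nrm_ge0 _ _) (nrm_ge0 _ _) (T0s s sT) h4).
    by rewrite -mulrA; exact: average_arith.
  have -> : ip mu f k = - T^-1 * ip mu f (u \- P T u).
    rewrite -ipZr ?L2_B//; congr (ip mu f _); apply/funext => x /=.
    by rewrite /k mulNr -mulrN opprB.
  rewrite mulrA mulNr mulrN opprK mulrAC ler_pdivrMr//.
  by rewrite -mulrA; apply: average_arith2; rewrite mulrA.
have df : in_domain mu P f by exists k.
have Lf : {ae mu, forall x, L f x = k x} by exact: generator_unique.
have [_ /(_ f df)[w [Aw cw cLw]]] := core_generator setting.
have bw n : bounded_mfun (w n) by exact: (algebra_bmf setting).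
have lw n : L2 (w n) by exact: L2_bmf.
have [_ lLf _] := generatorP df.
have lLw n : L2 (L (w n)) by exact: (algebra_genL2 setting).
have {}cw : nrm mu (w n \- f) @[n --> \oo] --> 0 by apply/cvg_Lp_dist2.
have {}cLw : nrm mu (L (w n) \- L f) @[n --> \oo] --> 0 by apply/cvg_Lp_dist2.
have cE : ip mu (w n) (L (w n)) @[n --> \oo] --> ip mu f k.
  rewrite (_ : ip mu f k = ip mu f (L f)); first exact: cvg_ip.
  rewrite ipC [RHS]ipC; apply: ip_eq_ae; [exact: L2_meas lk|exact: L2_meas lLf|
    exact: L2_meas lf|].
  by apply: filterS Lf => x.
near \oo => n; exists (w n); split=> //.
  rewrite (le_trans (nrmB3 (lw n) lf lu))// (splitr d) lerD//.
  rewrite -[leLHS]ger0_norm ?nrm_ge0//; near: n.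
  by move: cw => /cvgr0Pnorm_le; apply; rewrite divr_gt0.
rewrite energyE// (le_trans _ (_ : -2 * ip mu f k + 1 <= _)) ?lerD2r//.
have : `|ip mu f k - ip mu (w n) (L (w n))| <= 1 / 2.
  by near: n; move: cE => /cvgrPdist_le; apply.
exact: two_dist_arith.
Unshelve. all: by end_near. Qed.

End DirichletDomain.

(** * Limits of means and the chain rule *)

Lemma three_arith (R : realType) (a b c e : R) :
  a <= e / 2 -> b <= e / 4 -> c <= e / 4 -> a + (b + c) <= e.
Proof. lra. Qed.

Lemma chain_arith3 (R : realType) (p q B a b : R) : p <= 2 * B -> q <= 2 * B ->
  0 <= B -> 0 <= a -> 0 <= b ->
  (p + q) * (B * (a + b)) <= 4 * B ^+ 2 * a + 4 * B ^+ 2 * b.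
Proof.
move=> pB qB B0 a0 b0.
rewrite (_ : 4 * B ^+ 2 * a + _ = 4 * B * (B * (a + b))); last by ring.
by rewrite ler_wpM2r ?mulr_ge0 ?addr_ge0//; lra.
Qed.

Lemma rho_arith (R : realType) (e a b c d : R) :
  e + (a + b + (c + d)) = e + (a + c) + (b + d).
Proof. by ring. Qed.

Section MeanLimits.
Context d (T : measurableType d) (R : realType) (mu : probability T R).
Implicit Types f g h : T -> R.
Local Notation L1 f := (mu.-integrable setT (EFin \o f)).

Lemma ae_and (P Q : T -> Prop) : {ae mu, forall x, P x} ->
  {ae mu, forall x, Q x} -> {ae mu, forall x, P x /\ Q x}.
Proof. by move=> p q; move: p q; apply: filterS2 => x. Qed.

Lemma measurable_cont (phi : R -> R) f : continuous phi -> measurable_fun setT f ->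
  measurable_fun setT (phi \o f).
Proof. by move=> cphi mf; apply: measurableT_comp => //; exact: continuous_measurable_fun. Qed.

Lemma mean_dominated (f_ : nat -> T -> R) f g :
  (forall n, measurable_fun setT (f_ n)) -> measurable_fun setT f -> L1 g ->
  {ae mu, forall x, f_ n x @[n --> \oo] --> f x} ->
  (forall n x, `|f_ n x| <= g x) ->
  L1 f /\ mean mu (f_ n) @[n --> \oo] --> mean mu f.
Proof.
move=> mf_ mf lg cf fg.
have lf_ n : L1 (f_ n) by apply: (L1_le (mf_ n) lg).
have [|||||lf _ H] := @dominated_convergence _ _ R mu setT measurableT
  (fun n => EFin \o f_ n) (EFin \o f) (EFin \o g).
- by move=> n; exact/measurable_EFinP.
- exact/measurable_EFinP.
- by apply: filterS cf => x cx _; apply: cvg_EFin; [exact: nearW|exact: cx].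
- exact: lg.
- by apply: aeW => x n _ /=; rewrite lee_fin.
split=> //; move: H.
rewrite (mean_EFin lf) (_ : (fun n => _) = EFin \o (fun n => mean mu (f_ n))).
  by move=> /fine_cvgP[].
by apply/funext => n; rewrite mean_EFin.
Qed.

Lemma mean_mul_le f g K : measurable_fun setT f -> L1 g -> 0 <= K ->
  (forall x, `|f x| <= K) -> `|mean mu (f \* g)| <= K * mean mu (fun x => `|g x|).
Proof.
move=> mf lg K0 fK; have bf : bounded_mfun f by split=> //; exists K.
rewrite (le_trans (mean_norm (L1_M bf lg)))// -mean_Z; last exact: L1_norm.
apply: mean_le; [exact/L1_norm/L1_M|exact/L1_Z/L1_norm|] => x.
by rewrite normrM ler_wpM2r.
Qed.

Lemma cvg_mean_prod (phi_ : nat -> T -> R) (phi : T -> R)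
  (H_ : nat -> T -> R) (H : T -> R) (K : R) :
  (forall n, measurable_fun setT (phi_ n)) ->
  (forall n x, `|phi_ n x| <= K) -> measurable_fun setT phi ->
  {ae mu, forall x, phi_ n x @[n --> \oo] --> phi x} ->
  (forall n, L1 (H_ n)) -> L1 H ->
  mean mu (fun x => `|H_ n x - H x|) @[n --> \oo] --> 0 ->
  L1 (phi \* H) /\ mean mu (phi_ n \* H_ n) @[n --> \oo] --> mean mu (phi \* H).
Proof.
move=> mphi_ phiK mphi cphi lH_ lH cH.
have K0 : 0 <= K by rewrite (le_trans _ (phiK 0%N point)).
have mH := L1_meas lH.
have [|||||l c] := @mean_dominated (fun n => phi_ n \* H) (phi \* H)
   (fun x => K * `|H x|).
- by move=> n; exact: measurable_funM.
- exact: measurable_funM.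
- by apply: L1_Z; exact: L1_norm.
- apply: filterS cphi => x cx; apply: cvgM; [exact: cx|exact: cvg_cst].
- by move=> n x; rewrite normrM ler_wpM2r.
split=> //.
have bphi n : bounded_mfun (phi_ n) by split=> //; exists K.
have c0 : mean mu (phi_ n \* (H_ n \- H)) @[n --> \oo] --> 0.
  apply/norm_cvg0P.
  have c1 : K * mean mu (fun x => `|H_ n x - H x|) @[n --> \oo] --> 0.
    by rewrite -[X in _ --> X](mulr0 K); exact: cvgMr.
  apply: (@squeeze_cvgr _ _ _ _ (cst 0)) c1; last exact: cvg_cst.
  apply: nearW => n; rewrite normr_ge0 /=.
  by apply: mean_mul_le => //; exact: L1_B.
have c1 : mean mu (phi_ n \* H) + mean mu (phi_ n \* (H_ n \- H)) @[n --> \oo] -->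
    mean mu (phi \* H) + 0 by exact: (cvgD c c0).
rewrite addr0 in c1; apply: cvg_trans c1; apply: near_eq_cvg; apply: nearW => n.
rewrite -mean_D; [|exact: L1_M|by apply: L1_M => //; exact: L1_B].
by congr mean; apply/funext => x /=; ring.
Qed.

End MeanLimits.

Section CarreSequences.
Context (R : realType) (dO : measure_display) (Omega : measurableType dO).
Context (E : puniformType) (M : markov_process R Omega E).
Context (mu : probability (borel E) R) (A : set (E -> R)).
Context (setting : standing_assumptions M mu A).
Implicit Types (f g h u v G : borel E -> R) (x : borel E) (t s : R).

Local Notation P := (semigroup M).
Local Notation Pd := (bdual M mu).
Local Notation L := (Defs.generator mu P).
Local Notation Gamma := (carre_du_champ mu P).
Local Notation L1 f := (mu.-integrable setT (EFin \o f)).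
Local Notation L2 f := (f \in Lfun mu 2%:E).
Local Notation energy := (energy M mu).

(** An approximating sequence in the sense of [is_carre_limit], thinned out so as
    to converge almost everywhere as well. *)
Record carre_sequence h G (a : nat -> borel E -> R) : Prop := CarreSequence {
  cs_alg : forall n, A (a n) ;
  cs_L2 : L2 h ;
  cs_L1 : L1 G ;
  cs_nrm : nrm mu (a n \- h) @[n --> \oo] --> 0 ;
  cs_ae : {ae mu, forall x, a n x @[n --> \oo] --> h x} ;
  cs_carre : mean mu (fun x => `|Gamma (a n) (a n) x - G x|) @[n --> \oo] --> 0 ;
  cs_ge0 : {ae mu, forall x, 0 <= G x} ;
  cs_cauchy : forall e, 0 < e -> exists N, forall n k, (N <= n)%N -> (N <= k)%N ->
     energy (a n \- a k) <= e }.

Lemma carre_sequence_exists h G : is_carre_limit M mu A h G ->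
  exists a, carre_sequence h G a.
Proof.
move=> [lh lG [u [Au uh uE uG]]].
have lu n : L2 (u n) by exact/L2_bmf/(algebra_bmf setting).
have lGu n : L1 (Gamma (u n) (u n)) by exact: (carre_L1 setting).
move: uh => /(cvg_Lp_dist2 lu lh) uh.
move: uG => /(cvg_Lp_dist1 lGu lG) uG.
have uh1 : mean mu (fun x => `|u n x - h x|) @[n --> \oo] --> 0.
  apply: (@squeeze_cvgr _ _ _ _ (cst 0)) uh; last exact: cvg_cst.
  apply: nearW => n; rewrite mean_ge0//=.
  by apply: mean_norm_le_nrm; exact: L2_B.
have [s [sk sae]] := L1_cvg_ae_subseq (fun n => L2_L1 (lu n)) (L2_L1 lh) uh1.
have soo := cvgn_infty_ge sk.
have [s' [sk' Gae]] := L1_cvg_ae_subseq lGu lG uG.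
exists (fun n => u (s n)); split.
- by move=> n; exact: Au.
- exact: lh.
- exact: lG.
- exact: (@cvg_comp _ _ _ s (fun n => nrm mu (u n \- h)) _ _ _ soo uh).
- exact: sae.
- exact: (@cvg_comp _ _ _ s
    (fun n => mean mu (fun x => `|Gamma (u n) (u n) x - G x|)) _ _ _ soo uG).
- have : {ae mu, forall x, forall n, 0 <= Gamma (u n) (u n) x}.
    by apply: ae_foralln => n; exact: (carre_ge0 setting).
  move: Gae; apply: filterS2 => x cx x0.
  rewrite -(cvg_lim (@Rhausdorff R) cx); apply: limr_ge.
    by apply/cvg_ex; eexists; exact: cx.
  exact: nearW.
- move: uE; rewrite (_ : (fun mn : nat * nat => _) =
     (fun mn => (energy (u mn.1 \- u mn.2))%:E)); last first.
    apply/funext => -[n k] /=; rewrite mean_EFin//.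
    by apply: (carre_L1 setting); exact: (algebra_B setting).
  move=> /(double_cvg0 (fun n k => energy (u n \- u k))) H e /H[N HN].
  exists N => n k Nn Nk; rewrite (le_trans (ler_norm _))//.
  by apply: HN; [exact: leq_trans (sk n)|exact: leq_trans (sk k)].
Qed.

Lemma measurable_poly (p : {poly R}) f : measurable_fun setT f ->
  measurable_fun setT (fun x => p.[f x]).
Proof.
move=> mf; elim/poly_ind: p => [|p c IH].
  by rewrite (_ : (fun x => _) = cst 0)//; apply/funext => x; rewrite horner0.
rewrite (_ : (fun x => _) = (fun x => p.[f x] * f x + c)); last first.
  by apply/funext => x; rewrite hornerMXaddC.
by apply: measurable_funD => //; exact: measurable_funM.
Qed.

(** With [x] and [y] the values of two derivatives and [gm], [gn], [gmn] the
    carrés du champ of two functions, the left-hand side is the carré du champ of the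
    difference of their images. It is [x * y] times that of the difference of the
    functions, plus [(x - y) * (x * gm - y * gn)]; [z] and [g] are the limits of [x],
    [y] and of [gm], [gn]. *)
Lemma chain_arith (x y z gm gn gmn g B : R) : `|x| <= B -> `|y| <= B ->
  `|z| <= B -> 0 <= gm - 2 * gmn + gn ->
  x ^+ 2 * gm - 2 * (x * y * gmn) + y ^+ 2 * gn <=
  B ^+ 2 * (gm - 2 * gmn + gn) +
  (4 * B ^+ 2 * `|gm - g| + 4 * B ^+ 2 * `|gn - g|) +
  (2 * B * (`|x - z| * `|g|) + 2 * B * (`|y - z| * `|g|)).
Proof.
move=> xB yB zB D0; have B0 : 0 <= B := le_trans (normr_ge0 _) xB.
have -> : x ^+ 2 * gm - 2 * (x * y * gmn) + y ^+ 2 * gn =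
  x * y * (gm - 2 * gmn + gn) + (x - y) * (x * gm - y * gn) by ring.
have h1 : x * y <= B ^+ 2.
  by rewrite (le_trans (ler_norm _))// normrM expr2 ler_pM.
have dx : `|x - z| <= 2 * B.
  by rewrite (le_trans (ler_normB _ _))// mulr_natl mulr2n lerD.
have dy : `|y - z| <= 2 * B.
  by rewrite (le_trans (ler_normB _ _))// mulr_natl mulr2n lerD.
have h2 : (x - y) * (x * gm - y * gn) <=
    (`|x - z| + `|y - z|) * (B * ((`|gm - g| + `|g|) + (`|gn - g| + `|g|))).
  rewrite (le_trans (ler_norm _))// normrM ler_pM//.
    by rewrite (le_trans (ler_distD z _ _))// lerD2l distrC.
  rewrite (le_trans (ler_normB _ _))// !normrM mulrDr lerD// ler_pM//.
    by rewrite -[X in `|X| <= _](subrK g) ler_normD.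
  by rewrite -[X in `|X| <= _](subrK g) ler_normD.
rewrite -[leRHS]addrA lerD ?ler_wpM2r// (le_trans h2)//.
have h3 := chain_arith3 dx dy B0 (normr_ge0 (gm - g)) (normr_ge0 (gn - g)).
move: h3; move: `|x - z| `|y - z| `|gm - g| `|gn - g| `|g|; clear=> p q b c a h3.
rewrite (_ : (p + q) * _ = (p + q) * (B * (b + c)) +
  (2 * B * (p * a) + 2 * B * (q * a))); last by ring.
by rewrite lerD2r.
Qed.

(** Chain rule for a function [J] with derivative [s] on the range of [u]: the
    polynomials [Q n] approximate [J], and their derivatives [q n]
    approximate [s], on the range of [u] and of [a n]. *)
Lemma chain_sequence u G a (K : R) (s S J : R -> R) (B : R) :
  carre_sequence u G a ->
  0 < K -> (forall x, 0 <= u x <= K) -> continuous S ->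
  (forall y : R, `|S y| <= B) -> (forall y : R, 0 <= y <= K -> s y = S y) ->
  continuous J -> J 0 = 0 ->
  (forall y : R, 0 < y -> is_derive y 1 J (s y)) ->
  exists v : nat -> borel E -> R, [/\ forall n, A (v n),
    nrm mu (v n \- (J \o u)) @[n --> \oo] --> 0,
    energy (v n) @[n --> \oo] --> mean mu (fun x => s (u x) ^+ 2 * G x) &
    forall e, 0 < e -> exists N, forall n k, (N <= n)%N -> (N <= k)%N ->
      energy (v n \- v k) <= e].
Proof.
move=> ca K0 uK cS SB sS cJ J0 dJ.
have B0 : 0 <= B by rewrite (le_trans _ (SB 0)).
have Aa := cs_alg ca; have lu := cs_L2 ca; have lG := cs_L1 ca.
have ba n := algebra_bmf setting (Aa n).
have mu_u := L2_meas lu.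
have Hq n : exists q : {poly R},
   [/\ forall x, `|q.[a n x] - S (a n x)| <= n.+1%:R^-1,
   forall y, 0 <= y <= K -> `|q.[y] - S y| <= n.+1%:R^-1 &
   exists V, [/\ K <= V, forall x, `|a n x| <= V &
      forall y, `|y| <= V -> `|q.[y]| <= B + 1]].
  have [V [V0 KV aV]] : exists V, [/\ 0 < V, K <= V & forall x, `|a n x| <= V].
    have [_ [V aV]] := ba n; exists (Num.max V K).
    rewrite lt_max K0 orbT le_max lexx orbT; split=> // x.
    by rewrite le_max aV.
  have n0 : 0 < (n.+1%:R^-1 : R) by rewrite invr_gt0.
  have [q Hq] := weierstrass cS SB V0 n0.
  exists q; split; first by move=> x; exact: Hq.
    by move=> y /andP[y0 yK]; apply: Hq; rewrite ger0_norm// (le_trans yK).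
  exists V; split=> // y /Hq H.
  rewrite -(subrK (S y) q.[y]) addrC (le_trans (ler_normD _ _))// lerD//.
  by rewrite (le_trans H)// invf_le1// ler1n.
have [q Hqq] := choice Hq; clear Hq.
pose Q n := primitive_poly (q n).
pose v n (x : borel E) := (Q n).[a n x].
have Av n : A (v n) by exact: (algebra_poly setting).
have bal n x : `|(q n).[a n x]| <= B + 1.
  by have [_ _ [V [KV aV H]]] := Hqq n; apply: H.
have mal n : measurable_fun setT (fun x => (q n).[a n x]).
  by apply: measurable_poly; case: (ba n).
have sSu x : s (u x) = S (u x) by exact: sS.
have mSu : measurable_fun setT (fun x => s (u x)).
  rewrite (_ : (fun x => _) = S \o u); first exact: measurable_cont.
  exact/funext.
have mJu : measurable_fun setT (J \o u) by exact: measurable_cont.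
have dQ n (y : R) : is_derive y 1 (horner (Q n)) (q n).[y].
  by rewrite -(primitive_polyE (q n)); exact: is_derive_poly.
have cQ n : continuous (horner (Q n)) by exact: continuous_horner.
have al_ae : {ae mu, forall x, (q n).[a n x] @[n --> \oo] --> s (u x)}.
  apply: filterS (cs_ae ca) => x cx; rewrite sSu.
  have c1 : S (a n x) @[n --> \oo] --> S (u x).
    by apply: continuous_cvg => //; exact: cS.
  have c2 : (q n).[a n x] - S (a n x) @[n --> \oo] --> 0.
    apply/cvgr0Pnorm_le => e e0; near=> n; have [H _ _] := Hqq n.
    rewrite (le_trans (H x))// ltW//; near: n.
    exact: near_infty_natSinv_lt (PosNum e0).
  have c3 : (q n).[a n x] - S (a n x) + S (a n x) @[n --> \oo] --> 0 + S (u x).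
    exact: (cvgD c2 c1).
  rewrite add0r in c3; apply: cvg_trans c3; apply: near_eq_cvg; apply: nearW => n.
  by rewrite subrK.
have lGa n : L1 (Gamma (a n) (a n)) by exact: (carre_L1 setting).
have lv n : L2 (v n) by exact/L2_bmf/(algebra_bmf setting).
have bJu : bounded_mfun (J \o u).
  split=> //; have [K' _ JK] := bounded_itv 0 K cJ.
  by exists K' => x; apply: JK; rewrite in_itv/= uK.
have lJu := L2_bmf mu bJu.
have alz n x : `|(q n).[a n x] - s (u x)| <= 2 * (B + 1).
  rewrite (le_trans (ler_normB _ _))// mulr_natl mulr2n lerD// sSu.
  by rewrite (le_trans (SB _))// lerDl.
exists v; split.
- exact: Av.
- have bQu n : bounded_mfun (fun x => (Q n).[u x]).
    split; first exact: measurable_poly.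
    have [K' _ QK] := bounded_itv 0 K (cQ n).
    by exists K' => x; apply: QK; rewrite in_itv/= uK.
  have c0 : (B + 1) * nrm mu (a n \- u) + n.+1%:R^-1 * K * nrm mu (cst 1 : borel E -> R)
      @[n --> \oo] --> (B + 1) * 0 + 0 * K * nrm mu (cst 1 : borel E -> R).
    apply: cvgD; first by apply: cvgMr; exact: cs_nrm ca.
    apply: cvgMl; apply: cvgMl; exact: cvg_harmonic.
  rewrite mulr0 !mul0r addr0 in c0.
  apply: (@squeeze_cvgr _ _ _ _ (cst 0)) c0; last exact: cvg_cst.
  apply: nearW => n; rewrite nrm_ge0 /=.
  have [_ Hs [V [KV aV HV]]] := Hqq n.
  rewrite (le_trans (nrmB3 (lv n) (L2_bmf mu (bQu n)) lJu))// lerD//.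
    apply: nrm_le_bound => [||| x]; first by rewrite addr_ge0.
    + exact: L2_meas (L2_B (lv n) (L2_bmf mu (bQu n))).
    + exact: L2_B (L2_bmf mu (ba n)) lu.
    + rewrite /v /=; have [c cx ->] := MVT_real (dQ n) (a n x) (u x).
      rewrite normrM ler_wpM2r//; apply: HV; rewrite ler_norml.
      have uV : - V <= u x <= V.
        have /andP[u0 u1] := uK x; rewrite (le_trans u1 KV) andbT.
        by rewrite (le_trans _ u0)// oppr_le0 (le_trans (ltW K0) KV).
      have aV' : - V <= a n x <= V by rewrite -ler_norml.
      exact: (between_itv aV' uV cx).
  apply: nrm_le_bound => [||| x].
  + by rewrite mulr_ge0 ?ltW.
  + exact: L2_meas (L2_B (L2_bmf mu (bQu n)) lJu).
  + exact/L2_bmf/bmf_cst.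
  + have dQJ (y : R) : 0 < y ->
        is_derive y 1 (horner (Q n) \- J) ((q n).[y] - s y).
      by move=> y0; apply: is_deriveB => //; exact: dJ.
    have cQJ : continuous (horner (Q n) \- J).
      by move=> y; apply: cvgB; [exact: cQ|exact: cJ].
    have /andP[u0 u1] := uK x.
    have [c cx] := MVT_ge0 dQJ cQJ u0 (lexx 0).
    rewrite /= primitive_poly0 J0 !subr0 => ->.
    have cK : 0 <= c <= K.
      by apply: between_itv cx; rewrite ?uK// lexx ltW.
    rewrite normr1 mulr1 normrM sS// ler_pM//; first exact: Hs.
    by rewrite ger0_norm.
- have [|||||||_ c] := @cvg_mean_prod _ _ R mu (fun n x => (q n).[a n x] ^+ 2)
    (fun x => s (u x) ^+ 2) (fun n => Gamma (a n) (a n)) G ((B + 1) ^+ 2).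
  + by move=> n; exact: measurable_funX.
  + by move=> n x; rewrite normrX lerXn2r ?nnegrE ?addr_ge0.
  + exact: measurable_funX.
  + apply: filterS al_ae => x cx; rewrite expr2.
    rewrite (_ : (fun n => _) = (fun n => (q n).[a n x] * (q n).[a n x])).
      exact: (cvgM cx cx).
    by apply/funext => n; rewrite expr2.
  + exact: lGa.
  + exact: lG.
  + exact: cs_carre ca.
  apply: cvg_trans c; apply: near_eq_cvg; apply: nearW => n.
  rewrite energy_mean; apply: mean_ae.
  + by apply: measurable_funM; [exact: measurable_funX|exact: (L1_meas (lGa n))].
  + exact: (L1_meas (carre_L1 setting (Av n) (Av n))).
  + have := carre_poly2 setting (Q n) (Q n) (Aa n) (Aa n).
    by apply: filterS => x; rewrite primitive_polyE -expr2 => e; exact: esym e.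
- pose B1 := B + 1; have B10 : 0 < B1 by rewrite ltr_wpDl.
  pose D n x := `|Gamma (a n) (a n) x - G x|.
  pose r n x := `|(q n).[a n x] - s (u x)| * `|G x|.
  have lD n : L1 (D n) by apply: L1_norm; exact: L1_B.
  have lr n : L1 (r n).
    apply: (L1_M _ (L1_norm lG)); split; last first.
      by exists (2 * B1) => x; rewrite normr_id.
    by apply: measurableT_comp => //; exact: measurable_funB.
  have cr : mean mu (r n) @[n --> \oo] --> 0.
    have [|||||_] := @mean_dominated _ _ R mu r (cst 0) (fun x => 2 * B1 * `|G x|).
    + by move=> n; exact: L1_meas (lr n).
    + by [].
    + by apply: L1_Z; exact: L1_norm.
    + apply: filterS al_ae => x cx /=.
      have c1 : `|(q n).[a n x] - s (u x)| * `|G x| @[n --> \oo] --> 0 * `|G x|.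
        apply: cvgMl; apply/norm_cvg0P.
        have c2 : (q n).[a n x] - s (u x) @[n --> \oo] --> s (u x) - s (u x).
          exact: (cvgB cx (cvg_cst _)).
        by rewrite subrr in c2.
      by rewrite mul0r in c1.
    + by move=> n x; rewrite /r normrM !normr_id ler_wpM2r.
    by rewrite mean_cst.
  pose rho n := 4 * B1 ^+ 2 * mean mu (D n) + 2 * B1 * mean mu (r n).
  have crho : rho n @[n --> \oo] --> 4 * B1 ^+ 2 * 0 + 2 * B1 * 0.
    by apply: cvgD; apply: cvgMr; [exact: cs_carre ca|exact: cr].
  rewrite !mulr0 addr0 in crho.
  have key n k : energy (v n \- v k) <= B1 ^+ 2 * energy (a n \- a k) +
      (rho n + rho k).
    have lB := carre_L1 setting (algebra_B setting (Aa n) (Aa k))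
      (algebra_B setting (Aa n) (Aa k)).
    have z1 := L1_Z (B1 ^+ 2) lB.
    have z2 := L1_Z (4 * B1 ^+ 2) (lD n); have z3 := L1_Z (4 * B1 ^+ 2) (lD k).
    have z4 := L1_Z (2 * B1) (lr n); have z5 := L1_Z (2 * B1) (lr k).
    pose W := ((fun x => B1 ^+ 2 * Gamma (a n \- a k) (a n \- a k) x) \+
      ((fun x => 4 * B1 ^+ 2 * D n x) \+ (fun x => 4 * B1 ^+ 2 * D k x))) \+
      ((fun x => 2 * B1 * r n x) \+ (fun x => 2 * B1 * r k x)).
    have -> : B1 ^+ 2 * energy (a n \- a k) + (rho n + rho k) = mean mu W.
      rewrite /W (mean_D (L1_D z1 (L1_D z2 z3)) (L1_D z4 z5)).
      rewrite (mean_D z1 (L1_D z2 z3)) (mean_D z2 z3) (mean_D z4 z5).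
      rewrite (mean_Z _ lB) !(mean_Z _ (lD _)) !(mean_Z _ (lr _)).
      exact: rho_arith.
    apply: mean_le_ae.
    + by apply: (carre_L1 setting); exact: (algebra_B setting).
    + exact: L1_D (L1_D z1 (L1_D z2 z3)) (L1_D z4 z5).
    + have e1 := carre_B2 setting (Av n) (Av k).
      have e2 := carre_B2 setting (Aa n) (Aa k).
      have e3 := carre_ge0 setting (algebra_B setting (Aa n) (Aa k)).
      have e4 := carre_poly2 setting (Q n) (Q n) (Aa n) (Aa n).
      have e5 := carre_poly2 setting (Q n) (Q k) (Aa n) (Aa k).
      have e6 := carre_poly2 setting (Q k) (Q k) (Aa k) (Aa k).
      have e456 := ae_and e4 (ae_and e5 e6).
      have e23 := ae_and e2 e3.
      move: e1 e23 e456; apply: filterS3 => x h1 [h2 h3] [h4 [h5 h6]].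
      rewrite /W /= h2 h1 h4 h5 h6 !primitive_polyE -!expr2.
      rewrite h2 in h3; apply: chain_arith => //.
      by rewrite sSu (le_trans (SB _))// lerDl.
  move=> e e0.
  have e1 : 0 < e / 2 / B1 ^+ 2 by rewrite !divr_gt0// exprn_gt0.
  have [N1 HN1] := cs_cauchy ca e1.
  have e4 : 0 < e / 4 by rewrite divr_gt0.
  have [N2 _ HN2] : \forall n \near \oo, `|rho n| <= e / 4.
    by move: crho => /cvgr0Pnorm_le; apply.
  exists (maxn N1 N2) => n k; rewrite !geq_max => /andP[n1 n2] /andP[k1 k2].
  rewrite (le_trans (key n k))//.
  have h1 : B1 ^+ 2 * energy (a n \- a k) <= e / 2.
    by rewrite mulrC -ler_pdivlMr ?exprn_gt0// HN1.
  have h2 := le_trans (ler_norm _) (HN2 _ n2).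
  have h3 := le_trans (ler_norm _) (HN2 _ k2).
  exact: three_arith.
Unshelve. all: by end_near. Qed.

End CarreSequences.

(** * Dissipation of the entropy *)

Lemma vanishing_perturbation (R : realType) (x y : R) :
  (forall tau, 0 < tau -> 0 <= x + tau * y) -> 0 <= x.
Proof.
move=> H; apply/ler_addgt0Pr => e e0; rewrite -lerBlDr sub0r.
have y0 : 0 < `|y| + 1 by rewrite ltr_wpDl.
have := H (e / (`|y| + 1)); rewrite divr_gt0// => /(_ isT) h.
have h1 : e / (`|y| + 1) * y <= e.
  rewrite mulrAC ler_pdivrMr// ler_wpM2l ?(ltW e0)//.
  by rewrite (le_trans (ler_norm _))// lerDl.
by rewrite -subr_ge0 opprK (le_trans h)// lerD2l.
Qed.

(** The difference of the two sides of [bregman_lower], as a sum of products of a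
    function of the first point by a function of the second one; the expectation
    of this sum is computed term by term in [dissipation_joint]. *)
Lemma dissipation_pointwise (R : realType) (pa pb qb a b wa wb v z tau C : R) :
  1 * (pa * 1) + (-1 * (1 * pb) + (-1 * (a * qb) + (1 * (1 * (qb * b)) +
  (-1 * (wa * v * 1) + (1 * (wa * z) + (1 * (v * wb) + (-1 * (1 * (wb * z)) +
  (1 / 2 * (1 * (v * v) * 1) + (-1 * (1 * v * z) + (1 / 2 * (1 * (z * z)) +
  (tau * (a * a * 1) + (- 2 * tau * (a * b) + (tau * (1 * (b * b)) +
  (C * (v * v * v * v * 1) + (- 4 * C * (v * v * v * z) +
  (6 * C * (v * v * (z * z)) + (- 4 * C * (v * (z * z * z)) +
   (C * (1 * (z * z * z * z)) + 0)))))))))))))))))) =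
  (pa - pb - qb * (a - b)) - ((wa - wb) * (v - z) - 1 / 2 * (v - z) ^+ 2
    - tau * (a - b) ^+ 2 - C * (v - z) ^+ 4).
Proof. by field. Qed.

Lemma dissipation_joint (R : realType)
  (i mp juq iuq jwv jvw iwv q1 q2 q3 juu iuu k1 k2 k3 k4 k5 tau C : R) :
  i * (1 * mp + (-1 * mp + (-1 * juq + (1 * iuq + (-1 * iwv + (1 * jwv +
   (1 * jvw + (-1 * iwv + (1 / 2 * q1 + (-1 * q2 + (1 / 2 * q3 +
   (tau * iuu + (- 2 * tau * juu + (tau * iuu + (C * k1 + (- 4 * C * k2 +
   (6 * C * k3 + (- 4 * C * k4 + (C * k5 + 0))))))))))))))))))) =
  - (i * (juq - iuq)) + (i * (jwv - iwv) + i * (jvw - iwv)) +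
   1 / 2 * (i * (q1 - 2 * q2 + q3)) + tau * (-2 * (i * (juu - iuu))) +
   C * (i * (k1 - 4 * k2 + 6 * k3 - 4 * k4 + k5)).
Proof. by field. Qed.

Lemma polar_arith (R : realType) (e a b c : R) : 0 < e ->
  a - 2 * b + c <= e -> - b + 1 / 2 * c + 1 / 2 * a <= e.
Proof. lra. Qed.

Lemma dissipation_arith (R : realType) (a b c d e : R) :
  b + c + d <= e -> a + b + c <= a + e - d.
Proof. lra. Qed.

Section Dissipation.
Context (R : realType) (dO : measure_display) (Omega : measurableType dO).
Context (E : puniformType) (M : markov_process R Omega E).
Context (mu : probability (borel E) R) (A : set (E -> R)).
Context (setting : standing_assumptions M mu A).
Implicit Types (f g h u v G : borel E -> R) (x : borel E) (t : R).

Local Notation P := (semigroup M).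
Local Notation Pdual := (dual_semigroup M mu).
Local Notation Pd := (bdual M mu).
Local Notation L := (Defs.generator mu P).
Local Notation Ld := (Defs.generator mu Pdual).
Local Notation Gamma := (carre_du_champ mu P).
Local Notation L1 f := (mu.-integrable setT (EFin \o f)).
Local Notation L2 f := (f \in Lfun mu 2%:E).
Local Notation energy := (energy M mu).
Local Notation joint := (joint M mu).
Local Notation rate := (rate M mu).

Let inv : Defs.invariant M mu := mu_invariant setting.

Lemma joint_comb_ge0 t (s : seq (R * ((borel E -> R) * (borel E -> R)))) :
  bmf_pairs [seq p.2 | p <- s] ->
  (forall x y, 0 <= \sum_(p <- s) p.1 * (p.2.1 x * p.2.2 y)) ->
  0 <= \sum_(p <- s) p.1 * joint t p.2.1 p.2.2.
Proof.
move=> bs Hs.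
have H := @joint_sum_ge0 _ _ _ _ M mu t [seq (fun x => p.1 * p.2.1 x, p.2.2) | p <- s].
have -> : \sum_(p <- s) p.1 * joint t p.2.1 p.2.2 =
   \sum_(p <- [seq (fun x => p.1 * p.2.1 x, p.2.2) | p <- s]) joint t p.1 p.2.
  rewrite big_map; elim: s bs {Hs H} => [|[c [f g]] s IH] /=; first by rewrite !big_nil.
  by move=> [bf bg bs]; rewrite !big_cons /= jointZl// IH.
apply: H.
  elim: s bs {Hs} => //= [[c [f g]] s IH] /= [bf bg bs].
  by split=> //=; [exact: bmf_Z|exact: IH].
move=> x y; rewrite big_map; have := Hs x y.
by congr (_ <= _); apply: eq_bigr => p _; rewrite /= mulrA.
Qed.

Definition dual_derivative u l := nrm mu ((fun x => t^-1 * (Pd t u x - u x)) \- l)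
  @[t --> (0 : R)^'+] --> 0.

Lemma dual_derivative_rate u l g : bounded_mfun u -> L2 l -> bounded_mfun g ->
  dual_derivative u l -> rate t u g @[t --> (0 : R)^'+] --> ip mu l g.
Proof.
move=> bu ll bg cl; have lg := L2_bmf mu bg; have lu := L2_bmf mu bu.
apply/cvgrPdist_le => e e0.
have c1 : nrm mu ((fun x => t^-1 * (Pd t u x - u x)) \- l) * nrm mu g
    @[t --> (0 : R)^'+] --> 0 * nrm mu g by apply: cvgMl.
rewrite mul0r in c1.
have H : \forall t \near (0 : R)^'+, `|nrm mu ((fun x => t^-1 * (Pd t u x - u x)) \- l)
  * nrm mu g| <= e by move: c1 => /cvgr0Pnorm_le; apply.
near=> t; have t0 : 0 < t by near: t; exact: nbhs_right_gt.
have bPu := bmf_bdual inv (ltW t0) bu; have lPu := L2_bmf mu bPu.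
have lq : L2 (fun x => t^-1 * (Pd t u x - u x)).
  by apply: L2_bmf; apply: bmf_Z; exact: bmf_B.
have -> : rate t u g = ip mu (fun x => t^-1 * (Pd t u x - u x)) g.
  have -> := ipZl t^-1 (L2_B lPu lu) lg.
  by rewrite ipBl// (bdual_ip inv (ltW t0) bu bg).
rewrite distrC -ipBl//.
rewrite (le_trans (ip_le_nrm _ lg)) ?L2_B//.
by rewrite (le_trans (ler_norm _))//; near: t.
Unshelve. all: by end_near. Qed.

(** The mean of [L (f * g)] vanishes. *)
Lemma generator_carre f g : A f -> A g ->
  ip mu f (L g) + ip mu (Ld g) f = - mean mu (Gamma f g).
Proof.
move=> Af Ag; rewrite -(generator_adj setting Ag Af).
have Afg := algebra_M setting Af Ag.
have l0 := L2_L1 (algebra_genL2 setting Afg).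
have l1 : L1 (f \* L g).
  by apply: L2_mul; [exact/L2_bmf/(algebra_bmf setting)|exact: algebra_genL2 setting _ _].
have l2 : L1 (g \* L f).
  by apply: L2_mul; [exact/L2_bmf/(algebra_bmf setting)|exact: algebra_genL2 setting _ _].
rewrite /carre_du_champ mean_B//; last exact: L1_B.
rewrite mean_B// (generator_mean setting Afg) sub0r opprD !opprK.
by rewrite /ip.
Qed.

Lemma energy_B f g : A f -> A g ->
  energy (f \- g) = energy f - 2 * mean mu (Gamma f g) + energy g.
Proof.
move=> Af Ag; have AB := algebra_B setting Af Ag.
have lf := carre_L1 setting Af Af; have lg := carre_L1 setting Ag Ag.
have lfg := carre_L1 setting Af Ag; have z := L1_Z 2 lfg.
rewrite !energy_mean -(mean_Z 2 lfg) -(mean_B lf z) -(mean_D (L1_B lf z) lg).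
apply: mean_ae; [exact: L1_meas (carre_L1 setting AB AB)|
  exact: L1_meas (L1_D (L1_B lf z) lg)|].
exact: (carre_B2 setting Af Ag).
Qed.

(** To first order in [t], the expectation of the Bregman divergence of [u (X_0)]
    and [u (X_t)] is [- t * <l, p1 (u)>], the mean of [p (u)] being the same at
    both times. It is compared with the bilinear form of [bregman_lower] in the
    increments of [J (u)] and [v]. *)
Lemma dissipation_test p p1 p2 J u l v (K : R) : smooth_convex p p1 p2 ->
  continuous J ->
  (forall y : R, 0 < y -> is_derive y 1 J (Num.sqrt (p2 y))) ->
  bounded_mfun u -> (forall x, 0 <= u x <= K) -> L2 l -> dual_derivative u l ->
  A v ->
  0 <= - ip mu l (p1 \o u) + (ip mu (J \o u) (L v) + ip mu (Ld v) (J \o u)) +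
    1 / 2 * energy v.
Proof.
move=> sc cJ dJ bu uK ll cl Av.
have bcomp (f : R -> R) : continuous f -> bounded_mfun (f \o u).
  move=> cf; split; first by apply: measurable_cont => //; case: bu.
  have [K' _ fK] := bounded_itv 0 K cf.
  by exists K' => x; apply: fK; rewrite in_itv/= uK.
pose w := J \o u; pose q := p1 \o u; pose pu := p \o u.
have bw : bounded_mfun w := bcomp _ cJ.
have bq : bounded_mfun q := bcomp _ (sc_cont1 sc).
have bpu : bounded_mfun pu := bcomp _ (sc_cont0 sc).
have bv := algebra_bmf setting Av.
have b1 := @bmf_cst _ (borel E) R 1.
(* the error [tau * (a - b) ^+ 2] contributes [- 2 * tau * <l, u>] *)
apply: (@vanishing_perturbation _ _ (-2 * ip mu l u)) => tau tau0.
have [C C0 HC] := bregman_lower sc K cJ dJ tau0.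
have bvv := bmf_M bv bv; have b1vv := bmf_M b1 bvv; have b1v := bmf_M b1 bv.
have bvvv := bmf_M bvv bv; have bvvvv := bmf_M bvvv bv.
pose s : seq (R * ((borel E -> R) * (borel E -> R))) :=
  [:: (1, (pu, cst 1)); (-1, (cst 1, pu)); (-1, (u, q)); (1, (cst 1, q \* u));
   (-1, (w \* v, cst 1)); (1, (w, v)); (1, (v, w)); (-1, (cst 1, w \* v));
   (1 / 2, (cst 1 \* (v \* v), cst 1)); (-1, (cst 1 \* v, v));
   (1 / 2, (cst 1, v \* v));
   (tau, (u \* u, cst 1)); (- 2 * tau, (u, u)); (tau, (cst 1, u \* u));
   (C, (v \* v \* v \* v, cst 1)); (- 4 * C, (v \* v \* v, v));
   (6 * C, (v \* v, v \* v)); (- 4 * C, (v, v \* v \* v));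
   (C, (cst 1, v \* v \* v \* v))].
have Hs t : 0 <= \sum_(p <- s) p.1 * joint t p.2.1 p.2.2.
  apply: joint_comb_ge0.
    have buu := bmf_M bu bu; have bqu := bmf_M bq bu; have bwv := bmf_M bw bv.
    by rewrite /s /=; do !split=> //.
  move=> x y; rewrite /s !big_cons big_nil.
  have H := HC (u x) (u y) (v x - v y) (uK x) (uK y).
  have -> := dissipation_pointwise (pu x) (pu y) (q y) (u x) (u y) (w x) (w y)
    (v x) (v y) tau C.
  by rewrite subr_ge0.
have c1 := dual_derivative_rate bu ll bq cl.
have c2 := algebra_rate setting bw Av.
have c3 := algebra_dual_rate setting Av bw.
have c4 := quad_cvg setting b1 Av.
have c5 := dual_derivative_rate bu ll bu cl.
have c6 := quart_cvg setting Av.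
have c : - rate t u q + (rate t w v + rate t v w) +
    1 / 2 * (t^-1 * quad M mu t (cst 1) v) + tau * (-2 * rate t u u) +
    C * (t^-1 * quart M mu t v) @[t --> (0 : R)^'+] -->
    - ip mu l q + (ip mu w (L v) + ip mu (Ld v) w) +
    1 / 2 * ip mu (cst 1) (Gamma v v) + tau * (-2 * ip mu l u) + C * 0.
  apply: cvgD; last exact: cvgMr.
  apply: cvgD; last by apply: cvgMr; exact: cvgMr.
  apply: cvgD; last exact: cvgMr.
  by apply: cvgD; [exact: cvgN|exact: cvgD].
rewrite mulr0 addr0 (ipC _ (cst 1)) ip_mul1 in c.
rewrite -(cvg_lim (@Rhausdorff R) c); apply: limr_ge.
  by apply/cvg_ex; eexists; exact: c.
near=> t; have t0 : 0 < t by near: t; exact: nbhs_right_gt.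
have := Hs t; rewrite -(pmulr_rge0 _ (_ : 0 < t^-1)) ?invr_gt0//.
congr (0 <= _); rewrite /s !big_cons big_nil /=.
have J1 f : joint t f (cst 1) = mean mu f by exact: joint_1r.
have J2 f : bounded_mfun f -> joint t (cst 1) f = mean mu f.
  by move=> bf; rewrite (joint_1l inv (ltW t0) bf).
rewrite (J1 pu) (J2 pu bpu) (J2 _ (bmf_M bq bu)) (J1 (w \* v)) (J2 _ (bmf_M bw bv)).
rewrite (J1 (u \* u)) (J2 _ (bmf_M bu bu)).
rewrite dissipation_joint !rateE (_ : mean mu (q \* u) = ip mu u q); last exact: ipC.
by rewrite (ipC mu v w).
Unshelve. all: by end_near. Qed.

(** Optimize [dissipation_test] over the test function [v], with [J (u)] as
    target. Since [J (u)] may be outside the domain of the generator, the optimum is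
    only approached, along a sequence [v n] of bounded energies: the terms which
    involve [L (v n)] are limits of [Gamma (v m) (v n)]. *)
Lemma dissipation p p1 p2 u l G (K : R) : smooth_convex p p1 p2 -> 0 < K ->
  bounded_mfun u -> (forall x, 0 <= u x <= K) -> L2 l -> dual_derivative u l ->
  is_carre_limit M mu A u G ->
  1 / 2 * mean mu (fun x => p2 (u x) * G x) <= - ip mu l (p1 \o u).
Proof.
move=> sc K0 bu uK ll cl /(carre_sequence_exists setting)[a ca].
have cs : continuous (fun y => Num.sqrt (p2 y)).
  by move=> y; apply: continuous_comp; [exact: sc_cont2 sc y|exact: sqrt_continuous].
have [J [cJ J0 dJ]] := exists_primitive cs.
pose clamp (y : R) := Num.max 0 (Num.min K y).
have clampK y : 0 <= clamp y <= K.
  by rewrite /clamp le_max lexx /= ge_max (ltW K0) ge_min lexx.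
(* the sequence [a] may leave the range [0, K] of [u], outside of which the
   derivative of [J] is frozen *)
pose S y := Num.sqrt (p2 (clamp y)).
have cS : continuous S.
  move=> y; apply: (@continuous_comp _ _ _ clamp (fun y => Num.sqrt (p2 y))).
    apply: (@continuous_max _ _ (cst 0)); first exact: cst_continuous.
    by apply: (@continuous_min _ _ (cst K)); [exact: cst_continuous|].
  exact: cs.
have [B _ HB] := bounded_itv 0 K cs.
have SB y : `|S y| <= B by apply: HB; rewrite in_itv/= clampK.
have sS (y : R) : 0 <= y <= K -> Num.sqrt (p2 y) = S y.
  move=> /andP[y0 yK]; rewrite /S /clamp; congr (Num.sqrt (p2 _)).
  by rewrite (min_idPr yK) (max_idPr y0).
have [v [Av cv cE Ecauchy]] := chain_sequence setting ca K0 uK cS SB sS cJ J0 dJ.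
have {}cE : energy (v n) @[n --> \oo] --> mean mu (fun x => p2 (u x) * G x).
  rewrite (_ : (fun x => _) = (fun x => Num.sqrt (p2 (u x)) ^+ 2 * G x))//.
  apply/funext => x; rewrite sqr_sqrtr//.
  by have /andP[u0 _] := uK x; exact: ltW (sc_ge0 sc u0).
have lv n : L2 (v n) by exact/L2_bmf/(algebra_bmf setting).
have lw : L2 (J \o u).
  apply: L2_bmf; split; first by apply: measurable_cont => //; case: bu.
  have [K' _ JK] := bounded_itv 0 K cJ.
  by exists K' => x; apply: JK; rewrite in_itv/= uK.
apply/ler_addgt0Pr => e e0.
have [N HN] := Ecauchy e e0.
have test := dissipation_test sc cJ dJ bu uK ll cl (Av N).
rewrite -subr_ge0 (le_trans test)//.
have lLv := algebra_genL2 setting (Av N); have lLdv := algebra_dualL2 setting (Av N).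
have c1 : ip mu (v m) (L (v N)) @[m --> \oo] --> ip mu (J \o u) (L (v N)).
  by apply: (cvg_ipl lv lw lLv cv).
have c2 : ip mu (Ld (v N)) (v m) @[m --> \oo] --> ip mu (Ld (v N)) (J \o u).
  by apply: (cvg_ipr lv lw lLdv cv).
have c3 : ip mu (v m) (L (v N)) + ip mu (Ld (v N)) (v m) + 1 / 2 * energy (v N) +
    1 / 2 * energy (v m) @[m --> \oo] -->
  ip mu (J \o u) (L (v N)) + ip mu (Ld (v N)) (J \o u) + 1 / 2 * energy (v N) +
    1 / 2 * mean mu (fun x => p2 (u x) * G x).
  by apply: cvgD; [apply: cvgD; [exact: (cvgD c1 c2)|exact: cvg_cst]|exact: cvgMr].
have : ip mu (J \o u) (L (v N)) + ip mu (Ld (v N)) (J \o u) + 1 / 2 * energy (v N) +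
    1 / 2 * mean mu (fun x => p2 (u x) * G x) <= e.
  rewrite -(cvg_lim (@Rhausdorff R) c3); apply: limr_le.
    by apply/cvg_ex; eexists; exact: c3.
  exists N => // m Nm; rewrite generator_carre//.
  have := HN m N Nm (leqnn N); rewrite energy_B//.
  by move: e0; clear; exact: polar_arith.
exact: dissipation_arith.
Unshelve. all: by end_near. Qed.

End Dissipation.

(** * From the functional inequality to exponential decay *)

Lemma le_addeps (R : realType) (x y M : R) : 0 <= M ->
  (forall e, 0 < e -> x <= y + e * M) -> x <= y.
Proof.
move=> M0 H; apply/ler_addgt0Pr => e e0.
have M1 : 0 < M + 1 by rewrite ltr_wpDl.
rewrite (le_trans (H (e / (M + 1)) _)) ?divr_gt0// lerD2l mulrAC ler_pdivrMr//.
by rewrite ler_wpM2l ?(ltW e0)// lerDl.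
Qed.

Lemma bregman_arith (R : realType) (a b q x y : R) :
  0 <= a - b - q * (x - y) -> b - a <= q * (y - x).
Proof. by rewrite -(opprB x y) mulrN; lra. Qed.

Lemma dini_arith (R : realType) (C e x y eta a b g : R) : 0 < C -> 0 < e ->
  x <= y + eta -> a - b <= e * x -> b <= C * g -> 1 / 2 * g <= - y ->
  a <= b - e * ((2 * C)^-1 * b) + eta * e.
Proof.
move=> C0 e0 xy abx bg gy.
have h1 : e * x <= e * (y + eta) by rewrite ler_pM2l.
have h2 : (2 * C)^-1 * b <= - y.
  rewrite (le_trans _ gy)// div1r invfM -[leLHS]mulrA ler_pM2l ?invr_gt0//.
  by rewrite ler_pdivrMl.
have h3 : e * ((2 * C)^-1 * b) <= e * - y by rewrite ler_pM2l.
move: h3; set z := e * ((2 * C)^-1 * b) => h3.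
rewrite mulrDr in h1; rewrite mulrN in h3; rewrite (mulrC eta).
by move: abx h1 h3; move: (e * x) (e * y) (e * eta); clear=> p q r; lra.
Qed.

Lemma decay_arith (R : realType) (k a b f h c e : R) : 0 <= k ->
  a <= b + c * e -> b <= k * f -> f <= h + c * e ->
  a <= k * h + e * (c + k * c).
Proof.
move=> k0 ab bf fh; have := ler_wpM2l k0 fh; rewrite mulrDr => kfh.
rewrite (_ : e * (c + k * c) = c * e + k * (c * e)); last by ring.
move: ab bf kfh; move: (k * f) (k * h) (k * (c * e)) (c * e); clear=> p q r s; lra.
Qed.

Section Decay.
Context (R : realType) (dO : measure_display) (Omega : measurableType dO).
Context (E : puniformType) (M : markov_process R Omega E).
Context (mu : probability (borel E) R) (A : set (E -> R)).
Context (setting : standing_assumptions M mu A).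
Implicit Types (f g h u v G : borel E -> R) (x : borel E) (t s : R).

Local Notation P := (semigroup M).
Local Notation Pdual := (dual_semigroup M mu).
Local Notation Pd := (bdual M mu).
Local Notation L1 f := (mu.-integrable setT (EFin \o f)).
Local Notation L2 f := (f \in Lfun mu 2%:E).
Local Notation joint := (joint M mu).
Local Notation dual_derivative := (dual_derivative M mu).

Let inv : Defs.invariant M mu := mu_invariant setting.

Lemma bmf_cont (phi : R -> R) u (K : R) : continuous phi -> bounded_mfun u ->
  (forall x, 0 <= u x <= K) -> bounded_mfun (phi \o u).
Proof.
move=> cphi [mu_u _] uK; split; first exact: measurable_cont.
have [K' _ HK] := bounded_itv 0 K cphi.
by exists K' => x; apply: HK; rewrite in_itv/= uK.
Qed.

Lemma bdual_add_ae s t h : 0 <= s -> 0 <= t -> bounded_mfun h ->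
  {ae mu, forall x, Pd (s + t) h x = Pd t (Pd s h) x}.
Proof.
move=> s0 t0 bh; apply: bmf_ip_ae => [||g bg].
- by apply: bmf_bdual; rewrite ?addr_ge0.
- by apply: bmf_bdual => //; exact: bmf_bdual.
- exact: bdualDt.
Qed.

Lemma bdual_dist t h k : 0 <= t -> bounded_mfun h -> bounded_mfun k ->
  mean mu (fun x => `|Pd t h x - Pd t k x|) <= mean mu (fun x => `|h x - k x|).
Proof.
move=> t0 bh bk; apply: le_trans (dual_dist inv t0 (bmf_L1 mu bh) (bmf_L1 mu bk)).
have lh := dual_L1 inv t0 (bmf_L1 mu bh); have lk := dual_L1 inv t0 (bmf_L1 mu bk).
rewrite le_eqVlt; apply/orP; left; apply/eqP; apply: mean_ae.
- apply: (@L1_meas _ _ _ mu); apply: L1_norm; apply: L1_B; apply: bmf_L1; exact: bmf_bdual.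
- exact: (L1_meas (L1_norm (L1_B lh lk))).
- have := bdual_ae inv t0 bh; have := bdual_ae inv t0 bk.
  by apply: filterS2 => x -> ->.
Qed.

(** The dual semigroup commutes with its derivative at time 0. *)
Lemma dual_derivative_shift s u l : 0 <= s -> bounded_mfun u -> bounded_mfun l ->
  dual_derivative u l -> dual_derivative (Pd s u) (Pd s l).
Proof.
move=> s0 bu bl cl.
apply: (@squeeze_cvgr _ _ _ _ (cst 0)) cl; last exact: cvg_cst.
near=> t; have t0 : 0 <= t by apply: ltW; near: t; exact: nbhs_right_gt.
rewrite nrm_ge0 /=.
have bsu := bmf_bdual inv s0 bu; have bsl := bmf_bdual inv s0 bl.
have btsu := bmf_bdual inv t0 bsu; have btu := bmf_bdual inv t0 bu.
have bd : bounded_mfun (fun x => t^-1 * (Pd t u x - u x)).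
  by apply: bmf_Z; exact: bmf_B.
have bds : bounded_mfun (fun x => t^-1 * (Pd t (Pd s u) x - Pd s u x)).
  by apply: bmf_Z; exact: bmf_B.
apply: nrm_le_ip => [||g bg]; [exact: bmf_B|exact: nrm_ge0|].
have bsg := bmf_semigroup M s bg.
have lg := L2_bmf mu bg; have lsg := L2_bmf mu bsg.
apply: (@le_trans _ _ (ip mu ((fun x => t^-1 * (Pd t u x - u x)) \- l) (P s g))).
  rewrite le_eqVlt; apply/orP; left; apply/eqP.
  rewrite (ipBl (L2_bmf mu bds) (L2_bmf mu bsl) lg).
  rewrite (ipBl (L2_bmf mu bd) (L2_bmf mu bl) lsg) (bdual_ip inv s0 bl bg).
  congr (_ - _).
  have -> := ipZl t^-1 (L2_bmf mu (bmf_B btsu bsu)) lg.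
  have -> := ipZl t^-1 (L2_bmf mu (bmf_B btu bu)) lsg.
  rewrite (ipBl (L2_bmf mu btsu) (L2_bmf mu bsu) lg).
  rewrite (ipBl (L2_bmf mu btu) (L2_bmf mu bu) lsg).
  rewrite -(bdualDt inv s0 t0 bu bg) (bdual_ip inv s0 bu bg) (bdual_ip inv t0 bu bsg).
  rewrite (bdual_ip inv (addr_ge0 s0 t0) bu bg) !jointE.
  by rewrite (addrC s t) (semigroupDt M t0 s0 bg).
rewrite (le_trans (ler_norm _))//.
rewrite (le_trans (ip_le_nrm (L2_bmf mu (bmf_B bd bl)) lsg))//.
by rewrite ler_wpM2l ?nrm_ge0// semigroup_contraction.
Unshelve. all: by end_near. Qed.

(** Time averages of the dual semigroup regularize a bounded density. *)
Lemma regular_density h (K e : R) : bounded_mfun h -> (forall x, 0 <= h x <= K) ->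
  mean mu h = 1 -> 0 < e -> exists f l, [/\ bounded_mfun f,
    forall x, 0 <= f x <= K, mean mu f = 1, bounded_mfun l &
    dual_derivative f l /\ nrm mu (f \- h) <= e].
Proof.
move=> bh hK h1 e0; have lh := L2_bmf mu bh.
have [T T0 HT] : exists2 T, 0 < T & forall s, 0 <= s <= T ->
    nrm mu (Pd s h \- h) <= e.
  have := bdual_cvg setting bh => /cvgr0Pnorm_le/(_ e e0)[T /= T0 H].
  exists (T / 2); first by rewrite divr_gt0.
  move=> s /andP[s0 sT]; have [sp|sp] := ltrP 0 s.
    have := H s; rewrite /ball_/= sub0r normrN (gtr0_norm sp).
    rewrite (ger0_norm (nrm_ge0 _ _)); apply=> //.
    by rewrite (le_lt_trans sT)// ltr_pdivrMr// mulr_natr mulr2n ltrDl.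
  have -> : s = 0 by apply/eqP; rewrite eq_le s0 sp.
  apply: nrm_le_ip => [||g bg]; [|exact: ltW|].
    by apply: bmf_B => //; exact: bmf_bdual.
  have b0 := bmf_bdual inv (lexx 0) bh.
  rewrite (ipBl (L2_bmf mu b0) lh (L2_bmf mu bg)).
  by rewrite (bs_0 (bdual_bounded setting) bh bg) subrr mulr_ge0 ?nrm_ge0// ltW.
have [f [bf fK fint fgen]] := average_exists (bdual_bounded setting) bh hK T0.
have bT := bmf_bdual inv (ltW T0) bh.
exists f, (fun x => T^-1 * (Pd T h x - h x)); split=> //; last split=> //.
- have b1 c : bounded_mfun (cst c : borel E -> R) by exact: bmf_cst.
  have ipc c g : bounded_mfun g -> ip mu g (cst c) = c * mean mu g.
    move=> bg; rewrite -mean_Z; last exact: bmf_L1.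
    by congr mean; apply/funext => x /=; rewrite mulrC.
  have H c : ip mu f (cst c) <= c.
    apply: fint => // s /andP[s0 _].
    by rewrite ipc ?mean_bdual ?h1 ?mulr1//; exact: bmf_bdual.
  have := H 1; have := H (-1); rewrite !ipc// mul1r mulN1r lerN2 => h2 h3.
  by apply/eqP; rewrite eq_le h2 h3.
- by apply: bmf_Z; exact: bmf_B.
- apply: nrm_le_ip => [||g bg]; [exact: bmf_B|exact: ltW|].
  rewrite (ipBl (L2_bmf mu bf) lh (L2_bmf mu bg)) lerBlDr.
  apply: fint => // s sT; have /andP[s0 _] := sT.
  have bs := bmf_bdual inv s0 bh.
  rewrite -lerBlDr -(ipBl (L2_bmf mu bs) lh (L2_bmf mu bg)).
  rewrite (le_trans (ler_norm _))//.
  rewrite (le_trans (ip_le_nrm (L2_bmf mu (bmf_B bs bh)) (L2_bmf mu bg)))//.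
  by rewrite ler_wpM2r ?nrm_ge0// HT.
Qed.

Section Entropy.
Context (p p1 p2 : R -> R) (sc : smooth_convex p p1 p2).
Context (p_ge0 : forall y : R, 0 <= y -> 0 <= p y).

(** The expectation of the Bregman divergence of [a (X_0)] and [b (X_t)]. *)
Lemma mean_bregman_ge0 t a b (K : R) : 0 <= t -> bounded_mfun a -> bounded_mfun b ->
  (forall x, 0 <= a x <= K) -> (forall x, 0 <= b x <= K) ->
  0 <= mean mu (p \o a) - mean mu (p \o b) -
    (joint t a (p1 \o b) - ip mu b (p1 \o b)).
Proof.
move=> t0 ba bb aK bK; have b1 := @bmf_cst _ (borel E) R 1.
have bpa := bmf_cont (sc_cont0 sc) ba aK; have bpb := bmf_cont (sc_cont0 sc) bb bK.
have bqb := bmf_cont (sc_cont1 sc) bb bK.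
have bbq := bmf_M bb bqb.
have := @joint_comb_ge0 _ _ _ _ M mu t
  [:: (1, (p \o a, cst 1)); (-1, (cst 1, p \o b)); (-1, (a, p1 \o b));
      (1, (cst 1, b \* (p1 \o b)))].
rewrite !big_cons big_nil /= joint_1r (joint_1l inv t0 bpb) (joint_1l inv t0 bbq).
have eH : mean mu (p \o a) - mean mu (p \o b) -
    (joint t a (p1 \o b) - ip mu b (p1 \o b)) = 1 * mean mu (p \o a) +
  (-1 * mean mu (p \o b) + (-1 * joint t a (p1 \o b) +
     (1 * mean mu (b \* (p1 \o b)) + 0))).
  by rewrite /ip !mul1r !mulN1r addr0 opprB [in RHS](addrC (- joint _ _ _)) [RHS]addrA.
rewrite eH => H; apply: H => // x y; rewrite !big_cons big_nil /=.
have /andP[a0 _] := aK x; have /andP[b0 _] := bK y.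
have := bregman_ge0 sc a0 b0; rewrite /bregman; congr (_ <= _); ring.
Qed.

(** Jensen's inequality: [P_t^* h (X_t)] is the conditional expectation of
    [h (X_0)] given [X_t]. *)
Lemma entropy_nonincreasing t h (K : R) : 0 <= t -> bounded_mfun h ->
  (forall x, 0 <= h x <= K) -> mean mu (p \o Pd t h) <= mean mu (p \o h).
Proof.
move=> t0 bh hK; have bg := bmf_bdual inv t0 bh; have gK := bdual_itv inv t0 bh hK.
have := mean_bregman_ge0 t0 bh bg hK gK.
rewrite -(bdual_ip inv t0 bh (bmf_cont (sc_cont1 sc) bg gK)).
by rewrite subrr subr0 subr_ge0.
Qed.

Lemma entropy_dist (K : R) : exists2 c, 0 <= c & forall a b,
  bounded_mfun a -> bounded_mfun b ->
  (forall x, 0 <= a x <= K) -> (forall x, 0 <= b x <= K) ->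
  `|mean mu (p \o a) - mean mu (p \o b)| <= c * mean mu (fun x => `|a x - b x|).
Proof.
have [c c0 Hc] := sc_lip0 sc K; exists c => // a b ba bb aK bK.
have bpa := bmf_cont (sc_cont0 sc) ba aK; have bpb := bmf_cont (sc_cont0 sc) bb bK.
have lB := L1_norm (bmf_L1 mu (bmf_B ba bb)).
have lpB := bmf_L1 mu (bmf_B bpa bpb).
rewrite -(mean_B (bmf_L1 mu bpa) (bmf_L1 mu bpb)) -(mean_Z c lB).
rewrite (le_trans (mean_norm lpB))//.
by apply: mean_le; [exact: L1_norm|exact: L1_Z|] => x; exact: Hc.
Qed.

Context (C : R) (C0 : 0 < C).
Context (ineq : forall u (K : R), bounded_mfun u -> (forall x, 0 <= u x <= K) ->
  mean mu u = 1 -> in_dirichlet_domain M mu A u ->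
  mean mu (p \o u) <= C * mean mu (fun x => p2 (u x) * carre M mu A u x)).

(** By convexity the increment of the entropy is bounded by the value of its
    derivative at the end of the time step, which converges to its value at the
    beginning. *)
Lemma entropy_dini u l (K : R) : 0 < K -> bounded_mfun u ->
  (forall x, 0 <= u x <= K) -> mean mu u = 1 -> L2 l -> dual_derivative u l ->
  forall eta, 0 < eta -> \forall e \near (0 : R)^'+,
   mean mu (p \o Pd e u) <=
     mean mu (p \o u) - e * ((2 * C)^-1 * mean mu (p \o u)) + eta * e.
Proof.
move=> K0 bu uK u1 ll cl eta eta0.
have du : in_dirichlet_domain M mu A u by exact: (dual_domain_dirichlet setting bu uK ll cl).
have cG : is_carre_limit M mu A u (carre M mu A u) by apply: getPex.
have diss := dissipation setting sc K0 bu uK ll cl cG.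
have lw : L2 (p1 \o u) by apply: L2_bmf; exact: bmf_cont (sc_cont1 sc) bu uK.
(* negative times, for which the dual semigroup means nothing, are frozen *)
pose uu e := if 0 <= e then Pd e u else u.
have buu e : bounded_mfun (uu e).
  by rewrite /uu; case: ifPn => // e0; exact: bmf_bdual.
have uuK e x : 0 <= uu e x <= K.
  rewrite /uu; case: ifPn => [e0|_]; last exact: uK.
  exact: (bdual_itv inv e0 bu uK x).
have lq e : L2 (fun x => e^-1 * (uu e x - u x)).
  by apply: L2_bmf; apply: bmf_Z; exact: bmf_B.
have cq : nrm mu ((fun x => e^-1 * (uu e x - u x)) \- l) @[e --> (0 : R)^'+] --> 0.
  apply: cvg_trans cl; apply: near_eq_cvg; near=> e.
  have e0 : 0 < e by near: e; exact: nbhs_right_gt.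
  by rewrite /uu (ltW e0).
have bpu e : bounded_mfun (p1 \o uu e) by exact: bmf_cont (sc_cont1 sc) (buu e) (uuK e).
have cp : nrm mu ((p1 \o uu e) \- (p1 \o u)) @[e --> (0 : R)^'+] --> 0.
  have [c c0 Hc] := sc_lip1 sc K.
  have c1 : c * nrm mu (Pd e u \- u) @[e --> (0 : R)^'+] --> c * 0.
    by apply: cvgMr; exact: (bdual_cvg setting).
  rewrite mulr0 in c1; apply: (@squeeze_cvgr _ _ _ _ (cst 0)) c1; last exact: cvg_cst.
  near=> e; have e0 : 0 < e by near: e; exact: nbhs_right_gt.
  rewrite nrm_ge0 /= (_ : Pd e u = uu e); last by rewrite /uu (ltW e0).
  apply: nrm_le_bound => //.
  + exact: L2_meas (L2_B (L2_bmf mu (bpu e)) lw).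
  + exact: (L2_bmf mu (bmf_B (buu e) bu)).
  + by move=> x; exact: Hc.
have c1 : ip mu (p1 \o uu e) (fun x => e^-1 * (uu e x - u x)) @[e --> (0 : R)^'+] -->
    ip mu (p1 \o u) l by apply: (cvg_ip (fun e => L2_bmf mu (bpu e)) lq lw ll cp cq).
near=> e; have e0 : 0 < e by near: e; exact: nbhs_right_gt.
have h1 : ip mu (p1 \o uu e) (fun x => e^-1 * (uu e x - u x)) <=
    ip mu (p1 \o u) l + eta.
  near: e; move: c1 => /cvgrPdist_le/(_ eta eta0); apply: filterS => e.
  by rewrite distrC ler_norml lerBlDl => /andP[].
have -> : Pd e u = uu e by rewrite /uu (ltW e0).
have h2 : mean mu (p \o uu e) - mean mu (p \o u) <=
    e * ip mu (p1 \o uu e) (fun x => e^-1 * (uu e x - u x)).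
  have bpe := bmf_cont (sc_cont0 sc) (buu e) (uuK e).
  have bp0 := bmf_cont (sc_cont0 sc) bu uK.
  rewrite -(mean_B (bmf_L1 mu bpe) (bmf_L1 mu bp0)) -mean_Z; last first.
    by apply: bmf_L1; apply: bmf_M => //; apply: bmf_Z; exact: bmf_B.
  apply: mean_le.
  + exact: (bmf_L1 mu (bmf_B bpe bp0)).
  + by apply: bmf_L1; apply: bmf_Z; apply: bmf_M => //; apply: bmf_Z; exact: bmf_B.
  move=> x /=; rewrite mulrCA (mulrA e) divff ?gt_eqF// mul1r.
  have /andP[u0 _] := uK x; have /andP[uu0 _] := uuK e x.
  have := bregman_ge0 sc u0 uu0; rewrite /bregman.
  exact: bregman_arith.
have h3 := ineq bu uK u1 du.
rewrite (ipC mu l) in diss.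
exact: (dini_arith C0 e0 h1 h2 h3 diss).
Unshelve. all: by end_near. Qed.

(** The regularized densities satisfy the differential inequality at all times;
    entropies are continuous for the L1 distance on densities bounded by [K]. *)
Lemma entropy_decay_bounded h (K : R) : bounded_mfun h -> (forall x, 0 <= h x <= K) ->
  mean mu h = 1 -> forall t, 0 <= t ->
  mean mu (p \o Pd t h) <= expR (- ((2 * C)^-1 * t)) * mean mu (p \o h).
Proof.
move=> bh hK h1 t t0.
have K0 : 0 < K.
  rewrite ltNge; apply/negP => K0; have : mean mu h <= mean mu (cst 0).
    apply: mean_le; [exact: bmf_L1|exact: L1_cst|] => x /=.
    by have /andP[_ /le_trans->] := hK x.
  by rewrite h1 mean_cst ler10.
have [c c0 Hc] := entropy_dist K.
have e0 := expR_ge0 (- ((2 * C)^-1 * t)).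
apply: (@le_addeps _ _ _ (c + expR (- ((2 * C)^-1 * t)) * c)).
  by rewrite addr_ge0 ?mulr_ge0.
move=> e ep; have [f [l [bf fK f1 bl [fl fh]]]] := regular_density bh hK h1 ep.
have lf := L2_bmf mu bf; have lh := L2_bmf mu bh.
have fh1 : mean mu (fun x => `|f x - h x|) <= e.
  by rewrite (le_trans (mean_norm_le_nrm (L2_B lf lh))).
have dec : mean mu (p \o Pd t f) <=
    expR (- ((2 * C)^-1 * t)) * mean mu (p \o f).
  have k0 : 0 <= (2 * C)^-1 by rewrite invr_ge0 mulr_ge0// ltW.
  have I0 : mean mu (p \o Pd 0 f) <= mean mu (p \o f).
    exact: entropy_nonincreasing (lexx 0) bf fK.
  apply: (le_trans (dini_exp_decay (I := fun s => mean mu (p \o Pd s f)) k0 _ _ _ t0)).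
  - move=> s s0; apply: mean_ge0 => x; apply: p_ge0.
    by have /andP[] := bdual_itv inv s0 bf fK x.
  - move=> s r s0 sr; have r0 : 0 <= r - s by rewrite subr_ge0.
    have bs := bmf_bdual inv s0 bf; have sK := bdual_itv inv s0 bf fK.
    apply: le_trans (entropy_nonincreasing r0 bs sK).
    rewrite le_eqVlt; apply/orP; left; apply/eqP.
    have brs := bmf_bdual inv r0 bs; have rsK := bdual_itv inv r0 bs sK.
    have br := bmf_bdual inv (le_trans s0 sr) bf.
    have rK := bdual_itv inv (le_trans s0 sr) bf fK.
    have [m1 _] := bmf_cont (sc_cont0 sc) br rK.
    have [m2 _] := bmf_cont (sc_cont0 sc) brs rsK.
    apply: mean_ae => //; have := bdual_add_ae s0 r0 bf; apply: filterS => x.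
    by rewrite addrC subrK /= => ->.
  - move=> s eta s0 eta0.
    have bs := bmf_bdual inv s0 bf; have sK := bdual_itv inv s0 bf fK.
    have s1 : mean mu (Pd s f) = 1 by rewrite mean_bdual.
    have sl := L2_bmf mu (bmf_bdual inv s0 bl).
    have ds := dual_derivative_shift s0 bf bl fl.
    have := entropy_dini K0 bs sK s1 sl ds eta0; apply: filter_app.
    near=> r; have r0 : 0 <= r by apply: ltW; near: r; exact: nbhs_right_gt.
    move=> /(le_trans _); apply; rewrite le_eqVlt; apply/orP; left; apply/eqP.
    have brs := bmf_bdual inv r0 bs; have rsK := bdual_itv inv r0 bs sK.
    have br := bmf_bdual inv (addr_ge0 s0 r0) bf.
    have rK := bdual_itv inv (addr_ge0 s0 r0) bf fK.
    have [m1 _] := bmf_cont (sc_cont0 sc) br rK.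
    have [m2 _] := bmf_cont (sc_cont0 sc) brs rsK.
    apply: mean_ae => //; have := bdual_add_ae s0 r0 bf; apply: filterS => x.
    by rewrite /= => ->.
  by rewrite ler_wpM2l.
have btf := bmf_bdual inv t0 bf; have btfK := bdual_itv inv t0 bf fK.
have bth := bmf_bdual inv t0 bh; have bthK := bdual_itv inv t0 bh hK.
have d1 : mean mu (p \o Pd t h) <= mean mu (p \o Pd t f) + c * e.
  rewrite -lerBlDl (le_trans (ler_norm _))// distrC.
  rewrite (le_trans (Hc _ _ btf bth btfK bthK))// ler_wpM2l//.
  by rewrite (le_trans (bdual_dist t0 bf bh)).
have d2 : mean mu (p \o f) <= mean mu (p \o h) + c * e.
  rewrite -lerBlDl (le_trans (ler_norm _))//.
  by rewrite (le_trans (Hc _ _ bf bh fK hK))// ler_wpM2l.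
exact: (decay_arith e0 d1 dec d2).
Unshelve. all: by end_near. Qed.

End Entropy.
End Decay.

(** * Truncation of densities *)

Section Fatou.
Context d (T : measurableType d) (R : realType) (mu : probability T R).
Implicit Types f g h : T -> R.
Local Notation L1 f := (mu.-integrable setT (EFin \o f)).

Lemma fatou_le (f_ : nat -> T -> R) f (c : \bar R) :
  (forall n, measurable_fun setT (f_ n)) -> (forall n x, 0 <= f_ n x) ->
  measurable_fun setT f -> {ae mu, forall x, f_ n x @[n --> \oo] --> f x} ->
  (forall n, (\int[mu]_x (f_ n x)%:E <= c)%E) ->
  (\int[mu]_x (f x)%:E <= c)%E.
Proof.
move=> mf_ f0 mf cf fc.
have mEf n : measurable_fun setT (EFin \o f_ n) by exact/measurable_EFinP.
have := @fatou _ _ R mu setT measurableT (fun n => EFin \o f_ n) mEf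
  (fun n x _ => f0 n x).
have -> : (\int[mu]_x limn_einf ((fun n => EFin \o f_ n) ^~ x) = \int[mu]_x (f x)%:E)%E.
  apply: ae_eq_integral => //.
  - rewrite (_ : (fun x => _) = (fun x => - limn_esup (fun n => - (f_ n x)%:E))%E)//.
    apply: measurableT_comp => //.
    apply: (@measurable_fun_limn_esup _ _ R setT (fun n x => - (f_ n x)%:E)%E) => n.
    have mN : measurable_fun setT (EFin \o (fun x => - f_ n x)).
      by apply/measurable_EFinP; exact: measurableT_comp.
    exact: mN.
  - exact/measurable_EFinP.
  - apply: filterS cf => x cx _.
    have cE : (EFin \o f_ n) x @[n --> \oo] --> (f x)%:E.
      by apply: cvg_EFin; [exact: nearW|exact: cx].
    by rewrite is_cvg_limn_einfE; [exact: cvg_lim cE|apply/cvg_ex; eexists; exact: cE].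
move=> /le_trans; apply; rewrite limn_einf_lim; apply: lime_le.
  exact: is_cvg_einfs.
apply: nearW => n; rewrite /einfs (le_trans _ (fc n))//.
by apply: ereal_inf_lbound; exists n => /=.
Qed.

Lemma ae_indic0 (B : set T) : measurable B -> mean mu \1_B = 0 ->
  {ae mu, forall x, \1_B x = 0 :> R}.
Proof.
move=> mB B0; have lB := bmf_L1 mu (@bmf_indic _ _ R _ mB).
apply: mean_norm0_ae => //; rewrite -B0; congr mean; apply/funext => x.
by rewrite ger0_norm// indicE.
Qed.

Definition conditional_mean (h : T -> R) (B : set T) : R :=
  mean mu (h \* \1_B) / mean mu \1_B.

(** Replacing [h] by its mean on [B] preserves the mean, and lowers the
    entropy by Jensen's inequality. *)
Definition levelled h (B : set T) : T -> R :=
  h \+ (fun x => (conditional_mean h B - h x) * \1_B x).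

Lemma conditional_meanE h B : L1 h -> measurable B ->
  conditional_mean h B * mean mu \1_B = mean mu (h \* \1_B).
Proof.
move=> lh mB; rewrite /conditional_mean.
have bB := @bmf_indic _ _ R _ mB.
have [B0|B0] := eqVneq (mean mu \1_B) 0; last by rewrite divfK.
rewrite B0 mulr0 -[LHS](mean_cst mu 0); apply: mean_ae => //.
  by apply: measurable_funM; [exact: L1_meas lh|case: bB].
by have := ae_indic0 mB B0; apply: filterS => x /= ->; rewrite mulr0.
Qed.

Lemma levelled_L1 h B : L1 h -> measurable B ->
  L1 (fun x => (conditional_mean h B - h x) * \1_B x).
Proof.
move=> lh mB; have bB := @bmf_indic _ _ R _ mB.
have := L1_M bB (L1_B (L1_cst mu (conditional_mean h B)) lh).
by congr (mu.-integrable _ (EFin \o _)); apply/funext => x /=; rewrite mulrC.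
Qed.

Lemma levelled_correction h B : L1 h -> measurable B ->
  mean mu (fun x => (conditional_mean h B - h x) * \1_B x) = 0.
Proof.
move=> lh mB; have bB := @bmf_indic _ _ R _ mB.
have lB := bmf_L1 mu bB; have lhB := L1_M bB lh.
have lhB' : L1 (h \* \1_B).
  by move: lhB; congr (mu.-integrable _ (EFin \o _)); apply/funext => x /=; rewrite mulrC.
rewrite (_ : (fun x => _) = (fun x => conditional_mean h B * \1_B x) \- (h \* \1_B)).
  by rewrite mean_B ?mean_Z ?conditional_meanE ?subrr//; exact: L1_Z.
by apply/funext => x /=; rewrite mulrBl.
Qed.

Lemma mean_flatten h B : L1 h -> measurable B -> mean mu (levelled h B) = mean mu h.
Proof.
move=> lh mB; rewrite mean_D ?levelled_correction ?addr0//; exact: levelled_L1.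
Qed.

Lemma conditional_mean_ge0 h B : (forall x, 0 <= h x) -> 0 <= conditional_mean h B.
Proof.
move=> h0; rewrite divr_ge0 ?mean_ge0// => x; rewrite ?mulr_ge0//; by rewrite indicE.
Qed.

Lemma levelled_dist h B : L1 h -> (forall x, 0 <= h x) -> measurable B ->
  mean mu (fun x => `|levelled h B x - h x|) <= 2 * mean mu (h \* \1_B).
Proof.
move=> lh h0 mB; have bB := @bmf_indic _ _ R _ mB.
have m0 := conditional_mean_ge0 B h0; set m := conditional_mean h B in m0 *.
have lB := bmf_L1 mu bB; have lhB := L1_M bB lh.
have lhB' : L1 (h \* \1_B).
  by move: lhB; congr (mu.-integrable _ (EFin \o _)); apply/funext => x /=; rewrite mulrC.
have -> : 2 * mean mu (h \* \1_B) = mean mu ((h \* \1_B) \+ (fun x => m * \1_B x)).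
  rewrite mean_D//; last exact: L1_Z.
  by rewrite mean_Z// conditional_meanE// mulr_natl mulr2n.
apply: mean_le.
- have := L1_norm (levelled_L1 lh mB); congr (mu.-integrable _ (EFin \o _)).
  by apply/funext => x; rewrite /levelled /= [h x + _]addrC addrK.
- by apply: L1_D => //; exact: L1_Z.
- move=> x; rewrite /levelled /= [h x + _]addrC addrK normrM.
  have i0 : 0 <= (\1_B x : R) by rewrite indicE.
  rewrite (ger0_norm i0) -mulrDl ler_wpM2r//.
  by rewrite (le_trans (ler_normB _ _))// !ger0_norm// addrC.
Qed.

Lemma levelled_entropy p p1 p2 h B : smooth_convex p p1 p2 -> L1 h ->
  (forall x, 0 <= h x) -> L1 (p \o h) -> L1 (p \o levelled h B) -> measurable B ->
  mean mu (p \o levelled h B) <= mean mu (p \o h).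
Proof.
move=> sc lh h0 lph lpf mB; set m := conditional_mean h B.
have m0 : 0 <= m := conditional_mean_ge0 B h0.
have lc := levelled_L1 lh mB.
have -> : mean mu (p \o h) =
  mean mu ((p \o h) \+ (fun x => p1 m * ((m - h x) * \1_B x))).
  rewrite (mean_D lph (L1_Z _ lc)) (mean_Z _ lc) levelled_correction//.
  by rewrite mulr0 addr0.
apply: mean_le => //; first exact: L1_D lph (L1_Z _ lc).
move=> x; rewrite /levelled /= -/m indicE; case: (x \in B); last first.
  by rewrite mulr0 addr0 mulr0 addr0.
rewrite mulr1 addrC subrK.
have := bregman_ge0 sc (h0 x) m0; rewrite /bregman => H.
by rewrite -lerBlDl; exact: bregman_arith H.
Qed.

End Fatou.

Section GeneralDecay.
Context (R : realType) (dO : measure_display) (Omega : measurableType dO).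
Context (E : puniformType) (M : markov_process R Omega E).
Context (mu : probability (borel E) R) (A : set (E -> R)).
Context (setting : standing_assumptions M mu A).
Implicit Types (f g h u v G : borel E -> R) (x : borel E) (t s : R).

Local Notation Pdual := (dual_semigroup M mu).
Local Notation Pd := (bdual M mu).
Local Notation L1 f := (mu.-integrable setT (EFin \o f)).

Let inv : Defs.invariant M mu := mu_invariant setting.

Lemma density_L1 h : is_density mu h -> L1 h /\ mean mu h = 1.
Proof.
move=> [mh h0 h1]; have lh : L1 h.
  apply/integrableP; split; first exact/measurable_EFinP.
  rewrite (eq_integral (fun x => (h x)%:E)) ?h1 ?ltry// => x _.
  by rewrite gee0_abs// lee_fin.
by split=> //; apply: EFin_inj; rewrite -mean_EFin.
Qed.

(** [h] is levelled off where it exceeds [n]: its entropy does not increase, its L1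
    distance to [h] vanishes, and Fatou's lemma transports the bound to [h]. *)
Lemma entropy_decay p p1 p2 t k h : smooth_convex p p1 p2 ->
  (forall y : R, 0 <= y -> 0 <= p y) -> 0 <= t -> 0 <= k ->
  (forall u (K : R), bounded_mfun u -> (forall x, 0 <= u x <= K) -> mean mu u = 1 ->
     mean mu (p \o Pd t u) <= k * mean mu (p \o u)) ->
  is_density mu h -> L1 (p \o h) ->
  (\int[mu]_x (p (Pdual t h x))%:E <= (k * mean mu (p \o h))%:E)%E.
Proof.
move=> sc p0 t0 k0 Hb dh lph; have [lh h1] := density_L1 dh.
have [mh h0 _] := dh.
pose B n := [set x | n%:R < h x].
have mB n : measurable (B n).
  rewrite -[B n]setTI (_ : _ `&` _ = setT `&` h @^-1` `]n%:R, +oo[%classic).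
    exact: mh.
  by congr (_ `&` _); apply/seteqP; split=> x /=; rewrite in_itv/= andbT.
pose hn n := levelled mu h (B n).
pose K n := Num.max n%:R (conditional_mean mu h (B n)).
have m0 n := conditional_mean_ge0 mu (B n) h0.
have hnK n x : 0 <= hn n x <= K n.
  rewrite /hn /levelled /= indicE /K; case: (boolP (x \in B n)) => xB.
    by rewrite mulr1 addrC subrK m0 le_max lexx orbT.
  rewrite mulr0 addr0 h0 le_max /=; move: xB; rewrite notin_setE /B /= => /negP.
  by rewrite -leNgt => ->.
have lhn n : L1 (hn n) by apply: L1_D => //; exact: levelled_L1.
have bhn n : bounded_mfun (hn n).
  split; first exact: L1_meas (lhn n).
  by exists (K n) => x; have /andP[h2 h3] := hnK n x; rewrite ger0_norm.
have hn1 n : mean mu (hn n) = 1 by rewrite mean_flatten.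
have chn : mean mu (fun x => `|hn n x - h x|) @[n --> \oo] --> 0.
  have [|||||_ c] := @mean_dominated _ _ R mu (fun n => h \* \1_(B n)) (cst 0) h.
  - by move=> n; apply: measurable_funM => //; case: (@bmf_indic _ _ R _ (mB n)).
  - by [].
  - exact: lh.
  - apply: aeW => x; apply: (@cvg_trans _ (cst 0 @ \oo)); last exact: cvg_cst.
    apply: near_eq_cvg; near=> n; rewrite /= indicE memNset ?mulr0// /B /=.
    apply/negP; rewrite -leNgt; near: n; exact: nbhs_infty_ger.
  - move=> n x; rewrite /= normrM ger0_norm// indicE.
    by case: (_ \in _); rewrite ?normr1 ?normr0 ?mulr1 ?mulr0.
  rewrite mean_cst in c.
  have c2 : (2 : R) * mean mu (h \* \1_(B n)) @[n --> \oo] --> (2 : R) * 0 by exact: cvgMr.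
  rewrite mulr0 in c2; apply: (@squeeze_cvgr _ _ _ _ (cst 0)) c2; last exact: cvg_cst.
  by apply: nearW => n; rewrite mean_ge0//= levelled_dist.
have lP := dual_L1 inv t0 lh.
have lPn n := dual_L1 inv t0 (lhn n).
have cPn : mean mu (fun x => `|Pdual t (hn n) x - Pdual t h x|) @[n --> \oo] --> 0.
  apply: (@squeeze_cvgr _ _ _ _ (cst 0)) chn; last exact: cvg_cst.
  by apply: nearW => n; rewrite mean_ge0//=; exact: dual_dist.
have [s [_ sae]] := L1_cvg_ae_subseq lPn lP cPn.
have hn0 n x : 0 <= hn n x by have /andP[] := hnK n x.
have mpP f : L1 f -> measurable_fun setT (p \o f).
  by move=> /L1_meas mf; apply: measurable_cont => //; exact: sc_cont0 sc.
apply: (fatou_le (f_ := fun n => p \o Pdual t (hn (s n)))).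
- by move=> n; exact: mpP.
- by move=> n x; apply: p0; exact: dual_ge0.
- exact: mpP.
- apply: filterS sae => x cx; apply: continuous_cvg => //; exact: (sc_cont0 sc).
- move=> n; have bP := bmf_bdual inv t0 (bhn (s n)).
  have PK := bdual_itv inv t0 (bhn (s n)) (hnK (s n)).
  have bpP := bmf_cont (sc_cont0 sc) bP PK.
  have -> : (\int[mu]_x (p (Pdual t (hn (s n)) x))%:E =
    \int[mu]_x (p (Pd t (hn (s n)) x))%:E)%E.
    apply: ae_eq_integral => //.
    + by apply/measurable_EFinP; exact: mpP.
    + by apply/measurable_EFinP; case: bpP.
    + by have := bdual_ae inv t0 (bhn (s n)); apply: filterS => x -> _.
  rewrite (mean_EFin (bmf_L1 mu bpP)) lee_fin.
  rewrite (le_trans (Hb _ _ (bhn (s n)) (hnK (s n)) (hn1 (s n))))//.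
  rewrite ler_wpM2l// (levelled_entropy sc)//.
  exact: bmf_L1 (bmf_cont (sc_cont0 sc) (bhn (s n)) (hnK (s n))).
Unshelve. all: by end_near. Qed.

End GeneralDecay.

(** * From exponential decay to the functional inequality *)

(** Same decomposition as in [dissipation_pointwise], for [bregman_upper]. *)
Lemma production_pointwise (R : realType) (pa pb qb a b g v z tau C : R) :
  -1 * (pa * 1) + (1 * (1 * pb) + (1 * (a * qb) + (-1 * (1 * (b * qb)) +
  (1 / 2 * (g * (v * v) * 1) + (-1 * (g * v * z) + (1 / 2 * (g * (z * z)) +
  (tau * (1 * (v * v) * 1) + (- 2 * tau * (1 * v * z) + (tau * (1 * (z * z)) +
  (C * (v * v * v * v * 1) + (- 4 * C * (v * v * v * z) +
  (6 * C * (v * v * (z * z)) + (- 4 * C * (v * (z * z * z)) +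
   (C * (1 * (z * z * z * z)) + 0)))))))))))))) =
  1 / 2 * g * (v - z) ^+ 2 + tau * (v - z) ^+ 2 + C * (v - z) ^+ 4 -
  (pa - pb - qb * (a - b)).
Proof. by field. Qed.

Lemma production_joint (R : realType)
  (mp j i q1 q2 q3 r1 r2 r3 k1 k2 k3 k4 k5 tau C : R) :
  -1 * mp + (1 * mp + (1 * j + (-1 * i +
  (1 / 2 * q1 + (-1 * q2 + (1 / 2 * q3 +
  (tau * r1 + (- 2 * tau * r2 + (tau * r3 +
  (C * k1 + (- 4 * C * k2 + (6 * C * k3 + (- 4 * C * k4 + (C * k5 + 0)))))))))))))) =
  1 / 2 * (q1 - 2 * q2 + q3) + tau * (r1 - 2 * r2 + r3) +
   C * (k1 - 4 * k2 + 6 * k3 - 4 * k4 + k5) - (i - j).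
Proof. by field. Qed.

Lemma exp_rate (R : realType) (k t I J : R) : 0 < k -> 0 < t -> 0 <= I ->
  J <= expR (- (k * t)) * I -> k * I <= (1 + k * t) * (t^-1 * (I - J)).
Proof.
move=> k0 t0 I0 HJ; have kt0 : 0 < k * t by rewrite mulr_gt0.
have kt1 : 0 < 1 + k * t by rewrite addr_gt0.
have h : expR (- (k * t)) <= (1 + k * t)^-1.
  by rewrite expRN lef_pV2 ?posrE ?expR_gt0//; exact: expR_ge1Dx.
have {}HJ : J <= (1 + k * t)^-1 * I by rewrite (le_trans HJ)// ler_wpM2r.
rewrite [leRHS]mulrCA -(ler_pM2l t0) [leRHS]mulrA divff ?gt_eqF// mul1r.
rewrite mulrBr; have := ler_wpM2l (ltW kt1) HJ.
rewrite mulrA divff ?gt_eqF// mul1r => h2.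
rewrite (le_trans _ (lerB (lexx _) h2))// mulrDl mul1r [leRHS]addrAC subrr add0r.
by rewrite mulrA (mulrC t).
Qed.

Lemma half_dist (R : realType) (m : R) : `|1 - m| <= 1 / 2 -> 1 / 2 <= m.
Proof. by rewrite ler_norml => /andP[_]; lra. Qed.

Section Production.
Context (R : realType) (dO : measure_display) (Omega : measurableType dO).
Context (E : puniformType) (M : markov_process R Omega E).
Context (mu : probability (borel E) R) (A : set (E -> R)).
Context (setting : standing_assumptions M mu A).
Implicit Types (f g h u v G : borel E -> R) (x : borel E) (t s : R).

Local Notation P := (semigroup M).
Local Notation Pd := (bdual M mu).
Local Notation Gamma := (carre_du_champ mu P).
Local Notation L1 f := (mu.-integrable setT (EFin \o f)).
Local Notation L2 f := (f \in Lfun mu 2%:E).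
Local Notation joint := (joint M mu).
Local Notation energy := (energy M mu).

Let inv : Defs.invariant M mu := mu_invariant setting.

Context (p p1 p2 : R -> R) (sc : smooth_convex p p1 p2).
Context (p_ge0 : forall y : R, 0 <= y -> 0 <= p y).
Context (C : R) (C0 : 0 < C).
Context (decay : forall u (K : R), bounded_mfun u -> (forall x, 0 <= u x <= K) ->
  mean mu u = 1 -> forall t, 0 <= t ->
  mean mu (p \o Pd t u) <= expR (- ((2 * C)^-1 * t)) * mean mu (p \o u)).

(** Convexity at [w]; the right-hand side is the expectation of the Bregman
    divergence of [w (X_0)] and [w (X_t)]. *)
Lemma entropy_drop t w (K : R) : 0 <= t -> bounded_mfun w ->
  (forall x, 0 <= w x <= K) ->
  mean mu (p \o w) - mean mu (p \o Pd t w) <=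
  ip mu w (p1 \o w) - joint t w (p1 \o w).
Proof.
move=> t0 bw wK; have bg := bmf_bdual inv t0 bw; have gK := bdual_itv inv t0 bw wK.
have bq := bmf_cont (sc_cont1 sc) bw wK.
have bpw := bmf_cont (sc_cont0 sc) bw wK; have bpg := bmf_cont (sc_cont0 sc) bg gK.
rewrite -(bdual_ip inv t0 bw bq).
rewrite -(ipBl (L2_bmf mu bw) (L2_bmf mu bg) (L2_bmf mu bq)).
rewrite -(mean_B (bmf_L1 mu bpw) (bmf_L1 mu bpg)).
apply: mean_le; [exact/bmf_L1/bmf_B|by apply: bmf_L1; apply: bmf_M => //; exact: bmf_B|].
move=> x /=; have /andP[w0 _] := wK x; have /andP[g0 _] := gK x.
rewrite [leRHS]mulrC; have := bregman_ge0 sc g0 w0; rewrite /bregman.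
exact: bregman_arith.
Qed.

(** The decay is differentiated at time 0: to first order in [t], the expectation
    of the Bregman divergence is bounded by that of its quadratic upper bound. *)
Lemma production_algebra v (phi phi1 : R -> R) : A v -> continuous phi1 ->
  (forall y : R, is_derive y 1 phi (phi1 y)) -> (forall y, 0 <= phi y) ->
  mean mu (phi \o v) = 1 ->
  mean mu (p \o phi \o v) <=
  C * ip mu (fun x => p2 (phi (v x)) * phi1 (v x) ^+ 2) (Gamma v v).
Proof.
move=> Av cphi1 dphi phi0 m1; have bv := algebra_bmf setting Av.
have [mv [V vV]] := bv.
have cphi : continuous phi.
  by move=> y; apply: differentiable_continuous; apply/derivable1_diffP; have [] := dphi y.
have b1 := @bmf_cst _ (borel E) R 1.
have bcomp (f : R -> R) : continuous f -> bounded_mfun (f \o v).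
  move=> cf; split; first exact: measurable_cont.
  have [K' _ fK] := bounded_itv (- V) V cf.
  by exists K' => x; apply: fK; rewrite in_itv/= -ler_norml.
pose w := phi \o v.
have bw : bounded_mfun w by exact: bcomp.
have [_ [K wK']] := bw.
have wK x : 0 <= w x <= K by rewrite phi0 /= (le_trans (ler_norm _)).
pose g x := p2 (phi (v x)) * phi1 (v x) ^+ 2.
have bg : bounded_mfun g.
  apply: (bcomp (fun y => p2 (phi y) * phi1 y ^+ 2)) => y.
  apply: cvgM; first by apply: continuous_comp; [exact: cphi|exact: sc_cont2 sc _].
  rewrite expr2 (_ : (fun y => _) = (fun y => phi1 y * phi1 y)).
    by apply: cvgM; exact: cphi1.
  by apply/funext => z; rewrite expr2.
have bpw := bmf_cont (sc_cont0 sc) bw wK.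
have bq := bmf_cont (sc_cont1 sc) bw wK.
pose I := mean mu (p \o w).
have I0 : 0 <= I by apply: mean_ge0 => x; apply: p_ge0; exact: phi0.
have k0 : 0 < (2 * C)^-1 by rewrite invr_gt0 mulr_gt0.
suff H : 0 <= 1 / 2 * ip mu g (Gamma v v) - (2 * C)^-1 * I.
  have {}H : (2 * C)^-1 * I <= 1 / 2 * ip mu g (Gamma v v) by rewrite -subr_ge0.
  move: H; rewrite div1r invfM -mulrA ler_pM2l ?invr_gt0// => H.
  by rewrite -ler_pdivrMl.
apply: (@vanishing_perturbation _ _ (energy v)) => tau tau0.
have [C' C'0 HC] := bregman_upper sc V cphi1 dphi phi0 tau0.
have bvv := bmf_M bv bv; have b1vv := bmf_M b1 bvv; have b1v := bmf_M b1 bv.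
have bvvv := bmf_M bvv bv; have bvvvv := bmf_M bvvv bv.
have bgv := bmf_M bg bv; have bgvv := bmf_M bg bvv; have bwq := bmf_M bw bq.
pose s : seq (R * ((borel E -> R) * (borel E -> R))) :=
  [:: (-1, (p \o w, cst 1)); (1, (cst 1, p \o w)); (1, (w, p1 \o w));
   (-1, (cst 1, w \* (p1 \o w)));
   (1 / 2, (g \* (v \* v), cst 1)); (-1, (g \* v, v)); (1 / 2, (g, v \* v));
   (tau, (cst 1 \* (v \* v), cst 1)); (- 2 * tau, (cst 1 \* v, v));
   (tau, (cst 1, v \* v));
   (C', (v \* v \* v \* v, cst 1)); (- 4 * C', (v \* v \* v, v));
   (6 * C', (v \* v, v \* v)); (- 4 * C', (v, v \* v \* v));
   (C', (cst 1, v \* v \* v \* v))].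
have Hs t : 0 <= \sum_(p <- s) p.1 * joint t p.2.1 p.2.2.
  apply: joint_comb_ge0.
    by rewrite /s /=; do !split=> //.
  move=> x y; rewrite /s !big_cons big_nil.
  have H := HC (v x) (v y) (vV x) (vV y).
  have -> := production_pointwise (p (w x)) (p (w y)) (p1 (w y)) (w x) (w y) (g x)
    (v x) (v y) tau C'.
  by rewrite subr_ge0.
have c1 := quad_cvg setting bg Av.
have c2 := quad_cvg setting b1 Av.
have c3 := quart_cvg setting Av.
have c4 : 1 + (2 * C)^-1 * t @[t --> (0 : R)^'+] --> 1 + (2 * C)^-1 * 0.
  apply: cvgD; first exact: cvg_cst.
  by apply: cvgMr; apply: cvg_at_right_filter; exact: cvg_id.
have c : (1 + (2 * C)^-1 * t) * (1 / 2 * (t^-1 * quad M mu t g v) +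
    tau * (t^-1 * quad M mu t (cst 1) v) + C' * (t^-1 * quart M mu t v))
    @[t --> (0 : R)^'+] --> (1 + (2 * C)^-1 * 0) *
    (1 / 2 * ip mu g (Gamma v v) + tau * ip mu (cst 1) (Gamma v v) + C' * 0).
  apply: cvgM => //; apply: cvgD; last exact: cvgMr.
  by apply: cvgD; exact: cvgMr.
have ec : (1 + (2 * C)^-1 * 0) * (1 / 2 * ip mu g (Gamma v v) +
    tau * ip mu (cst 1) (Gamma v v) + C' * 0) =
    1 / 2 * ip mu g (Gamma v v) + tau * energy v.
  by rewrite !mulr0 !addr0 [LHS]mul1r (ipC _ (cst 1)) ip_mul1.
rewrite ec in c.
rewrite addrAC subr_ge0 -(cvg_lim (@Rhausdorff R) c); apply: limr_ge.
  by apply/cvg_ex; eexists; exact: c.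
near=> t; have t0 : 0 < t by near: t; exact: nbhs_right_gt.
have dec := decay bw wK m1 (ltW t0).
have h1 := exp_rate k0 t0 I0 dec.
rewrite (le_trans h1)// ler_pM2l ?addr_gt0 ?mulr_gt0//.
have h2 := entropy_drop (ltW t0) bw wK.
have := Hs t; rewrite /s !big_cons big_nil /=.
have J1 f : joint t f (cst 1) = mean mu f by exact: joint_1r.
have J2 f : bounded_mfun f -> joint t (cst 1) f = mean mu f.
  by move=> bf; rewrite (joint_1l inv (ltW t0) bf).
rewrite (J1 (p \o w)) (J2 _ bpw) (J2 _ bwq) production_joint subr_ge0 => h3.
have h4 := le_trans h2 h3.
rewrite mulrCA (mulrCA tau) (mulrCA C') -!mulrDr ler_pM2l ?invr_gt0//.
Unshelve. all: by end_near. Qed.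

(** Passing to the limit along an approximating sequence [a] of [h]; the
    densities [phi (a n)] are renormalized. *)
Lemma production_limit h G a (phi phi1 : R -> R) (B : R) :
  carre_sequence M mu A h G a -> continuous phi1 ->
  (forall y : R, is_derive y 1 phi (phi1 y)) -> (forall y : R, 0 <= phi y <= B) ->
  (forall y : R, `|phi1 y| <= B) -> mean mu (phi \o h) = 1 ->
  mean mu (p \o phi \o h) <=
  C * mean mu (fun x => p2 (phi (h x)) * phi1 (h x) ^+ 2 * G x).
Proof.
move=> ca cphi1 dphi phiB phi1B m1.
have B0 : 0 <= B by rewrite (le_trans _ (phi1B 0)).
have Aa := cs_alg ca; have lh := cs_L2 ca; have lG := cs_L1 ca.
have mh := L2_meas lh.
have cphi : continuous phi.
  by move=> y; apply: differentiable_continuous; apply/derivable1_diffP; have [] := dphi y.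
have ma n : measurable_fun setT (a n) by have [] := algebra_bmf setting (Aa n).
have mphi n : measurable_fun setT (phi \o a n) by exact: measurable_cont.
have phin (x : R) : `|phi x| <= B by have /andP[h1 h2] := phiB x; rewrite ger0_norm.
pose m n := mean mu (phi \o a n).
have cm : m n @[n --> \oo] --> (1 : R).
  rewrite -m1; have [|||||//] := @mean_dominated _ _ R mu (fun n => phi \o a n)
    (phi \o h) (cst B).
  - by [].
  - exact: measurable_cont.
  - exact: L1_cst.
  - by apply: filterS (cs_ae ca) => x cx; apply: continuous_cvg => //; exact: cphi.
  - by move=> n x; exact: phin.
have mhalf : \forall n \near \oo, 1 / 2 <= m n.
  have h2 : 0 < (1 / 2 : R) by rewrite divr_gt0.
  move: cm => /cvgrPdist_le/(_ _ h2); apply: filterS => n.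
  exact: half_dist.
(* equal to [(m n)^-1] for large [n], and bounded for all [n] *)
pose c n := (Num.max (1 / 2) (m n))^-1.
have M0 n : 0 < Num.max (1 / 2) (m n) by rewrite lt_max divr_gt0.
have c0 n : 0 < c n by rewrite invr_gt0.
have c2 n : c n <= 2.
  by rewrite /c invf_ple ?posrE// le_max div1r lexx.
have cc : c n @[n --> \oo] --> (1 : R).
  rewrite -[X in _ --> X]invr1; apply: cvgV; first exact: oner_neq0.
  apply: cvg_trans cm; apply: near_eq_cvg; near=> n.
  by rewrite (max_idPr _)//; near: n.
have cae : {ae mu, forall x, c n * phi (a n x) @[n --> \oo] --> phi (h x)}.
  apply: filterS (cs_ae ca) => x cx; rewrite -[X in _ --> X]mul1r.
  by apply: cvgM => //; apply: continuous_cvg => //; exact: cphi.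
have cphiB n x : 0 <= c n * phi (a n x) <= 2 * B.
  have /andP[h1 h2] := phiB (a n x).
  by rewrite mulr_ge0 ?(ltW (c0 n))//= ler_pM// ltW.
have [Kp _ HKp] := bounded_itv 0 (2 * B) (sc_cont0 sc).
have [K2 K20 HK2] := bounded_itv 0 (2 * B) (sc_cont2 sc).
have mcphi n : measurable_fun setT (fun x => c n * phi (a n x)) by apply: (measurable_funM (measurable_cst _) (mphi n)).
have cL : mean mu (fun x => p (c n * phi (a n x))) @[n --> \oo] -->
    mean mu (p \o phi \o h).
  have [|||||//] := @mean_dominated _ _ R mu (fun n x => p (c n * phi (a n x)))
    (p \o phi \o h) (cst Kp).
  - by move=> n; apply: (measurable_cont (sc_cont0 sc) (mcphi n)).
  - by apply: (measurable_cont (sc_cont0 sc)); exact: measurable_cont.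
  - exact: L1_cst.
  - apply: filterS cae => x cx; apply: continuous_cvg => //; exact: (sc_cont0 sc).
  - by move=> n x; apply: HKp; rewrite in_itv/= cphiB.
have cR : mean mu ((fun x => p2 (c n * phi (a n x)) * (c n * phi1 (a n x)) ^+ 2) \*
    Gamma (a n) (a n)) @[n --> \oo] -->
    mean mu (fun x => p2 (phi (h x)) * phi1 (h x) ^+ 2 * G x).
  have [|||||||_ //] := @cvg_mean_prod _ _ R mu
    (fun n x => p2 (c n * phi (a n x)) * (c n * phi1 (a n x)) ^+ 2)
    (fun x => p2 (phi (h x)) * phi1 (h x) ^+ 2) (fun n => Gamma (a n) (a n)) G
    (K2 * (2 * B) ^+ 2).
  - move=> n; apply: measurable_funM.
      by apply: (measurable_cont (sc_cont2 sc) (mcphi n)).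
    apply: measurable_funX; apply: measurable_funM => //.
    exact: (measurable_cont cphi1 (ma n)).
  - move=> n x; rewrite normrM normrX ler_pM ?exprn_ge0//.
      by apply: HK2; rewrite in_itv/= cphiB.
    rewrite lerXn2r ?nnegrE ?mulr_ge0// normrM gtr0_norm// ler_pM//.
    exact: ltW.
  - apply: measurable_funM.
      by apply: (measurable_cont (sc_cont2 sc)); exact: (measurable_cont cphi mh).
    by apply: measurable_funX; exact: (measurable_cont cphi1 mh).
  - move: cae (cs_ae ca); apply: filterS2 => x cx cx'.
    apply: cvgM; first by apply: continuous_cvg => //; exact: (sc_cont2 sc).
    have c3 : c n * phi1 (a n x) @[n --> \oo] --> 1 * phi1 (h x).
      by apply: cvgM => //; apply: continuous_cvg => //; exact: cphi1.
    rewrite mul1r in c3; rewrite expr2.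
    rewrite (_ : (fun n => _) = (fun n => (c n * phi1 (a n x)) * (c n * phi1 (a n x)))).
      exact: cvgM.
    by apply/funext => n; rewrite expr2.
  - by move=> n; exact: (carre_L1 setting).
  - exact: lG.
  - exact: cs_carre ca.
have cCR : C * mean mu ((fun x => p2 (c n * phi (a n x)) *
    (c n * phi1 (a n x)) ^+ 2) \* Gamma (a n) (a n)) @[n --> \oo] -->
    C * mean mu (fun x => p2 (phi (h x)) * phi1 (h x) ^+ 2 * G x).
  exact: cvgMr.
apply: (ler_cvg_to cL cCR); near=> n.
have mn : 1 / 2 <= m n by near: n.
have dcphi (y : R) : is_derive y 1 (fun y => c n * phi y) (c n * phi1 y).
  by have := dphi y; exact: is_deriveZ.
have H := @production_algebra (a n) (fun y => c n * phi y) (fun y => c n * phi1 y) (Aa n).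
apply: (H _ dcphi).
- by move=> y; apply: cvgM; [exact: cvg_cst|exact: cphi1].
- by move=> y; rewrite mulr_ge0 ?(ltW (c0 n))//; have /andP[] := phiB y.
- rewrite (_ : _ \o _ = fun x => c n * (phi \o a n) x)//.
  rewrite mean_Z; last by apply: bmf_L1; split=> //; exists B => x; exact: phin.
  by rewrite /c (max_idPr mn) mulVf// gt_eqF// (lt_le_trans _ mn)// divr_gt0.
Unshelve. all: by end_near. Qed.

End Production.

(** * C1 truncations of the identity *)

Section Splines.
Context (R : realType).
Implicit Types x u h e r : R.

(** Gives the derivative of the square of the positive part at its kink too. *)
Lemma is_derive_quadratic (f : R -> R) x l c : 0 <= c ->
  (forall h, `|f (h + x) - f x - l * h| <= c * h ^+ 2) -> is_derive x 1 f l.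
Proof.
move=> c0 Hf.
have H : h^-1 *: ((f \o shift x) (h *: (1 : R)) - f x) @[h --> (0 : R)^'] --> l.
  apply/cvgrPdist_le => e e0.
  have ec : 0 < e / (c + 1) by rewrite divr_gt0// ltr_wpDl.
  near=> h; have h0 : h != 0 by near: h; exact: nbhs_dnbhs_neq.
  have he : `|h| <= e / (c + 1) by near: h; apply: dnbhs0_le.
  rewrite /= /GRing.scale /= mulr1.
  have h0' : 0 < `|h| by rewrite normr_gt0.
  rewrite -(ler_pM2l h0') -normrM mulrBr mulrA divff// mul1r -normrN opprB.
  rewrite (mulrC h l) (le_trans (Hf h))// -(real_normK (num_real h)) expr2 mulrCA.
  rewrite ler_pM2l// mulrC; rewrite ler_pdivlMr ?ltr_wpDl// in he.
  by rewrite (le_trans _ he)// ler_wpM2l// lerDl.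
by apply: DeriveDef; [apply/cvg_ex; exists l|exact: cvg_lim H].
Unshelve. all: by end_near. Qed.

Definition pos x : R := Num.max x 0.

Lemma pos_ge0 x : 0 <= pos x.
Proof. by rewrite /pos le_max lexx orbT. Qed.

Lemma posE x : 0 <= x -> pos x = x.
Proof. by move=> x0; rewrite /pos (max_idPl x0). Qed.

Lemma pos0 x : x <= 0 -> pos x = 0.
Proof. by move=> x0; rewrite /pos (max_idPr x0). Qed.

Lemma pos_continuous : continuous pos.
Proof.
move=> x; apply: (@continuous_max _ _ id (cst 0)); first exact: cvg_id.
exact: cst_continuous.
Qed.

Lemma pos_cvg r : continuous (fun x => pos (x - r)).
Proof.
move=> x; apply: (@continuous_comp _ _ _ (fun x => x - r) pos).
  by apply: cvgB; [exact: cvg_id|exact: cvg_cst].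
exact: pos_continuous.
Qed.

Lemma pos_cvgN r : continuous (fun x => pos (r - x)).
Proof.
move=> x; apply: (@continuous_comp _ _ _ (fun x => r - x) pos).
  by apply: cvgB; [exact: cvg_cst|exact: cvg_id].
exact: pos_continuous.
Qed.

Lemma pos_sqr_quadratic x h :
  `|pos (h + x) ^+ 2 - pos x ^+ 2 - 2 * pos x * h| <= 1 * h ^+ 2.
Proof.
rewrite mul1r; have [x0|x0] := orP (le_total 0 x); have [y0|y0] := orP (le_total 0 (h + x)).
- rewrite !posE// (_ : _ - _ = h ^+ 2); first by rewrite ger0_norm// sqr_ge0.
  by ring.
- rewrite (posE x0) (pos0 y0) expr0n /= sub0r ler_norml; apply/andP; split; nra.
- rewrite (posE y0) (pos0 x0) expr0n /= mulr0 mul0r !subr0 ger0_norm ?sqr_ge0//; nra.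
- by rewrite (pos0 y0) (pos0 x0) expr0n /= mulr0 mul0r !subr0 normr0 sqr_ge0.
Qed.

Lemma pos_sqr_derive r x :
  is_derive x 1 (fun u => pos (u - r) ^+ 2) (2 * pos (x - r)).
Proof.
apply: (@is_derive_quadratic _ _ _ 1) => // h.
have -> : h + x - r = h + (x - r) by rewrite addrA.
exact: pos_sqr_quadratic.
Qed.

Lemma pos_sqr_deriveN r x :
  is_derive x 1 (fun u => pos (r - u) ^+ 2) (- (2 * pos (r - x))).
Proof.
apply: (@is_derive_quadratic _ _ _ 1) => // h.
rewrite opprD addrA (addrC r) -addrA mulNr -mulrN -(sqrrN h).
exact: pos_sqr_quadratic.
Qed.

(** * A smooth positive part *)

(** A C1 function which is 0 on the left of [- e] and the identity on the right of
    [e]. *)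
Definition theta e u : R := (4 * e)^-1 * (pos (u - - e) ^+ 2 - pos (u - e) ^+ 2).
Definition theta1 e u : R := (2 * e)^-1 * (pos (u - - e) - pos (u - e)).

Lemma theta1E e x :
  theta1 e x = (4 * e)^-1 * (2 * pos (x - - e) - 2 * pos (x - e)).
Proof.
rewrite /theta1 -mulrBr mulrA; congr (_ * _).
by rewrite !invfM mulrAC; congr (_ * _); field.
Qed.

Lemma theta_derive e x : is_derive x 1 (theta e) (theta1 e x).
Proof.
rewrite theta1E; have H := is_deriveB (pos_sqr_derive (- e) x) (pos_sqr_derive e x).
exact: (is_deriveZ (4 * e)^-1 H).
Qed.

Lemma theta1_continuous e : continuous (theta1 e).
Proof.
move=> x; apply: cvgM; first exact: cvg_cst.
by apply: cvgB; exact: pos_cvg.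
Qed.

Lemma theta1_1 e u : 0 < e -> e <= u -> theta1 e u = 1.
Proof.
move=> e0 eu; rewrite /theta1 !posE ?subr_ge0//; last by lra.
by field; rewrite gt_eqF.
Qed.

Lemma theta1_0 e u : 0 < e -> u <= - e -> theta1 e u = 0.
Proof.
move=> e0 ue; rewrite /theta1 !pos0 ?subr_le0 ?subrr ?mulr0//.
by lra.
Qed.

Lemma theta0 e u : 0 < e -> u <= - e -> theta e u = 0.
Proof.
move=> e0 ue; rewrite /theta !pos0 ?subr_le0 ?subrr ?mulr0//.
by lra.
Qed.

Lemma theta1_le e u v : 0 < e -> u <= v -> theta1 e u <= theta1 e v.
Proof.
move=> e0 uv; rewrite /theta1 ler_pM2l ?invr_gt0 ?mulr_gt0//.
rewrite /pos /Num.max; do 4 case: ifPn; rewrite -?leNgt; lra.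
Qed.

Lemma theta1_itv e u : 0 < e -> 0 <= theta1 e u <= 1.
Proof.
move=> e0; apply/andP; split.
  have [h|h] := orP (le_total u (- e)); first by rewrite theta1_0.
  by rewrite -[leLHS](theta1_0 e0 (lexx _)) theta1_le.
have [h|h] := orP (le_total e u); first by rewrite theta1_1.
by rewrite -[leRHS](theta1_1 e0 (lexx _)) theta1_le.
Qed.

Lemma theta_dist e u : 0 < e -> `|theta e u - pos u| <= e.
Proof.
move=> e0.
have [h|h] := orP (le_total u (- e)).
  have u0 : u <= 0 by lra.
  by rewrite theta0// pos0// subrr normr0 ltW.
have [k|k] := orP (le_total e u).
  rewrite /theta !posE ?subr_ge0 ?(le_trans (ltW e0))//.
  rewrite (_ : _ - _ = 0) ?normr0 ?ltW//; by field; rewrite gt_eqF.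
rewrite /theta (posE (_ : 0 <= u - - e)) ?subr_ge0// (pos0 (_ : u - e <= 0)) ?subr_le0//.
rewrite expr0n subr0 opprK.
have e4 : 0 < 4 * e by rewrite mulr_gt0.
rewrite -(ler_pM2l e4) -{1}(gtr0_norm e4) -normrM mulrBr mulrA divff ?gt_eqF// mul1r.
have [u0|u0] := orP (le_total 0 u).
  by rewrite posE// ler_norml; apply/andP; split; nra.
by rewrite pos0// mulr0 subr0 ger0_norm ?sqr_ge0//; nra.
Qed.

(** * A hump on [r, s] *)

Definition hump r s u : R := pos (u - r) ^+ 2 * pos (s - u) ^+ 2.
Definition hump1 r s u : R :=
  pos (u - r) ^+ 2 * - (2 * pos (s - u)) + pos (s - u) ^+ 2 * (2 * pos (u - r)).

Lemma hump_derive r s x : is_derive x 1 (hump r s) (hump1 r s x).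
Proof. exact: (is_deriveM (pos_sqr_derive r x) (pos_sqr_deriveN s x)). Qed.

Lemma hump_ge0 r s u : 0 <= hump r s u.
Proof. by rewrite mulr_ge0 ?sqr_ge0. Qed.

Lemma hump_gt0 r s u : r < u < s -> 0 < hump r s u.
Proof.
move=> /andP[ru us]; rewrite /hump !posE ?subr_ge0 ?ltW//.
by rewrite mulr_gt0// exprn_gt0 ?subr_gt0.
Qed.

Lemma hump_out r s u : (u <= r) || (s <= u) -> hump r s u = 0 /\ hump1 r s u = 0.
Proof.
rewrite /hump /hump1 => /orP[h|h].
  by rewrite (pos0 (_ : u - r <= 0)) ?subr_le0// expr0n /= !(mul0r, mulr0) addr0.
by rewrite (pos0 (_ : s - u <= 0)) ?subr_le0// expr0n /= !(mul0r, mulr0) oppr0 mulr0 add0r.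
Qed.

Lemma sqr_continuous (f : R -> R) : continuous f -> continuous (fun u => f u ^+ 2).
Proof.
move=> cf x; rewrite (_ : (fun u => _) = (fun u => f u * f u)).
  by apply: cvgM; exact: cf.
by apply/funext => u; rewrite expr2.
Qed.

Lemma hump_continuous r s : continuous (hump r s).
Proof.
by move=> x; apply: cvgM; [exact: (sqr_continuous (@pos_cvg r))|
  exact: (sqr_continuous (@pos_cvgN s))].
Qed.

Lemma hump1_continuous r s : continuous (hump1 r s).
Proof.
move=> x; apply: cvgD; apply: cvgM.
- exact: (sqr_continuous (@pos_cvg r)).
- by apply: cvgN; apply: cvgM; [exact: cvg_cst|exact: pos_cvgN].
- exact: (sqr_continuous (@pos_cvgN s)).
- by apply: cvgM; [exact: cvg_cst|exact: pos_cvg].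
Qed.

Lemma hump_bound r s : exists2 X, 0 < X & forall u, `|hump r s u| <= X /\ `|hump1 r s u| <= X.
Proof.
have [X1 X10 H1] := bounded_itv r s (@hump_continuous r s).
have [X2 X20 H2] := bounded_itv r s (@hump1_continuous r s).
have X0 : 0 < X1 + X2 + 1 by rewrite ltr_wpDl// addr_ge0.
exists (X1 + X2 + 1) => // u.
have [h|h] := boolP ((u <= r) || (s <= u)).
  by have [-> ->] := hump_out h; rewrite normr0 ltW.
have us : u \in `[r, s].
  by rewrite in_itv /=; move: h; rewrite negb_or -!ltNge => /andP[/ltW-> /ltW->].
split; first by rewrite (le_trans (H1 _ us))// -addrA lerDl addr_ge0.
by rewrite (le_trans (H2 _ us))// addrAC lerDr addr_ge0.
Qed.

Context (p p1 p2 : R -> R) (sc : smooth_convex p p1 p2).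

(** Uniform continuity of [p2] in multiplicative form, [p2] being bounded away
    from 0 on bounded sets. *)
Lemma convexity_perturb (K eta : R) : 0 < eta -> exists2 rho, 0 < rho & rho <= 1 /\
  forall u y z, 0 <= u <= K -> 0 <= y <= K -> `|y - u| <= rho -> `|z| <= 1 + rho ->
    p2 y * z ^+ 2 <= (1 + eta) * p2 u.
Proof.
move=> eta0; have [c c0 Hc] := sc_pos sc K.
pose eta' := Num.min 1 eta / 4.
have m0 : 0 < Num.min 1 eta by rewrite lt_min ltr01.
have e0 : 0 < eta' by rewrite divr_gt0.
have ce0 : 0 < c * eta' by rewrite mulr_gt0.
have [r r0 Hr] := heine 0 K (sc_cont2 sc) ce0.
have re0 : 0 < Num.min r (eta' / 3) by rewrite lt_min r0 divr_gt0.
have m1 : Num.min 1 eta <= 1 by rewrite ge_min lexx.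
have m2 : Num.min 1 eta <= eta by rewrite ge_min lexx orbT.
have rho_e : Num.min r (eta' / 3) <= eta' / 3 by rewrite ge_min lexx orbT.
exists (Num.min r (eta' / 3)) => //; split.
  by rewrite (le_trans rho_e)// /eta'; lra.
move=> u y z uK yK yu z1; have pu := Hc u uK.
have py : p2 y <= p2 u + c * eta'.
  have := Hr u y; rewrite in_itv /= uK distrC => /(_ isT).
  have yr : `|y - u| <= r by rewrite (le_trans yu)// ge_min lexx.
  by move=> /(_ yr); rewrite distrC ler_norml lerBlDl => /andP[].
have z2 : z ^+ 2 <= 1 + eta'.
  rewrite -real_normK ?num_real//.
  have h1 : `|z| <= 1 + eta' / 3 by rewrite (le_trans z1)// lerD2l.
  apply: (@le_trans _ _ ((1 + eta' / 3) ^+ 2)).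
    by rewrite lerXn2r ?nnegrE// addr_ge0// divr_ge0// ltW.
  have e1 : eta' <= 1 by rewrite /eta'; lra.
  by nra.
have py' : p2 y <= p2 u * (1 + eta').
  by rewrite (le_trans py)// mulrDr mulr1 lerD2l ler_pM2r.
have p0 : 0 <= p2 y by rewrite (le_trans (ltW c0))// Hc.
have e1 : (1 + eta') * (1 + eta') <= 1 + eta by rewrite /eta'; nra.
apply: (@le_trans _ _ (p2 u * (1 + eta') * (1 + eta'))).
  by rewrite ler_pM// sqr_ge0.
by rewrite -mulrA mulrC ler_wpM2r// (le_trans (ltW c0)).
Qed.

(** The truncation of the identity to [0, K], made C1 on a width [e], plus a
    multiple of a hump whose coefficient [a] is left free to adjust masses. *)
Definition cutoff e K a r s u : R := theta e u - theta e (u - K) + a * hump r s u.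
Definition cutoff1 e K a r s u : R := theta1 e u - theta1 e (u - K) + a * hump1 r s u.

Lemma cutoff_derive e K a r s x :
  is_derive x 1 (cutoff e K a r s) (cutoff1 e K a r s x).
Proof.
have H1 : is_derive x 1 (fun u => theta e (u - K)) (theta1 e (x - K)).
  rewrite (_ : (fun u => _) =
    (fun u => (4 * e)^-1 * (pos (u - (K - e)) ^+ 2 - pos (u - (K + e)) ^+ 2))).
    rewrite (_ : theta1 e (x - K) =
      (4 * e)^-1 * (2 * pos (x - (K - e)) - 2 * pos (x - (K + e)))).
      exact: (is_deriveZ (4 * e)^-1
        (is_deriveB (pos_sqr_derive (K - e) x) (pos_sqr_derive (K + e) x))).
    by rewrite theta1E !opprD !addrA.
  by apply/funext => u; rewrite /theta !opprD !addrA.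
have H2 := is_deriveB (theta_derive e x) H1.
exact: (is_deriveD H2 (is_deriveZ a (hump_derive r s x))).
Qed.

Lemma cutoff1_continuous e K a r s : continuous (cutoff1 e K a r s).
Proof.
move=> x; apply: cvgD; last by apply: cvgM; [exact: cvg_cst|exact: hump1_continuous].
apply: cvgB; first exact: theta1_continuous.
apply: (@continuous_comp _ _ _ (fun x => x - K) (theta1 e)).
  by apply: cvgB; [exact: cvg_id|exact: cvg_cst].
exact: theta1_continuous.
Qed.

Lemma cutoff_dist0 e K u : 0 < e -> 0 <= K -> 0 <= u ->
  `|theta e u - theta e (u - K) - u| <= pos (u - K) + 2 * e.
Proof.
move=> e0 K0 u0; have h1 := theta_dist u e0; have h2 := theta_dist (u - K) e0.
rewrite posE// in h1.
rewrite (_ : _ - u = (theta e u - u) - (theta e (u - K) - pos (u - K)) - pos (u - K)); last by ring.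
rewrite addrC (le_trans (ler_normD _ _))// normrN (ger0_norm (pos_ge0 _)) lerD2l.
by rewrite (le_trans (ler_normB _ _))// mulr_natl mulr2n lerD.
Qed.

Lemma cutoff_ge0 e K u : 0 < e -> 0 <= K -> 0 <= theta e u - theta e (u - K).
Proof.
move=> e0 K0; have [c _ ->] := MVT_real (theta_derive e) u (u - K).
by rewrite opprB addrC subrK mulr_ge0//; have /andP[] := theta1_itv c e0.
Qed.

(** The order of the choices matters. The admissible size of the coefficient of the
    hump is fixed by [r] and [s] only, before [K]: the mass to be compensated depends
    on [K]. The width [e] comes last, according to the modulus of continuity of
    [p2] up to [K]. *)
Lemma cutoff_spec r s (eta zeta N : R) : 0 < r -> r < s -> 0 < eta -> 0 < zeta ->
  exists2 al, 0 < al & exists K0, forall K, K0 <= K -> exists2 e0, 0 < e0 &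
    forall e a, 0 < e <= e0 -> `|a| <= al ->
    [/\ forall u, 0 <= cutoff e K a r s u <= K + 3,
        forall u, `|cutoff1 e K a r s u| <= K + 3,
        forall u, 0 <= u ->
          p2 (cutoff e K a r s u) * cutoff1 e K a r s u ^+ 2 <= (1 + eta) * p2 u &
        forall u, 0 <= u <= N -> `|cutoff e K a r s u - u| <= zeta].
Proof.
move=> r0 rs eta0 zeta0; have [X X0 HX] := hump_bound r s.
have s0 := lt_trans r0 rs.
have [rS rS0 [rS1 HS]] := convexity_perturb (s + 1) eta0.
pose m := Num.min (Num.min (r / 2) (zeta / 2)) (rS / 2).
have m0 : 0 < m by rewrite !lt_min !divr_gt0.
have [[mr mz] mS] : (m <= r / 2 /\ m <= zeta / 2) /\ m <= rS / 2.
  by rewrite /m !ge_min !lexx ?orbT.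
clearbody m.
exists (m / X); first by rewrite divr_gt0.
exists (Num.max (s + 1) (N + 1)) => K; rewrite ge_max => /andP[Ks KN].
have K0 : 0 <= K by rewrite (le_trans _ Ks)// addr_ge0 ?ltW.
have [rK rK0 [rK1 HK]] := convexity_perturb (K + 3) eta0.
pose e0 := Num.min (Num.min (r / 2) (zeta / 4)) (Num.min (rS / 4) (Num.min (rK / 4) (1 / 4))).
have e00 : 0 < e0 by rewrite !lt_min !divr_gt0.
have [er ez eS eK e1] : [/\ e0 <= r / 2, e0 <= zeta / 4, e0 <= rS / 4, e0 <= rK / 4 & e0 <= 1 / 4].
  by rewrite /e0 !ge_min !lexx ?orbT.
clearbody e0; exists e0 => // e a /andP[ep ee0] aa.
have aX u : `|a * hump r s u| <= m.
  have [H _] := HX u; rewrite normrM (_ : m = m / X * X) ?ler_pM//.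
  by rewrite divfK// gt_eqF.
have aX1 u : `|a * hump1 r s u| <= m.
  have [_ H] := HX u; rewrite normrM (_ : m = m / X * X) ?ler_pM//.
  by rewrite divfK// gt_eqF.
have t1 u : 0 <= theta1 e u - theta1 e (u - K) <= 1.
  have /andP[a1 a2] := theta1_itv u ep; have /andP[b1 b2] := theta1_itv (u - K) ep.
  have : theta1 e (u - K) <= theta1 e u by apply: theta1_le => //; rewrite gerBl.
  by move: a1 a2 b1 b2; lra.
have small u : u <= s -> theta e (u - K) = 0 /\ theta1 e (u - K) = 0.
  by move=> us; split; [apply: theta0|apply: theta1_0] => //; lra.
have d0 u : 0 <= u -> `|cutoff e K a r s u - u| <= pos (u - K) + 2 * e + `|a * hump r s u|.
  move=> u0; rewrite /cutoff addrAC (le_trans (ler_normD _ _))// lerD2r.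
  exact: cutoff_dist0.
have ub u : theta e u - theta e (u - K) <= K + 2 * e.
  have := theta_dist u ep; have := theta_dist (u - K) ep.
  rewrite !ler_norml => /andP[h1 h2] /andP[h3 h4].
  have : pos u <= pos (u - K) + K.
    rewrite /pos /Num.max; do 2 case: ifPn; rewrite -?leNgt; lra.
  by move: h1 h4; lra.
have ge0 u : 0 <= cutoff e K a r s u.
  have [h|h] := boolP ((u <= r) || (s <= u)).
    by rewrite /cutoff (hump_out h).1 mulr0 addr0 cutoff_ge0.
  move: h; rewrite negb_or -!ltNge => /andP[ru us].
  rewrite /cutoff (small u (ltW us)).1 subr0.
  have := theta_dist u ep; rewrite posE ?(le_trans (ltW r0) (ltW ru))//.
  have := aX u; rewrite !ler_norml => /andP[h1 _] /andP[h2 _].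
  by lra.
have le u : cutoff e K a r s u <= K + 3.
  have := aX u; rewrite ler_norml => /andP[_ h1]; have h2 := ub u.
  by rewrite /cutoff; lra.
split.
- by move=> u; rewrite ge0 le.
- move=> u; rewrite /cutoff1 (le_trans (ler_normD _ _))//.
  have /andP[h1 h2] := t1 u; rewrite (ger0_norm h1); have := aX1 u; lra.
- move=> u u0.
  have [us|us] := orP (le_total u s).
    have [h1 h2] := small u us.
    have d := d0 u u0; rewrite pos0 ?add0r in d; last by lra.
    have ax := aX u; have ax1 := aX1 u.
    apply: HS.
    + by rewrite u0 (le_trans us)// lerDl.
    + rewrite ge0 /=; move: d; rewrite ler_norml => /andP[_ d].
      have : `|a * hump r s u| <= m by []. lra.
    + by lra.
    + rewrite /cutoff1 (le_trans (ler_normD _ _))//.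
      have /andP[h3 h4] := t1 u; rewrite (ger0_norm h3); lra.
  have hb : (u <= r) || (s <= u) by rewrite us orbT.
  have [b0 b1] := hump_out hb.
  have [uK|uK] := orP (le_total (K + e) u).
    rewrite /cutoff1 b1 mulr0 addr0 !theta1_1 ?subrr ?expr0n /= ?mulr0//; try lra.
    by rewrite mulr_ge0 ?(ltW (sc_ge0 sc u0))// addr_ge0// ltW.
  have d := d0 u u0; rewrite b0 mulr0 normr0 addr0 in d.
  have pK : pos (u - K) <= e.
    by rewrite /pos ge_max; apply/andP; split; lra.
  apply: HK.
  + by rewrite u0 /=; lra.
  + by rewrite ge0 le.
  + by lra.
  + rewrite /cutoff1 b1 mulr0 addr0; have /andP[h3 h4] := t1 u.
    by rewrite (ger0_norm h3); lra.
- move=> u /andP[u0 uN]; have d := d0 u u0.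
  rewrite pos0 ?add0r in d; last by lra.
  by have := aX u; lra.
Qed.

End Splines.

(** * The functional inequality for nice densities *)

Lemma quarter_le_half (R : realType) (e b : R) : e <= b / 4 -> 2 * e <= b / 2.
Proof. lra. Qed.

Lemma half_add_half (R : realType) (x y b : R) :
  x <= b / 2 -> y <= b / 2 -> x + y <= b.
Proof. lra. Qed.

Section MassBalance.
Context d (T : measurableType d) (R : realType) (mu : probability T R).
Implicit Types f g h : T -> R.
Local Notation L1 f := (mu.-integrable setT (EFin \o f)).

Context (h : T -> R) (lh : L1 h) (h0 : forall x, 0 <= h x) (h1 : mean mu h = 1).

Let mh : measurable_fun setT h := L1_meas lh.

Let bcont (f : R -> R) B : continuous f -> (forall y : R, `|f y| <= B) ->
  bounded_mfun (f \o h).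
Proof. by move=> cf fB; split; [exact: measurable_cont|exists B => x; exact: fB]. Qed.

(** The density [h] charges some segment away from 0, otherwise it would vanish. *)
Lemma hump_mean_gt0 : exists r s : R, [/\ 0 < r, r < s & 0 < mean mu (hump r s \o h)].
Proof.
pose rn n : R := n.+1%:R^-1; pose sn n : R := n.+2%:R.
have rn0 n : 0 < rn n by rewrite invr_gt0.
have rsn n : rn n < sn n.
  by rewrite (@le_lt_trans _ _ 1)// ?ltr1n// invf_le1// ler1n.
apply: contrapT => /forallNP H.
have bb n : bounded_mfun (hump (rn n) (sn n) \o h).
  have [X _ HX] := hump_bound (rn n) (sn n).
  by apply: (@bcont _ X); [exact: hump_continuous|move=> y; case: (HX y)].
have z n : mean mu (fun x => `|(hump (rn n) (sn n) \o h) x|) = 0.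
  rewrite (_ : (fun x => _) = hump (rn n) (sn n) \o h); last first.
    by apply/funext => x; rewrite ger0_norm//= hump_ge0.
  apply/eqP; rewrite eq_le mean_ge0 ?andbT; last by move=> x; exact: hump_ge0.
  rewrite leNgt; apply/negP => m0; have /forallNP/(_ (sn n)) := H (rn n).
  by apply; split.
have : {ae mu, forall x, forall n, (hump (rn n) (sn n) \o h) x = 0}.
  by apply: ae_foralln => n; apply: mean_norm0_ae => //; exact: bmf_L1.
move=> hz; have : mean mu h = mean mu (cst 0).
  apply: mean_ae => //; apply: filterS hz => x Hx /=.
  apply/eqP; rewrite eq_le h0 andbT leNgt; apply/negP => hx.
  have : \forall n \near \oo, rn n < h x.
    exact: near_infty_natSinv_lt (PosNum hx).
  have : \forall n \near \oo, h x <= n%:R by exact: nbhs_infty_ger.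
  move=> A1 A2; near \oo => n.
  have b : rn n < h x < sn n.
    apply/andP; split; first by near: n.
    have : h x <= n%:R by near: n.
    by move=> /le_lt_trans; apply; rewrite ltr_nat ltnW.
  by have := hump_gt0 b; rewrite -/((hump (rn n) (sn n) \o h) x) Hx ltxx.
by rewrite h1 mean_cst => /eqP; rewrite oner_eq0.
Unshelve. all: by end_near. Qed.

Lemma excess_cvg : mean mu (fun x => pos (h x - n%:R)) @[n --> \oo] --> 0.
Proof.
have [|||||_ ] := @mean_dominated _ _ R mu (fun n x => pos (h x - n%:R)) (cst 0) h.
- move=> n; apply: (measurable_cont (phi := @pos R)); first exact: pos_continuous.
  exact: measurable_funB.
- by [].
- exact: lh.
- apply: aeW => x; apply: (@cvg_trans _ (cst 0 @ \oo)); last exact: cvg_cst.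
  apply: near_eq_cvg; near=> n; rewrite pos0// subr_le0; near: n.
  exact: nbhs_infty_ger.
- move=> n x; rewrite ger0_norm ?pos_ge0// /pos ge_max h0 andbT.
  by rewrite gerBl.
by rewrite mean_cst.
Unshelve. all: by end_near. Qed.

Context (p p1 p2 : R -> R) (sc : smooth_convex p p1 p2).

(** The hump compensates for the mass lost by truncation, at most the mean of the
    excess over [K] plus [2 * e]. *)
Lemma balanced_cutoff (eta zeta N : R) : 0 < eta -> 0 < zeta ->
  exists (phi phi1 : R -> R) (B : R), [/\ continuous phi1,
    forall y : R, is_derive y 1 phi (phi1 y),
    (forall y : R, 0 <= phi y <= B) /\ (forall y : R, `|phi1 y| <= B),
    mean mu (phi \o h) = 1 &
    (forall u : R, 0 <= u -> p2 (phi u) * phi1 u ^+ 2 <= (1 + eta) * p2 u) /\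
    (forall u : R, 0 <= u <= N -> `|phi u - u| <= zeta)].
Proof.
move=> eta0 zeta0; have [r [s [r0 rs mchi]]] := hump_mean_gt0.
set m := mean mu _ in mchi.
have [al al0 [K0 HK]] := cutoff_spec sc N r0 rs eta0 zeta0.
have am : 0 < al * m / 2 by rewrite divr_gt0// mulr_gt0.
have [K [KK0 K0' Kex]] : exists K, [/\ K0 <= K, 0 <= K &
    mean mu (fun x => pos (h x - K)) <= al * m / 2].
  near \oo => n; exists n%:R; split=> //.
    by near: n; exact: nbhs_infty_ger.
  rewrite (le_trans (ler_norm _))//; near: n.
  by move: excess_cvg => /cvgr0Pnorm_le; apply.
have [e0 e00 He] := HK K KK0.
pose e := Num.min e0 (al * m / 4).
have e_gt0 : 0 < e by rewrite lt_min e00 divr_gt0// mulr_gt0.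
have ee0 : 0 < e <= e0 by rewrite e_gt0 ge_min lexx.
have e2 : 2 * e <= al * m / 2.
  by apply: quarter_le_half; rewrite ge_min lexx orbT.
pose phi0 u : R := theta e u - theta e (u - K).
have e_le : forall u, 0 <= cutoff e K 0 r s u <= K + 3.
  by have [] := He e 0 ee0 (_ : `|0| <= al); rewrite ?normr0 ?ltW.
have c0E : cutoff e K 0 r s = phi0.
  by apply/funext => u; rewrite /cutoff mul0r addr0.
have dcont a : continuous (cutoff e K a r s).
  move=> y; apply: differentiable_continuous; apply/derivable1_diffP.
  by have [] := cutoff_derive e K a r s y.
have cphi0 : continuous phi0 by rewrite -c0E.
have bphi0 : bounded_mfun (phi0 \o h).
  apply: (bcont (B := K + 3)) => // y.
  by have := e_le y; rewrite c0E => /andP[y0 y1]; rewrite ger0_norm.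
have bchi : bounded_mfun (hump r s \o h).
  have [X _ HX] := hump_bound r s.
  by apply: (@bcont _ X); [exact: hump_continuous|move=> y; case: (HX y)].
have lphi0 := bmf_L1 mu bphi0; have lchi := bmf_L1 mu bchi.
pose a := (1 - mean mu (phi0 \o h)) / m.
have lpos : L1 (fun x => pos (h x - K)).
  apply: (L1_le _ lh).
    by apply: (measurable_cont (phi := @pos R)); [exact: pos_continuous|exact: measurable_funB].
  move=> x; rewrite ger0_norm ?pos_ge0// /pos ge_max h0 andbT.
  by rewrite gerBl.
have aal : `|a| <= al.
  rewrite /a normrM normfV (gtr0_norm mchi) ler_pdivrMr// distrC -h1.
  rewrite -(mean_B lphi0 lh) (le_trans (mean_norm (L1_B lphi0 lh)))//.
  apply: (@le_trans _ _ (mean mu ((fun x => pos (h x - K)) \+ cst (2 * e)))).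
    apply: mean_le; [exact/L1_norm/L1_B|exact: (L1_D lpos (L1_cst mu (2 * e)))|].
    by move=> x; exact: cutoff_dist0.
  rewrite (mean_D lpos (L1_cst mu (2 * e))) mean_cst.
  exact: half_add_half.
have [S1 S2 S3 S4] := He e a ee0 aal.
exists (cutoff e K a r s), (cutoff1 e K a r s), (K + 3); split=> //.
- exact: cutoff1_continuous.
- exact: cutoff_derive.
- rewrite (_ : _ \o h = (phi0 \o h) \+ (fun x => a * (hump r s \o h) x))//.
  rewrite (mean_D lphi0 (L1_Z a lchi)) (mean_Z a lchi) -/m /a divfK ?gt_eqF//.
  by rewrite addrC subrK.
Unshelve. all: by end_near. Qed.

End MassBalance.

Section Inequality.
Context (R : realType) (dO : measure_display) (Omega : measurableType dO).
Context (E : puniformType) (M : markov_process R Omega E).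
Context (mu : probability (borel E) R) (A : set (E -> R)).
Context (setting : standing_assumptions M mu A).
Implicit Types (f g h u v G : borel E -> R) (x : borel E) (t s : R).

Local Notation Pd := (bdual M mu).
Local Notation L1 f := (mu.-integrable setT (EFin \o f)).

Context (p p1 p2 : R -> R) (sc : smooth_convex p p1 p2).
Context (p_ge0 : forall y : R, 0 <= y -> 0 <= p y).
Context (C : R) (C0 : 0 < C).
Context (decay : forall u (K : R), bounded_mfun u -> (forall x, 0 <= u x <= K) ->
  mean mu u = 1 -> forall t, 0 <= t ->
  mean mu (p \o Pd t u) <= expR (- ((2 * C)^-1 * t)) * mean mu (p \o u)).

(** If the right-hand side is finite, it bounds those of the truncated densities up
    to a factor [1 + eta], and Fatou's lemma gives the left-hand side. *)
Lemma production_inequality h G : is_density mu h -> is_carre_limit M mu A h G ->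
  (\int[mu]_x (p (h x))%:E <= C%:E * \int[mu]_x (p2 (h x) * G x)%:E)%E.
Proof.
move=> dh cG; have [lh h1] := density_L1 dh; have [mh h0 _] := dh.
have [a ca] := carre_sequence_exists setting cG.
have lG := cs_L1 ca; have G0 := cs_ge0 ca.
have mpG : measurable_fun setT (fun x => p2 (h x) * G x).
  apply: measurable_funM; last exact: L1_meas lG.
  exact: (measurable_cont (sc_cont2 sc) mh).
have pG0 : {ae mu, forall x, 0 <= p2 (h x) * G x}.
  by apply: filterS G0 => x Gx; rewrite mulr_ge0// ltW// (sc_ge0 sc).
have absE : (\int[mu]_x `|(p2 (h x) * G x)%:E| = \int[mu]_x (p2 (h x) * G x)%:E)%E.
  apply: ae_eq_integral => //.
  - by apply: measurableT_comp => //; exact/measurable_EFinP.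
  - exact/measurable_EFinP.
  - by apply: filterS pG0 => x Hx _; rewrite gee0_abs// lee_fin.
have [fin|inf] := boolP (\int[mu]_x `|(p2 (h x) * G x)%:E| < +oo)%E; last first.
  move: inf; rewrite absE -leNgt leye_eq => /eqP ->.
  by rewrite gt0_muley ?lte_fin// leey.
have lpG : L1 (fun x => p2 (h x) * G x).
  by apply/integrableP; split=> //; exact/measurable_EFinP.
rewrite (mean_EFin lpG) -EFinM.
set I := mean mu _.
have I0 : 0 <= I by exact: mean_ge0_ae.
have key eta : 0 < eta -> (\int[mu]_x (p (h x))%:E <= ((1 + eta) * (C * I))%:E)%E.
  move=> eta0.
  have Hn n : exists phi : R -> R, [/\ continuous phi, forall y, 0 <= phi y,
     (\int[mu]_x (p (phi (h x)))%:E <= ((1 + eta) * (C * I))%:E)%E &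
     forall u : R, 0 <= u <= n%:R -> `|phi u - u| <= n.+1%:R^-1].
    have n0 : 0 < (n.+1%:R^-1 : R) by rewrite invr_gt0.
    have [phi [phi1 [B [c1 dphi [phiB phi1B] m1 [Hp Hd]]]]] :=
      balanced_cutoff lh h0 h1 sc n%:R eta0 n0.
    have cphi : continuous phi.
      move=> y; apply: differentiable_continuous; apply/derivable1_diffP.
      by have [] := dphi y.
    exists phi; split=> //; first by move=> y; have /andP[] := phiB y.
    have bphi : bounded_mfun (phi \o h).
      split; first exact: measurable_cont.
      by exists B => x; have /andP[y0 y1] := phiB (h x); rewrite ger0_norm.
    have bp : bounded_mfun (p \o (phi \o h)).
      by apply: (bmf_cont (K := B) (sc_cont0 sc) bphi) => x; exact: phiB.
    have lp := bmf_L1 mu bp.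
    have -> : (\int[mu]_x (p (phi (h x)))%:E = (mean mu (p \o (phi \o h)))%:E)%E.
      by rewrite -(mean_EFin lp).
    rewrite lee_fin.
    rewrite (le_trans (production_limit setting sc p_ge0 C0 decay ca c1 dphi phiB phi1B m1))//.
    rewrite (mulrCA _ C) ler_pM2l// /I -(mean_Z _ lpG).
    have b2 : bounded_mfun (p2 \o (phi \o h)).
      by apply: (bmf_cont (K := B) (sc_cont2 sc) bphi) => x; exact: phiB.
    have b3 : bounded_mfun (phi1 \o h) by split; [exact: measurable_cont|exists B => x; exact: phi1B].
    apply: mean_le_ae.
    - have := L1_M (bmf_M b2 (bmf_M b3 b3)) lG.
      by congr (mu.-integrable _ (EFin \o _)); apply/funext => x.
    - exact: L1_Z.
    - apply: filterS G0 => x Gx; rewrite mulrA ler_wpM2r//; exact: Hp.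
  have [phi Hphi] := choice Hn.
  apply: (fatou_le (f_ := fun n x => p (phi n (h x)))).
  - move=> n; have [c _ _ _] := Hphi n.
    exact: (measurable_cont (sc_cont0 sc) (measurable_cont c mh)).
  - by move=> n x; apply: p_ge0; have [_ H _ _] := Hphi n.
  - exact: (measurable_cont (sc_cont0 sc) mh).
  - apply: aeW => x; apply: continuous_cvg; first exact: (sc_cont0 sc).
    apply/cvgrPdist_le => e e0; near=> n; have [_ _ _ H] := Hphi n.
    rewrite distrC (le_trans (H (h x) _))//.
      by rewrite h0 /=; near: n; exact: nbhs_infty_ger.
    by rewrite ltW//; near: n; exact: near_infty_natSinv_lt (PosNum e0).
  - by move=> n; have [] := Hphi n.
have lp : L1 (p \o h).
  apply/integrableP; split; first by apply/measurable_EFinP; exact: (measurable_cont (sc_cont0 sc) mh).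
  rewrite (eq_integral (fun x => (p (h x))%:E)).
    by rewrite (le_lt_trans (key 1 ltr01))// ltry.
  by move=> x _; rewrite gee0_abs// lee_fin p_ge0.
move: key; rewrite (mean_EFin lp) => key; rewrite lee_fin.
apply: (@le_addeps _ _ _ (C * I)); first by rewrite mulr_ge0// ltW.
move=> eta eta0; have := key eta eta0; rewrite lee_fin => /le_trans; apply.
by rewrite mulrDl mul1r.
Unshelve. all: by end_near. Qed.

End Inequality.

(** * The equivalence and the total variation distance *)

(** Subtracting the tangent at 1 does not change the entropy of a density, and
    makes the integrand nonnegative. *)
Lemma smooth_convex_bregman (R : realType) (p p1 p2 : R -> R) :
  smooth_convex p p1 p2 ->
  smooth_convex (fun u => bregman p p1 u 1) (fun u => p1 u - p1 1) p2.
Proof.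
move=> sc; split.
- move=> u; apply: cvgB; first by apply: cvgB; [exact: sc_cont0 sc u|exact: cvg_cst].
  by apply: cvgM; [exact: cvg_cst|apply: cvgB; [exact: cvg_id|exact: cvg_cst]].
- by move=> u; apply: cvgB; [exact: sc_cont1 sc u|exact: cvg_cst].
- exact: sc_cont2 sc.
- move=> u u0; pose l (y : R) := p1 1 * (y - 1) + p 1.
  have dl : is_derive u 1 l (p1 1).
    apply: (@is_derive_quadratic _ _ _ _ 0) => // h.
    by rewrite mul0r /l (_ : _ - _ = 0) ?normr0//; ring.
  rewrite (_ : (fun u => _) = p \- l); first exact: (is_deriveB (sc_derive0 sc u0) dl).
  by apply/funext => y; rewrite /l /= opprD addrA addrAC.
- move=> u u0.
  have dl : is_derive u 1 (cst (p1 1)) (0 : R).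
    apply: (@is_derive_quadratic _ _ _ _ 0) => // h.
    by rewrite mul0r /= subrr mul0r subrr normr0.
  by rewrite -[p2 u]subr0; exact: (is_deriveB (sc_derive1 sc u0) dl).
- exact: sc_pos sc.
Qed.

Lemma pinsker_constant (R : realType) (c s I : R) : 0 < c -> 0 < s -> I <= s ^+ 2 ->
  s + I / (c * s) <= (1 + c^-1) * s.
Proof.
move=> c0 s0 Is; rewrite mulrDl mul1r lerD2l ler_pdivrMr ?mulr_gt0//.
by rewrite mulrACA mulVf ?gt_eqF// mul1r -expr2.
Qed.

Section EntropyFunctional.
Context (R : realType) (dO : measure_display) (Omega : measurableType dO).
Context (E : puniformType) (M : markov_process R Omega E).
Context (mu : probability (borel E) R) (A : set (E -> R)).
Context (setting : standing_assumptions M mu A).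
Context (psi psi' psi'' : R -> R) (psi_C2 : C2_on_nonneg psi psi' psi'').
Context (unif : forall a : R, 0 < a -> uniformly_convex_on `[0, a] psi).
Context (psi1 : psi 1 = 0).
Implicit Types (f g h u v G : borel E -> R) (x : borel E).

Local Notation Pdual := (dual_semigroup M mu).
Local Notation Pd := (bdual M mu).
Local Notation L1 f := (mu.-integrable setT (EFin \o f)).

Let inv : Defs.invariant M mu := mu_invariant setting.

Definition entropy_density (u : R) := bregman (posext psi) (posext psi') u 1.
Local Notation beta := entropy_density.
Local Notation p2 := (posext psi'').
Local Notation q := (posext psi' 1).

Let sc0 : smooth_convex (posext psi) (posext psi') p2 :=
  smooth_convex_posext psi_C2 unif.

Lemma beta_convex : smooth_convex beta (fun y : R => posext psi' y - q) p2.
Proof. exact: smooth_convex_bregman sc0. Qed.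

Lemma beta_ge0 (y : R) : 0 <= y -> 0 <= beta y.
Proof. by move=> y0; exact: (bregman_ge0 sc0 y0 ler01). Qed.

Lemma betaE (y : R) : 0 <= y -> psi y = beta y + q * (y - 1).
Proof.
move=> y0; rewrite /beta /bregman !posextE ?ler01// psi1 subr0.
by rewrite subrK.
Qed.

Let psi_split h x : is_density mu h -> psi (h x) = beta (h x) + q * (h x - 1).
Proof. by move=> [_ h0 _]; exact: betaE. Qed.

Let lin_L1 h : is_density mu h -> L1 (fun x => q * (h x - 1)) /\
  mean mu (fun x => q * (h x - 1)) = 0.
Proof.
move=> /density_L1[lh h1]; have lB := L1_B lh (L1_cst mu 1).
split; first exact: (L1_Z q lB).
by rewrite (mean_Z q lB) (mean_B lh (L1_cst mu 1)) h1 mean_cst subrr mulr0.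
Qed.

Lemma I_psi_mean h : is_density mu h -> L1 (beta \o h) ->
  I_psi mu psi h = (mean mu (beta \o h))%:E.
Proof.
move=> dh lb; have [ll l0] := lin_L1 dh.
rewrite /I_psi (_ : (fun x => (psi (h x))%:E) = EFin \o
   ((beta \o h) \+ (fun x => q * (h x - 1)))); last first.
  by apply/funext => x /=; rewrite psi_split.
by rewrite (mean_EFin (L1_D lb ll)) (mean_D lb ll) l0 addr0.
Qed.

Let mpsi h : is_density mu h -> measurable_fun setT (fun x => psi (h x)).
Proof.
move=> dh; have [mh h0 _] := dh.
rewrite (_ : (fun x => _) = posext psi \o h).
  by apply: measurable_cont => //; exact: sc_cont0 sc0.
by apply/funext => x; rewrite /= posextE.
Qed.

(** The negative part of [psi (h)] is dominated by an affine function of [h]. *)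
Lemma finite_entropy h : is_density mu h -> (I_psi mu psi h < +oo)%E ->
  L1 (beta \o h).
Proof.
move=> dh; have [ll _] := lin_L1 dh; have [mh h0 _] := dh.
pose F x := (psi (h x))%:E.
have mF : measurable_fun setT F by apply/measurable_EFinP; exact: mpsi.
rewrite /I_psi -/F integralE => fin.
have neg : (\int[mu]_x (F^\- x) < +oo)%E.
  have := L1_norm ll => /integrableP[_]; apply: le_lt_trans.
  apply: ge0_le_integral => //.
  - exact: measurable_funeneg.
  - apply: measurableT_comp => //; apply/measurable_EFinP.
    exact: (L1_meas (L1_norm ll)).
  - move=> x _; rewrite /F -[(fun x => _)]/(EFin \o (fun x => psi (h x))) funerneg.
    rewrite /= lee_fin normr_id /funrneg ge_max normr_ge0 andbT psi_split//.
    have b0 := beta_ge0 (h0 x); rewrite opprD -normrN.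
    by rewrite (le_trans _ (ler_norm _))// gerDr oppr_le0.
have pos : (\int[mu]_x (F^\+ x) < +oo)%E.
  rewrite ltNge leye_eq; apply/negP => /eqP e; move: fin; rewrite e addye ?ltxx//.
  apply/negP => /eqP/(congr1 oppe); rewrite oppeK /= => en.
  by move: neg; rewrite en ltxx.
have lpsi : L1 (fun x => psi (h x)).
  apply/integrableP; split=> //.
  rewrite (eq_integral (fun x => F^\+ x + F^\- x)%E).
    rewrite ge0_integralD//; last 2 first.
    - exact: measurable_funepos.
    - exact: measurable_funeneg.
    by rewrite lte_add_pinfty.
  by move=> x _; rewrite -[LHS]/((abse \o F) x) fune_abse.
have := L1_B lpsi ll; congr (mu.-integrable _ (EFin \o _)); apply/funext => x /=.
by rewrite psi_split// addrK.
Qed.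

Lemma dual_density t h : 0 <= t -> is_density mu h -> is_density mu (Pdual t h).
Proof.
move=> t0 dh; have [lh h1] := density_L1 dh; have [_ h0 _] := dh.
have lP := dual_L1 inv t0 lh.
split; [exact: L1_meas lP|exact: dual_ge0|].
by rewrite (mean_EFin lP) (dual_mean inv t0 lh) h1.
Qed.

Lemma bounded_density_nice u (K : R) : bounded_mfun u -> (forall x, 0 <= u x <= K) ->
  mean mu u = 1 -> is_density mu u /\ L1 (beta \o u).
Proof.
move=> bu uK u1; split; last first.
  by apply: bmf_L1; exact: (bmf_cont (sc_cont0 beta_convex) bu uK).
split; [by case: bu|by move=> x; case/andP: (uK x)|].
by rewrite (mean_EFin (bmf_L1 mu bu)) u1.
Qed.

Lemma mean_beta_bdual t u (K : R) : 0 <= t -> bounded_mfun u ->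
  (forall x, 0 <= u x <= K) -> L1 (beta \o Pdual t u) /\
  mean mu (beta \o Pdual t u) = mean mu (beta \o Pd t u).
Proof.
move=> t0 bu uK; have bP := bmf_bdual inv t0 bu; have PK := bdual_itv inv t0 bu uK.
have lP := dual_L1 inv t0 (bmf_L1 mu bu).
have bb := bmf_cont (sc_cont0 beta_convex) bP PK.
have mb : measurable_fun setT (beta \o Pdual t u).
  by apply: measurable_cont; [exact: sc_cont0 beta_convex|exact: L1_meas lP].
have e : {ae mu, forall x, (beta \o Pd t u) x = (beta \o Pdual t u) x}.
  by have := bdual_ae inv t0 bu; apply: filterS => x /= ->.
split; first exact: (L1_ae (bmf_L1 mu bb) mb e).
by apply/esym; apply: mean_ae => //; case: bb.
Qed.

Section Equivalence.
Context (C : R) (C0 : 0 < C).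

Let decay := forall h, is_density mu h -> (I_psi mu psi h < +oo)%E ->
  forall t : R, 0 <= t ->
    (I_psi mu psi (Pdual t h) <=
     (expR (- (t / (2 * C))))%:E * I_psi mu psi h)%E.

Let inequality := forall h, nice_density M mu A h ->
  (\int[mu]_x (psi (h x))%:E <=
   C%:E * \int[mu]_x (psi'' (h x) * carre M mu A h x)%:E)%E.

Lemma inequality_decay : inequality -> decay.
Proof.
move=> Hineq h dh fin t t0.
have lb := finite_entropy dh fin.
have ineq u (K : R) : bounded_mfun u -> (forall x, 0 <= u x <= K) ->
   mean mu u = 1 -> in_dirichlet_domain M mu A u ->
   mean mu (beta \o u) <= C * mean mu (fun x => p2 (u x) * carre M mu A u x).
  move=> bu uK u1 du; have [deu lu] := bounded_density_nice bu uK u1.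
  have [_ lG _] : is_carre_limit M mu A u (carre M mu A u) by apply: getPex.
  have lpG := L1_M (bmf_cont (sc_cont2 sc0) bu uK) lG.
  have := Hineq u (conj deu du).
  rewrite -[X in (X <= _)%E]/(I_psi mu psi u) (I_psi_mean deu lu).
  have -> : (\int[mu]_x (psi'' (u x) * carre M mu A u x)%:E =
     (mean mu (fun x => p2 (u x) * carre M mu A u x))%:E)%E.
    rewrite -(mean_EFin lpG); apply: eq_integral => x _ /=.
    by rewrite posextE//; case/andP: (uK x).
  by rewrite -EFinM lee_fin.
have dP := dual_density t0 dh.
have H : (\int[mu]_x (beta (Pdual t h x))%:E <=
    (expR (- ((2 * C)^-1 * t)) * mean mu (beta \o h))%:E)%E.
  apply: (entropy_decay setting beta_convex beta_ge0 t0 (expR_ge0 _) _ dh lb).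
  move=> u K bu uK u1.
  exact: (entropy_decay_bounded setting beta_convex beta_ge0 C0 ineq bu uK u1 t0).
have lP : L1 (beta \o Pdual t h).
  have [mP P0 _] := dP.
  apply/integrableP; split.
    by apply/measurable_EFinP; apply: (measurable_cont (sc_cont0 beta_convex) mP).
  rewrite (eq_integral (fun x => (beta (Pdual t h x))%:E)).
    by rewrite (le_lt_trans H)// ltry.
  by move=> x _; rewrite gee0_abs// lee_fin beta_ge0.
rewrite (I_psi_mean dP lP) (I_psi_mean dh lb) -EFinM (mulrC t).
by move: H; rewrite (mean_EFin lP).
Qed.

Lemma decay_inequality : decay -> inequality.
Proof.
move=> Hdec h [dh du].
have cG : is_carre_limit M mu A h (carre M mu A h) by apply: getPex.
have dec u (K : R) : bounded_mfun u -> (forall x, 0 <= u x <= K) ->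
  mean mu u = 1 -> forall t, 0 <= t ->
  mean mu (beta \o Pd t u) <= expR (- ((2 * C)^-1 * t)) * mean mu (beta \o u).
  move=> bu uK u1 t t0; have [deu lu] := bounded_density_nice bu uK u1.
  have [lP <-] := mean_beta_bdual t0 bu uK.
  have := Hdec u deu; rewrite (I_psi_mean deu lu) ltry => /(_ isT t t0).
  by rewrite (I_psi_mean (dual_density t0 deu) lP) -EFinM lee_fin (mulrC t).
have H := production_inequality setting beta_convex beta_ge0 C0 dec dh cG.
have [mh h0 _] := dh.
have -> : (\int[mu]_x (psi'' (h x) * carre M mu A h x)%:E =
   \int[mu]_x (p2 (h x) * carre M mu A h x)%:E)%E.
  by apply: eq_integral => x _; rewrite posextE.
have [fin|] := boolP (C%:E * \int[mu]_x (p2 (h x) * carre M mu A h x)%:E < +oo)%E; last first.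
  by rewrite -leNgt leye_eq => /eqP ->; exact: leey.
have lb : L1 (beta \o h).
  apply/integrableP; split.
    by apply/measurable_EFinP; apply: (measurable_cont (sc_cont0 beta_convex) mh).
  rewrite (eq_integral (fun x => (beta (h x))%:E)).
    by rewrite (le_lt_trans H).
  by move=> x _; rewrite gee0_abs// lee_fin beta_ge0.
rewrite -[X in (X <= _)%E]/(I_psi mu psi h) (I_psi_mean dh lb).
by rewrite -(mean_EFin lb).
Qed.

End Equivalence.

(** Take [s] close to the square root of the entropy in [bregman_pinsker], when
    it is at most 1; otherwise use that the distance is at most 2. *)
Lemma TV_entropy : exists2 K : R, 0 <= K & forall h, is_density mu h ->
  L1 (beta \o h) ->
  (TV_to_mu mu h <= (K * Num.sqrt (mean mu (beta \o h)))%:E)%E.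
Proof.
have [c c0 Hc] := bregman_pinsker sc0.
exists (2 + (1 + c^-1)); first by rewrite !addr_ge0 ?invr_ge0 ?ltW.
move=> h dh lb; have [lh h1] := density_L1 dh; have [mh h0 _] := dh.
set I := mean mu _.
have I0 : 0 <= I by apply: mean_ge0 => x; apply: beta_ge0; exact: h0.
have lB := L1_norm (L1_B lh (L1_cst mu 1)).
rewrite /TV_to_mu (mean_EFin lB) lee_fin.
have pinsker s : 0 < s <= 1 -> mean mu (fun x => `|h x - 1|) <= s + I / (c * s).
  move=> s01; have lz := L1_Z (c * s)^-1 lb.
  rewrite mulrC /I -(mean_Z _ lb) -[X in X + _](mean_cst mu s).
  rewrite -(mean_D (L1_cst mu s) lz); apply: mean_le => //.
    exact: L1_D (L1_cst mu s) lz.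
  by move=> x /=; rewrite mulrC; exact: Hc.
have c1 : 0 <= 1 + c^-1 by rewrite addr_ge0 ?invr_ge0 ?ltW.
have s0 := sqrtr_ge0 I.
have [I1|I1] := orP (le_total 1 I).
  have h2 : mean mu (fun x => `|h x - 1|) <= 2.
    have -> : (2 : R) = mean mu (h \+ cst 1).
      by rewrite (mean_D lh (L1_cst mu 1)) h1 mean_cst.
    apply: mean_le => //; first exact: L1_D lh (L1_cst mu 1).
    by move=> x /=; rewrite (le_trans (ler_normB _ _))// normr1 ger0_norm.
  have s1 : 1 <= Num.sqrt I by rewrite -[leLHS]sqrtr1 ler_sqrt// (lt_le_trans ltr01).
  rewrite (le_trans h2)// mulrDl -[leLHS]addr0 lerD ?mulr_ge0//.
  by rewrite -[leLHS]mulr1 ler_pM2l.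
apply: (@le_addeps _ _ _ (1 + c^-1)) => // e e0.
pose s := Num.min 1 (Num.sqrt I + e).
have sp : 0 < s by rewrite lt_min ltr01 ltr_wpDl.
have s1 : 0 < s <= 1 by rewrite sp ge_min lexx.
have Is : I <= s ^+ 2.
  have a : Num.sqrt I <= s.
    rewrite le_min lerDl (ltW e0) andbT -[leRHS]sqrtr1 ler_sqrt//.
  by rewrite -[leLHS]sqr_sqrtr// lerXn2r ?nnegrE// ltW.
rewrite (le_trans (pinsker s s1))// (le_trans (pinsker_constant c0 sp Is))//.
apply: (@le_trans _ _ ((1 + c^-1) * (Num.sqrt I + e))).
  by rewrite ler_wpM2l// ge_min lexx orbT.
by rewrite mulrDr (mulrC _ e) lerD2r ler_wpM2r// lerDr.
Qed.

End EntropyFunctional.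

Theorem proposition1p8 (R : realType) (dO : measure_display)
  (Omega : measurableType dO) (E : puniformType)
  (M : markov_process R Omega E) (mu : probability (borel E) R)
  (A : set (E -> R)) (setting : standing_assumptions M mu A)
  (psi psi' psi'' : R -> R)
  (psi_C2 : C2_on_nonneg psi psi' psi'')
  (psi_convex : convex_function (`[0, +oo[%classic : set R) psi)
  (psi_unif_convex : forall a : R, 0 < a -> uniformly_convex_on `[0, a] psi)
  (psi1 : psi 1 = 0)
  (psi_superlinear : psi u / u @[u --> +oo] --> +oo) :
  exists M_psi : R, forall C_psi : R, 0 < C_psi ->
    let decay :=
      forall h, is_density mu h -> (I_psi mu psi h < +oo)%E ->
        forall t : R, 0 <= t ->
          (I_psi mu psi (dual_semigroup M mu t h) <=
           (expR (- (t / (2 * C_psi))))%:E * I_psi mu psi h)%E in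
    let inequality :=
      forall h, nice_density M mu A h ->
        (\int[mu]_x (psi (h x))%:E <=
         C_psi%:E * \int[mu]_x (psi'' (h x) * carre M mu A h x)%:E)%E in
    (decay <-> inequality) /\
    (decay ->
      forall h, is_density mu h -> (I_psi mu psi h < +oo)%E ->
        forall t : R, 0 <= t ->
          (TV_to_mu mu (dual_semigroup M mu t h) <=
           (M_psi * expR (- (t / (4 * C_psi))) *
            Num.sqrt (fine (I_psi mu psi h)))%:E)%E).
Proof.
have [K K0 HK] := TV_entropy mu psi_C2 psi_unif_convex.
exists K => C C0 decay inequality; split.
  split; first exact: (decay_inequality setting psi_C2 psi_unif_convex psi1 C0).
  exact: (inequality_decay setting psi_C2 psi_unif_convex psi1 C0).
move=> Hdec h dh fin t t0.
have lb := finite_entropy psi_C2 psi_unif_convex psi1 dh fin.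
have dP := dual_density setting t0 dh.
have Hd := Hdec h dh fin t t0.
have finP : (I_psi mu psi (dual_semigroup M mu t h) < +oo)%E.
  rewrite (le_lt_trans Hd)// (I_psi_mean psi1 dh lb) -EFinM ltry//.
have lP := finite_entropy psi_C2 psi_unif_convex psi1 dP finP.
rewrite (le_trans (HK _ dP lP))// lee_fin (I_psi_mean psi1 dh lb) /=.
move: Hd; rewrite (I_psi_mean psi1 dh lb) (I_psi_mean psi1 dP lP) -EFinM lee_fin => Hd.
rewrite -mulrA ler_wpM2l//.
have -> : expR (- (t / (4 * C))) = Num.sqrt (expR (- (t / (2 * C)))).
  rewrite (_ : - (t / (2 * C)) = - (t / (4 * C)) + - (t / (4 * C))).
    by rewrite expRD -expr2 sqrtr_sqr gtr0_norm ?expR_gt0.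
  by field; rewrite gt_eqF.
rewrite -sqrtrM ?expR_ge0// ler_wsqrtr//.
Qed.
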